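(* Let $X$ be a Banach space with norm $\|\cdot\|$ and consider the initial value problem $u'(t)=F(u(t))=Au(t)+g(u(t))$, $u(t_0)=u_0$, on $t_0\le t\le T$. Assume: (A1) the linear operator $A$ is the infinitesimal generator of an analytic semigroup $\mathrm{e}^{tA}$ on $X$; (A2) the problem possesses a sufficiently smooth solution $u:[t_0,T]\to X$ with derivatives in $X$, and $g:X\to X$ is sufficiently often Fréchet differentiable in a strip along the exact solution, all occurring derivatives being uniformly bounded. Consider for its numerical solution an explicit exponential Runge--Kutta method with constant step size $h>0$ (as defined in the context) that fulfills the order conditions 1--7 listed in the context. Assume further that condition 8 holds in the weakened form with $Z=0$, i.e. $\sum_{i=2}^s b_i(0)\frac{c_i^4}{4!}=\varphi_5(0)$, and that the remaining conditions 9--16 hold in the weaker form in which $b_i(Z)$ is replaced by $b_i(0)$. Then the method is convergent of order 5. In particular, the numerical solution $u_n$ satisfies the error bound $$\|u_n-u(t_n)\|\le C h^5$$ uniformly on compact time intervals $t_0\le t_n=t_0+nh\le T$, with a constant $C$ that depends on $T-t_0$ but is independent of $n$ and $h$.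
   Context: The functions $\varphi_k$, $k\ge 0$, are the entire functions $\varphi_0(z)=\mathrm{e}^z$ and $\varphi_k(z)=\int_0^1 \mathrm{e}^{(1-\theta)z}\frac{\theta^{k-1}}{(k-1)!}\,\mathrm{d}\theta$ for $k\ge1$. An $s$-stage explicit exponential Runge--Kutta method has nodes $c_i$ and coefficient functions $a_{ij}(z)$ ($2\le j<i\le s$), $b_i(z)$ ($2\le i\le s$), which are chosen as linear combinations of the entire functions $\varphi_k(z)$, $k\ge 0$, and scaled versions thereof. With step size $h$ it reads $$U_{ni}=u_n+c_ih\varphi_1(c_ihA)F(u_n)+h\sum_{j=2}^{i-1}a_{ij}(hA)D_{nj},\quad 1\le i\le s,$$ $$u_{n+1}=u_n+h\varphi_1(hA)F(u_n)+h\sum_{i=2}^s b_i(hA)D_{ni},\qquad D_{ni}=g(U_{ni})-g(u_n)\quad (2\le i\le s),$$ starting from $u_0$; one may set $c_1=0$, $U_{n1}=u_n$, but these quantities do not enter the scheme. The functions of $hA$ are obtained by inserting $z=hA$ in the formulas for $\varphi_k$, and the coefficients $a_{ij}(hA)$, $b_i(hA)$ are bounded operators on $X$. Define $\psi_{j,i}(Z)=\sum_{k=2}^{i-1}a_{ik}(Z)\frac{c_k^{j-1}}{(j-1)!}-c_i^j\varphi_j(c_iZ)$. Order conditions. Below, $Z,J,K,L$ denote arbitrary square matrices and $B$ an arbitrary bilinear mapping of appropriate dimensions; each condition is required for all of these. All outer sums run over $i=2,\dots,s$. 1: $\sum b_i(Z)c_i=\varphi_2(Z)$. 2: $\sum b_i(Z)\frac{c_i^2}{2!}=\varphi_3(Z)$.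 3: $\sum b_i(Z)J\psi_{2,i}(Z)=0$. 4: $\sum b_i(Z)\frac{c_i^3}{3!}=\varphi_4(Z)$. 5: $\sum b_i(Z)J\psi_{3,i}(Z)=0$. 6: $\sum b_i(Z)J\sum_{j=2}^{i-1}a_{ij}(Z)J\psi_{2,j}(Z)=0$. 7: $\sum b_i(Z)c_iK\psi_{2,i}(Z)=0$. 8: $\sum b_i(Z)\frac{c_i^4}{4!}=\varphi_5(Z)$. 9: $\sum b_i(Z)J\psi_{4,i}(Z)=0$. 10: $\sum b_i(Z)J\sum_{j=2}^{i-1}a_{ij}(Z)J\psi_{3,j}(Z)=0$. 11: $\sum b_i(Z)J\sum_{j=2}^{i-1}a_{ij}(Z)J\sum_{k=2}^{j-1}a_{jk}(Z)J\psi_{2,k}(Z)=0$. 12: $\sum b_i(Z)J\sum_{j=2}^{i-1}a_{ij}(Z)c_jK\psi_{2,j}(Z)=0$. 13: $\sum b_i(Z)c_iK\psi_{3,i}(Z)=0$. 14: $\sum b_i(Z)c_iK\sum_{j=2}^{i-1}a_{ij}(Z)J\psi_{2,j}(Z)=0$. 15: $\sum b_i(Z)B(\psi_{2,i}(Z),\psi_{2,i}(Z))=0$. 16: $\sum b_i(Z)c_i^2L\psi_{2,i}(Z)=0$.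
   Formalization: The bound is proved for step sizes 0 < h ≤ h0, with h0 depending on problem and method, since for large h stages may leave the strip where g is controlled; nodes and scalings of the φ_k are taken nonnegative and u_n in the domain of A so that the scheme is defined. *)

(* Defs.v *)
From Stdlib Require Import Reals List Factorial.
From Coquelicot Require Import Coquelicot.

Open Scope R_scope.

(** * Semigroups and their generators *)

(** [X] is a real Banach space (a complex one is viewed as a real one), and
    analyticity of a semigroup is understood, as usual for real spaces, on the
    complexification [X * X], where [(x, y)] stands for [x + i y]. *)

Definition Cscal {X : NormedModule R_AbsRing} (z : C) (w : X * X) : X * X :=
  (minus (scal (Re z) (fst w)) (scal (Im z) (snd w)),
   plus (scal (Re z) (snd w)) (scal (Im z) (fst w))).

Definition C_linear {X : NormedModule R_AbsRing} (L : X * X -> X * X) : Prop :=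
  is_linear L /\ forall z w, L (Cscal z w) = Cscal z (L w).

Definition sector (kappa : R) (z : C) : Prop :=
  0 < Re z /\ Rabs (Im z) < kappa * Re z.

(** Complex differentiability at [z0], in the operator norm. *)
Definition C_diff_at {X : NormedModule R_AbsRing}
    (T : C -> X * X -> X * X) (z0 : C) : Prop :=
  exists T' : X * X -> X * X, C_linear T' /\
    forall eps : posreal, exists delta : posreal, forall z : C,
      Cmod (z - z0) < delta -> forall w : X * X,
      norm (minus (minus (T z w) (T z0 w)) (Cscal (z - z0)%C (T' w)))
        <= eps * Cmod (z - z0) * norm w.

(** Only the values [S t] with [0 <= t] are meaningful. *)
Definition C0_semigroup {X : NormedModule R_AbsRing} (S : R -> X -> X) : Prop :=
  (forall t, 0 <= t -> is_linear (S t)) /\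
  (forall x, S 0 x = x) /\
  (forall t r x, 0 <= t -> 0 <= r -> S (t + r) x = S t (S r x)) /\
  (forall x, filterlim (fun t => S t x) (at_right 0) (locally x)).

Definition analytic_semigroup {X : NormedModule R_AbsRing}
    (S : R -> X -> X) : Prop :=
  C0_semigroup S /\
  exists (kappa : R) (T : C -> X * X -> X * X),
    0 < kappa /\
    (forall t x, 0 < t -> T (RtoC t) (x, zero) = (S t x, zero)) /\
    (forall z, sector kappa z -> C_linear (T z)) /\
    (forall z, sector kappa z -> C_diff_at T z) /\
    (forall z1 z2 w, sector kappa z1 -> sector kappa z2 ->
       T (z1 + z2)%C w = T z1 (T z2 w)) /\
    (forall w, filterlim (fun z => T z w)
       (within (sector kappa) (locally (RtoC 0))) (locally w)).

(** The unbounded operator [A] has domain [D]; its values outside [D] are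
    irrelevant. *)
Definition generator {X : NormedModule R_AbsRing}
    (S : R -> X -> X) (D : X -> Prop) (A : X -> X) : Prop :=
  forall x y, (D x /\ A x = y) <->
    filterlim (fun t => scal (/ t) (minus (S t x) x)) (at_right 0) (locally y).

Definition generates_analytic_semigroup {X : NormedModule R_AbsRing}
    (D : X -> Prop) (A : X -> X) (S : R -> X -> X) : Prop :=
  analytic_semigroup S /\ generator S D A.

(** * Smoothness *)

(** Derivative relative to [[t0, T]], hence one-sided at the end points. *)
Definition has_deriv_on {X : NormedModule R_AbsRing}
    (t0 T : R) (u : R -> X) (t : R) (l : X) : Prop :=
  filterlim (fun r => scal (/ (r - t)) (minus (u r) (u t)))
    (within (fun r => t0 <= r <= T /\ r <> t) (locally t)) (locally l).

Definition smooth_curve {X : NormedModule R_AbsRing}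
    (p : nat) (t0 T : R) (u : R -> X) : Prop :=
  exists (du : nat -> R -> X) (M : R),
    (forall t, t0 <= t <= T -> du 0%nat t = u t) /\
    (forall k t, (k < p)%nat -> t0 <= t <= T ->
       has_deriv_on t0 T (du k) t (du (S k) t)) /\
    (forall k t, (k <= p)%nat -> t0 <= t <= T -> norm (du k t) <= M).

Definition strip {X : NormedModule R_AbsRing}
    (t0 T : R) (u : R -> X) (rho : R) (x : X) : Prop :=
  exists t, t0 <= t <= T /\ norm (minus x (u t)) < rho.

Fixpoint norms_prod {X : NormedModule R_AbsRing} (vs : list X) : R :=
  match vs with
  | nil => 1
  | v :: vs' => norm v * norms_prod vs'
  end.

(** A [k]-linear map takes its arguments as a list of length [k]; its values on
    lists of other lengths are irrelevant. *)
Definition multilinear {X : NormedModule R_AbsRing}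
    (k : nat) (m : list X -> X) : Prop :=
  forall (vs ws : list X) (a : R) (x y : X),
    (length vs + S (length ws) = k)%nat ->
    m (vs ++ plus (scal a x) y :: ws) =
      plus (scal a (m (vs ++ x :: ws))) (m (vs ++ y :: ws)).

(** [g] is [p] times Frechet differentiable on the open set [N], with uniformly
    bounded derivatives: [dg k x] is the [k]-th derivative at [x], viewed as a
    [k]-linear map, and [dg (S k)] is the derivative of [dg k] in the operator
    norm, the direction of the last differentiation coming first. *)
Definition frechet_smooth {X : NormedModule R_AbsRing}
    (p : nat) (N : X -> Prop) (g : X -> X) : Prop :=
  exists (dg : nat -> X -> list X -> X) (M : R),
    (forall x, N x -> dg 0%nat x nil = g x) /\
    (forall k x, (k <= p)%nat -> N x -> multilinear k (dg k x)) /\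
    (forall k x vs, (1 <= k <= p)%nat -> N x -> length vs = k ->
       norm (dg k x vs) <= M * norms_prod vs) /\
    (forall k x, (k < p)%nat -> N x ->
       forall eps : posreal, exists delta : posreal, forall d : X,
       norm d < delta -> forall vs, length vs = k ->
       norm (minus (minus (dg k (plus x d) vs) (dg k x vs))
                   (dg (S k) x (d :: vs)))
         <= eps * norm d * norms_prod vs).

(** * The functions phi_k and their linear combinations *)

Definition kern (k : nat) (th : R) : R := th ^ (k - 1) / INR (fact (k - 1)).

Definition phi (k : nat) (z : R) : R :=
  match k with
  | O => exp z
  | S _ => RInt (fun th => exp ((1 - th) * z) * kern k th) 0 1
  end.

(** [phi_op S k tau] is phi_k(tau A), where [S t] is exp(t A). *)
Definition phi_op {X : CompleteNormedModule R_AbsRing}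
    (S : R -> X -> X) (k : nat) (tau : R) (x : X) : X :=
  match k with
  | O => S tau x
  | _ => RInt (fun th => scal (kern k th) (S ((1 - th) * tau) x)) 0 1
  end.

Record term := Term { twt : R; tidx : nat; tscale : R }.

(** The list of terms (w, k, lambda) encodes the entire function
    z |-> sum of the w phi_k(lambda z). *)
Definition coef := list term.

(** Negative scalings are excluded: phi_k(lambda h A) would not be a bounded
    operator. *)
Definition admissible (f : coef) : Prop :=
  forall q, In q f -> 0 <= tscale q.

Definition coef_eval (f : coef) (z : R) : R :=
  fold_right (fun q acc => twt q * phi (tidx q) (tscale q * z) + acc) 0 f.

Definition coef_op {X : CompleteNormedModule R_AbsRing}
    (S : R -> X -> X) (f : coef) (h : R) (x : X) : X :=
  fold_right (fun q acc =>
    plus (scal (twt q) (phi_op S (tidx q) (tscale q * h) x)) acc) zero f.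

(** * Explicit exponential Runge-Kutta methods *)

(** Only [node i] and [bcoef i] for [2 <= i <= stages], and [acoef i j] for
    [2 <= j < i <= stages], are meaningful. *)
Record expRK := ExpRK {
  stages : nat;
  node : nat -> R;
  acoef : nat -> nat -> coef;
  bcoef : nat -> coef }.

Definition expRK_wf (m : expRK) : Prop :=
  (forall i, (2 <= i <= stages m)%nat -> 0 <= node m i) /\
  (forall i j, (2 <= j < i)%nat -> (i <= stages m)%nat ->
     admissible (acoef m i j)) /\
  (forall i, (2 <= i <= stages m)%nat -> admissible (bcoef m i)).

(** One step of size [h] from [v] to [w]. The formulas contain [F v], so they
    make sense only for [v] in the domain of [A]; when all scalings in the
    [bcoef m i] are positive, the semigroup being analytic, [w] is in the domain
    again. The first stage does not enter. *)
Definition expRK_step {X : CompleteNormedModule R_AbsRing} (m : expRK)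
    (D : X -> Prop) (A : X -> X) (S : R -> X -> X) (g : X -> X)
    (h : R) (v w : X) : Prop :=
  D v /\
  let F := fun x => plus (A x) (g x) in
  exists U : nat -> X,
    let Dn := fun i => minus (g (U i)) (g v) in
    (forall i, (2 <= i <= stages m)%nat ->
       U i = plus (plus v
               (scal (node m i * h) (phi_op S 1 (node m i * h) (F v))))
               (scal h (sum_n_m (fun j => coef_op S (acoef m i j) h (Dn j))
                          2 (i - 1)))) /\
    w = plus (plus v (scal h (phi_op S 1 h (F v))))
          (scal h (sum_n_m (fun i => coef_op S (bcoef m i) h (Dn i))
                     2 (stages m))).

(** * Order conditions *)

Definition node_pow (m : expRK) (i j : nat) : R :=
  node m i ^ j / INR (fact j).

From mathcomp Require Import all_boot all_algebra Rstruct.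
Import GRing.Theory.

Local Open Scope ring_scope.

Definition exp_mx {n : nat} (Z : 'M[R]_n) : 'M[R]_n :=
  \matrix_(i, j) Series (fun r => Rdiv ((Z ^+ r) i j) (INR (fact r))).

Definition phi_mx {n : nat} (k : nat) (Z : 'M[R]_n) : 'M[R]_n :=
  match k with
  | O => exp_mx Z
  | _ => \matrix_(i, j)
           RInt (fun th : R => Rmult (kern k th) (exp_mx ((1 - th) *: Z) i j)) 0 1
  end.

Definition coef_mx {n : nat} (f : coef) (Z : 'M[R]_n) : 'M[R]_n :=
  \sum_(q <- f) twt q *: phi_mx (tidx q) (tscale q *: Z).

Definition psi {n : nat} (m : expRK) (j i : nat) (Z : 'M[R]_n) : 'M[R]_n :=
  \sum_(2 <= k < i) node_pow m k j.-1 *: coef_mx (acoef m i k) Z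
  - node m i ^+ j *: phi_mx j (node m i *: Z).

Definition is_bilinear {n : nat} (B : 'cV[R]_n -> 'cV[R]_n -> 'cV[R]_n) : Prop :=
  (forall v, linear (B v)) /\ (forall w, linear (fun v => B v w)).

(** The conditions are stated for a family [W Z i] of matrices, which is either
    b_i(Z) or b_i(0) I. *)
Definition weights := forall n : nat, 'M[R]_n -> nat -> 'M[R]_n.

Definition full (m : expRK) : weights :=
  fun n Z i => coef_mx (bcoef m i) Z.

Definition frozen (m : expRK) : weights :=
  fun n Z i => (coef_eval (bcoef m i) 0)%:M.

Section OrderConditions.
Variables (m : expRK) (W : weights).
Let s := stages m.
Let c := node m.
Let a {n : nat} i j (Z : 'M[R]_n) := coef_mx (acoef m i j) Z.

Definition cond1 : Prop := forall n (Z : 'M[R]_n),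
  \sum_(2 <= i < s.+1) c i *: W n Z i = phi_mx 2 Z.

Definition cond2 : Prop := forall n (Z : 'M[R]_n),
  \sum_(2 <= i < s.+1) node_pow m i 2 *: W n Z i = phi_mx 3 Z.

Definition cond3 : Prop := forall n (Z J : 'M[R]_n),
  \sum_(2 <= i < s.+1) W n Z i *m J *m psi m 2 i Z = 0.

Definition cond4 : Prop := forall n (Z : 'M[R]_n),
  \sum_(2 <= i < s.+1) node_pow m i 3 *: W n Z i = phi_mx 4 Z.

Definition cond5 : Prop := forall n (Z J : 'M[R]_n),
  \sum_(2 <= i < s.+1) W n Z i *m J *m psi m 3 i Z = 0.

Definition cond6 : Prop := forall n (Z J : 'M[R]_n),
  \sum_(2 <= i < s.+1) W n Z i *m J *m
    (\sum_(2 <= j < i) a i j Z *m J *m psi m 2 j Z) = 0.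

Definition cond7 : Prop := forall n (Z K : 'M[R]_n),
  \sum_(2 <= i < s.+1) c i *: (W n Z i *m K *m psi m 2 i Z) = 0.

Definition cond9 : Prop := forall n (Z J : 'M[R]_n),
  \sum_(2 <= i < s.+1) W n Z i *m J *m psi m 4 i Z = 0.

Definition cond10 : Prop := forall n (Z J : 'M[R]_n),
  \sum_(2 <= i < s.+1) W n Z i *m J *m
    (\sum_(2 <= j < i) a i j Z *m J *m psi m 3 j Z) = 0.

Definition cond11 : Prop := forall n (Z J : 'M[R]_n),
  \sum_(2 <= i < s.+1) W n Z i *m J *m
    (\sum_(2 <= j < i) a i j Z *m J *m
      (\sum_(2 <= k < j) a j k Z *m J *m psi m 2 k Z)) = 0.

Definition cond12 : Prop := forall n (Z J K : 'M[R]_n),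
  \sum_(2 <= i < s.+1) W n Z i *m J *m
    (\sum_(2 <= j < i) c j *: (a i j Z *m K *m psi m 2 j Z)) = 0.

Definition cond13 : Prop := forall n (Z K : 'M[R]_n),
  \sum_(2 <= i < s.+1) c i *: (W n Z i *m K *m psi m 3 i Z) = 0.

Definition cond14 : Prop := forall n (Z J K : 'M[R]_n),
  \sum_(2 <= i < s.+1) c i *: (W n Z i *m K *m
    (\sum_(2 <= j < i) a i j Z *m J *m psi m 2 j Z)) = 0.

Definition cond15 : Prop := forall n (Z : 'M[R]_n)
    (B : 'cV[R]_n -> 'cV[R]_n -> 'cV[R]_n), is_bilinear B ->
  forall v w : 'cV[R]_n,
  \sum_(2 <= i < s.+1) W n Z i *m B (psi m 2 i Z *m v) (psi m 2 i Z *m w) = 0.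

Definition cond16 : Prop := forall n (Z L : 'M[R]_n),
  \sum_(2 <= i < s.+1) c i ^+ 2 *: (W n Z i *m L *m psi m 2 i Z) = 0.

End OrderConditions.

Definition cond8_at0 (m : expRK) : Prop :=
  \sum_(2 <= i < (stages m).+1) coef_eval (bcoef m i) 0 * node_pow m i 4
  = phi 5 0.

(* Main.v *)
Require Import Defs.
From Stdlib Require Import Reals List Factorial Arith Lia Lra Psatz ClassicalEpsilon.
From Coquelicot Require Import Coquelicot.
From mathcomp Require all_boot all_algebra Rstruct.
Open Scope R_scope.

(** All the order conditions are linear relations between products of entire
    functions phi_k(lambda z). Tested on diagonal matrices and shifts they become
    scalar identities in independent variables; as the only linear relations
    between the phi_k(lambda z) come from phi_k(0) = 1/k!, these identities hold
    for the operators phi_k(lambda h A) as well.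

    With x in the domain of A, phi_k(tau A) x = x / k! + tau phi_(k+1)(tau A) A x;
    applied to the derivatives of u, this expands the Taylor polynomial of u at t
    in terms of phi_k and the derivatives F_k of g(u(t)). Inserting approximate
    stages Taylor polynomial + h^2 Y2 + h^3 Y3 + h^4 Y4 into the scheme, the
    conditions 1-7 cancel the defect up to order h^4, and the conditions 8-16
    leave
      h^5 (phi_5(hA) - phi_5(0)) F_4 - h^5 sum_i (b_i(hA) - b_i(0)) V_i + O(h^6),
    where F_4 and V_i are bounded and Lipschitz in t. No smallness of
    b_i(hA) - b_i(0) is available, but since the semigroup is analytic,
    the sums over n of S(nh) (f(hA) - f(0)) v are bounded by a multiple of v
    (a consequence of a second difference estimate for S), and summation by
    parts bounds the sum of the propagated defects by C h^5. A discrete Gronwall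
    lemma concludes. *)

(** * Linear identities in modules *)

(** The crux is to reach h^5 rather than h^5 |log h|. Smoothing gives S(jh + sigma) - S(jh) only the
    size 1/j, whose sum over the steps costs a logarithm. Compared with a multiple of the one-step
    difference S((j+1)h) - S(jh), whose sum telescopes, the remainder has size 1/j^2. The bound K/t
    for the derivative of S behind this is not contained in the definition of an analytic semigroup,
    which provides complex differentiability and strong continuity at 0; uniform boundedness and a
    Cauchy estimate produce it. Once the scheme is in mild form, the unbounded [A] enters only
    through [integrated_generator], a relation between bounded operators that survives limits and
    can therefore be differentiated in time along the solution. The order conditions speak of
    matrices, whereas [A] and the derivatives of [g] are operators on X that need not commute. Hence
    each coefficient function gets its own scalar variable, and the variables are exchanged for
    operators one at a time, the linear maps between them being carried along. *)

Inductive mexp : Type :=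
| MAtom (n : nat)
| MZero
| MPlus (e1 e2 : mexp)
| MOpp (e : mexp)
| MScal (r : R) (e : mexp).

Section LinearIdentities.
Context {V : ModuleSpace R_AbsRing}.

Fixpoint meval (env : list V) (e : mexp) : V :=
  match e with
  | MAtom n => nth n env zero
  | MZero => zero
  | MPlus e1 e2 => plus (meval env e1) (meval env e2)
  | MOpp e => opp (meval env e)
  | MScal r e => scal r (meval env e)
  end.

Fixpoint mcoef (e : mexp) (n : nat) : R :=
  match e with
  | MAtom k => if Nat.eqb k n then 1 else 0
  | MZero => 0
  | MPlus e1 e2 => mcoef e1 n + mcoef e2 n
  | MOpp e => - mcoef e n
  | MScal r e => r * mcoef e n
  end.

Fixpoint lincomb (f : nat -> R) (env : list V) : V :=
  match env with
  | nil => zero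
  | x :: t => plus (scal (f 0%nat) x) (lincomb (fun n => f (S n)) t)
  end.

(** Coefficients are compared only at the indices of the environment, so the condition computes to a
    finite conjunction of equations between reals. *)
Fixpoint same_coef (f1 f2 : nat -> R) (env : list V) : Prop :=
  match env with
  | nil => True
  | _ :: t => f1 0%nat = f2 0%nat
              /\ same_coef (fun n => f1 (S n)) (fun n => f2 (S n)) t
  end.

Lemma lincomb_zero (env : list V) f :
  (forall n, f n = 0) -> lincomb f env = zero.
Proof.
revert f; induction env as [|x t IH]; intros f Hf; simpl; [easy|].
rewrite (IH (fun n => f (S n))); [|intros; apply Hf].
rewrite Hf, plus_zero_r; exact (scal_zero_l x).
Qed.

Lemma lincomb_atom (env : list V) k f :
  (forall n, f n = if Nat.eqb k n then 1 else 0) ->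
  lincomb f env = nth k env zero.
Proof.
revert k f; induction env as [|x t IH]; intros k f Hf; simpl.
- now destruct k.
- destruct k as [|k]; rewrite Hf; simpl.
  + rewrite lincomb_zero, plus_zero_r; [exact (scal_one x)|].
    intros n; now rewrite Hf.
  + rewrite (IH k); [|intros n; now rewrite Hf].
    rewrite <- (plus_zero_l (nth k t zero)) at 2; f_equal.
    exact (scal_zero_l x).
Qed.

Lemma lincomb_plus (env : list V) f1 f2 :
  lincomb (fun n => f1 n + f2 n) env = plus (lincomb f1 env) (lincomb f2 env).
Proof.
revert f1 f2; induction env as [|x t IH]; intros f1 f2; simpl.
- now rewrite plus_zero_l.
- rewrite (IH (fun n => f1 (S n)) (fun n => f2 (S n))).
  rewrite (scal_distr_r (K := R_AbsRing) (f1 0%nat) (f2 0%nat) x : scal (f1 0%nat + f2 0%nat) x = _).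
  rewrite <- !plus_assoc; f_equal; rewrite plus_comm, <- plus_assoc.
  f_equal; apply plus_comm.
Qed.

Lemma lincomb_scal (env : list V) r f :
  lincomb (fun n => r * f n) env = scal r (lincomb f env).
Proof.
revert f; induction env as [|x t IH]; intros f; simpl.
- symmetry; exact (scal_zero_r r).
- rewrite (IH (fun n => f (S n))), scal_distr_l; f_equal.
  symmetry; exact (scal_assoc r (f 0%nat) x).
Qed.

Lemma lincomb_ext (env : list V) f1 f2 :
  same_coef f1 f2 env -> lincomb f1 env = lincomb f2 env.
Proof.
revert f1 f2; induction env as [|x t IH]; simpl; intros f1 f2 H; [easy|].
destruct H as [-> H]; f_equal; now apply IH.
Qed.

Lemma meval_lincomb (env : list V) e : meval env e = lincomb (mcoef e) env.
Proof.
induction e as [n| |e1 IH1 e2 IH2|e IH|r e IH]; simpl.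
- symmetry; now apply lincomb_atom.
- symmetry; now apply lincomb_zero.
- rewrite (lincomb_plus env (mcoef e1) (mcoef e2)), IH1, IH2; reflexivity.
- rewrite IH, <- (scal_opp_one (lincomb (mcoef e) env)).
  change (opp (one : R_AbsRing)) with (- (1)).
  rewrite <- lincomb_scal; apply lincomb_ext.
  generalize (mcoef e); clear; induction env as [|x t IH]; intros f; simpl; [easy|].
  split; [ring|exact (IH (fun n => f (S n)))].
- now rewrite (lincomb_scal env r (mcoef e)), IH.
Qed.

Lemma mexp_eq (env : list V) e1 e2 :
  same_coef (mcoef e1) (mcoef e2) env -> meval env e1 = meval env e2.
Proof. intros H; rewrite !meval_lincomb; now apply lincomb_ext. Qed.

End LinearIdentities.

(** Atoms are compared by unification rather than syntactically, so that convertible spellings of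
    one vector share an index. *)
Ltac madd x env :=
  let rec go l :=
    lazymatch l with
    | nil => constr:(cons x env)
    | cons ?y ?t => let r := match goal with
                    | _ => let _ := match goal with _ => unify x y end in constr:(env)
                    | _ => go t end in r
    end in go env.

Ltac matoms e env :=
  lazymatch e with
  | plus ?a ?b => let env1 := matoms a env in matoms b env1
  | minus ?a ?b => let env1 := matoms a env in matoms b env1
  | opp ?a => matoms a env
  | scal _ ?a => matoms a env
  | zero => constr:(env)
  | _ => madd e env
  end.

Ltac mindex x env :=
  lazymatch env with
  | cons ?y ?t => match goal with
                  | _ => let _ := match goal with _ => unify x y end in constr:(O)
                  | _ => let n := mindex x t in constr:(S n) end
  end.

Ltac mreify e env :=
  lazymatch e with
  | plus ?a ?b => let a' := mreify a env in let b' := mreify b env in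
                  constr:(MPlus a' b')
  | minus ?a ?b => let a' := mreify a env in let b' := mreify b env in
                   constr:(MPlus a' (MOpp b'))
  | opp ?a => let a' := mreify a env in constr:(MOpp a')
  | scal ?r ?a => let a' := mreify a env in constr:(MScal r a')
  | zero => constr:(MZero)
  | _ => let n := mindex e env in constr:(MAtom n)
  end.

(** Reduces an identity between linear combinations in a module to the
    identities between the real coefficients of its atoms. *)
Ltac mcoefs :=
  lazymatch goal with
  | |- @eq ?T ?l ?r =>
    let env0 := matoms l (@nil T) in
    let env := matoms r env0 in
    let el := mreify l env in
    let er := mreify r env in
    refine (mexp_eq env el er _); cbn [same_coef mcoef Nat.eqb];
    repeat match goal with |- _ /\ _ => split end; try exact I
  end.

Ltac module :=
  mcoefs; (ring || (field; repeat split; first [apply INR_fact_neq_0 | lra])).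

(** * Norms and finite sums of vectors *)

Section NormedModules.
Context {V : NormedModule R_AbsRing}.
Implicit Types x y z : V.

Lemma norm_minus_sym x y : norm (minus x y) = norm (minus y x).
Proof. rewrite <- norm_opp; f_equal; module. Qed.

Lemma norm_minus_zero x : norm (minus x zero) = norm x.
Proof. f_equal; module. Qed.

Lemma norm_le_eq y x (c : R) : x = y -> norm y <= c -> norm x <= c.
Proof. now intros ->. Qed.

(** The axioms of a normed module give one inequality; the other is the same inequality for the
    inverse scalar. *)
Lemma norm_scal_eq (a : R) x : norm (scal a x) = Rabs a * norm x.
Proof.
apply Rle_antisym; [exact (norm_scal a x)|].
destruct (Req_dec a 0) as [->|Ha].
- rewrite Rabs_R0, Rmult_0_l; apply norm_ge_0.
- assert (H : norm x <= Rabs (/ a) * norm (scal a x)).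
  { replace x with (scal (/ a) (scal a x)) at 1 by module.
    exact (norm_scal (/ a) (scal a x)). }
  rewrite Rabs_inv in H; apply Rabs_no_R0 in Ha as Ha'.
  apply (Rmult_le_compat_l (Rabs a)) in H; [|apply Rabs_pos].
  rewrite <- Rmult_assoc, Rinv_r, Rmult_1_l in H; easy.
Qed.

Lemma norm_scal_pos (a : R) x : 0 <= a -> norm (scal a x) = a * norm x.
Proof. intros Ha; rewrite norm_scal_eq, Rabs_pos_eq; easy. Qed.

Lemma norm_plus_le x y (a b : R) :
  norm x <= a -> norm y <= b -> norm (plus x y) <= a + b.
Proof. intros Hx Hy; pose proof (norm_triangle x y); lra. Qed.

Lemma norm_minus_le x y (a b : R) :
  norm x <= a -> norm y <= b -> norm (minus x y) <= a + b.
Proof.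
intros Hx Hy; unfold minus; apply norm_plus_le; [easy|now rewrite norm_opp].
Qed.

Lemma norm_scal_le (a c b : R) x :
  Rabs a <= c -> norm x <= b -> norm (scal a x) <= c * b.
Proof.
intros Ha Hb; rewrite norm_scal_eq; apply Rmult_le_compat; try easy.
apply Rabs_pos. apply norm_ge_0.
Qed.

Lemma norm_le_minus x y : norm x <= norm (minus x y) + norm y.
Proof.
replace x with (plus (minus x y) y) at 1 by module; apply norm_triangle.
Qed.

Lemma norm_minus_trans x y z :
  norm (minus x z) <= norm (minus x y) + norm (minus y z).
Proof.
replace (minus x z) with (plus (minus x y) (minus y z)) by module.
apply norm_triangle.
Qed.

Lemma minus_eq x y : norm (minus x y) = 0 -> x = y.
Proof.
intros H; apply norm_eq_zero in H.
replace x with (plus (minus x y) y) by module; rewrite H; apply plus_zero_l.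
Qed.

Lemma norm_small_eq x y :
  (forall eps : R, 0 < eps -> norm (minus x y) <= eps) -> x = y.
Proof.
intros H; apply minus_eq; apply Rle_antisym; [|apply norm_ge_0].
apply le_epsilon; intros e He; rewrite Rplus_0_l; now apply H.
Qed.

Lemma filterlim_norm_le {T} (F : (T -> Prop) -> Prop) {FF : Filter F}
  (f : T -> V) (l : V) :
  filterlim f F (locally l) <->
  forall eps : R, 0 < eps -> F (fun t => norm (minus (f t) l) <= eps).
Proof.
split.
- intros H eps He.
  apply (filter_imp (fun t => norm (minus (f t) l) < eps)); [intros; lra|].
  apply (H (fun y => norm (minus y l) < eps)).
  apply locally_le_locally_norm; exists (mkposreal _ He); intros y Hy; exact Hy.
- intros H P HP; apply locally_norm_le_locally in HP; destruct HP as [e He].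
  unfold filtermap.
  apply (filter_imp (fun t => norm (minus (f t) l) <= e / 2)).
  + intros t Ht; apply He; change (norm (minus (f t) l) < e).
    pose proof (cond_pos e); lra.
  + apply H; pose proof (cond_pos e); lra.
Qed.

Lemma filterlim_unique_norm {T} (F : (T -> Prop) -> Prop) {FF : ProperFilter F}
  (f : T -> V) (l l' : V) :
  filterlim f F (locally l) -> filterlim f F (locally l') -> l = l'.
Proof.
intros H H'; apply norm_small_eq; intros e He.
assert (He2 : 0 < e / 2) by lra.
apply filterlim_norm_le with (eps := e / 2) in H; [|exact _|exact He2].
apply filterlim_norm_le with (eps := e / 2) in H'; [|exact _|exact He2].
destruct (filter_ex _ (filter_and _ _ H H')) as [t [H1 H2]].
pose proof (norm_minus_trans l (f t) l') as H3.
rewrite (norm_minus_sym l (f t)) in H3; simpl in H1, H2; lra.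
Qed.

Lemma filterlim_plus_to {T} (F : (T -> Prop) -> Prop) {FF : Filter F}
  (f g h : T -> V) (a b c : V) :
  filterlim f F (locally a) -> filterlim g F (locally b) ->
  c = plus a b -> (forall r, h r = plus (f r) (g r)) ->
  filterlim h F (locally c).
Proof.
intros Hf Hg -> Eh; eapply filterlim_ext; [intros r; symmetry; apply Eh|].
eapply (filterlim_comp_2 (F := F)); [exact Hf|exact Hg|exact (filterlim_plus a b)].
Qed.

(** Sums run over lists of arbitrary indices because nested sums are later flattened, filtered and
    indexed by pairs or by lists of derivative orders. *)
Fixpoint vsum {I : Type} (l : list I) (F : I -> V) : V :=
  match l with
  | nil => zero
  | i :: t => plus (F i) (vsum t F)
  end.

Lemma vsum_ext {I} (l : list I) (F G : I -> V) :
  (forall i, In i l -> F i = G i) -> vsum l F = vsum l G.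
Proof.
induction l as [|i t IH]; simpl; intros H; [easy|].
rewrite H, IH; auto.
Qed.

Lemma vsum_zero {I} (l : list I) (F : I -> V) :
  (forall i, In i l -> F i = zero) -> vsum l F = zero.
Proof.
induction l as [|i t IH]; simpl; intros H; [easy|].
rewrite H, IH; auto; apply plus_zero_l.
Qed.

Lemma vsum_plus {I} (l : list I) (F G : I -> V) :
  vsum l (fun i => plus (F i) (G i)) = plus (vsum l F) (vsum l G).
Proof.
induction l as [|i t IH]; simpl; [now rewrite plus_zero_l|].
rewrite IH; module.
Qed.

Lemma vsum_minus {I} (l : list I) (F G : I -> V) :
  vsum l (fun i => minus (F i) (G i)) = minus (vsum l F) (vsum l G).
Proof.
induction l as [|i t IH]; simpl; [module|].
rewrite IH; module.
Qed.

Lemma vsum_scal {I} (l : list I) (a : R) (F : I -> V) :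
  vsum l (fun i => scal a (F i)) = scal a (vsum l F).
Proof.
induction l as [|i t IH]; simpl; [symmetry; exact (scal_zero_r a)|].
rewrite IH; module.
Qed.

Lemma vsum_app {I} (l1 l2 : list I) (F : I -> V) :
  vsum (l1 ++ l2) F = plus (vsum l1 F) (vsum l2 F).
Proof.
induction l1 as [|i t IH]; simpl; [now rewrite plus_zero_l|].
now rewrite IH, plus_assoc.
Qed.

Lemma vsum_map {I J} (f : J -> I) (l : list J) (F : I -> V) :
  vsum (map f l) F = vsum l (fun j => F (f j)).
Proof. induction l as [|i t IH]; simpl; [easy|now rewrite IH]. Qed.

Lemma vsum_flat_map {I J} (f : J -> list I) (l : list J) (F : I -> V) :
  vsum (flat_map f l) F = vsum l (fun j => vsum (f j) F).
Proof.
induction l as [|i t IH]; simpl; [easy|now rewrite vsum_app, IH].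
Qed.

Lemma vsum_scal_l {I} (l : list I) (a : I -> R) x :
  vsum l (fun i => scal (a i) x) = scal (fold_right (fun i s => a i + s) 0 l) x.
Proof.
induction l as [|i t IH]; simpl; [symmetry; exact (scal_zero_l x)|].
rewrite IH; module.
Qed.

Lemma vsum_filter {I} (p : I -> bool) (l : list I) (F : I -> V) :
  vsum l F = plus (vsum (filter p l) F) (vsum (filter (fun i => negb (p i)) l) F).
Proof.
induction l as [|i t IH]; simpl; [now rewrite plus_zero_l|].
rewrite IH; destruct (p i); simpl; module.
Qed.

Lemma norm_vsum_le {I} (l : list I) (F : I -> V) (C : R) :
  (forall i, In i l -> norm (F i) <= C) -> norm (vsum l F) <= INR (length l) * C.
Proof.
induction l as [|i t IH]; intros H; cbn [vsum length].
- rewrite norm_zero, Rmult_0_l; apply Rle_refl.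
- rewrite S_INR; eapply Rle_trans; [apply norm_plus_le|].
  apply H; simpl; auto. apply IH; intros; apply H; simpl; auto. lra.
Qed.

Lemma sum_n_m_vsum (F : nat -> V) n m :
  sum_n_m F n m = vsum (seq n (S m - n)) F.
Proof.
destruct (Nat.le_gt_cases n m) as [H|H].
- replace m with (n + (m - n))%nat by lia.
  replace (S (n + (m - n)) - n)%nat with (S (m - n)) by lia.
  generalize (m - n)%nat as k; clear m H; intros k; revert n.
  induction k as [|k IH]; intros n.
  + rewrite Nat.add_0_r, sum_n_n; simpl; now rewrite plus_zero_r.
  + rewrite sum_Sn_m by lia.
    replace (n + S k)%nat with (S n + k)%nat by lia; rewrite IH; reflexivity.
- replace (S m - n)%nat with 0%nat by lia; now rewrite sum_n_m_zero.
Qed.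

End NormedModules.

Lemma vsum_linear {U V : NormedModule R_AbsRing} {I} (L : U -> V)
  (l : list I) (F : I -> U) :
  (forall x y, L (plus x y) = plus (L x) (L y)) ->
  L zero = zero ->
  L (vsum l F) = vsum l (fun i => L (F i)).
Proof.
intros HL H0; induction l as [|i t IH]; simpl; [easy|now rewrite HL, IH].
Qed.

(** * One-sided derivatives on an interval *)

Definition punctured (a b t : R) : (R -> Prop) -> Prop :=
  within (fun r => a <= r <= b /\ r <> t) (locally t).

Global Instance punctured_filter a b t : Filter (punctured a b t).
Proof. apply within_filter, locally_filter. Qed.

Lemma punctured_proper a b t :
  a < b -> a <= t <= b -> ProperFilter (punctured a b t).
Proof.
intros Hab Ht; apply Build_ProperFilter; [|apply punctured_filter].
intros P [d Hd].
assert (Hd0 := cond_pos d).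
destruct (Rlt_dec t b) as [Htb|Htb].
- exists (t + Rmin (d / 2) (b - t)).
  assert (0 < Rmin (d / 2) (b - t)) by (apply Rmin_glb_lt; lra).
  pose proof (Rmin_l (d / 2) (b - t)); pose proof (Rmin_r (d / 2) (b - t)).
  apply Hd; [|lra].
  change (Rabs (t + Rmin (d / 2) (b - t) - t) < d).
  rewrite Rabs_pos_eq; lra.
- exists (t - Rmin (d / 2) (t - a)).
  assert (0 < Rmin (d / 2) (t - a)) by (apply Rmin_glb_lt; lra).
  pose proof (Rmin_l (d / 2) (t - a)); pose proof (Rmin_r (d / 2) (t - a)).
  apply Hd; [|lra].
  change (Rabs (t - Rmin (d / 2) (t - a) - t) < d).
  rewrite Rabs_left1; lra.
Qed.

Section Derivatives.
Context {V : NormedModule R_AbsRing}.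
Implicit Types f g : R -> V.

Lemma punctured_spec a b t (P : R -> Prop) :
  punctured a b t P <->
  exists d, 0 < d /\ forall r, a <= r <= b -> r <> t -> Rabs (r - t) < d -> P r.
Proof.
split.
- intros [d Hd]; exists d; split; [apply cond_pos|].
  intros r H1 H2 H3; apply Hd; [exact H3|easy].
- intros [d [Hd H]]; exists (mkposreal d Hd); intros r Hr [H1 H2]; now apply H.
Qed.

(** Multiplied out, the estimate is also meaningful at [r = t], which makes compositions with affine
    maps, constant ones included, unproblematic. *)
Lemma has_deriv_on_eps a b f t l :
  has_deriv_on a b f t l <->
  forall eps, 0 < eps -> exists d, 0 < d /\
    forall r, a <= r <= b -> Rabs (r - t) < d ->
    norm (minus (minus (f r) (f t)) (scal (r - t) l)) <= eps * Rabs (r - t).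
Proof.
assert (E : forall r, r <> t ->
  norm (minus (minus (f r) (f t)) (scal (r - t) l)) =
  Rabs (r - t) * norm (minus (scal (/ (r - t)) (minus (f r) (f t))) l)).
{ intros r Hr; rewrite <- norm_scal_eq; f_equal; mcoefs; field; lra. }
etransitivity; [exact (filterlim_norm_le (punctured a b t) _ l)|].
split; intros H eps He; specialize (H eps He).
- apply punctured_spec in H; destruct H as [d [Hd H]]; exists d; split; [easy|].
  intros r Hr Hrd; destruct (Req_dec r t) as [->|Hrt].
  + replace (minus (minus (f t) (f t)) (scal (t - t) l)) with (zero : V) by module.
    rewrite norm_zero, Rminus_diag, Rabs_R0; lra.
  + rewrite E, Rmult_comm by easy; apply Rmult_le_compat_r; [apply Rabs_pos|auto].
- apply punctured_spec; destruct H as [d [Hd H]]; exists d; split; [easy|].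
  intros r Hr Hrt Hrd; specialize (H r Hr Hrd); rewrite E in H by easy.
  assert (0 < Rabs (r - t)) by (apply Rabs_pos_lt; now apply Rminus_eq_contra).
  apply Rmult_le_reg_l with (Rabs (r - t)); [easy|].
  rewrite (Rmult_comm _ eps); exact H.
Qed.

Lemma has_deriv_on_cont a b f t l :
  has_deriv_on a b f t l -> filterlim f (punctured a b t) (locally (f t)).
Proof.
intros H; apply (filterlim_norm_le (punctured a b t)); intros eps He.
rewrite has_deriv_on_eps in H; destruct (H 1 Rlt_0_1) as [d [Hd Hf]].
apply punctured_spec.
assert (Hl := norm_ge_0 l).
exists (Rmin d (eps / (1 + norm l))); split.
{ apply Rmin_glb_lt; [easy|]; apply Rdiv_lt_0_compat; lra. }
intros r Hr _ Hrd.
assert (H1 := Rlt_le_trans _ _ _ Hrd (Rmin_l _ _)).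
assert (H2 := Rlt_le_trans _ _ _ Hrd (Rmin_r _ _)).
specialize (Hf r Hr H1).
replace (minus (f r) (f t)) with
  (plus (minus (minus (f r) (f t)) (scal (r - t) l)) (scal (r - t) l)) by module.
eapply Rle_trans; [apply norm_plus_le; [exact Hf|rewrite norm_scal_eq; apply Rle_refl]|].
apply (Rmult_lt_compat_r (1 + norm l)) in H2; [|lra].
unfold Rdiv in H2; rewrite Rmult_assoc, Rinv_l in H2 by lra. lra.
Qed.

Lemma has_deriv_on_eq a b f t l l' :
  l = l' -> has_deriv_on a b f t l -> has_deriv_on a b f t l'.
Proof. now intros ->. Qed.

Lemma has_deriv_on_ext a b f g t l :
  a <= t <= b -> (forall r, a <= r <= b -> f r = g r) ->
  has_deriv_on a b f t l -> has_deriv_on a b g t l.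
Proof.
intros Ht E H; eapply (filterlim_within_ext (F := locally t)); [|exact H].
intros r [Hr _]; simpl; now rewrite !E.
Qed.

Lemma has_deriv_on_sub a b a' b' f t l :
  a <= a' -> b' <= b -> has_deriv_on a b f t l -> has_deriv_on a' b' f t l.
Proof.
rewrite !has_deriv_on_eps; intros Ha Hb H e He.
destruct (H e He) as [d [Hd K]]; exists d; split; [easy|].
intros r Hr; apply K; lra.
Qed.

Lemma has_deriv_on_unique a b f t l l' :
  a < b -> a <= t <= b ->
  has_deriv_on a b f t l -> has_deriv_on a b f t l' -> l = l'.
Proof.
intros Hab Ht.
exact (filterlim_unique_norm (punctured a b t) (FF := punctured_proper a b t Hab Ht) _ l l').
Qed.

Lemma has_deriv_on_plus a b f g t l m :
  has_deriv_on a b f t l -> has_deriv_on a b g t m ->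
  has_deriv_on a b (fun r => plus (f r) (g r)) t (plus l m).
Proof.
intros Hf Hg.
eapply filterlim_ext; [|eapply (filterlim_comp_2 (F := punctured a b t));
  [exact Hf|exact Hg|apply filterlim_plus]].
intros r; simpl; module.
Qed.

Lemma has_deriv_on_const a b (x : V) t :
  has_deriv_on a b (fun _ => x) t zero.
Proof.
apply (filterlim_ext (fun _ => zero : V)); [intros r; module|].
apply filterlim_const.
Qed.

Lemma is_derive_has_deriv_on a b f t l :
  is_derive f t l -> has_deriv_on a b f t l.
Proof.
intros [_ H]; rewrite has_deriv_on_eps; intros e He.
specialize (H t (fun P HP => HP) (mkposreal e He)).
destruct H as [d Hd]; exists d; split; [apply cond_pos|].
intros r _ Hr; exact (Hd r Hr).
Qed.

Lemma has_deriv_on_mult a b (k : R -> R) f t (k' : R) l :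
  has_deriv_on (X := R_NormedModule) a b k t k' -> has_deriv_on a b f t l ->
  has_deriv_on a b (fun r => scal (k r) (f r)) t
    (plus (scal k' (f t)) (scal (k t) l)).
Proof.
intros Hk Hf; assert (Hc := has_deriv_on_cont a b f t l Hf).
eapply filterlim_ext; [|eapply (filterlim_comp_2 (F := punctured a b t));
  [eapply (filterlim_comp_2 (F := punctured a b t));
     [exact Hk|exact Hc|exact (filterlim_scal (K := R_AbsRing) k' (f t))]
  |eapply filterlim_comp; [exact Hf|exact (filterlim_scal_r (k t) l)]
  |exact (filterlim_plus (scal k' (f t)) (scal (k t) l))]].
intros r; simpl.
change (scal (/ (r - t)) (minus (k r) (k t))) with (/ (r - t) * (k r - k t)).
mcoefs; ring.
Qed.

Lemma has_deriv_on_affine a b a' b' f (u v : R) t l :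
  (forall r, a' <= r <= b' -> a <= u * r + v <= b) ->
  has_deriv_on a b f (u * t + v) l ->
  has_deriv_on a' b' (fun r => f (u * r + v)) t (scal u l).
Proof.
intros Hm; rewrite !has_deriv_on_eps; intros H e He.
assert (Hu : 0 < Rabs u + 1) by (pose proof (Rabs_pos u); lra).
destruct (H (e / (Rabs u + 1))) as [d [Hd K]]; [now apply Rdiv_lt_0_compat|].
exists (d / (Rabs u + 1)); split; [now apply Rdiv_lt_0_compat|].
intros r Hr Hrd.
assert (Eu : u * r + v - (u * t + v) = u * (r - t)) by ring.
assert (Hd' : Rabs (u * (r - t)) < d).
{ rewrite Rabs_mult.
  apply (Rmult_lt_compat_l (Rabs u + 1)) in Hrd; [|easy].
  replace ((Rabs u + 1) * (d / (Rabs u + 1))) with d in Hrd by (field; lra).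
  pose proof (Rabs_pos (r - t)); lra. }
specialize (K (u * r + v) (Hm r Hr)); rewrite Eu in K; specialize (K Hd').
replace (scal (r - t) (scal u l)) with (scal (u * (r - t)) l) by module.
eapply Rle_trans; [exact K|].
rewrite Rabs_mult, <- Rmult_assoc; apply Rmult_le_compat_r; [apply Rabs_pos|].
apply Rmult_le_reg_r with (Rabs u + 1); [easy|].
replace (e / (Rabs u + 1) * Rabs u * (Rabs u + 1)) with (e * Rabs u) by (field; lra).
apply Rmult_le_compat_l; lra.
Qed.

(** For vector values there is no intermediate point to use. Instead a bound with slack [e] per unit
    length is propagated: it holds up to the supremum of the points it reaches, and
    differentiability there pushes it further unless the end is attained. *)
Lemma mean_value_inequality a b f (f' : R -> V) (M : R) :
  a <= b ->
  (forall t, a <= t <= b -> has_deriv_on a b f t (f' t)) ->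
  (forall t, a <= t <= b -> norm (f' t) <= M) ->
  norm (minus (f b) (f a)) <= M * (b - a).
Proof.
intros Hab Hf HM; apply le_epsilon; intros e0 He0.
(* The total slack [e * (b - a)] stays below [e0]; the summand 1 covers [a = b]. *)
set (e := e0 / (b - a + 1)).
assert (He : 0 < e) by (apply Rdiv_lt_0_compat; lra).
set (P := fun y => norm (minus (f y) (f a)) <= (M + e) * (y - a)).
set (E := fun x => a <= x <= b /\ forall y, a <= y <= x -> P y).
assert (HM0 : 0 <= M).
{ eapply Rle_trans; [apply (norm_ge_0 (f' a))|apply (HM a); lra]. }
assert (Pa : P a).
{ unfold P; replace (minus (f a) (f a)) with (zero : V) by module.
  rewrite norm_zero; lra. }
assert (Ea : E a).
{ split; [lra|]; intros y Hy; now replace y with a by lra. }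
destruct (completeness E) as [s [Hub Hlub]].
{ exists b; intros x [Hx _]; lra. }
{ now exists a. }
assert (Hs : a <= s <= b).
{ split; [now apply Hub|]; apply Hlub; intros x [Hx _]; lra. }
assert (Hbelow : forall y, y < s -> exists x, E x /\ y < x).
{ intros y Hy; apply NNPP; intros N; apply (Rlt_not_le _ _ Hy), Hlub.
  intros x Hx; destruct (Rle_lt_dec x y) as [|Hxy]; [easy|].
  exfalso; apply N; now exists x. }
pose proof (Hf s Hs) as Hfs; rewrite has_deriv_on_eps in Hfs.
destruct (Hfs e He) as [d [Hd Hloc]]; clear Hfs.
assert (Hl : forall y, a <= y <= b -> Rabs (y - s) < d ->
  norm (minus (f y) (f s)) <= (M + e) * Rabs (y - s)).
{ intros y Hy Hyd; specialize (Hloc y Hy Hyd).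
  replace (minus (f y) (f s)) with
    (plus (minus (minus (f y) (f s)) (scal (y - s) (f' s))) (scal (y - s) (f' s)))
    by module.
  eapply Rle_trans; [apply norm_plus_le; [exact Hloc|]|].
  apply norm_scal_le; [apply Rle_refl|now apply HM]. lra. }
assert (Ps : P s).
{ destruct (Rle_lt_or_eq_dec a s (proj1 Hs)) as [Has|<-]; [|easy].
  destruct (Hbelow (s - d)) as [x [[Hx Px] Hxs]]; [lra|].
  assert (Hxs' : x <= s) by (apply Hub; now split).
  specialize (Px x ltac:(lra)); unfold P in *.
  assert (H1 : Rabs (x - s) < d) by (rewrite Rabs_left1; lra).
  specialize (Hl x Hx H1); rewrite Rabs_left1 in Hl by lra.
  rewrite norm_minus_sym in Hl.
  pose proof (norm_minus_trans (f s) (f x) (f a)); lra. }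
(* The bound reaches [b'], so [b' <= s] by the choice of [s]; this forces [s = b]. *)
set (b' := Rmin b (s + d / 2)).
assert (Hb' : s <= b' <= b).
{ unfold b'; split; [apply Rmin_glb; lra|apply Rmin_l]. }
assert (Hb'2 : b' <= s + d / 2) by apply Rmin_r.
assert (Eb' : E b').
{ split; [lra|]; intros y Hy.
  destruct (Rlt_dec y s) as [Hys|Hys].
  - destruct (Hbelow y Hys) as [x [[Hx Px] Hxy]]; apply Px; lra.
  - assert (H1 : Rabs (y - s) < d) by (rewrite Rabs_pos_eq; lra).
    specialize (Hl y ltac:(lra) H1); rewrite Rabs_pos_eq in Hl by lra.
    unfold P in *; pose proof (norm_minus_trans (f y) (f s) (f a)); lra. }
assert (Hbs : b' <= s) by (now apply Hub).
assert (Eb : b = s).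
{ unfold b' in Hbs; revert Hbs; unfold Rmin; destruct Rle_dec; lra. }
subst s; unfold P in Ps; eapply Rle_trans; [exact Ps|].
assert (e * (b - a) <= e0); [|lra].
unfold e; apply Rmult_le_reg_r with (b - a + 1); [lra|].
replace (e0 / (b - a + 1) * (b - a) * (b - a + 1)) with (e0 * (b - a)) by (field; lra).
apply Rmult_le_compat_l; lra.
Qed.

Lemma has_deriv_on_lipschitz a b f (f' : R -> V) (M : R) :
  (forall t, a <= t <= b -> has_deriv_on a b f t (f' t)) ->
  (forall t, a <= t <= b -> norm (f' t) <= M) ->
  forall s t, a <= s <= b -> a <= t <= b ->
  norm (minus (f s) (f t)) <= M * Rabs (s - t).
Proof.
intros Hf HM.
assert (H : forall s t, a <= s <= b -> a <= t <= b -> s <= t ->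
  norm (minus (f s) (f t)) <= M * Rabs (s - t)).
{ intros s t Hs Ht Hst; rewrite norm_minus_sym, Rabs_minus_sym, Rabs_pos_eq by lra.
  apply (mean_value_inequality s t f f'); [easy| |].
  - intros r Hr; apply has_deriv_on_sub with a b; try lra; apply Hf; lra.
  - intros r Hr; apply HM; lra. }
intros s t Hs Ht; destruct (Rle_dec s t); [now apply H|].
rewrite norm_minus_sym, Rabs_minus_sym; apply H; auto; lra.
Qed.

Lemma has_deriv_on_zero a b f :
  (forall t, a <= t <= b -> has_deriv_on a b f t zero) ->
  forall s t, a <= s <= b -> a <= t <= b -> f s = f t.
Proof.
intros Hf s t Hs Ht; apply minus_eq, Rle_antisym; [|apply norm_ge_0].
rewrite <- (Rmult_0_l (Rabs (s - t))).
apply (has_deriv_on_lipschitz a b f (fun _ => zero)); auto.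
intros; rewrite norm_zero; lra.
Qed.

End Derivatives.

(** * Taylor polynomials *)

Section Taylor.
Context {V : NormedModule R_AbsRing}.
Implicit Types f g : R -> V.

Definition tpoly (c : nat -> V) (n : nat) (x : R) : V :=
  vsum (seq 0 n) (fun j => scal (x ^ j / INR (fact j)) (c j)).

Lemma tpoly_S_l c n x :
  tpoly c (S n) x =
  plus (c 0%nat)
    (vsum (seq 0 n) (fun j => scal (x ^ S j / INR (fact (S j))) (c (S j)))).
Proof.
unfold tpoly; simpl seq; cbn [vsum].
rewrite <- seq_shift, vsum_map; f_equal; simpl; mcoefs; field.
Qed.

Lemma tpoly_S_r c n x :
  tpoly c (S n) x = plus (tpoly c n x) (scal (x ^ n / INR (fact n)) (c n)).
Proof.
unfold tpoly; rewrite seq_S, vsum_app; simpl; f_equal; apply plus_zero_r.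
Qed.

Lemma tpoly_0 c n : tpoly c (S n) 0 = c 0%nat.
Proof.
rewrite tpoly_S_l, vsum_zero; [apply plus_zero_r|].
intros j _; rewrite pow_i by lia; unfold Rdiv; rewrite Rmult_0_l.
exact (scal_zero_l (c (S j))).
Qed.

Lemma is_derive_pow_fact n x :
  is_derive (fun x => x ^ S n / INR (fact (S n))) x (x ^ n / INR (fact n)).
Proof.
assert (H := is_derive_pow (fun x => x) (S n) x 1 (is_derive_id x)).
apply (is_derive_scal _ _ (/ INR (fact (S n)))) in H.
eapply is_derive_ext; [intros y; apply Rmult_comm|].
replace (x ^ n / INR (fact n)) with
  (/ INR (fact (S n)) * (INR (S n) * 1 * x ^ Init.Nat.pred (S n))); [exact H|].
change (Init.Nat.pred (S n)) with n.
rewrite fact_simpl, mult_INR; field; split; [apply INR_fact_neq_0|].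
apply not_0_INR; lia.
Qed.

Lemma tpoly_deriv (c : nat -> V) n a b x :
  has_deriv_on a b (tpoly c (S n)) x (tpoly (fun j => c (S j)) n x).
Proof.
apply is_derive_has_deriv_on.
apply (is_derive_ext (fun x => plus (c 0%nat)
    (vsum (seq 0 n) (fun j => scal (x ^ S j / INR (fact (S j))) (c (S j)))))).
{ intros y; symmetry; apply tpoly_S_l. }
rewrite <- (plus_zero_l (tpoly _ n x)).
apply is_derive_plus; [apply is_derive_const|].
unfold tpoly; generalize (seq 0 n); clear n; intros l.
induction l as [|j l IH]; simpl vsum; [apply is_derive_const|].
apply is_derive_plus; [|exact IH].
apply (is_derive_scal_l (K := R_AbsRing) (fun x => x ^ S j / INR (fact (S j)))).
apply is_derive_pow_fact.
Qed.

Lemma tpoly_norm_le (c : nat -> V) n x M :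
  0 <= x <= 1 -> (forall j, (j < n)%nat -> norm (c j) <= M) ->
  norm (tpoly c n x) <= INR n * M.
Proof.
intros Hx HM; unfold tpoly.
replace (INR n) with (INR (length (seq 0 n))) by (now rewrite length_seq).
apply norm_vsum_le; intros j Hj; apply in_seq in Hj.
assert (HMj := HM j ltac:(lia)); assert (Hc := norm_ge_0 (c j)).
rewrite <- (Rmult_1_l M); apply norm_scal_le; [|easy].
assert (Hf : 1 <= INR (fact j)).
{ apply (le_INR 1); pose proof (lt_O_fact j); lia. }
assert (Hp : 0 <= x ^ j <= 1).
{ split; [apply pow_le; lra|]; rewrite <- (pow1 j); apply pow_incr; lra. }
rewrite Rabs_pos_eq.
- apply Rmult_le_reg_r with (INR (fact j)); [lra|].
  unfold Rdiv; rewrite Rmult_assoc, Rinv_l by lra; lra.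
- apply Rdiv_le_0_compat; lra.
Qed.

(** The remainder of [df k] has the remainder of [df (S k)] as its derivative, so the mean value
    inequality gains one power per induction step. This is why [k] varies; the factorial is given
    away. *)
Lemma taylor_bound a b (df : nat -> R -> V) (N : nat) (M : R) :
  (forall k t, (k < N)%nat -> a <= t <= b ->
     has_deriv_on a b (df k) t (df (S k) t)) ->
  (forall t, a <= t <= b -> norm (df N t) <= M) ->
  forall n k t, (k + n = N)%nat -> a <= t <= b ->
  norm (minus (df k t) (tpoly (fun j => df (k + j)%nat a) n (t - a)))
    <= M * (t - a) ^ n.
Proof.
intros Hd HM; induction n as [|n IH]; intros k t Hk Ht.
- unfold tpoly; simpl; rewrite Nat.add_0_r in Hk; subst k.
  rewrite Rmult_1_r; specialize (HM t Ht).
  replace (df N t) with (minus (df N t) zero) in HM by module; exact HM.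
- set (Rm := fun r => minus (df k r) (tpoly (fun j => df (k + j)%nat a) (S n) (r - a)) : V).
  assert (Hra : Rm a = zero).
  { unfold Rm; rewrite Rminus_diag, tpoly_0, Nat.add_0_r; module. }
  change (norm (Rm t) <= M * (t - a) ^ S n).
  replace (Rm t) with (minus (Rm t) (Rm a)) by (rewrite Hra; module).
  change ((t - a) ^ S n) with ((t - a) * (t - a) ^ n).
  rewrite (Rmult_comm (t - a)), <- Rmult_assoc.
  apply (mean_value_inequality a t Rm (fun r => minus (df (S k) r)
    (tpoly (fun j => df (S k + j)%nat a) n (r - a)))); [easy| |].
  + intros r Hr; unfold Rm.
    apply has_deriv_on_sub with a b; try lra.
    unfold minus; apply has_deriv_on_plus; [apply Hd; [lia|lra]|].
    (* This is the shape the product rule gives for the constant factor -1. *)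
    replace (opp (tpoly (fun j => df (S k + j)%nat a) n (r - a))) with
      (plus (scal 0 (tpoly (fun j => df (k + j)%nat a) (S n) (r - a)))
        (scal (- (1)) (scal 1 (tpoly (fun j => df (S k + j)%nat a) n (r - a)))))
      by module.
    apply (has_deriv_on_ext a b (fun r => scal (- (1))
      (tpoly (fun j => df (k + j)%nat a) (S n) (r - a)))); [lra|intros; module|].
    apply (has_deriv_on_mult a b (fun _ => - (1))
      (fun r => tpoly (fun j => df (k + j)%nat a) (S n) (r - a)));
      [exact (has_deriv_on_const (V := R_NormedModule) a b (- (1)) r)|].
    apply (has_deriv_on_ext a b (fun r =>
      (tpoly (fun j => df (k + j)%nat a) (S n) (1 * r + - a)))); [lra| |].
    { intros s _; f_equal; ring. }
    apply (has_deriv_on_affine 0 (b - a) a b (tpoly (fun j => df (k + j)%nat a) (S n)) 1 (- a));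
      [intros; lra|].
    replace (1 * r + - a) with (r - a) by ring.
    assert (K := tpoly_deriv (fun j => df (k + j)%nat a) n 0 (b - a) (r - a)).
    cbv beta in K. unfold tpoly at 2 in K. unfold tpoly at 2.
    erewrite vsum_ext; [exact K|].
    intros j _; simpl; now rewrite Nat.add_succ_r.
  + intros r Hr; eapply Rle_trans; [apply IH; [lia|lra]|].
    apply Rmult_le_compat_l.
    * eapply Rle_trans; [apply (norm_ge_0 (df N a))|apply (HM a); lra].
    * apply pow_incr; lra.
Qed.

End Taylor.

(** * Integrals and the fundamental theorem on an interval *)

Lemma has_deriv_on_linear {U V : NormedModule R_AbsRing} (L : U -> V) a b
  (f : R -> U) t l :
  is_linear L -> has_deriv_on a b f t l ->
  has_deriv_on a b (fun r => L (f r)) t (L l).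
Proof.
intros HL Hf; eapply filterlim_ext;
  [|eapply filterlim_comp; [exact Hf|exact (linear_cont L l HL)]].
intros r; simpl; rewrite (linear_scal L HL (/ (r - t))), (linear_minus L _ _ HL).
reflexivity.
Qed.

Lemma is_RInt_linear {U V : NormedModule R_AbsRing} (L : U -> V) (f : R -> U)
  a b (l : U) :
  is_linear L -> is_RInt f a b l -> is_RInt (fun x => L (f x)) a b (L l).
Proof.
intros HL Hf; unfold is_RInt.
eapply filterlim_ext; [|eapply filterlim_comp; [exact Hf|exact (linear_cont L l HL)]].
intros ptd; simpl; rewrite (linear_scal L HL (sign (b - a))); f_equal.
apply SF_cons_ind with (s := ptd).
- intros x; unfold Riemann_sum; simpl; apply (linear_zero L HL).
- intros h s IH; rewrite !Riemann_sum_cons.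
  rewrite (linear_plus L HL), (linear_scal L HL), IH; reflexivity.
Qed.

Definition cont_on {V : NormedModule R_AbsRing} (a b : R) (f : R -> V) : Prop :=
  forall t, a <= t <= b -> forall eps, 0 < eps -> exists d, 0 < d /\
  forall r, a <= r <= b -> Rabs (r - t) < d -> norm (minus (f r) (f t)) <= eps.

Lemma has_deriv_on_cont_on {V : NormedModule R_AbsRing} a b (f f' : R -> V) :
  (forall t, a <= t <= b -> has_deriv_on a b f t (f' t)) -> cont_on a b f.
Proof.
intros H t Ht e He; apply H, has_deriv_on_cont in Ht as Hc.
apply (filterlim_norm_le (punctured a b t)) with (eps := e) in Hc; [|easy].
apply punctured_spec in Hc; destruct Hc as [d [Hd Hf]]; exists d; split; [easy|].
intros r Hr Hrd; destruct (Req_dec r t) as [->|Hne]; [|now apply Hf].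
apply Rle_trans with 0; [|lra]; right.
eapply eq_trans; [|apply (norm_zero (V := V))]; f_equal; module.
Qed.

Lemma cont_on_scal {V : NormedModule R_AbsRing} a b (k : R -> R) (f : R -> V) :
  cont_on (V := R_NormedModule) a b k -> cont_on a b f ->
  cont_on a b (fun t => scal (k t) (f t)).
Proof.
intros Hk Hf t Ht e He.
assert (Hn := norm_ge_0 (f t)).
assert (Ha := Rabs_pos (k t)).
assert (He1 : 0 < Rmin 1 (e / (2 * (norm (f t) + 1)))).
{ apply Rmin_glb_lt; [lra|apply Rdiv_lt_0_compat; lra]. }
assert (He2 : 0 < e / (2 * (Rabs (k t) + 1))) by (apply Rdiv_lt_0_compat; lra).
destruct (Hk t Ht _ He1) as [d1 [Hd1 H1]].
destruct (Hf t Ht _ He2) as [d2 [Hd2 H2]].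
exists (Rmin d1 d2); split; [now apply Rmin_glb_lt|].
intros r Hr Hrd.
specialize (H1 r Hr (Rlt_le_trans _ _ _ Hrd (Rmin_l _ _))).
specialize (H2 r Hr (Rlt_le_trans _ _ _ Hrd (Rmin_r _ _))).
change (Rabs (k r - k t) <= Rmin 1 (e / (2 * (norm (f t) + 1)))) in H1.
assert (H1a := Rle_trans _ _ _ H1 (Rmin_l _ _)).
assert (H1b := Rle_trans _ _ _ H1 (Rmin_r _ _)).
apply (norm_le_eq (plus (scal (k r) (minus (f r) (f t))) (scal (k r - k t) (f t))));
  [module|].
assert (Hkr : Rabs (k r) <= Rabs (k t) + 1).
{ pose proof (Rabs_triang (k r - k t) (k t)) as T.
  replace (k r - k t + k t) with (k r) in T by ring; lra. }
replace e with ((Rabs (k t) + 1) * (e / (2 * (Rabs (k t) + 1))) +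
  e / (2 * (norm (f t) + 1)) * (norm (f t) + 1)) by (field; lra).
apply norm_plus_le; apply norm_scal_le; try easy; apply Rle_refl || idtac; lra.
Qed.

Lemma cont_on_affine {V : NormedModule R_AbsRing} a b a' b' (f : R -> V) (u v : R) :
  (forall r, a' <= r <= b' -> a <= u * r + v <= b) ->
  cont_on a b f -> cont_on a' b' (fun r => f (u * r + v)).
Proof.
intros Hm Hf t Ht e He; destruct (Hf _ (Hm t Ht) e He) as [d [Hd H]].
assert (Hu : 0 < Rabs u + 1) by (pose proof (Rabs_pos u); lra).
exists (d / (Rabs u + 1)); split; [now apply Rdiv_lt_0_compat|].
intros r Hr Hrd; apply H; [now apply Hm|].
replace (u * r + v - (u * t + v)) with (u * (r - t)) by ring.
rewrite Rabs_mult; apply (Rmult_lt_compat_l (Rabs u + 1)) in Hrd; [|easy].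
replace ((Rabs u + 1) * (d / (Rabs u + 1))) with d in Hrd by (field; lra).
pose proof (Rabs_pos (r - t)); lra.
Qed.

(** Composition with this retraction extends a function that is continuous on the interval only to a
    continuous function on the line, to which the integration theorems apply. *)
Definition clamp (a b x : R) : R := Rmax a (Rmin b x).

Lemma clamp_in a b x : a <= b -> a <= clamp a b x <= b.
Proof.
intros Hab; unfold clamp; split; [apply Rmax_l|].
apply Rmax_lub; [easy|apply Rmin_l].
Qed.

Lemma clamp_id a b x : a <= x <= b -> clamp a b x = x.
Proof. intros Hx; unfold clamp; rewrite Rmin_right, Rmax_right; lra. Qed.

Lemma clamp_dist a b x y : Rabs (clamp a b x - clamp a b y) <= Rabs (x - y).
Proof.
unfold clamp, Rmax, Rmin; repeat destruct Rle_dec; unfold Rabs;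
  repeat destruct Rcase_abs; lra.
Qed.

Lemma clamp_continuous {V : NormedModule R_AbsRing} a b (f : R -> V) x :
  a <= b -> cont_on a b f -> continuous (fun y => f (clamp a b y)) x.
Proof.
intros Hab Hf; apply (filterlim_norm_le (locally x)); intros e He.
destruct (Hf _ (clamp_in a b x Hab) e He) as [d [Hd H]].
exists (mkposreal d Hd); intros y Hy; apply H; [now apply clamp_in|].
eapply Rle_lt_trans; [apply clamp_dist|exact Hy].
Qed.

Section Integrals.
Context {V : CompleteNormedModule R_AbsRing}.

Lemma ex_RInt_cont_on a b (f : R -> V) : a <= b -> cont_on a b f -> ex_RInt f a b.
Proof.
intros Hab Hf; apply (ex_RInt_ext (fun y => f (clamp a b y))).
- rewrite Rmin_left, Rmax_right by easy; intros x Hx; f_equal; apply clamp_id; lra.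
- apply (ex_RInt_continuous (V := V)); intros z _.
  exact (clamp_continuous a b f z Hab Hf).
Qed.

(** The difference between [f] and the integral of the extended derivative has one-sided derivative
    zero, hence is constant by the mean value inequality. *)
Lemma ftc_on a b (f f' : R -> V) :
  a <= b -> (forall t, a <= t <= b -> has_deriv_on a b f t (f' t)) ->
  cont_on a b f' -> is_RInt f' a b (minus (f b) (f a)).
Proof.
intros Hab Hf Hc.
set (fe := fun y => f' (clamp a b y)).
assert (Hfe : forall x, continuous fe x)
  by (intros x; exact (clamp_continuous a b f' x Hab Hc)).
assert (Hex : forall x, is_RInt fe a x (RInt fe a x)).
{ intros x; apply (RInt_correct (V := V)), (ex_RInt_continuous (V := V)); intros; apply Hfe. }
assert (Hd : forall t, a <= t <= b ->
  has_deriv_on a b (fun x => plus (f x) (scal (- (1)) (RInt fe a x))) t zero).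
{ intros t Ht.
  apply (has_deriv_on_eq a b _ t
    (plus (f' t) (plus (scal 0 (RInt fe a t)) (scal (- (1)) (fe t))))).
  { unfold fe; rewrite clamp_id by easy; module. }
  apply (has_deriv_on_plus a b f); [now apply Hf|].
  apply (has_deriv_on_mult a b (fun _ => - (1)) (RInt fe a)).
  - exact (has_deriv_on_const (V := R_NormedModule) a b (- (1)) t).
  - apply is_derive_has_deriv_on, (is_derive_RInt fe (RInt fe a) a); [|apply Hfe].
    exists (mkposreal 1 Rlt_0_1); intros y _; apply Hex. }
assert (E := has_deriv_on_zero a b _ Hd b a ltac:(lra) ltac:(lra)); cbv beta in E.
rewrite (RInt_point a fe) in E.
apply (is_RInt_ext fe).
{ rewrite Rmin_left, Rmax_right by easy; intros x Hx; unfold fe; f_equal.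
  apply clamp_id; lra. }
assert (E' : RInt fe a b = minus (f b) (f a)); [|rewrite <- E'; apply Hex].
refine (eq_trans _ (eq_trans (f_equal (minus (f b)) E) _)); module.
Qed.

End Integrals.

Lemma is_derive_cont_on {V : NormedModule R_AbsRing} a b (f f' : R -> V) :
  (forall t, a <= t <= b -> is_derive f t (f' t)) -> cont_on a b f.
Proof.
intros H; apply (has_deriv_on_cont_on a b f f').
intros t Ht; now apply is_derive_has_deriv_on, H.
Qed.

(** * Multilinear maps and the higher chain rule *)

Lemma norms_prod_ge_0 {X : NormedModule R_AbsRing} (vs : list X) :
  0 <= norms_prod vs.
Proof.
induction vs as [|v vs IH]; simpl; [lra|].
apply Rmult_le_pos; [apply norm_ge_0|easy].
Qed.

Lemma norms_prod_app {X : NormedModule R_AbsRing} (vs ws : list X) :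
  norms_prod (vs ++ ws) = norms_prod vs * norms_prod ws.
Proof. induction vs as [|v vs IH]; simpl; [ring|rewrite IH; ring]. Qed.

Section Multilinear.
Context {X : NormedModule R_AbsRing}.

Lemma multilinear_plus k (m : list X -> X) vs ws (x y : X) :
  multilinear k m -> (length vs + S (length ws) = k)%nat ->
  m (vs ++ plus x y :: ws) = plus (m (vs ++ x :: ws)) (m (vs ++ y :: ws)).
Proof.
intros Hm Hk; assert (H := Hm vs ws 1 x y Hk).
replace (plus (scal 1 x) y) with (plus x y) in H by module.
eapply eq_trans; [exact H|module].
Qed.

Lemma multilinear_zero k (m : list X -> X) vs ws :
  multilinear k m -> (length vs + S (length ws) = k)%nat ->
  m (vs ++ zero :: ws) = zero.
Proof.
intros Hm Hk; eapply eq_trans; [|eapply eq_trans;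
  [exact (Hm vs ws (- (1)) zero zero Hk)|module]].
do 3 f_equal; module.
Qed.

Lemma multilinear_scal k (m : list X -> X) vs ws (a : R) (x : X) :
  multilinear k m -> (length vs + S (length ws) = k)%nat ->
  m (vs ++ scal a x :: ws) = scal a (m (vs ++ x :: ws)).
Proof.
intros Hm Hk; eapply eq_trans; [|eapply eq_trans;
  [exact (Hm vs ws a x zero Hk)|]].
- do 3 f_equal; module.
- eapply eq_trans; [apply f_equal, (multilinear_zero k m vs ws Hm Hk)|].
  apply plus_zero_r.
Qed.

Lemma multilinear_minus k (m : list X -> X) vs ws (x y : X) :
  multilinear k m -> (length vs + S (length ws) = k)%nat ->
  m (vs ++ minus x y :: ws) = minus (m (vs ++ x :: ws)) (m (vs ++ y :: ws)).
Proof.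
intros Hm Hk; eapply eq_trans; [|eapply eq_trans;
  [exact (Hm vs ws (- (1)) y x Hk)|module]].
do 3 f_equal; module.
Qed.

Lemma multilinear_cons k (m : list X -> X) x :
  multilinear (S k) m -> multilinear k (fun vs => m (x :: vs)).
Proof.
intros Hm vs ws a y z Hk; apply (Hm (x :: vs) ws a y z); simpl; lia.
Qed.

Lemma multilinear_app k l (m : list X -> X) ys :
  multilinear (k + l) m -> length ys = l -> multilinear k (fun vs => m (vs ++ ys)).
Proof.
intros Hm Hl vs ws a y z Hk; rewrite <- !app_assoc; simpl.
apply Hm; rewrite length_app; lia.
Qed.

Definition ml_bounded (k : nat) (B : R) (m : list X -> X) : Prop :=
  forall vs, length vs = k -> norm (m vs) <= B * norms_prod vs.

Lemma ml_bounded_cons k B (m : list X -> X) x :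
  ml_bounded (S k) B m -> ml_bounded k (B * norm x) (fun vs => m (x :: vs)).
Proof.
intros H vs Hvs; rewrite Rmult_assoc; apply (H (x :: vs)); simpl; lia.
Qed.

Lemma norms_prod_lim {T} (F : (T -> Prop) -> Prop) {FF : Filter F}
  (fs : list (T -> X)) (ls : list X) :
  Forall2 (fun f l => filterlim f F (locally l)) fs ls ->
  filterlim (fun r => norms_prod (map (fun f => f r) fs)) F (locally (norms_prod ls)).
Proof.
induction 1 as [|f l fs ls Hf H IH]; simpl; [apply filterlim_const|].
apply (filterlim_comp_2 (F := F) (fun r => norm (f r))
  (fun r => norms_prod (map (fun f => f r) fs)) Rmult
  (G := locally (norm l)) (H := locally (norms_prod ls))); [|exact IH|].
- eapply filterlim_comp; [exact Hf|apply filterlim_norm].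
- exact (filterlim_scal (K := R_AbsRing) (V := R_NormedModule) (norm l) (norms_prod ls)).
Qed.

Lemma lim_zero_mult {T} (F : (T -> Prop) -> Prop) {FF : Filter F}
  (f : T -> X) (q h : T -> R) (L C : R) :
  filterlim q F (locally 0) -> filterlim h F (locally L) ->
  F (fun r => norm (f r) <= C * (q r * h r)) ->
  filterlim f F (locally (zero : X)).
Proof.
intros Hq Hh Hf.
assert (H : filterlim (fun r => C * (q r * h r)) F (locally 0)).
{ replace 0 with (C * (0 * L)) by ring.
  eapply filterlim_comp; [|exact (filterlim_scal_r (V := R_NormedModule) C (0 * L))].
  eapply filterlim_comp_2; [exact Hq|exact Hh|].
  exact (filterlim_scal (K := R_AbsRing) (V := R_NormedModule) 0 L). }
apply (filterlim_norm_le F); intros e He.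
apply (filterlim_norm_le (V := R_NormedModule) F) with (eps := e) in H; [|easy].
generalize (filter_and _ _ Hf H); apply filter_imp; intros r [H1 H2].
eapply Rle_trans; [right; exact (norm_minus_zero (f r))|].
eapply Rle_trans; [exact H1|]; eapply Rle_trans; [apply Rle_abs|].
change (Rabs (C * (q r * h r) - 0) <= e) in H2; now rewrite Rminus_0_r in H2.
Qed.

Lemma filterlim_norm_minus {T} (F : (T -> Prop) -> Prop) {FF : Filter F}
  (f : T -> X) (l : X) :
  filterlim f F (locally l) ->
  filterlim (fun r => norm (minus (f r) l)) F (locally 0).
Proof.
intros H; apply (filterlim_norm_le (V := R_NormedModule) F); intros e He.
apply (filterlim_norm_le F) with (eps := e) in H; [|easy].
revert H; apply filter_imp; intros r Hr.
change (Rabs (norm (minus (f r) l) - 0) <= e).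
rewrite Rminus_0_r, Rabs_pos_eq; [exact Hr|apply norm_ge_0].
Qed.

(** The arguments converge one after the other: replacing the first one by its limit costs a term
    bounded by its distance to the limit, and the map with that argument fixed falls under the
    induction hypothesis. *)
Lemma multilinear_lim {T} (F : (T -> Prop) -> Prop) {FF : Filter F}
  (fs : list (T -> X)) (ls : list X) :
  Forall2 (fun f l => filterlim f F (locally l)) fs ls ->
  forall k B (m : list X -> X), k = length fs -> multilinear k m ->
  ml_bounded k B m ->
  filterlim (fun r => m (map (fun f => f r) fs)) F (locally (m ls)).
Proof.
induction 1 as [|f l fs ls Hf H IH]; intros k B m Hk Hm HB; simpl;
  [apply filterlim_const|].
simpl in Hk; subst k.
specialize (IH _ _ (fun vs => m (l :: vs)) eq_refl
  (multilinear_cons _ _ _ Hm) (ml_bounded_cons _ _ _ _ HB)); simpl in IH.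
assert (Hz : filterlim (fun r => m (minus (f r) l :: map (fun f => f r) fs))
  F (locally (zero : X))).
{ apply (lim_zero_mult F _ (fun r => norm (minus (f r) l))
    (fun r => norms_prod (map (fun f => f r) fs)) (norms_prod ls) B).
  - now apply filterlim_norm_minus.
  - now apply norms_prod_lim.
  - apply filter_forall; intros r.
    apply (HB (minus (f r) l :: map (fun f => f r) fs)).
    simpl; now rewrite length_map. }
refine (filterlim_plus_to F _ _ _ zero _ _ Hz IH _ _); [module|].
intros r; eapply eq_trans; [|apply plus_comm].
refine (eq_trans _ (f_equal _ (eq_sym (multilinear_minus _ m nil _ (f r) l Hm _)))).
- simpl; module.
- simpl; now rewrite length_map.
Qed.

(** The product rule for a multilinear expression in derivatives of a curve: each resulting list
    raises a single order by one. *)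
Fixpoint incrs (l : list nat) : list (list nat) :=
  match l with
  | nil => nil
  | j :: l' => (S j :: l') :: map (cons j) (incrs l')
  end.

Definition slope (f : R -> X) (t r : R) : X := scal (/ (r - t)) (minus (f r) (f t)).

Lemma multilinear_deriv a b t (dc : nat -> R -> X) (l : list nat) :
  (forall j, In j l -> has_deriv_on a b (dc j) t (dc (S j) t)) ->
  forall k B (m : list X -> X), k = length l -> multilinear k m ->
  ml_bounded k B m ->
  has_deriv_on a b (fun r => m (map (fun j => dc j r) l)) t
    (vsum (incrs l) (fun l' => m (map (fun j => dc j t) l'))).
Proof.
induction l as [|j l IH]; intros Hd k B m Hk Hm HB;
  [exact (has_deriv_on_const a b (m nil) t)|].
simpl in Hk; subst k; simpl incrs; cbn [vsum]; rewrite vsum_map.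
assert (IH' := IH (fun i Hi => Hd i (or_intror Hi)) _ _ (fun vs => m (dc j t :: vs))
  eq_refl (multilinear_cons _ _ _ Hm) (ml_bounded_cons _ _ _ _ HB)).
assert (Hj := Hd j (or_introl eq_refl)).
assert (H1 : filterlim (fun r => m (slope (dc j) t r :: map (fun j => dc j r) l))
  (punctured a b t) (locally (m (dc (S j) t :: map (fun j => dc j t) l)))).
{ eapply filterlim_ext; [|apply (multilinear_lim (punctured a b t)
    (slope (dc j) t :: map dc l) (dc (S j) t :: map (fun j => dc j t) l)) with
    (k := S (length l)) (B := B) (m := m)]; try easy.
  - intros r; simpl; now rewrite map_map.
  - constructor; [exact Hj|].
    clear -Hd; induction l as [|i l IH]; simpl; constructor.
    + eapply has_deriv_on_cont; apply Hd; simpl; auto.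
    + apply IH; intros i' [->|Hi]; apply Hd; simpl; auto.
  - simpl; now rewrite length_map. }
refine (filterlim_plus_to (punctured a b t) _ _ _ _ _ _ H1 IH' eq_refl _).
intros r; unfold slope.
set (w := map (fun j => dc j r) l).
assert (Hw : (0 + S (length w) = S (length l))%nat) by (unfold w; now rewrite length_map).
assert (E1 := multilinear_scal _ m nil w (/ (r - t)) (minus (dc j r) (dc j t)) Hm Hw).
assert (E2 := multilinear_minus _ m nil w (dc j r) (dc j t) Hm Hw).
refine (eq_trans _ (f_equal (fun x => plus x _) (eq_sym (eq_trans E1 (f_equal _ E2))))).
simpl; module.
Qed.

End Multilinear.

(** [comp_lists k] describes the [k]-th derivative of [t |-> g (c t)]: the list
    [j1, ..., jr] stands for the term
    [g^(r) (c t) (c^(j1) t, ..., c^(jr) t)]. *)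
Fixpoint comp_lists (k : nat) : list (list nat) :=
  match k with
  | O => nil :: nil
  | S k => flat_map (fun l => (1%nat :: l) :: incrs l) (comp_lists k)
  end.

Lemma incrs_spec l l' :
  In l' (incrs l) -> length l' = length l /\
  list_sum l' = S (list_sum l) /\
  ((forall j, In j l -> (1 <= j)%nat) -> forall j, In j l' -> (1 <= j)%nat).
Proof.
revert l'; induction l as [|j l IH]; intros l' H; simpl in H; [easy|].
destruct H as [<-|H].
- simpl; repeat split; auto; intros H i [<-|Hi]; [lia|]; apply H; auto.
- apply in_map_iff in H; destruct H as [l0 [<- H]]; destruct (IH l0 H) as [E1 [E2 E3]].
  simpl; repeat split; [congruence|lia|].
  intros H0 i [<-|Hi]; [apply H0; auto|]; apply E3; auto.
Qed.

(** The length bounds the order of the derivative of [g] involved. Since the orders sum to [k],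
    bounds [K ^ j] on the j-th derivatives of the curve multiply to exactly [K ^ k]. *)
Lemma comp_lists_spec k l :
  In l (comp_lists k) -> (length l <= k)%nat /\ list_sum l = k /\
  (forall j, In j l -> (1 <= j)%nat) /\ (k <> 0%nat -> l <> nil).
Proof.
revert l; induction k as [|k IH]; intros l H; simpl in H.
- destruct H as [<-|[]]; simpl; repeat split; auto; easy.
- apply in_flat_map in H; destruct H as [l0 [H0 [<-|H]]];
    destruct (IH l0 H0) as [E1 [E2 [E3 E4]]]; simpl.
  + repeat split; [lia|simpl; lia| |easy].
    intros j [<-|Hj]; [lia|auto].
  + destruct (incrs_spec _ _ H) as [F1 [F2 F3]]; repeat split; try lia.
    * auto.
    * intros _ ->; simpl in F2; lia.
Qed.

Lemma in_le_list_sum j l : In j l -> (j <= list_sum l)%nat.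
Proof.
induction l as [|i l IH]; simpl; [easy|]; intros [->|H]; [lia|specialize (IH H); lia].
Qed.

(** The [k]-th derivative of [t |-> dg r (c t) ys] along a curve [c] whose jet
    at the current point is [x], [d 1], [d 2], ... *)
Definition comp_deriv {X : NormedModule R_AbsRing} (dg : nat -> X -> list X -> X)
    (x : X) (d : nat -> X) (ys : list X) (k : nat) : X :=
  vsum (comp_lists k)
    (fun l => dg (length l + length ys)%nat x (map d l ++ ys)).

Lemma comp_deriv_ext {X : NormedModule R_AbsRing} (dg : nat -> X -> list X -> X)
  x (d d' : nat -> X) ys k :
  (forall j, (1 <= j <= k)%nat -> d j = d' j) ->
  comp_deriv dg x d ys k = comp_deriv dg x d' ys k.
Proof.
intros H; apply vsum_ext; intros l Hl.
destruct (comp_lists_spec _ _ Hl) as [_ [H2 [H3 _]]]; do 2 f_equal.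
apply map_ext_in; intros j Hj; apply H; split; [auto|].
apply in_le_list_sum in Hj; lia.
Qed.

Lemma comp_deriv_0 {X : NormedModule R_AbsRing} (dg : nat -> X -> list X -> X) x d ys :
  comp_deriv dg x d ys 0 = dg (length ys) x ys.
Proof. unfold comp_deriv; simpl; apply plus_zero_r. Qed.

Section ChainRule.
Context {X : NormedModule R_AbsRing} (p : nat) (N : X -> Prop) (dg : nat -> X -> list X -> X)
  (M : R).
Hypothesis Hml : forall k x, (k <= p)%nat -> N x -> multilinear k (dg k x).
Hypothesis Hbd : forall k x vs, (1 <= k <= p)%nat -> N x -> length vs = k ->
  norm (dg k x vs) <= M * norms_prod vs.
Hypothesis Hfr : forall k x, (k < p)%nat -> N x ->
  forall eps : posreal, exists delta : posreal, forall d : X,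
  norm d < delta -> forall vs, length vs = k ->
  norm (minus (minus (dg k (plus x d) vs) (dg k x vs)) (dg (S k) x (d :: vs)))
    <= eps * norm d * norms_prod vs.

(** The difference quotient has three parts: the Frechet remainder evaluated at the moving
    arguments, the next derivative of [g] applied to the slope of [c], and the difference quotient
    of the arguments at the fixed base point. The first vanishes in the limit; the others give the
    new leading list and the increments. *)
Lemma comp_term_deriv a b t (c : R -> X) (dc : nat -> R -> X) (l : list nat) ys :
  a <= t <= b -> N (c t) -> (length l + length ys < p)%nat ->
  has_deriv_on a b c t (dc 1%nat t) ->
  (forall j, In j l -> has_deriv_on a b (dc j) t (dc (S j) t)) ->
  has_deriv_on a b (fun r => dg (length l + length ys)%nat (c r)
      (map (fun j => dc j r) l ++ ys)) t
    (vsum ((1%nat :: l) :: incrs l) (fun l' => dg (length l' + length ys)%nat (c t)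
      (map (fun j => dc j t) l' ++ ys))).
Proof.
intros Ht HN Hp Hc Hd; set (k := (length l + length ys)%nat) in *.
assert (Hlen : forall r, length (map (fun j => dc j r) l ++ ys) = k).
{ intros r; now rewrite length_app, length_map. }
assert (Hlims : Forall2 (fun f l => filterlim f (punctured a b t) (locally l))
  (map dc l ++ map (fun y _ => y) ys) (map (fun j => dc j t) l ++ ys)).
{ apply Forall2_app.
  - clear -Hd; induction l as [|i l IH]; simpl; constructor.
    + eapply has_deriv_on_cont; apply Hd; simpl; auto.
    + apply IH; intros i' Hi'; apply Hd; simpl; auto.
  - clear; induction ys as [|y ys IH]; simpl; constructor; [apply filterlim_const|easy]. }
assert (Hmap : forall r, map (fun f => f r) (map dc l ++ map (fun y _ => y) ys) =
  map (fun j => dc j r) l ++ ys).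
{ intros r; rewrite map_app, !map_map, map_id; easy. }
assert (HmlS := Hml (S k) (c t) Hp HN).
assert (HbdS : ml_bounded (S k) M (dg (S k) (c t))).
{ intros vs Hvs; apply Hbd; auto; lia. }
assert (H1 : filterlim (fun r => dg (S k) (c t) (slope c t r :: map (fun j => dc j r) l ++ ys))
  (punctured a b t) (locally (dg (S k) (c t) (dc 1%nat t :: map (fun j => dc j t) l ++ ys)))).
{ eapply filterlim_ext; [|apply (multilinear_lim (punctured a b t)
    (slope c t :: (map dc l ++ map (fun y _ => y) ys))
    (dc 1%nat t :: (map (fun j => dc j t) l ++ ys))) with
    (k := S k) (B := M) (m := dg (S k) (c t))]; try easy.
  - intros r; cbn [map]; now rewrite Hmap.
  - now constructor.
  - simpl; rewrite length_app, !length_map; reflexivity. }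
assert (H2 : filterlim (fun r => minus (scal (/ (r - t))
     (minus (dg k (c r) (map (fun j => dc j r) l ++ ys))
            (dg k (c t) (map (fun j => dc j r) l ++ ys))))
     (dg (S k) (c t) (slope c t r :: map (fun j => dc j r) l ++ ys)))
  (punctured a b t) (locally (zero : X))).
{ apply (filterlim_norm_le (punctured a b t)); intros e He.
  assert (Hn := norms_prod_lim (punctured a b t) _ _ Hlims).
  assert (Hs := filterlim_comp _ _ _ _ norm _ _ _ Hc (filterlim_norm (dc 1%nat t))).
  (* [C] bounds, near [t], the slope times the product of the norms of the moving arguments. The
     remainder is controlled in operator norm, hence uniformly in these arguments. *)
  set (C := (norm (dc 1%nat t) + 1) * (norms_prod (map (fun j => dc j t) l ++ ys) + 1)).
  assert (P1 := norm_ge_0 (dc 1%nat t)).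
  assert (P2 := norms_prod_ge_0 (map (fun j => dc j t) l ++ ys)).
  assert (HC : 0 < C) by (apply Rmult_lt_0_compat; lra).
  destruct (Hfr k (c t) Hp HN (mkposreal _ (Rdiv_lt_0_compat _ _ He HC))) as [del Hdel].
  apply (filterlim_norm_le (V := R_NormedModule) (punctured a b t))
    with (eps := 1) in Hn; [|lra].
  apply (filterlim_norm_le (V := R_NormedModule) (punctured a b t))
    with (eps := 1) in Hs; [|lra].
  assert (Hcc := has_deriv_on_cont _ _ _ _ _ Hc).
  apply (filterlim_norm_le (punctured a b t)) with (eps := del / 2) in Hcc;
    [|pose proof (cond_pos del); lra].
  assert (Hne : punctured a b t (fun r => r <> t)).
  { apply punctured_spec; exists 1; split; [lra|easy]. }
  generalize (filter_and _ _ Hne (filter_and _ _ Hcc (filter_and _ _ Hn Hs))).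
  apply filter_imp; intros r [Hr [Hcr [Hnr Hsr]]].
  rewrite Hmap in Hnr.
  apply Rabs_le_between in Hnr; apply Rabs_le_between in Hsr.
  change (- (1) <= norms_prod (map (fun j => dc j r) l ++ ys)
    - norms_prod (map (fun j => dc j t) l ++ ys) <= 1) in Hnr.
  change (- (1) <= norm (slope c t r) - norm (dc 1%nat t) <= 1) in Hsr.
  assert (Hr' : r - t <> 0) by lra.
  set (d := minus (c r) (c t)) in *.
  assert (Ed : plus (c t) d = c r) by (unfold d; module).
  assert (Hd2 : norm d < del) by (pose proof (cond_pos del); simpl in Hcr; lra).
  specialize (Hdel d Hd2 _ (Hlen r)); rewrite Ed in Hdel.
  assert (E1 : dg (S k) (c t) (slope c t r :: map (fun j => dc j r) l ++ ys) =
    scal (/ (r - t)) (dg (S k) (c t) (d :: map (fun j => dc j r) l ++ ys))).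
  { apply (multilinear_scal (S k) _ nil); [easy|simpl; now rewrite Hlen]. }
  rewrite E1.
  match goal with |- norm (minus (minus ?A _) zero) <= _ => set (a0 := A) end.
  assert (E2 : minus (minus a0 (scal (/ (r - t)) (dg (S k) (c t) (d :: map (fun j => dc j r) l ++ ys)))) zero =
   scal (/ (r - t)) (minus (minus (dg k (c r) (map (fun j => dc j r) l ++ ys))
     (dg k (c t) (map (fun j => dc j r) l ++ ys)))
     (dg (S k) (c t) (d :: map (fun j => dc j r) l ++ ys)))).
  { unfold a0; module. }
  eapply Rle_trans; [right; exact (eq_trans (f_equal norm E2) (norm_scal_eq _ _))|].
  assert (Es : norm (slope c t r) = Rabs (/ (r - t)) * norm d) by apply norm_scal_eq.
  eapply Rle_trans; [apply Rmult_le_compat_l; [apply Rabs_pos|exact Hdel]|].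
  simpl pos.
  replace (Rabs (/ (r - t)) * (e / C * norm d * norms_prod (map (fun j => dc j r) l ++ ys)))
   with (e / C * (norm (slope c t r) * norms_prod (map (fun j => dc j r) l ++ ys)))
   by (rewrite Es; ring).
  apply Rle_trans with (e / C * C); [|right; field; lra].
  apply Rmult_le_compat_l; [apply Rlt_le, Rdiv_lt_0_compat; easy|].
  apply Rmult_le_compat; try lra; [apply norm_ge_0|apply norms_prod_ge_0]. }
assert (H3 : has_deriv_on a b (fun r => dg k (c t) (map (fun j => dc j r) l ++ ys)) t
  (vsum (incrs l) (fun l' => dg k (c t) (map (fun j => dc j t) l' ++ ys)))).
(* The bounds on [dg] start at order 1; at order 0 there are no arguments that could vary. *)
{ destruct (Nat.eq_dec k 0) as [Hk|Hk].
  - assert (El : l = nil) by (apply length_zero_iff_nil; lia).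
    rewrite El; exact (has_deriv_on_const a b (dg k (c t) ys) t).
  - apply (multilinear_deriv a b t dc l Hd (length l) (M * norms_prod ys)
      (fun vs => dg k (c t) (vs ++ ys))); [easy| |].
    + apply (multilinear_app (length l) (length ys)); [|easy].
      apply Hml; [unfold k in *; lia|easy].
    + intros vs Hvs; rewrite Rmult_assoc, (Rmult_comm (norms_prod ys)), <- norms_prod_app.
      apply Hbd; [lia|easy|rewrite length_app; lia]. }
cbn [vsum].
replace (dg _ (c t) (map (fun j => dc j t) (1%nat :: l) ++ ys)) with
  (plus zero (dg (S k) (c t) (dc 1%nat t :: map (fun j => dc j t) l ++ ys)))
  by (rewrite plus_zero_l; reflexivity).
rewrite (vsum_ext (incrs l) (fun l' => dg (length l' + length ys)%nat _ _)
  (fun l' => dg k (c t) (map (fun j => dc j t) l' ++ ys))).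
2:{ intros l' Hl'; unfold k; now rewrite (proj1 (incrs_spec _ _ Hl')). }
assert (H12 := filterlim_plus_to (punctured a b t) _ _ _ _ _ _ H2 H1 eq_refl
  (fun r => eq_refl)).
refine (filterlim_plus_to (punctured a b t) _ _ _ _ _ _ H12 H3 eq_refl _).
intros r; simpl; module.
Qed.

Lemma comp_deriv_deriv a b (c : R -> X) (dc : nat -> R -> X) ys k t :
  a <= t <= b -> N (c t) -> (k + length ys < p)%nat ->
  has_deriv_on a b c t (dc 1%nat t) ->
  (forall j, (j <= k)%nat -> has_deriv_on a b (dc j) t (dc (S j) t)) ->
  has_deriv_on a b (fun r => comp_deriv dg (c r) (fun j => dc j r) ys k) t
    (comp_deriv dg (c t) (fun j => dc j t) ys (S k)).
Proof.
intros Ht HN Hk Hc Hd; unfold comp_deriv; cbn [comp_lists].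
rewrite vsum_flat_map.
assert (Hl : forall l, In l (comp_lists k) -> (length l + length ys < p)%nat /\
  forall j, In j l -> has_deriv_on a b (dc j) t (dc (S j) t)).
{ intros l Hl; destruct (comp_lists_spec _ _ Hl) as [H1 [H2 _]]; split; [lia|].
  intros j Hj; apply Hd; apply in_le_list_sum in Hj; lia. }
revert Hl; generalize (comp_lists k); intros L HL.
induction L as [|l L IH]; cbn [vsum]; [exact (has_deriv_on_const a b zero t)|].
apply (has_deriv_on_plus a b (fun r => dg (length l + length ys)%nat (c r)
      (map (fun j => dc j r) l ++ ys))).
- destruct (HL l (or_introl eq_refl)); now apply comp_term_deriv.
- apply IH; intros l' Hl'; apply HL; now right.
Qed.

Lemma comp_deriv_norm x (d : nat -> X) ys k (K : R) :
  N x -> (1 <= k + length ys <= p)%nat -> 0 <= K -> 0 <= M ->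
  (forall j, (1 <= j <= k)%nat -> norm (d j) <= K ^ j) ->
  norm (comp_deriv dg x d ys k)
    <= INR (length (comp_lists k)) * (M * K ^ k * norms_prod ys).
Proof.
intros HN Hk HK HM Hd; apply norm_vsum_le; intros l Hl.
destruct (comp_lists_spec _ _ Hl) as [H1 [H2 [H3 H4]]].
assert (1 <= length l + length ys)%nat.
{ destruct (Nat.eq_dec k 0) as [->|Hk0]; [lia|].
  specialize (H4 Hk0); destruct l; simpl; [easy|lia]. }
eapply Rle_trans; [apply Hbd; [lia|easy|now rewrite length_app, length_map]|].
rewrite norms_prod_app, <- Rmult_assoc.
apply Rmult_le_compat_r; [apply norms_prod_ge_0|].
apply Rmult_le_compat_l; [easy|].
assert (Hdl : forall j, In j l -> norm (d j) <= K ^ j).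
{ intros j Hj; apply Hd; split; [now apply H3|].
  apply in_le_list_sum in Hj; lia. }
rewrite <- H2; clear -Hdl HK; induction l as [|j l IH]; simpl; [lra|].
rewrite pow_add; apply Rmult_le_compat; [apply norm_ge_0|apply norms_prod_ge_0| |].
- apply Hdl; simpl; auto.
- apply IH; intros; apply Hdl; simpl; auto.
Qed.

Lemma comp_deriv_multilinear x (d : nat -> X) k r :
  N x -> (k + r <= p)%nat -> multilinear r (fun ys => comp_deriv dg x d ys k).
Proof.
intros HN Hk vs ws a y z Hr; unfold comp_deriv.
refine (eq_trans _ (eq_trans (vsum_plus (comp_lists k) (fun l => scal a _) _)
  (f_equal2 plus (vsum_scal _ _ _) eq_refl))).
apply vsum_ext; intros l Hl.
destruct (comp_lists_spec _ _ Hl) as [H1 _].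
assert (E : forall v : X, length (vs ++ v :: ws) = r).
{ intros v; rewrite length_app; simpl; lia. }
rewrite !E, !app_assoc.
apply (Hml (length l + r) x); [lia|easy|].
rewrite length_app, length_map; simpl; lia.
Qed.

End ChainRule.

(** * Uniform boundedness *)

Definition seq_complete (U : NormedModule R_AbsRing) : Prop := forall x : nat -> U,
  (forall eps, 0 < eps -> exists N, forall n m, (N <= n)%nat -> (N <= m)%nat ->
     norm (minus (x n) (x m)) <= eps) ->
  exists l : U, forall eps, 0 < eps -> exists N, forall n, (N <= n)%nat ->
     norm (minus (x n) l) <= eps.

Lemma CompleteNormedModule_seq_complete (U : CompleteNormedModule R_AbsRing) :
  seq_complete U.
Proof.
intros x Hx; set (F := filtermap x eventually).
assert (HF : ProperFilter F) by apply filtermap_proper_filter, eventually_filter.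
assert (Hc : cauchy F).
{ intros e; destruct (Hx (e / 2)) as [N HN]; [pose proof (cond_pos e); lra|].
  exists (x N), N; intros n Hn; apply (norm_compat1 (V := U) (x N) (x n) e).
  eapply Rle_lt_trans; [exact (HN n N Hn (le_n N))|pose proof (cond_pos e); lra]. }
exists (lim F); intros e He.
assert (Hnf := norm_factor_gt_0 (V := U)).
assert (He' : 0 < e / norm_factor (V := U)) by now apply Rdiv_lt_0_compat.
destruct (complete_cauchy F HF Hc (mkposreal _ He')) as [N HN].
exists N; intros n Hn; specialize (HN n Hn); apply (norm_compat2 (V := U) _ (x n)) in HN.
simpl in HN; apply Rlt_le; eapply Rlt_le_trans; [exact HN|right; field; lra].
Qed.

Section ProductSpace.
Variables U V : CompleteNormedModule R_AbsRing.

Definition prod_lim (F : (U * V -> Prop) -> Prop) : U * V :=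
  (lim (filtermap fst F), lim (filtermap snd F)).

Lemma prod_complete_cauchy F :
  ProperFilter F -> cauchy F -> forall eps : posreal, F (ball (prod_lim F) eps).
Proof.
intros HF Hc e.
assert (H1 : cauchy (filtermap fst F)).
{ intros d; destruct (Hc d) as [[x y] H]; exists x.
  exact (filter_imp (F := F) _ _ (fun z Hz => proj1 Hz) H). }
assert (H2 : cauchy (filtermap snd F)).
{ intros d; destruct (Hc d) as [[x y] H]; exists y.
  exact (filter_imp (F := F) _ _ (fun z Hz => proj2 Hz) H). }
assert (K1 := complete_cauchy _ (filtermap_proper_filter _ _ fst F HF) H1 e).
assert (K2 := complete_cauchy _ (filtermap_proper_filter _ _ snd F HF) H2 e).
exact (filter_imp (F := F) _ _ (fun z Hz => Hz) (filter_and (F := F) _ _ K1 K2)).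
Qed.

Lemma prod_close_lim (F1 F2 : (U * V -> Prop) -> Prop) :
  filter_le F1 F2 -> filter_le F2 F1 -> close (prod_lim F1) (prod_lim F2).
Proof.
intros H1 H2 e; split; [apply (close_lim (T := U))|apply (close_lim (T := V))];
  intros P; apply H1 || apply H2.
Qed.

(** The complexification as a complete space, as needed for uniform boundedness and for the
    integrals in the Cauchy estimate. *)
Definition prod_CompleteNormedModule : CompleteNormedModule R_AbsRing :=
  CompleteNormedModule.Pack R_AbsRing (U * V)
    (CompleteNormedModule.Class R_AbsRing (U * V)
       (NormedModule.class R_AbsRing (prod_NormedModule R_AbsRing U V))
       (CompleteSpace.Mixin (prod_UniformSpace U V) prod_lim
          prod_complete_cauchy prod_close_lim))
    (U * V).

End ProductSpace.

(** An elementary substitute for the Baire category argument. As L (x + xi) - L (x - xi) = 2 L xi,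
    at least one of the points x + xi and x - xi has an image as large as that of xi. *)
Lemma ubp_step {U V : NormedModule R_AbsRing} (Fam : (U -> V) -> Prop) (k : R) (x : U) (r : R) :
  (forall L, Fam L -> is_linear L) ->
  (forall K, exists L y, Fam L /\ K * norm y < norm (L y)) ->
  0 < r -> 0 <= k ->
  exists x' r', 0 < r' <= r / 2 /\ norm (minus x' x) <= r / 2 /\
    exists L, Fam L /\ forall z, norm (minus z x') <= r' -> k <= norm (L z).
Proof.
intros Hlin Hunb Hr Hk.
(* After rescaling [y] to length r/2 its image exceeds k + 1; the surplus 1 is what may be lost on
   the ball of radius 1/B. *)
destruct (Hunb (2 * (k + 1) / r)) as [L [y [HL Hy]]].
assert (HLl := Hlin L HL).
assert (Hy0 : 0 < norm y).
{ destruct (Rle_lt_or_eq_dec 0 (norm y) (norm_ge_0 y)) as [|E]; [easy|].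
  exfalso; symmetry in E; apply norm_eq_zero in E; subst y.
  rewrite (linear_zero L HLl), !norm_zero in Hy; lra. }
set (xi := scal (r / 2 / norm y) y : U).
assert (Hxi : norm xi = r / 2).
{ unfold xi; rewrite norm_scal_pos; [field; lra|].
  apply Rlt_le, Rdiv_lt_0_compat; lra. }
assert (HLxi : k + 1 < norm (L xi)).
{ unfold xi; rewrite (linear_scal L HLl), norm_scal_pos
    by (apply Rlt_le, Rdiv_lt_0_compat; lra).
  apply (Rmult_lt_compat_l (r / 2 / norm y)) in Hy; [|apply Rdiv_lt_0_compat; lra].
  eapply Rle_lt_trans; [|exact Hy]; right; field; lra. }
assert (Hx' : exists x', norm (minus x' x) <= r / 2 /\ k + 1 <= norm (L x')).
{ destruct (Rle_lt_dec (k + 1) (norm (L (plus x xi)))) as [H|H].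
  - exists (plus x xi); split; [|easy].
    apply (norm_le_eq xi); [module|lra].
  - exists (minus x xi); split.
    + apply (norm_le_eq (opp xi)); [module|].
      eapply Rle_trans; [right; exact (norm_opp xi)|lra].
    + rewrite (linear_plus L HLl) in H; rewrite (linear_minus L _ _ HLl).
      assert (T : norm (L xi) + norm (L xi) <= norm (plus (L x) (L xi)) + norm (minus (L x) (L xi))).
      { replace (norm (L xi) + norm (L xi)) with (norm (scal 2 (L xi)))
          by (rewrite norm_scal_pos; lra).
        apply (norm_le_eq (minus (plus (L x) (L xi)) (minus (L x) (L xi)))); [module|].
        apply norm_minus_le; apply Rle_refl. }
      lra. }
destruct Hx' as [x' [Hx1 Hx2]].
destruct (linear_norm L HLl) as [B [HB HBL]].
exists x', (Rmin (r / 2) (/ B)); split; [|split; [easy|]].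
- split; [|apply Rmin_l]; apply Rmin_glb_lt; [lra|now apply Rinv_0_lt_compat].
- exists L; split; [easy|]; intros z Hz.
  assert (H1 : norm (L (minus x' z)) <= 1).
  { eapply Rle_trans; [apply HBL|]; rewrite norm_minus_sym.
    apply Rle_trans with (B * / B); [|right; field; lra].
    apply Rmult_le_compat_l; [lra|].
    eapply Rle_trans; [exact Hz|apply Rmin_r]. }
  rewrite (linear_minus L _ _ HLl) in H1.
  pose proof (norm_le_minus (L x') (L z)); lra.
Qed.

(** A contrapositive for a sequence of families, each of them unbounded: nested balls with halving
    radii yield one vector whose images grow along the sequence. The sequence is there because
    boundedness will be tested on shrinking neighbourhoods of time 0. *)
Lemma uniform_boundedness {U V : NormedModule R_AbsRing}
  (Fam : nat -> (U -> V) -> Prop) :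
  seq_complete U ->
  (forall k L, Fam k L -> is_linear L) ->
  (forall k K, exists L y, Fam k L /\ K * norm y < norm (L y)) ->
  exists z, forall k, exists L, Fam k L /\ INR k <= norm (L z).
Proof.
intros Hcomp Hlin Hunb.
set (good := fun (k : nat) (b b' : U * R) =>
  0 < snd b' <= snd b / 2 /\ norm (minus (fst b') (fst b)) <= snd b / 2 /\
  exists L, Fam k L /\ forall z, norm (minus z (fst b')) <= snd b' -> INR k <= norm (L z)).
assert (Hstep : forall k (b : U * R), exists b', 0 < snd b -> good k b b').
{ intros k [x r]; destruct (Rlt_dec 0 r) as [Hr|Hr].
  - destruct (ubp_step (Fam k) (INR k) x r (Hlin k) (Hunb k) Hr (pos_INR k))
      as [x' [r' H]].
    exists (x', r'); intros _; exact H.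
  - exists (x, r); simpl; lra. }
set (next := fun k b => proj1_sig (constructive_indefinite_description _ (Hstep k b))).
assert (Hnext : forall k b, 0 < snd b -> good k b (next k b)).
{ intros k b; exact (proj2_sig (constructive_indefinite_description _ (Hstep k b))). }
set (ball := fix ball (n : nat) : U * R := match n with O => (zero, 1) | S n => next n (ball n) end).
assert (Hpos : forall n, 0 < snd (ball n)).
{ induction n as [|n IH]; [simpl; lra|]; apply (Hnext n _ IH). }
assert (Hg : forall n, good n (ball n) (ball (S n))) by (intros n; apply Hnext, Hpos).
assert (Hnest : forall n m, norm (minus (fst (ball (n + m)%nat)) (fst (ball n)))
  + snd (ball (n + m)%nat) <= snd (ball n)).
{ intros n m; induction m as [|m IH].
  - rewrite Nat.add_0_r; replace (norm (minus (fst (ball n)) (fst (ball n)))) with 0; [lra|].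
    symmetry; refine (eq_trans (f_equal norm _) (norm_zero (V := U))); module.
  - rewrite Nat.add_succ_r; destruct (Hg (n + m)%nat) as [H1 [H2 _]].
    pose proof (norm_minus_trans (V := U) (fst (ball (S (n + m)))) (fst (ball (n + m)%nat))
      (fst (ball n))) as T.
    apply Rle_trans with (snd (ball (n + m)%nat) / 2 +
      (norm (minus (fst (ball (n + m)%nat)) (fst (ball n))) + snd (ball (n + m)%nat) / 2)); [|lra].
    eapply Rle_trans; [apply Rplus_le_compat_r; exact T|]; lra. }
assert (Hsmall : forall n, snd (ball n) <= (/ 2) ^ n).
{ induction n as [|n IH]; [simpl; lra|].
  destruct (Hg n) as [H1 _]; simpl pow; lra. }
destruct (Hcomp (fun n => fst (ball n))) as [z Hz].
{ intros e He.
  destruct (pow_lt_1_zero (/ 2)) with (y := e / 2) as [N HN];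
    [rewrite Rabs_pos_eq; lra|lra|].
  exists N; intros n m Hn Hm.
  assert (HNe := HN N (le_n N)); rewrite Rabs_pos_eq in HNe by (apply pow_le; lra).
  assert (HsN := Hsmall N).
  assert (H1 := Hnest N (n - N)%nat); replace (N + (n - N))%nat with n in H1 by lia.
  assert (H2 := Hnest N (m - N)%nat); replace (N + (m - N))%nat with m in H2 by lia.
  pose proof (Hpos n); pose proof (Hpos m).
  pose proof (norm_minus_trans (V := U) (fst (ball n)) (fst (ball N)) (fst (ball m))) as T.
  rewrite (norm_minus_sym (V := U) (fst (ball N))) in T; lra. }
exists z; intros k; destruct (Hg k) as [_ [_ [L [HL HLz]]]]; exists L; split; [easy|].
apply HLz; apply le_epsilon; intros e He.
destruct (Hz e He) as [N HN]; specialize (HN (S k + N)%nat ltac:(lia)); cbv beta in HN.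
pose proof (Hnest (S k) N); pose proof (Hpos (S k + N)%nat).
pose proof (norm_minus_trans z (fst (ball (S k + N)%nat)) (fst (ball (S k)))) as T.
rewrite (norm_minus_sym z (fst (ball (S k + N)%nat))) in T; lra.
Qed.

(** * The Cauchy estimate *)

(** Here [J] is multiplication by [i] on a complex Banach space seen as a real
    one, [f] is holomorphic on the disc of radius [Rad] around the real point [c],
    with derivative [f'], and the arguments of [f] and [f'] are the real and
    imaginary parts. *)
Section CauchyEstimate.
Context {Y : CompleteNormedModule R_AbsRing} (J : Y -> Y) (jb : R).
Hypothesis HJ : is_linear J.
Hypothesis HJJ : forall y, J (J y) = opp y.
Hypothesis HJn : forall y, norm (J y) <= jb * norm y.
Context (c Rad : R) (f f' : R -> R -> Y) (M : R).
Hypothesis HRad : 0 < Rad.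
Hypothesis Hf : forall eps, 0 < eps -> exists d, 0 < d /\ forall x y p q,
  (x - c) ^ 2 + y ^ 2 <= Rad ^ 2 -> (x + p - c) ^ 2 + (y + q) ^ 2 <= Rad ^ 2 ->
  Rabs p < d -> Rabs q < d ->
  norm (minus (minus (f (x + p) (y + q)) (f x y))
    (plus (scal p (f' x y)) (scal q (J (f' x y))))) <= eps * (Rabs p + Rabs q).
Hypothesis Hf'c : forall r, 0 <= r <= Rad ->
  cont_on 0 (2 * PI) (fun th => f' (c + r * cos th) (r * sin th)).
Hypothesis Hf'0 : forall eps, 0 < eps -> exists d, 0 < d /\ forall p q,
  Rabs p < d -> Rabs q < d -> norm (minus (f' (c + p) q) (f' c 0)) <= eps.
Hypothesis HfM : forall x y, (x - c) ^ 2 + y ^ 2 <= Rad ^ 2 -> norm (f x y) <= M.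

Let F r th := f (c + r * cos th) (r * sin th).
Let F' r th := f' (c + r * cos th) (r * sin th).

Lemma circle_in r th : 0 <= r <= Rad ->
  (c + r * cos th - c) ^ 2 + (r * sin th) ^ 2 <= Rad ^ 2.
Proof.
intros Hr; replace (c + r * cos th - c) with (r * cos th) by ring.
assert (E := sin2_cos2 th); unfold Rsqr in E.
replace ((r * cos th) ^ 2 + (r * sin th) ^ 2) with
  (r ^ 2 * (sin th * sin th + cos th * cos th)) by ring.
rewrite E, Rmult_1_r; apply pow_incr; lra.
Qed.

Lemma lipschitz_sin_cos s t :
  Rabs (cos s - cos t) <= Rabs (s - t) /\ Rabs (sin s - sin t) <= Rabs (s - t).
Proof.
rewrite <- (Rmult_1_l (Rabs (s - t))); split.
- apply (bounded_variation cos (fun x => - sin x)); intros x _; split.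
  + auto_derive; [easy|ring].
  + rewrite Rabs_Ropp; apply Rabs_le; pose proof (SIN_bound x); lra.
- apply (bounded_variation sin cos); intros x _; split.
  + auto_derive; [easy|ring].
  + apply Rabs_le; pose proof (COS_bound x); lra.
Qed.

Lemma circle_deriv r t : 0 <= r <= Rad ->
  has_deriv_on 0 (2 * PI) (F r) t
    (plus (scal (- (r * sin t)) (F' r t)) (scal (r * cos t) (J (F' r t)))).
Proof.
intros Hr.
set (p := fun s => r * cos s - r * cos t).
set (q := fun s => r * sin s - r * sin t).
set (lin := fun s => plus (scal (p s) (F' r t)) (scal (q s) (J (F' r t))) : Y).
apply (has_deriv_on_eq 0 (2 * PI) _ t (plus zero
  (plus (scal (- (r * sin t)) (F' r t)) (scal (r * cos t) (J (F' r t))))));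
  [module|].
assert (H1 : has_deriv_on 0 (2 * PI) (fun s => minus (F r s) (lin s)) t zero).
{ apply has_deriv_on_eps; intros e He.
  assert (Hr1 : 0 < 2 * (r + 1)) by lra.
  destruct (Hf (e / (2 * (r + 1)))) as [d [Hd H]]; [now apply Rdiv_lt_0_compat|].
  exists (d / (r + 1)); split; [apply Rdiv_lt_0_compat; lra|]; intros s _ Hs.
  destruct (lipschitz_sin_cos s t) as [Hc Hsn].
  assert (Hp : Rabs (p s) <= r * Rabs (s - t)).
  { unfold p; rewrite <- Rmult_minus_distr_l, Rabs_mult, (Rabs_pos_eq r) by lra.
    apply Rmult_le_compat_l; lra. }
  assert (Hq : Rabs (q s) <= r * Rabs (s - t)).
  { unfold q; rewrite <- Rmult_minus_distr_l, Rabs_mult, (Rabs_pos_eq r) by lra.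
    apply Rmult_le_compat_l; lra. }
  assert (Hd' : r * Rabs (s - t) < d).
  { apply (Rmult_lt_compat_l (r + 1)) in Hs; [|lra].
    replace ((r + 1) * (d / (r + 1))) with d in Hs by (field; lra).
    pose proof (Rabs_pos (s - t)); lra. }
  specialize (H (c + r * cos t) (r * sin t) (p s) (q s)).
  replace (c + r * cos t + p s) with (c + r * cos s) in H by (unfold p; ring).
  replace (r * sin t + q s) with (r * sin s) in H by (unfold q; ring).
  specialize (H (circle_in r t Hr) (circle_in r s Hr)
    (Rle_lt_trans _ _ _ Hp Hd') (Rle_lt_trans _ _ _ Hq Hd')).
  eapply Rle_trans; [|eapply Rle_trans; [exact H|]].
  - right; f_equal; unfold lin, F, F', p, q; module.
  - apply Rle_trans with (e / (2 * (r + 1)) * (2 * (r * Rabs (s - t)))).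
    + apply Rmult_le_compat_l; [apply Rlt_le, Rdiv_lt_0_compat; lra|lra].
    + replace (e / (2 * (r + 1)) * (2 * (r * Rabs (s - t)))) with
        (e * (r / (r + 1)) * Rabs (s - t)) by (field; lra).
      apply Rmult_le_compat_r; [apply Rabs_pos|].
      rewrite <- (Rmult_1_r e) at 2; apply Rmult_le_compat_l; [lra|].
      apply Rmult_le_reg_r with (r + 1); [lra|].
      unfold Rdiv; rewrite Rmult_assoc, Rinv_l; lra. }
assert (H2 : has_deriv_on 0 (2 * PI) lin t
  (plus (scal (- (r * sin t)) (F' r t)) (scal (r * cos t) (J (F' r t))))).
{ apply is_derive_has_deriv_on; unfold lin, p, q.
  apply (is_derive_plus (K := R_AbsRing) (V := Y));
    apply (is_derive_scal_l (K := R_AbsRing) (V := Y)); auto_derive; auto; ring. }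
unfold has_deriv_on in *.
refine (filterlim_plus_to (punctured 0 (2 * PI) t) _ _ _ _ _ _ H1 H2 eq_refl _).
intros s; module.
Qed.

(** This is e^(-i th) F, the integrand of Cauchy's formula for the derivative, up to the factor
    1/r. *)
Let D r th := minus (scal (cos th) (F r th)) (scal (sin th) (J (F r th))) : Y.

(** The function is i e^(-i th) F, and it is periodic. The formula for its derivative thus says that
    [D] and r [F'] have the same integral over the circle. *)
Lemma circle_aux_deriv r t : 0 <= r <= Rad ->
  has_deriv_on 0 (2 * PI)
    (fun th => plus (scal (cos th) (J (F r th))) (scal (sin th) (F r th))) t
    (minus (D r t) (scal r (F' r t))).
Proof.
intros Hr.
assert (H := circle_deriv r t Hr).
assert (HJd := has_deriv_on_linear J _ _ _ _ _ HJ H).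
assert (Hcos : has_deriv_on (X := R_NormedModule) 0 (2 * PI) cos t (- sin t)).
{ apply (is_derive_has_deriv_on (V := R_NormedModule)); auto_derive; [easy|ring]. }
assert (Hsin : has_deriv_on (X := R_NormedModule) 0 (2 * PI) sin t (cos t)).
{ apply (is_derive_has_deriv_on (V := R_NormedModule)); auto_derive; [easy|ring]. }
eapply has_deriv_on_eq; [|exact (has_deriv_on_plus _ _ _ _ _ _ _
  (has_deriv_on_mult _ _ _ _ _ _ _ Hcos HJd)
  (has_deriv_on_mult _ _ _ _ _ _ _ Hsin H))].
rewrite (linear_plus J HJ), !(linear_scal J HJ), HJJ; unfold D.
assert (E := sin2_cos2 t); unfold Rsqr in E.
mcoefs; try ring.
replace (-(r * 1)) with (- (r * (sin t * sin t + cos t * cos t))) by (rewrite E; ring).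
ring.
Qed.

Lemma circle_cont r : 0 <= r <= Rad -> cont_on 0 (2 * PI) (D r).
Proof.
intros Hr.
assert (H : cont_on 0 (2 * PI) (fun th => minus (D r th) (scal r (F' r th)))
  -> cont_on 0 (2 * PI) (D r)).
{ intros H t Ht e He.
  destruct (H t Ht (e / 2)) as [d1 [Hd1 K1]]; [lra|].
  assert (He2 : 0 < e / (2 * (r + 1))) by (apply Rdiv_lt_0_compat; lra).
  destruct (Hf'c r Hr t Ht _ He2) as [d2 [Hd2 K2]].
  exists (Rmin d1 d2); split; [now apply Rmin_glb_lt|]; intros s Hs Hsd.
  specialize (K1 s Hs (Rlt_le_trans _ _ _ Hsd (Rmin_l _ _))).
  specialize (K2 s Hs (Rlt_le_trans _ _ _ Hsd (Rmin_r _ _))).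
  replace e with (e / 2 + r * (e / (2 * (r + 1))) + e / (2 * (r + 1))) by (field; lra).
  apply (norm_le_eq (V := Y) (plus (minus (minus (D r s) (scal r (F' r s)))
    (minus (D r t) (scal r (F' r t)))) (scal r (minus (F' r s) (F' r t))))); [module|].
  rewrite Rplus_assoc; apply (norm_plus_le (V := Y)); [exact K1|].
  eapply Rle_trans; [apply (norm_scal_le (V := Y) _ r (e / (2 * (r + 1))))|lra].
  - rewrite Rabs_pos_eq; lra.
  - exact K2. }
apply H; clear H.
assert (Hcos : cont_on (V := R_NormedModule) 0 (2 * PI) cos).
{ apply (is_derive_cont_on _ _ _ (fun x => - sin x)).
  intros t _; auto_derive; [easy|ring]. }
assert (Hsin : cont_on (V := R_NormedModule) 0 (2 * PI) (fun t => - sin t)).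
{ apply (is_derive_cont_on _ _ _ (fun x => - cos x)).
  intros t _; auto_derive; [easy|ring]. }
assert (Hr' : cont_on (V := R_NormedModule) 0 (2 * PI) (fun _ => - r)).
{ apply (is_derive_cont_on _ _ _ (fun x => 0)).
  intros t _; auto_derive; [easy|ring]. }
assert (HF : cont_on 0 (2 * PI) (F r)).
{ eapply has_deriv_on_cont_on; intros t Ht; now apply circle_deriv. }
assert (HJF : cont_on 0 (2 * PI) (fun t => J (F r t))).
{ eapply has_deriv_on_cont_on; intros t Ht.
  apply (has_deriv_on_linear J); [easy|now apply circle_deriv]. }
assert (K1 := cont_on_scal _ _ _ _ Hcos HF).
assert (K2 := cont_on_scal _ _ _ _ Hsin HJF).
assert (K3 := cont_on_scal _ _ _ _ Hr' (Hf'c r Hr)).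
intros t Ht e He.
destruct (K1 t Ht (e / 3)) as [d1 [Hd1 L1]]; [lra|].
destruct (K2 t Ht (e / 3)) as [d2 [Hd2 L2]]; [lra|].
destruct (K3 t Ht (e / 3)) as [d3 [Hd3 L3]]; [lra|].
exists (Rmin d1 (Rmin d2 d3)); split; [repeat apply Rmin_glb_lt; easy|].
intros s Hs Hsd.
assert (A1 := Rlt_le_trans _ _ _ Hsd (Rmin_l _ _)).
assert (A2 := Rlt_le_trans _ _ _ Hsd (Rmin_r _ _)).
assert (A3 := Rlt_le_trans _ _ _ A2 (Rmin_r _ _)).
apply (fun x => Rlt_le_trans _ _ _ x (Rmin_l _ _)) in A2.
specialize (L1 s Hs A1); specialize (L2 s Hs A2); specialize (L3 s Hs A3).
replace e with (e / 3 + (e / 3 + e / 3)) by field.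
eapply (norm_le_eq (V := Y));
  [|apply (norm_plus_le (V := Y)); [exact L1|apply (norm_plus_le (V := Y)); [exact L2|exact L3]]].
unfold D, F', F; module.
Qed.

Let I r := RInt (D r) 0 (2 * PI).
Let G r := RInt (F' r) 0 (2 * PI).

Lemma two_PI_ge_0 : 0 <= 2 * PI.
Proof. pose proof PI_RGT_0; lra. Qed.

Lemma circle_is_RInt r : 0 <= r <= Rad ->
  is_RInt (D r) 0 (2 * PI) (I r) /\ is_RInt (F' r) 0 (2 * PI) (G r).
Proof.
intros Hr; split; apply (RInt_correct (V := Y)), ex_RInt_cont_on;
  try apply two_PI_ge_0; [now apply circle_cont|exact (Hf'c r Hr)].
Qed.

Lemma circle_parts r : 0 <= r <= Rad -> I r = scal r (G r).
Proof.
intros Hr; destruct (circle_is_RInt r Hr) as [HI HG].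
assert (H := is_RInt_minus _ _ _ _ _ _ HI (is_RInt_scal _ _ _ r _ HG)).
assert (H' := is_RInt_unique _ _ _ _ H).
assert (K : is_RInt (fun y => minus (D r y) (scal r (F' r y))) 0 (2 * PI) zero).
{ assert (Hc : cont_on 0 (2 * PI) (fun y => minus (D r y) (scal r (F' r y)))).
  { assert (Hr' : cont_on (V := R_NormedModule) 0 (2 * PI) (fun _ => - r)).
    { apply (is_derive_cont_on _ _ _ (fun x => 0)).
      intros t _; auto_derive; [easy|ring]. }
    assert (K3 := cont_on_scal _ _ _ _ Hr' (Hf'c r Hr)).
    intros t Ht e He.
    destruct (circle_cont r Hr t Ht (e / 2)) as [d1 [Hd1 L1]]; [lra|].
    destruct (K3 t Ht (e / 2)) as [d2 [Hd2 L2]]; [lra|].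
    exists (Rmin d1 d2); split; [now apply Rmin_glb_lt|]; intros s Hs Hsd.
    specialize (L1 s Hs (Rlt_le_trans _ _ _ Hsd (Rmin_l _ _))).
    specialize (L2 s Hs (Rlt_le_trans _ _ _ Hsd (Rmin_r _ _))).
    replace e with (e / 2 + e / 2) by field.
    eapply (norm_le_eq (V := Y)); [|apply (norm_plus_le (V := Y)); [exact L1|exact L2]].
    unfold F'; module. }
  assert (L := ftc_on 0 (2 * PI) _ _ two_PI_ge_0 (fun t _ => circle_aux_deriv r t Hr) Hc).
  cbv beta in L; unfold F in L; rewrite cos_2PI, sin_2PI, cos_0, sin_0 in L.
  refine (eq_ind _ (is_RInt _ 0 (2 * PI)) L _ _); module. }
apply is_RInt_unique in K; apply minus_eq.
refine (eq_trans (f_equal norm (eq_trans (eq_sym H') K)) (norm_zero (V := Y))).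
Qed.

(** The radial derivative of [f] is e^(i th) f', and the factor e^(-i th) in [D] cancels the
    direction. Uniformity of [Hf] on the disc allows differentiation under the integral. *)
Lemma circle_integral_deriv r0 r : 0 < r0 -> r0 <= r <= Rad ->
  has_deriv_on r0 Rad I r (G r).
Proof.
intros Hr0 Hr; apply has_deriv_on_eps; intros e He.
assert (Hjb : 0 <= Rabs jb) by apply Rabs_pos.
assert (HPI := PI_RGT_0).
(* The factors stem from the norm of multiplication by e^(-i th), from the two increments [p] and
   [q], and from the length of the interval of integration. *)
set (k := (1 + Rabs jb) * 2 * (2 * PI)).
assert (Hk : 0 < k) by (unfold k; apply Rmult_lt_0_compat; [apply Rmult_lt_0_compat|]; lra).
destruct (Hf (e / k)) as [d [Hd H]]; [now apply Rdiv_lt_0_compat|].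
exists d; split; [easy|]; intros s Hs Hsd.
destruct (circle_is_RInt r ltac:(lra)) as [HI HG].
destruct (circle_is_RInt s ltac:(lra)) as [HIs _].
assert (K := is_RInt_minus _ _ _ _ _ _ (is_RInt_minus _ _ _ _ _ _ HIs HI)
  (is_RInt_scal _ _ _ (s - r) _ HG)).
eapply Rle_trans; [apply (norm_RInt_le_const _ 0 (2 * PI) _
  ((1 + Rabs jb) * (e / k * (2 * Rabs (s - r)))) two_PI_ge_0) with (2 := K)|].
2:{ right; unfold k; field; lra. }
intros th _; cbv beta.
set (p := (s - r) * cos th); set (q := (s - r) * sin th).
specialize (H (c + r * cos th) (r * sin th) p q).
replace (c + r * cos th + p) with (c + s * cos th) in H by (unfold p; ring).
replace (r * sin th + q) with (s * sin th) in H by (unfold q; ring).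
assert (Hc : Rabs (cos th) <= 1) by (apply Rabs_le; pose proof (COS_bound th); lra).
assert (Hsn : Rabs (sin th) <= 1) by (apply Rabs_le; pose proof (SIN_bound th); lra).
assert (Ha := Rabs_pos (s - r)).
assert (Hp : Rabs p <= Rabs (s - r)).
{ unfold p; rewrite Rabs_mult; rewrite <- (Rmult_1_r (Rabs (s - r))) at 2.
  now apply Rmult_le_compat_l. }
assert (Hq : Rabs q <= Rabs (s - r)).
{ unfold q; rewrite Rabs_mult; rewrite <- (Rmult_1_r (Rabs (s - r))) at 2.
  now apply Rmult_le_compat_l. }
specialize (H (circle_in r th ltac:(lra)) (circle_in s th ltac:(lra))
  (Rle_lt_trans _ _ _ Hp Hsd) (Rle_lt_trans _ _ _ Hq Hsd)).
match type of H with norm ?x <= _ => set (err := x : Y) in H end.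
assert (Herr : norm err <= e / k * (2 * Rabs (s - r))).
{ eapply Rle_trans; [exact H|]; apply Rmult_le_compat_l; [|lra].
  now apply Rlt_le, Rdiv_lt_0_compat. }
apply (norm_le_eq (V := Y) (minus (scal (cos th) err) (scal (sin th) (J err)))).
{ unfold err, D, F, F'.
  rewrite !(linear_minus J _ _ HJ), (linear_plus J HJ), !(linear_scal J HJ), HJJ.
  assert (E := sin2_cos2 th); unfold Rsqr in E.
  unfold p, q; mcoefs; try ring.
  replace (- ((s - r) * 1)) with (- ((s - r) * (sin th * sin th + cos th * cos th)))
    by (rewrite E; ring).
  ring. }
rewrite Rmult_plus_distr_r; apply (norm_minus_le (V := Y)); [now apply (norm_scal_le (V := Y))|].
rewrite <- (Rmult_1_l (Rabs jb * _)); apply (norm_scal_le (V := Y)); [easy|].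
eapply Rle_trans; [apply HJn|]; eapply Rle_trans.
- apply Rmult_le_compat_r; [apply norm_ge_0|apply Rle_abs].
- now apply Rmult_le_compat_l.
Qed.

(** The relations I = r G and I' = G make I / r constant. This is the mean value property of f',
    obtained without contour integrals. *)
Lemma circle_mean_const r : 0 < r <= Rad -> G r = G Rad.
Proof.
intros Hr.
assert (H : forall t, r <= t <= Rad ->
  has_deriv_on r Rad (fun t => scal (/ t) (I t)) t zero).
{ intros t Ht; eapply has_deriv_on_eq; [|apply (has_deriv_on_mult r Rad Rinv I t (- / t ^ 2) (G t))].
  - rewrite circle_parts by lra; module.
  - apply (is_derive_has_deriv_on (V := R_NormedModule)); auto_derive; [lra|field; lra].
  - apply circle_integral_deriv; lra. }
assert (E := has_deriv_on_zero r Rad _ H r Rad ltac:(lra) ltac:(lra)); cbv beta in E.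
rewrite !circle_parts in E by lra.
refine (eq_trans _ (eq_trans E _)); module.
Qed.

(** Small circles give 2 PI f'(c) in the limit, whereas the largest circle gives I / Rad, where only
    [f] itself enters. The factor with [jb] accounts for a norm that need not be invariant under
    multiplication by i. *)
Lemma cauchy_estimate : norm (f' c 0) <= (1 + Rabs jb) * (M / Rad).
Proof.
assert (HPI := PI_RGT_0).
assert (HM : 0 <= M).
{ eapply Rle_trans; [apply (norm_ge_0 (f c 0))|apply HfM]; nra. }
assert (Hjb : 0 <= Rabs jb) by apply Rabs_pos.
apply le_epsilon; intros e He.
destruct (Hf'0 e He) as [d [Hd H]].
set (r := Rmin (d / 2) Rad).
assert (Hr : 0 < r <= Rad) by (split; [apply Rmin_glb_lt; lra|apply Rmin_r]).
assert (Hrd : r <= d / 2) by apply Rmin_l.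
assert (H1 : norm (minus (G r) (scal (2 * PI) (f' c 0))) <= 2 * PI * e).
{ destruct (circle_is_RInt r ltac:(lra)) as [_ HG].
  assert (K := is_RInt_minus _ _ _ _ _ _ HG (is_RInt_const 0 (2 * PI) (f' c 0))).
  rewrite Rminus_0_r in K.
  eapply Rle_trans; [apply (norm_RInt_le_const _ 0 (2 * PI) _ e two_PI_ge_0) with (2 := K)|lra].
  intros th _; cbv beta; unfold F'.
  assert (Hc : Rabs (cos th) <= 1) by (apply Rabs_le; pose proof (COS_bound th); lra).
  assert (Hsn : Rabs (sin th) <= 1) by (apply Rabs_le; pose proof (SIN_bound th); lra).
  apply H; rewrite Rabs_mult, (Rabs_pos_eq r) by lra; nra. }
assert (H2 : norm (G r) <= 2 * PI * ((1 + Rabs jb) * (M / Rad))).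
{ rewrite circle_mean_const by lra.
  assert (EI := circle_parts Rad ltac:(lra)).
  destruct (circle_is_RInt Rad ltac:(lra)) as [HI _].
  assert (K : norm (I Rad) <= 2 * PI * ((1 + Rabs jb) * M)).
  { rewrite <- (Rminus_0_r (2 * PI)).
    apply (norm_RInt_le_const _ 0 (2 * PI) _ _ two_PI_ge_0) with (2 := HI).
    intros th _; unfold D.
    assert (Hc : Rabs (cos th) <= 1) by (apply Rabs_le; pose proof (COS_bound th); lra).
    assert (Hsn : Rabs (sin th) <= 1) by (apply Rabs_le; pose proof (SIN_bound th); lra).
    assert (HF : norm (F Rad th) <= M) by (apply HfM, circle_in; lra).
    rewrite Rmult_plus_distr_r; apply (norm_minus_le (V := Y)); [now apply (norm_scal_le (V := Y))|].
    rewrite <- (Rmult_1_l (Rabs jb * _)); apply (norm_scal_le (V := Y)); [easy|].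
    eapply Rle_trans; [apply HJn|]; eapply Rle_trans.
    - apply Rmult_le_compat_r; [apply norm_ge_0|apply Rle_abs].
    - now apply Rmult_le_compat_l. }
  apply (norm_le_eq (V := Y) (scal (/ Rad) (I Rad))); [rewrite EI; module|].
  eapply Rle_trans; [apply (norm_scal_le (V := Y) _ (/ Rad)
    (2 * PI * ((1 + Rabs jb) * M)))|].
  - rewrite Rabs_pos_eq; [apply Rle_refl|apply Rlt_le, Rinv_0_lt_compat; lra].
  - exact K.
  - right; field; lra. }
assert (H3 : norm (scal (2 * PI) (f' c 0)) <= 2 * PI * ((1 + Rabs jb) * (M / Rad)) + 2 * PI * e).
{ apply (norm_le_eq (V := Y) (minus (G r) (minus (G r) (scal (2 * PI) (f' c 0))))); [module|].
  now apply (norm_minus_le (V := Y)). }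
assert (H4 := norm_scal_pos (2 * PI) (f' c 0) ltac:(lra)).
apply Rmult_le_reg_l with (2 * PI); [lra|].
eapply Rle_trans; [right; symmetry; exact H4|].
eapply Rle_trans; [exact H3|lra].
Qed.

End CauchyEstimate.

(** * Analytic semigroups *)

Lemma Cmod_le_sum (p q : R) : Cmod (p, q) <= Rabs p + Rabs q.
Proof.
unfold Cmod; simpl fst; simpl snd.
rewrite <- (sqrt_pow2 (Rabs p + Rabs q));
  [|pose proof (Rabs_pos p); pose proof (Rabs_pos q); lra].
apply sqrt_le_1_alt; rewrite <- (pow2_abs p), <- (pow2_abs q).
pose proof (Rabs_pos p); pose proof (Rabs_pos q); nra.
Qed.

Lemma Rabs_le_Cmod (p q : R) : Rabs p <= Cmod (p, q) /\ Rabs q <= Cmod (p, q).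
Proof.
pose proof (Rmax_Cmod (p, q)) as H; simpl in H; split;
  (eapply Rle_trans; [|exact H]); [apply Rmax_l|apply Rmax_r].
Qed.

Section ComplexStructure.
Context {X : NormedModule R_AbsRing}.

Definition mul_i (w : X * X) : X * X := (opp (snd w), fst w).

Lemma mul_i_linear : is_linear mul_i.
Proof.
apply is_linear_prod; [|apply is_linear_fst].
apply (is_linear_comp snd opp); [apply is_linear_snd|apply is_linear_opp].
Qed.

Lemma mul_i_mul_i w : mul_i (mul_i w) = opp w.
Proof. reflexivity. Qed.

Lemma Cscal_mul_i (p q : R) (w : X * X) :
  Cscal (p, q) w = plus (scal p w) (scal q (mul_i w)).
Proof.
destruct w as [x y].
change ((minus (scal p x) (scal q y), plus (scal p y) (scal q x)) =
  (plus (scal p x) (scal q (opp y)), plus (scal p y) (scal q x))).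
f_equal; module.
Qed.

Lemma norm_fst_le (w : X * X) : norm (fst w) <= norm w.
Proof.
destruct w as [x y]; eapply Rle_trans; [|apply (norm_prod x y)]; apply Rmax_l.
Qed.

Lemma norm_pair_zero_le (x : X) : norm ((x, zero) : X * X) <= 2 * norm x.
Proof.
eapply Rle_trans; [apply (norm_prod x zero)|].
assert (E : norm (zero : X) = 0) by apply norm_zero.
assert (Hx := norm_ge_0 x).
rewrite Rmax_left.
2:{ eapply Rle_trans; [right; exact E|exact Hx]. }
apply Rmult_le_compat_r; [easy|].
replace 2 with (sqrt (2 ^ 2)) at 2 by (apply sqrt_pow2; lra).
apply sqrt_le_1_alt; lra.
Qed.

Lemma C_diff_at_real (T : C -> X * X -> X * X) (x0 y0 : R) :
  C_diff_at T (x0, y0) ->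
  exists T' : X * X -> X * X, is_linear T' /\
  forall eps, 0 < eps -> exists d, 0 < d /\ forall p q,
  Rabs p < d -> Rabs q < d -> forall w,
  norm (minus (minus (T (x0 + p, y0 + q)%R w) (T (x0, y0) w))
    (plus (scal p (T' w)) (scal q (mul_i (T' w)))))
    <= eps * (Rabs p + Rabs q) * norm w.
Proof.
intros [T' [[HT' _] H]]; exists T'; split; [easy|]; intros e He.
destruct (H (mkposreal e He)) as [d Hd]; exists (d / 2); split.
{ pose proof (cond_pos d); lra. }
intros p q Hp Hq w.
assert (E : ((x0 + p, y0 + q)%R - (x0, y0))%C = (p, q)).
{ apply injective_projections; simpl; ring. }
specialize (Hd (x0 + p, y0 + q)%R); rewrite E in Hd.
assert (Hc := Cmod_le_sum p q).
specialize (Hd ltac:(lra) w); rewrite Cscal_mul_i in Hd.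
eapply Rle_trans; [exact Hd|].
apply Rmult_le_compat_r; [apply norm_ge_0|].
apply Rmult_le_compat_l; [simpl; lra|easy].
Qed.

End ComplexStructure.

Section AnalyticSemigroup.
Context {X : CompleteNormedModule R_AbsRing} (S : R -> X -> X).
Let Y := prod_CompleteNormedModule X X.
Let Y2 := prod_NormedModule R_AbsRing X X.
Hypothesis HS : C0_semigroup S.
Context (kappa : R) (T : C -> X * X -> X * X).
Hypothesis Hkappa : 0 < kappa.
Hypothesis HTS : forall t x, 0 < t -> T (RtoC t) (x, zero) = (S t x, zero).
Hypothesis HTlin : forall z, sector kappa z -> C_linear (T z).
Hypothesis HTd : forall z, sector kappa z -> C_diff_at T z.
Hypothesis HTsem : forall z1 z2 w, sector kappa z1 -> sector kappa z2 ->
  T (z1 + z2)%C w = T z1 (T z2 w).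
Hypothesis HT0 : forall w, filterlim (fun z => T z w)
  (within (sector kappa) (locally (RtoC 0))) (locally w).

(** If this failed, the operators at distance less than 1/(k+1) from 0 would be unbounded for each
    k. Uniform boundedness would then give one vector whose images blow up as z tends to 0, against
    strong continuity. *)
Lemma sector_bounded : exists M delta, 0 < M /\ 0 < delta /\
  forall z, sector kappa z -> Cmod z < delta -> forall w : X * X,
  norm (T z w) <= M * norm w.
Proof.
apply NNPP; intros N.
set (Fam := fun (k : nat) (L : X * X -> X * X) =>
  exists z, sector kappa z /\ Cmod z < / (INR k + 1) /\ L = T z).
destruct (uniform_boundedness Fam) as [w Hw].
- exact (CompleteNormedModule_seq_complete Y).
- intros k L [z [Hz [_ ->]]]; apply (HTlin z Hz).
- intros k K; apply NNPP; intros N'; apply N.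
  assert (Hk := pos_INR k).
  exists (Rmax K 1), (/ (INR k + 1)); split; [|split].
  + eapply Rlt_le_trans; [apply Rlt_0_1|apply Rmax_r].
  + apply Rinv_0_lt_compat; lra.
  + intros z Hz Hzk w; apply Rnot_lt_le; intros Hlt; apply N'.
    exists (T z), w; split; [now exists z|].
    eapply Rle_lt_trans; [|exact Hlt].
    apply Rmult_le_compat_r; [apply norm_ge_0|apply Rmax_l].
- specialize (HT0 w).
  destruct (proj1 (filterlim_norm_le (V := Y) (within (sector kappa) (locally (RtoC 0)))
    (fun z => T z w) w) HT0 1 Rlt_0_1) as [d Hd].
  assert (Hd0 := cond_pos d).
  destruct (INR_unbounded (norm w + 1)) as [k1 Hk1].
  destruct (INR_unbounded (/ d)) as [k2 Hk2].
  set (k := Nat.max k1 k2).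
  apply Rgt_lt, Rlt_le in Hk1, Hk2.
  assert (Hk1' := Rle_trans _ _ _ Hk1 (le_INR _ _ (Nat.le_max_l k1 k2))); fold k in Hk1'.
  assert (Hk2' := Rle_trans _ _ _ Hk2 (le_INR _ _ (Nat.le_max_r k1 k2))); fold k in Hk2'.
  assert (Hdi : 0 < / d) by now apply Rinv_0_lt_compat.
  destruct (Hw (Datatypes.S k)) as [L [[z [Hz [Hzk ->]]] HLw]].
  assert (Hz' : Cmod z < d).
  { rewrite S_INR in Hzk; eapply Rlt_trans; [exact Hzk|].
    rewrite <- (Rinv_inv d); apply Rinv_lt_contravar.
    - apply Rmult_lt_0_compat; [easy|lra].
    - lra. }
  destruct z as [a b]; destruct (Rabs_le_Cmod a b) as [Ha Hb].
  assert (Hball : ball (RtoC 0) d (a, b)).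
  { split; [change (Rabs (a - 0) < d)|change (Rabs (b - 0) < d)];
      rewrite Rminus_0_r; lra. }
  specialize (Hd (a, b) Hball Hz).
  rewrite S_INR in HLw.
  assert (Tr : norm (T (a, b) w) <= 1 + norm w).
  { eapply Rle_trans; [exact (norm_le_minus (V := Y2) (T (a, b) w) w)|].
    apply Rplus_le_compat_r; exact Hd. }
  simpl in *; lra.
Qed.

Lemma sector_cont (x0 y0 : R) (w : X * X) : sector kappa (x0, y0) ->
  forall eps, 0 < eps -> exists d, 0 < d /\ forall p q, Rabs p < d -> Rabs q < d ->
  norm (minus (T (x0 + p, y0 + q)%R w) (T (x0, y0) w)) <= eps.
Proof.
intros Hs e He; destruct (C_diff_at_real T x0 y0 (HTd _ Hs)) as [T' [HT' H]].
destruct (H 1 Rlt_0_1) as [d [Hd Hd']].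
set (K := norm (T' w) + norm (mul_i (T' w)) + 2 * norm w + 1).
assert (P1 := norm_ge_0 (T' w)); assert (P2 := norm_ge_0 (mul_i (T' w))).
assert (P3 := norm_ge_0 w).
assert (HK : 0 < K) by (unfold K; simpl in *; lra).
exists (Rmin d (e / K)); split; [apply Rmin_glb_lt; [easy|now apply Rdiv_lt_0_compat]|].
intros p q Hp Hq.
assert (Hp1 := Rlt_le_trans _ _ _ Hp (Rmin_l _ _)).
assert (Hp2 := Rlt_le_trans _ _ _ Hp (Rmin_r _ _)).
assert (Hq1 := Rlt_le_trans _ _ _ Hq (Rmin_l _ _)).
assert (Hq2 := Rlt_le_trans _ _ _ Hq (Rmin_r _ _)).
specialize (Hd' p q Hp1 Hq1 w).
assert (H1 : norm (minus (minus (T (x0 + p, y0 + q)%R w) (T (x0, y0) w))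
    (plus (scal p (T' w)) (scal q (mul_i (T' w))))) <= e / K * (2 * norm w + 1)).
{ eapply Rle_trans; [exact Hd'|]; rewrite Rmult_1_l.
  apply Rle_trans with ((e / K * 2) * norm w); [apply Rmult_le_compat_r; [easy|lra]|].
  assert (0 < e / K) by now apply Rdiv_lt_0_compat.
  replace (e / K * (2 * norm w + 1)) with (e / K * 2 * norm w + e / K) by ring; lra. }
assert (H2 : norm (scal p (T' w)) <= e / K * norm (T' w))
  by (apply (norm_scal_le (V := Y2)); [lra|apply Rle_refl]).
assert (H3 : norm (scal q (mul_i (T' w))) <= e / K * norm (mul_i (T' w)))
  by (apply (norm_scal_le (V := Y2)); [lra|apply Rle_refl]).
assert (H4 := norm_plus_le (V := Y2) _ _ _ _ H1 (norm_plus_le (V := Y2) _ _ _ _ H2 H3)).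
replace e with (e / K * (2 * norm w + 1) +
  (e / K * norm (T' w) + e / K * norm (mul_i (T' w)))).
- eapply (norm_le_eq (V := Y2)); [|exact H4]; module.
- unfold K in *; field; lra.
Qed.

(** The disc of radius eta c about c stays in the sector even after a shift to the left by c/6: the
    real part remains at least c/2, while the imaginary part is at most kappa c/3. *)
Let eta := Rmin kappa 1 / 3.

Lemma eta_bounds : 0 < eta /\ 3 * eta <= kappa /\ 3 * eta <= 1.
Proof.
unfold eta; assert (0 < Rmin kappa 1) by (apply Rmin_glb_lt; lra).
pose proof (Rmin_l kappa 1); pose proof (Rmin_r kappa 1); lra.
Qed.

Lemma disc_bounds c x y : 0 < c -> (x - c) ^ 2 + y ^ 2 <= (eta * c) ^ 2 ->
  Rabs (x - c) <= eta * c /\ Rabs y <= eta * c.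
Proof.
intros Hc H; destruct eta_bounds as [He _].
assert (Hec : 0 < eta * c) by now apply Rmult_lt_0_compat.
assert (Ha : forall a b, 0 < b -> a ^ 2 <= b ^ 2 -> Rabs a <= b).
{ intros a b Hb Hab; apply Rabs_le; split; apply Rnot_lt_le; intros N; nra. }
pose proof (pow2_ge_0 (x - c)); pose proof (pow2_ge_0 y).
split; apply Ha; lra.
Qed.

Lemma disc_sector c x y : 0 < c -> (x - c) ^ 2 + y ^ 2 <= (eta * c) ^ 2 ->
  sector kappa (x, y) /\ sector kappa ((x - c / 6)%R, y) /\
  Cmod (x, y) < 2 * c /\ Cmod ((x - c / 6)%R, y) < 2 * c.
Proof.
intros Hc H; destruct (disc_bounds c x y Hc H) as [H1 H2].
destruct eta_bounds as [He [Hk H1']].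
assert (Hec : eta * c <= c / 3) by nra.
apply Rabs_le_between in H1.
assert (Hyk : Rabs y <= kappa * c / 3) by nra.
repeat split; simpl; try lra; try nra.
- eapply Rle_lt_trans; [apply Cmod_le_sum|]; rewrite (Rabs_pos_eq x); lra.
- eapply Rle_lt_trans; [apply Cmod_le_sum|]; rewrite (Rabs_pos_eq (x - _)); lra.
Qed.

(** By T(z) = T(c/6) T(z - c/6) the derivative at each point of the disc is the single operator
    [B0], the derivative at c/6, composed with T(z - c/6). Differentiability thereby becomes uniform
    on the disc and the derivative continuous, as the Cauchy estimate demands. *)
Lemma small_time_deriv : exists K delta, 0 < K /\ 0 < delta /\
  forall c, 0 < c < delta -> exists B : X -> X, is_linear B /\
  (forall x, norm (B x) <= K / c * norm x) /\
  forall eps, 0 < eps -> exists d, 0 < d /\ forall s, Rabs s < d -> forall x,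
  norm (minus (minus (S (c + s) x) (S c x)) (scal s (B x)))
    <= eps * Rabs s * norm x.
Proof.
destruct sector_bounded as [M [delta [HM [Hdelta HMb]]]].
destruct (linear_norm (mul_i (X := X)) mul_i_linear) as [jb [Hjb HJn]].
destruct eta_bounds as [Heta [Hek He1]].
(* The radius eta c explains 1/eta, and 2 bounds the norm of the embedding of X into its
   complexification. Halving [delta] keeps the disc about c, whose points have modulus below 2 c,
   where [M] is valid. *)
exists ((1 + Rabs jb) * (M * 2 / eta) + 1), (delta / 2).
assert (HK : 0 <= (1 + Rabs jb) * (M * 2 / eta)).
{ apply Rmult_le_pos; [pose proof (Rabs_pos jb); lra|].
  apply Rlt_le, Rdiv_lt_0_compat; lra. }
split; [lra|]; split; [lra|]; intros c Hc.
assert (Hs0 : sector kappa (c / 6, 0)%R).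
{ split; simpl; [lra|]; rewrite Rabs_R0; apply Rmult_lt_0_compat; lra. }
destruct (C_diff_at_real T (c / 6) 0 (HTd _ Hs0)) as [B0 [HB0 HB0d]].
set (f := fun w x y => T (x, y) w : Y).
set (f' := fun w x y => B0 (T ((x - c / 6)%R, y) w) : Y).
assert (Hb : forall x y, (x - c) ^ 2 + y ^ 2 <= (eta * c) ^ 2 -> forall w : X * X,
  norm (T (x, y) w) <= M * norm w /\ norm (T ((x - c / 6)%R, y) w) <= M * norm w).
{ intros x y H w; destruct (disc_sector c x y (proj1 Hc) H) as [K1 [K2 [K3 K4]]].
  split; apply HMb; auto; lra. }
assert (Hdf : forall w : X * X, forall eps, 0 < eps -> exists d, 0 < d /\ forall x y p q,
  (x - c) ^ 2 + y ^ 2 <= (eta * c) ^ 2 ->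
  Rabs p < d -> Rabs q < d ->
  norm (minus (minus (f w (x + p) (y + q)) (f w x y))
    (plus (scal p (f' w x y)) (scal q (mul_i (f' w x y))))) <=
    eps * (Rabs p + Rabs q) * (M * norm w)).
{ intros w e He; destruct (HB0d e He) as [d [Hd H]].
  (* Displacements below [d1] keep the point c/6 + p + i q inside the sector. *)
  set (d1 := Rmin kappa 1 * c / 24).
  assert (Hmk : 0 < Rmin kappa 1) by (apply Rmin_glb_lt; lra).
  assert (Hmk1 := Rmin_l kappa 1); assert (Hmk2 := Rmin_r kappa 1).
  assert (Hd1 : 0 < d1) by (unfold d1; nra).
  assert (Hd1c : d1 <= c / 24) by (unfold d1; nra).
  assert (Hd1k : d1 <= kappa * c / 24) by (unfold d1; nra).
  exists (Rmin d d1); split; [now apply Rmin_glb_lt|].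
  intros x y p q Hxy Hp Hq.
  assert (Hp1 := Rlt_le_trans _ _ _ Hp (Rmin_l _ _)).
  assert (Hp2 := Rlt_le_trans _ _ _ Hp (Rmin_r _ _)).
  assert (Hq1 := Rlt_le_trans _ _ _ Hq (Rmin_l _ _)).
  assert (Hq2 := Rlt_le_trans _ _ _ Hq (Rmin_r _ _)).
  destruct (disc_sector c x y (proj1 Hc) Hxy) as [_ [K2 _]].
  specialize (H p q Hp1 Hq1 (T ((x - c / 6)%R, y) w)).
  assert (Hs1 : sector kappa ((c / 6 + p)%R, (0 + q)%R)).
  { apply Rabs_def2 in Hp2; split; simpl; [lra|rewrite Rplus_0_l; nra]. }
  rewrite <- (HTsem _ _ w Hs1 K2), <- (HTsem _ _ w Hs0 K2) in H.
  replace ((c / 6 + p)%R, (0 + q)%R) with ((c / 6 + p)%R, (0 + q)%R) in H by easy.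
  assert (E1 : (((c / 6 + p)%R, (0 + q)%R) + ((x - c / 6)%R, y))%C = ((x + p)%R, (y + q)%R)).
  { apply injective_projections; simpl; ring. }
  assert (E2 : ((c / 6, 0)%R + ((x - c / 6)%R, y))%C = (x, y)).
  { apply injective_projections; simpl; ring. }
  rewrite E1, E2 in H.
  eapply Rle_trans; [exact H|]; apply Rmult_le_compat_l; [|now apply Hb].
  apply Rmult_le_pos; [lra|]; pose proof (Rabs_pos p); pose proof (Rabs_pos q); lra. }
assert (Hcont : forall (w : X * X) x y, (x - c) ^ 2 + y ^ 2 <= (eta * c) ^ 2 ->
  forall eps, 0 < eps -> exists d, 0 < d /\ forall p q, Rabs p < d -> Rabs q < d ->
  norm (minus (f' w (x + p) (y + q)) (f' w x y)) <= eps).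
{ intros w x y Hxy e He.
  destruct (linear_norm B0 HB0) as [b [Hb0 HbB]].
  destruct (disc_sector c x y (proj1 Hc) Hxy) as [_ [K2 _]].
  destruct (sector_cont _ _ w K2 (e / b)) as [d [Hd H]]; [now apply Rdiv_lt_0_compat|].
  exists d; split; [easy|]; intros p q Hp Hq; specialize (H p q Hp Hq).
  unfold f'; replace (x + p - c / 6) with (x - c / 6 + p) by ring.
  eapply (norm_le_eq (V := Y2)); [symmetry; apply (linear_minus B0 _ _ HB0)|].
  eapply Rle_trans; [apply HbB|].
  replace e with (b * (e / b)) by (field; lra).
  apply Rmult_le_compat_l; [lra|exact H]. }
assert (Hcc : (c - c) ^ 2 + 0 ^ 2 <= (eta * c) ^ 2) by nra.
assert (Hest : forall w : X * X, norm (f' w c 0) <= (1 + Rabs jb) * (M * norm w / (eta * c))).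
{ intros w.
  assert (HMw : 0 <= M * norm w) by (apply Rmult_le_pos; [lra|apply norm_ge_0]).
  apply (cauchy_estimate (Y := Y) mul_i jb) with (f := f w).
  - exact mul_i_linear.
  - exact mul_i_mul_i.
  - exact HJn.
  - nra.
  - intros e He.
    destruct (Hdf w (e / (M * norm w + 1))) as [d [Hd H]]; [apply Rdiv_lt_0_compat; lra|].
    exists d; split; [easy|]; intros x y p q H1 _ H3 H4.
    eapply Rle_trans; [apply (H x y p q H1 H3 H4)|].
    replace (e / (M * norm w + 1) * (Rabs p + Rabs q) * (M * norm w)) with
      (e * (Rabs p + Rabs q) * (M * norm w / (M * norm w + 1))) by (field; lra).
    rewrite <- (Rmult_1_r (e * (Rabs p + Rabs q))) at 2.
    apply Rmult_le_compat_l.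
    + apply Rmult_le_pos; [lra|]; pose proof (Rabs_pos p); pose proof (Rabs_pos q); lra.
    + apply Rmult_le_reg_r with (M * norm w + 1); [lra|].
      unfold Rdiv; rewrite Rmult_assoc, Rinv_l; lra.
  - intros r Hr t _ e He.
    destruct (Hcont w (c + r * cos t) (r * sin t)) with (eps := e) as [d [Hd H]]; [|easy|].
    { now apply circle_in. }
    exists (d / (r + 1)); split; [apply Rdiv_lt_0_compat; lra|].
    intros s _ Hs.
    destruct (lipschitz_sin_cos s t) as [L1 L2].
    assert (Hd' : r * Rabs (s - t) < d).
    { apply (Rmult_lt_compat_l (r + 1)) in Hs; [|lra].
      replace ((r + 1) * (d / (r + 1))) with d in Hs by (field; lra).
      pose proof (Rabs_pos (s - t)); lra. }
    specialize (H (r * (cos s - cos t)) (r * (sin s - sin t))).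
    replace (c + r * cos t + r * (cos s - cos t)) with (c + r * cos s) in H by ring.
    replace (r * sin t + r * (sin s - sin t)) with (r * sin s) in H by ring.
    apply H; rewrite Rabs_mult, (Rabs_pos_eq r) by lra;
      (eapply Rle_lt_trans; [apply Rmult_le_compat_l; [lra|eassumption]|exact Hd']).
  - intros e He; destruct (Hcont w c 0 Hcc e He) as [d [Hd H]]; exists d; split; [easy|].
    intros p q Hp Hq; specialize (H p q Hp Hq); rewrite Rplus_0_l in H; exact H.
  - intros x y Hxy; now apply Hb. }
exists (fun x => fst (f' (x, zero) c 0)).
assert (Hs2 := proj1 (proj2 (disc_sector c c 0 (proj1 Hc) Hcc))).
split; [|split].
- unfold f'; apply (is_linear_comp (fun x : X => ((x, zero) : Y2))
    (fun w => fst (B0 (T ((c - c / 6)%R, 0) w)))).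
  + apply is_linear_prod; [apply is_linear_id|apply is_linear_zero].
  + apply (is_linear_comp (fun w => B0 (T ((c - c / 6)%R, 0) w)) fst); [|apply is_linear_fst].
    apply (is_linear_comp (T ((c - c / 6)%R, 0)) B0); [apply (HTlin _ Hs2)|easy].
- intros x; eapply Rle_trans; [apply norm_fst_le|].
  eapply Rle_trans; [apply Hest|].
  assert (Hx := norm_ge_0 x); assert (Hx2 := norm_pair_zero_le x).
  apply Rle_trans with ((1 + Rabs jb) * (M * (2 * norm x) / (eta * c))).
  + apply Rmult_le_compat_l; [pose proof (Rabs_pos jb); lra|].
    apply Rmult_le_compat_r; [apply Rlt_le, Rinv_0_lt_compat; nra|].
    apply Rmult_le_compat_l; [lra|exact Hx2].
  + replace ((1 + Rabs jb) * (M * (2 * norm x) / (eta * c))) with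
      ((1 + Rabs jb) * (M * 2 / eta) * / c * norm x) by (field; lra).
    apply Rmult_le_compat_r; [easy|].
    apply Rmult_le_compat_r; [apply Rlt_le, Rinv_0_lt_compat|]; lra.
- intros e He.
  set (b := 2 * (1 + 2 * M)).
  assert (Hb0 : 0 < b) by (unfold b; lra).
  destruct (Hdf zero 1 Rlt_0_1) as [dd _]; clear dd.
  destruct (HB0d (e / b)) as [d [Hd H]]; [now apply Rdiv_lt_0_compat|].
  exists (Rmin d (c / 12)); split; [apply Rmin_glb_lt; lra|]; intros s Hs x.
  assert (Hsa := Rlt_le_trans _ _ _ Hs (Rmin_l _ _)).
  assert (Hsb := Rlt_le_trans _ _ _ Hs (Rmin_r _ _)).
  apply Rabs_def2 in Hsb.
  specialize (H s 0 Hsa ltac:(rewrite Rabs_R0; lra) (T ((c - c / 6)%R, 0) (x, zero))).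
  assert (Hs1 : sector kappa ((c / 6 + s)%R, (0 + 0)%R)).
  { split; simpl; [lra|]; rewrite Rplus_0_l, Rabs_R0; nra. }
  rewrite <- (HTsem _ _ (x, zero) Hs1 Hs2), <- (HTsem _ _ (x, zero) Hs0 Hs2) in H.
  assert (E1 : (((c / 6 + s)%R, (0 + 0)%R) + ((c - c / 6)%R, 0))%C = RtoC (c + s)).
  { apply injective_projections; simpl; field. }
  assert (E2 : ((c / 6, 0)%R + ((c - c / 6)%R, 0))%C = RtoC c).
  { apply injective_projections; simpl; field. }
  rewrite E1, E2, !HTS, Rabs_R0, Rplus_0_r in H by lra.
  eapply Rle_trans; [|eapply Rle_trans; [exact H|]].
  + eapply Rle_trans; [|apply norm_fst_le].
    apply (norm_le_eq (V := X) (minus (minus (S (c + s) x) (S c x))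
      (plus (scal s (fst (f' (x, zero) c 0))) (scal 0 (fst (mul_i (f' (x, zero) c 0)))))));
      [module|apply Rle_refl].
  + destruct (Hb c 0 Hcc (x, zero)) as [_ Hbx].
    assert (Hx := norm_ge_0 x); assert (Hx2 := norm_pair_zero_le x).
    apply Rle_trans with (e / b * Rabs s * (M * (2 * norm x))).
    * apply Rmult_le_compat_l.
      { apply Rmult_le_pos; [apply Rlt_le, Rdiv_lt_0_compat; lra|apply Rabs_pos]. }
      eapply Rle_trans; [exact Hbx|]; apply Rmult_le_compat_l; [lra|exact Hx2].
    * replace (e / b * Rabs s * (M * (2 * norm x))) with
        (e * Rabs s * norm x * (2 * M / b)) by (field; lra).
      rewrite <- (Rmult_1_r (e * Rabs s * norm x)) at 2.
      apply Rmult_le_compat_l.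
      { apply Rmult_le_pos; [apply Rmult_le_pos; [lra|apply Rabs_pos]|easy]. }
      apply Rmult_le_reg_r with b; [easy|].
      unfold Rdiv; rewrite Rmult_assoc, Rinv_l by lra; unfold b; lra.
Qed.

End AnalyticSemigroup.

(** * Bounds for analytic semigroups on bounded time intervals *)

Section SemigroupBounds.
Context {X : CompleteNormedModule R_AbsRing} (S : R -> X -> X).
Hypothesis HS : analytic_semigroup S.

Lemma sg_linear t : 0 <= t -> is_linear (S t).
Proof. apply HS. Qed.

Lemma sg_0 x : S 0 x = x.
Proof. apply HS. Qed.

Lemma sg_add t r x : 0 <= t -> 0 <= r -> S (t + r) x = S t (S r x).
Proof. apply HS. Qed.

(** The bound near 0 is carried along in steps of length d/2 by the semigroup law, with one factor
    [M1] per step. *)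
Lemma sg_bounded (Tm : R) : exists M, 1 <= M /\
  forall t x, 0 <= t <= Tm -> norm (S t x) <= M * norm x.
Proof.
destruct HS as [H0 [kappa [T [Hk [HTS [HTl [HTd [HTs HT0]]]]]]]].
destruct (sector_bounded kappa T HTl HT0) as [M [d [HM [Hd HMb]]]].
set (M1 := Rmax 1 (M * 2)).
assert (HM1 : 1 <= M1) by apply Rmax_l.
assert (Hsmall : forall t x, 0 <= t < d -> norm (S t x) <= M1 * norm x).
{ intros t x Ht; assert (Hx := norm_ge_0 x).
  destruct (Req_dec t 0) as [->|Ht0].
  - rewrite sg_0, <- (Rmult_1_l (norm x)) at 1; now apply Rmult_le_compat_r.
  - apply Rle_trans with (norm (T (RtoC t) (x, zero))).
    + rewrite HTS by lra; apply (norm_fst_le (S t x, zero)).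
    + eapply Rle_trans; [apply HMb|].
      * split; simpl; [lra|]; rewrite Rabs_R0; apply Rmult_lt_0_compat; lra.
      * rewrite Cmod_R, Rabs_pos_eq; lra.
      * apply Rle_trans with (M * (2 * norm x)).
        -- apply Rmult_le_compat_l; [lra|apply norm_pair_zero_le].
        -- rewrite <- Rmult_assoc; apply Rmult_le_compat_r; [easy|apply Rmax_r]. }
assert (Hn : forall n t x, 0 <= t <= INR n * (d / 2) -> norm (S t x) <= M1 ^ n * norm x).
{ induction n as [|n IH]; intros t x Ht.
  - simpl in Ht; replace t with 0 by lra; rewrite sg_0; simpl; lra.
  - destruct (Rle_dec t (d / 2)) as [Htd|Htd].
    + eapply Rle_trans; [apply Hsmall; lra|]; apply Rmult_le_compat_r; [apply norm_ge_0|].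
      rewrite <- (pow_1 M1) at 1; apply Rle_pow; [easy|lia].
    + rewrite S_INR in Ht; replace t with (d / 2 + (t - d / 2)) by ring.
      rewrite sg_add by lra; eapply Rle_trans; [apply Hsmall; lra|].
      simpl; rewrite Rmult_assoc; apply Rmult_le_compat_l; [lra|apply IH; lra]. }
destruct (INR_unbounded (Tm / (d / 2))) as [n Hnn].
exists (M1 ^ n); split; [apply pow_R1_Rle; lra|].
intros t x Ht; apply Hn; split; [lra|].
apply Rle_trans with (Tm / (d / 2) * (d / 2)); [|apply Rmult_le_compat_r; lra].
replace (Tm / (d / 2) * (d / 2)) with Tm by (field; lra); lra.
Qed.

Definition op_deriv_at (t : R) (B : X -> X) : Prop :=
  forall eps, 0 < eps -> exists d, 0 < d /\ forall s, Rabs s < d -> forall x,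
  norm (minus (minus (S (t + s) x) (S t x)) (scal s (B x))) <= eps * Rabs s * norm x.

(** Away from 0 the derivative at t is the one at a fixed small time c composed with S (t - c); its
    constant bound is at most a multiple of 1/t because t is bounded. *)
Lemma sg_deriv (Tm : R) : exists K, 0 < K /\ forall t, 0 < t <= Tm ->
  exists B : X -> X, is_linear B /\ (forall x, norm (B x) <= K / t * norm x) /\
  op_deriv_at t B.
Proof.
destruct (sg_bounded Tm) as [M [HM HMb]].
destruct HS as [H0 [kappa [T [Hk [HTS [HTl [HTd [HTs HT0]]]]]]]].
destruct (small_time_deriv S kappa T Hk HTS HTl HTd HTs HT0) as [K [d [HK [Hd HB]]]].
set (c := d / 2).
exists (K + K / c * M * Rabs Tm).
assert (Hc : 0 < c) by (unfold c; lra).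
assert (HKc : 0 < K / c) by now apply Rdiv_lt_0_compat.
assert (HKM : 0 < K / c * M) by (apply Rmult_lt_0_compat; lra).
assert (HT : 0 <= Rabs Tm) by apply Rabs_pos.
assert (HKMT : 0 <= K / c * M * Rabs Tm) by (apply Rmult_le_pos; lra).
split; [lra|]; intros t Ht.
assert (Hti : 0 < / t) by (apply Rinv_0_lt_compat; lra).
destruct (Rlt_dec t d) as [Htd|Htd].
- destruct (HB t ltac:(lra)) as [B [HB1 [HB2 HB3]]]; exists B; split; [easy|split; [|exact HB3]].
  intros x; eapply Rle_trans; [apply HB2|]; apply Rmult_le_compat_r; [apply norm_ge_0|].
  apply Rmult_le_compat_r; lra.
- destruct (HB c ltac:(unfold c; lra)) as [B [HB1 [HB2 HB3]]].
  assert (Htc : 0 <= t - c) by (unfold c; lra).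
  exists (fun x => B (S (t - c) x)); split; [|split].
  + apply (is_linear_comp (S (t - c)) B); [now apply sg_linear|easy].
  + intros x; eapply Rle_trans; [apply HB2|].
    apply Rle_trans with (K / c * (M * norm x)).
    * apply Rmult_le_compat_l; [lra|apply HMb; lra].
    * rewrite <- Rmult_assoc; apply Rmult_le_compat_r; [apply norm_ge_0|].
      apply Rmult_le_reg_r with t; [lra|].
      replace ((K + K / c * M * Rabs Tm) / t * t) with (K + K / c * M * Rabs Tm) by (field; lra).
      assert (K / c * M * t <= K / c * M * Rabs Tm); [|lra].
      apply Rmult_le_compat_l; [lra|]; pose proof (Rle_abs Tm); lra.
  + intros e He.
    destruct (HB3 (e / M)) as [d' [Hd' H]]; [apply Rdiv_lt_0_compat; lra|].
    exists (Rmin d' c); split; [now apply Rmin_glb_lt|]; intros s Hs x.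
    assert (Hs1 := Rlt_le_trans _ _ _ Hs (Rmin_l _ _)).
    assert (Hs2 := Rlt_le_trans _ _ _ Hs (Rmin_r _ _)); apply Rabs_def2 in Hs2.
    specialize (H s Hs1 (S (t - c) x)).
    rewrite <- (sg_add (c + s)), <- (sg_add c) in H by lra.
    replace (c + s + (t - c)) with (t + s) in H by ring.
    replace (c + (t - c)) with t in H by ring.
    eapply Rle_trans; [exact H|].
    apply Rle_trans with (e / M * Rabs s * (M * norm x)).
    * apply Rmult_le_compat_l; [|apply HMb; lra].
      apply Rmult_le_pos; [apply Rlt_le, Rdiv_lt_0_compat; lra|apply Rabs_pos].
    * right; field; lra.
Qed.

(** One operator [B] describes the derivative at all later times, so that derivatives at different
    times can be compared through differences of S. *)
Lemma op_deriv_has_deriv_on (t : R) (B : X -> X) x (a b r : R) :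
  op_deriv_at t B -> 0 < t -> t <= r ->
  has_deriv_on a b (fun s => S s x) r (B (S (r - t) x)).
Proof.
intros H Ht Htr; apply has_deriv_on_eps; intros e He.
set (y := S (r - t) x).
assert (Hy := norm_ge_0 y).
destruct (H (e / (norm y + 1))) as [d [Hd Hd']]; [apply Rdiv_lt_0_compat; lra|].
exists (Rmin d t); split; [now apply Rmin_glb_lt|]; intros s _ Hs.
assert (Hs1 := Rlt_le_trans _ _ _ Hs (Rmin_l _ _)).
assert (Hs2 := Rlt_le_trans _ _ _ Hs (Rmin_r _ _)); apply Rabs_def2 in Hs2.
specialize (Hd' (s - r) Hs1 y); unfold y in Hd' at 1 2.
rewrite <- (sg_add (t + (s - r))), <- (sg_add t) in Hd' by lra.
replace (t + (s - r) + (r - t)) with s in Hd' by ring.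
replace (t + (r - t)) with r in Hd' by ring.
eapply Rle_trans; [exact Hd'|].
replace (e / (norm y + 1) * Rabs (s - r) * norm y) with
  (e * Rabs (s - r) * (norm y / (norm y + 1))) by (field; lra).
rewrite <- (Rmult_1_r (e * Rabs (s - r))) at 2.
apply Rmult_le_compat_l; [apply Rmult_le_pos; [lra|apply Rabs_pos]|].
apply Rmult_le_reg_r with (norm y + 1); [lra|].
unfold Rdiv; rewrite Rmult_assoc, Rinv_l; lra.
Qed.

Lemma sg_lipschitz (Tm : R) : exists K, 0 < K /\ forall t a x, 0 < t -> 0 <= a ->
  t + a <= Tm -> norm (minus (S (t + a) x) (S t x)) <= K * a / t * norm x.
Proof.
destruct (sg_deriv Tm) as [K [HK HB]]; exists (2 * K); split; [lra|].
destruct (sg_bounded Tm) as [M [HM HMb]].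
intros t a x Ht Ha Hta; assert (Hx := norm_ge_0 x).
assert (Hex : forall r, exists l : X, t <= r <= t + a ->
  has_deriv_on t (t + a) (fun s => S s x) r l /\ norm l <= K / r * norm x).
{ intros r; destruct (Rle_dec t r) as [Hr|Hr]; [|exists zero; lra].
  destruct (Rle_dec r (t + a)) as [Hr'|Hr']; [|exists zero; lra].
  destruct (HB r ltac:(lra)) as [B [_ [HB2 HB3]]]; exists (B x); intros _; split.
  - assert (H := op_deriv_has_deriv_on r B x t (t + a) r HB3 ltac:(lra) ltac:(lra)).
    rewrite Rminus_diag, sg_0 in H; exact H.
  - apply HB2. }
set (f' := fun r => proj1_sig (constructive_indefinite_description _ (Hex r))).
assert (Hf' : forall r, t <= r <= t + a ->
  has_deriv_on t (t + a) (fun s => S s x) r (f' r) /\ norm (f' r) <= K / r * norm x).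
{ intros r; exact (proj2_sig (constructive_indefinite_description _ (Hex r))). }
assert (HKt : 0 < K / t) by now apply Rdiv_lt_0_compat.
eapply Rle_trans; [apply (mean_value_inequality t (t + a) (fun s => S s x) f' (K / t * norm x))|].
- lra.
- intros r Hr; now apply Hf'.
- intros r Hr; eapply Rle_trans; [now apply Hf'|].
  apply Rmult_le_compat_r; [easy|]; apply Rmult_le_compat_l; [lra|].
  apply Rinv_le_contravar; lra.
- replace (t + a - t) with a by ring.
  replace (2 * K * a / t * norm x) with (K / t * norm x * a + K / t * norm x * a) by (field; lra).
  assert (0 <= K / t * norm x * a); [|lra].
  apply Rmult_le_pos; [|easy]; apply Rmult_le_pos; lra.
Qed.

(** Factoring the derivative through time t/2 gives S'(r) - S'(t) = B (S(r - t/2) - S(t/2)), which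
    is O(c / t^2) for r in [t, t + c]. Hence S(t + c) - S(t) is linear in c up to O(c^2 / t^2). The
    linear parts for a and b cancel, and a^2 + (a/b) b^2 = a (a + b). *)
Lemma sg_second_difference (Tm : R) : exists K, 0 < K /\ forall t a b x,
  0 < t -> 0 <= a -> 0 < b -> t + a <= Tm -> t + b <= Tm ->
  norm (minus (minus (S (t + a) x) (S t x))
    (scal (a / b) (minus (S (t + b) x) (S t x))))
  <= K * (a * (a + b)) / t ^ 2 * norm x.
Proof.
destruct (sg_deriv Tm) as [K1 [HK1 HB]].
destruct (sg_lipschitz Tm) as [K2 [HK2 HL]].
exists (4 * K1 * K2); split; [apply Rmult_lt_0_compat; lra|].
intros t a b x Ht Ha Hb Hta Htb; assert (Hx := norm_ge_0 x).
destruct (HB (t / 2) ltac:(lra)) as [B [HB1 [HB2 HB3]]].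
set (y := B (S (t / 2) x)).
set (K := 4 * K1 * K2 / t ^ 2).
assert (Ht2 : 0 < t ^ 2) by (apply pow_lt; lra).
assert (HK : 0 < K) by (apply Rdiv_lt_0_compat; [apply Rmult_lt_0_compat; lra|easy]).
assert (Hr : forall c, 0 <= c -> t + c <= Tm ->
  norm (minus (minus (S (t + c) x) (S t x)) (scal c y)) <= K * (c * c) * norm x).
{ intros c Hc Htc.
  apply (norm_le_eq (V := X) (minus (minus (S (t + c) x) (scal (t + c) y))
    (minus (S t x) (scal t y)))); [module|].
  replace (K * (c * c) * norm x) with (K * c * norm x * (t + c - t)) by ring.
  apply (mean_value_inequality t (t + c) (fun s => minus (S s x) (scal s y))
    (fun s => minus (B (S (s - t / 2) x)) y)); [lra| |].
  - intros r Hr; apply (has_deriv_on_eq t (t + c) _ r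
      (plus (B (S (r - t / 2) x)) (scal (- (1)) y))); [module|].
    apply (has_deriv_on_ext t (t + c) (fun s => plus (S s x) (scal (- s) y)));
      [lra|intros; module|].
    apply (has_deriv_on_plus (V := X) t (t + c) (fun s => S s x) (fun s => scal (- s) y));
      [apply op_deriv_has_deriv_on; auto; lra|].
    apply is_derive_has_deriv_on, (is_derive_scal_l (K := R_AbsRing) (V := X)).
    auto_derive; [easy|ring].
  - intros r Hr; unfold y.
    apply (norm_le_eq (V := X) (B (minus (S (r - t / 2) x) (S (t / 2) x)))).
    { symmetry; apply (linear_minus B _ _ HB1). }
    eapply Rle_trans; [apply HB2|].
    replace (r - t / 2) with (t / 2 + (r - t)) by field.
    eapply Rle_trans; [apply Rmult_le_compat_l; [apply Rlt_le, Rdiv_lt_0_compat; lra|]|].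
    { apply HL; lra. }
    apply Rle_trans with (K1 / (t / 2) * (K2 * c / (t / 2) * norm x)).
    + apply Rmult_le_compat_l; [apply Rlt_le, Rdiv_lt_0_compat; lra|].
      apply Rmult_le_compat_r; [easy|].
      apply Rmult_le_compat_r; [apply Rlt_le, Rinv_0_lt_compat; lra|].
      apply Rmult_le_compat_l; lra.
    + right; unfold K; field; lra. }
assert (H1 := Hr a Ha Hta); assert (H2 := Hr b ltac:(lra) Htb).
apply (norm_le_eq (V := X) (minus (minus (minus (S (t + a) x) (S t x)) (scal a y))
  (scal (a / b) (minus (minus (S (t + b) x) (S t x)) (scal b y))))).
{ module. }
replace (4 * K1 * K2 * (a * (a + b)) / t ^ 2 * norm x) with
  (K * (a * a) * norm x + (a / b) * (K * (b * b) * norm x)) by (unfold K; field; lra).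
apply (norm_minus_le (V := X)); [exact H1|].
apply (norm_scal_le (V := X)); [|exact H2].
rewrite Rabs_pos_eq; [lra|apply Rdiv_le_0_compat; lra].
Qed.

Lemma sg_right_cont x eps : 0 < eps -> exists d, 0 < d /\
  forall t, 0 <= t < d -> norm (minus (S t x) x) <= eps.
Proof.
intros He; destruct HS as [[_ [H0 [_ Hc]]] _].
destruct (proj1 (filterlim_norm_le (V := X) (at_right 0) (fun t => S t x) x) (Hc x) eps He)
  as [d Hd].
exists d; split; [apply cond_pos|]; intros t Ht.
destruct (Req_dec t 0) as [->|Ht0].
- apply (norm_le_eq (V := X) zero); [rewrite H0; module|].
  eapply Rle_trans; [right; apply (norm_zero (V := X))|lra].
- apply Hd; [|lra]; change (Rabs (t - 0) < d).
  rewrite Rminus_0_r, Rabs_pos_eq; lra.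
Qed.

Lemma sg_cont_on (Tm : R) x : cont_on 0 Tm (fun t => S t x).
Proof.
destruct (sg_bounded Tm) as [M [HM HMb]].
intros t Ht e He.
destruct (sg_right_cont x (e / M)) as [d [Hd H]]; [apply Rdiv_lt_0_compat; lra|].
exists d; split; [easy|]; intros r Hr Hrd.
assert (K : forall a b, 0 <= a <= b -> b <= Tm -> b - a < d ->
  norm (minus (S b x) (S a x)) <= e).
{ intros a b Ha Hb Hab; replace b with (a + (b - a)) by ring.
  rewrite sg_add by lra.
  apply (norm_le_eq (V := X) (S a (minus (S (b - a) x) x))).
  { symmetry; apply (linear_minus (S a)), sg_linear; lra. }
  eapply Rle_trans; [apply HMb; lra|].
  replace e with (M * (e / M)) by (field; lra).
  apply Rmult_le_compat_l; [lra|apply H; lra]. }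
destruct (Rle_dec t r).
- apply K; try lra. rewrite Rabs_pos_eq in Hrd; lra.
- eapply Rle_trans; [right; apply (norm_minus_sym (V := X))|].
  apply K; try lra. rewrite Rabs_left1 in Hrd; lra.
Qed.

(** The generator supplies a right difference quotient at 0, which the semigroup law moves to every
    time with a uniform error. A left quotient at t is a right quotient at r < t, and continuity of
    S (A x) exchanges the base point. *)
Lemma sg_generator_deriv (Tm : R) (D : X -> Prop) (A : X -> X) x t :
  generator S D A -> D x -> 0 <= t <= Tm ->
  has_deriv_on 0 Tm (fun s => S s x) t (S t (A x)).
Proof.
intros HG HD Ht.
assert (Hlim := proj1 (HG x (A x)) (conj HD eq_refl)).
destruct (sg_bounded Tm) as [M [HM HMb]].
apply has_deriv_on_eps; intros e He.
assert (He' : 0 < e / (2 * M)) by (apply Rdiv_lt_0_compat; lra).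
destruct (proj1 (filterlim_norm_le (V := X) (at_right 0) _ _) Hlim _ He') as [d1 Hd1].
destruct (sg_cont_on Tm (A x) t Ht (e / 2) ltac:(lra)) as [d2 [Hd2 H2]].
assert (Hq : forall a b, 0 <= a <= b -> b <= Tm -> b - a < d1 ->
  norm (minus (minus (S b x) (S a x)) (scal (b - a) (S a (A x)))) <= e / 2 * (b - a)).
{ intros a b Ha Hb Hab; destruct (Req_dec a b) as [<-|Hne].
  - apply (norm_le_eq (V := X) zero); [module|].
    eapply Rle_trans; [right; apply (norm_zero (V := X))|lra].
  - assert (Hball : ball 0 d1 (b - a)).
    { change (Rabs (b - a - 0) < d1); rewrite Rminus_0_r, Rabs_pos_eq; lra. }
    specialize (Hd1 (b - a) Hball ltac:(lra)).
    replace (S b x) with (S a (S (b - a) x)) by (rewrite <- sg_add by lra; f_equal; ring).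
    assert (HSa := sg_linear a (proj1 Ha)).
    apply (norm_le_eq (V := X) (scal (b - a) (S a (minus (scal (/ (b - a))
      (minus (S (b - a) x) x)) (A x))))).
    { rewrite (linear_minus _ _ _ HSa), (linear_scal _ HSa), (linear_minus _ _ _ HSa).
      mcoefs; field; lra. }
    replace (e / 2 * (b - a)) with ((b - a) * (M * (e / (2 * M)))) by (field; lra).
    apply (norm_scal_le (V := X)); [rewrite Rabs_pos_eq; lra|].
    eapply Rle_trans; [apply HMb; lra|apply Rmult_le_compat_l; [lra|exact Hd1]]. }
exists (Rmin d1 d2); split; [apply Rmin_glb_lt; [apply cond_pos|easy]|].
intros r Hr Hrd.
assert (Hrd1 := Rlt_le_trans _ _ _ Hrd (Rmin_l _ _)).
assert (Hrd2 := Rlt_le_trans _ _ _ Hrd (Rmin_r _ _)).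
destruct (Rle_dec t r) as [Htr|Htr].
- rewrite Rabs_pos_eq in Hrd1 |- * by lra.
  eapply Rle_trans; [apply Hq; lra|]; apply Rmult_le_compat_r; lra.
- specialize (H2 r Hr Hrd2); rewrite Rabs_left1 in Hrd1 |- * by lra.
  assert (H3 := Hq r t ltac:(lra) ltac:(lra) ltac:(lra)).
  apply (norm_le_eq (V := X) (minus (scal (t - r) (minus (S t (A x)) (S r (A x))))
    (minus (minus (S t x) (S r x)) (scal (t - r) (S r (A x)))))); [module|].
  replace (e * - (r - t)) with ((t - r) * (e / 2) + e / 2 * (t - r)) by field.
  apply (norm_minus_le (V := X)); [|exact H3].
  apply (norm_scal_le (V := X)); [rewrite Rabs_pos_eq; lra|].
  eapply Rle_trans; [right; apply (norm_minus_sym (V := X))|exact H2].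
Qed.

End SemigroupBounds.

(** * The operators phi_k *)

Lemma kern_S k th : kern (S k) th = th ^ k / INR (fact k).
Proof. unfold kern; now replace (S k - 1)%nat with k by lia. Qed.

Lemma kern_bounds k th : 0 <= th <= 1 -> 0 <= kern k th <= 1.
Proof.
intros Hth; unfold kern; set (n := (k - 1)%nat).
assert (Hf : 1 <= INR (fact n)).
{ apply (le_INR 1); pose proof (lt_O_fact n); lia. }
assert (Hp : 0 <= th ^ n <= 1).
{ split; [apply pow_le; lra|]; rewrite <- (pow1 n); apply pow_incr; lra. }
split; [apply Rdiv_le_0_compat; lra|].
apply Rmult_le_reg_r with (INR (fact n)); [lra|].
unfold Rdiv; rewrite Rmult_assoc, Rinv_l by lra; lra.
Qed.

Lemma is_derive_kern k th :
  is_derive (kern (S (S k))) th (kern (S k) th).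
Proof.
rewrite kern_S; eapply is_derive_ext; [intros t; symmetry; apply kern_S|].
apply is_derive_pow_fact.
Qed.

Lemma is_derive_kern_1 th : is_derive (kern 1) th 0.
Proof.
eapply is_derive_ext; [intros t; symmetry; apply kern_S|]; simpl.
apply (is_derive_const (V := R_NormedModule)).
Qed.

Lemma kern_cont_on k a b : cont_on (V := R_NormedModule) a b (kern (S k)).
Proof.
destruct k as [|k].
- apply (is_derive_cont_on _ _ _ (fun _ => 0)); intros t _; apply is_derive_kern_1.
- apply (is_derive_cont_on _ _ _ (kern (S k))); intros t _; apply is_derive_kern.
Qed.

Section PhiOperators.
Context {X : CompleteNormedModule R_AbsRing} (S : R -> X -> X).
Hypothesis HS : analytic_semigroup S.

Lemma sg_cont_on_rev tau x : 0 <= tau -> cont_on 0 1 (fun th => S ((1 - th) * tau) x).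
Proof.
intros Ht.
assert (H := cont_on_affine 0 tau 0 1 (fun s => S s x) (- tau) tau
  ltac:(intros; nra) (sg_cont_on S HS tau x)).
intros t Ht1 e He; destruct (H t Ht1 e He) as [d [Hd H1]]; exists d; split; [easy|].
intros r Hr Hrd; specialize (H1 r Hr Hrd); cbv beta in H1 |- *.
replace ((1 - r) * tau) with (- tau * r + tau) by ring.
replace ((1 - t) * tau) with (- tau * t + tau) by ring; exact H1.
Qed.

Lemma phi_op_is_RInt k tau x : 0 <= tau ->
  is_RInt (fun th => scal (kern (Datatypes.S k) th) (S ((1 - th) * tau) x)) 0 1
    (phi_op S (Datatypes.S k) tau x).
Proof.
intros Ht; apply (RInt_correct (V := X)), ex_RInt_cont_on; [lra|].
apply (cont_on_scal (V := X)); [apply kern_cont_on|now apply sg_cont_on_rev].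
Qed.

Lemma phi_op_plus k tau x y : 0 <= tau ->
  phi_op S k tau (plus x y) = plus (phi_op S k tau x) (phi_op S k tau y).
Proof.
intros Ht; destruct k as [|k]; [apply (linear_plus _ (sg_linear S HS tau Ht))|].
apply (is_RInt_unique (V := X)).
apply (is_RInt_ext (V := X) (fun th => plus
  (scal (kern (Datatypes.S k) th) (S ((1 - th) * tau) x))
  (scal (kern (Datatypes.S k) th) (S ((1 - th) * tau) y)))).
- rewrite Rmin_left, Rmax_right by lra; intros th Hth.
  rewrite (linear_plus (S ((1 - th) * tau))) by (apply sg_linear; [easy|nra]).
  module.
- apply (is_RInt_plus (V := X)); now apply phi_op_is_RInt.
Qed.

Lemma phi_op_scal k tau (a : R) x : 0 <= tau ->
  phi_op S k tau (scal a x) = scal a (phi_op S k tau x).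
Proof.
intros Ht; destruct k as [|k]; [apply (linear_scal _ (sg_linear S HS tau Ht))|].
apply (is_RInt_unique (V := X)).
apply (is_RInt_ext (V := X) (fun th => scal a
  (scal (kern (Datatypes.S k) th) (S ((1 - th) * tau) x)))).
- rewrite Rmin_left, Rmax_right by lra; intros th Hth.
  rewrite (linear_scal (S ((1 - th) * tau))) by (apply sg_linear; [easy|nra]).
  module.
- apply (is_RInt_scal (V := X)); now apply phi_op_is_RInt.
Qed.

Lemma phi_op_norm (Tm M : R) : 0 <= M ->
  (forall t x, 0 <= t <= Tm -> norm (S t x) <= M * norm x) ->
  forall k tau x, 0 <= tau <= Tm -> norm (phi_op S k tau x) <= M * norm x.
Proof.
intros HM0 HM k tau x Ht; destruct k as [|k]; [now apply HM|].
replace (M * norm x) with ((1 - 0) * (M * norm x)) by ring.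
apply (norm_RInt_le_const _ 0 1 _ _ ltac:(lra)) with (2 := phi_op_is_RInt k tau x (proj1 Ht)).
intros th Hth; rewrite <- (Rmult_1_l (M * norm x)).
apply (norm_scal_le (V := X)).
- destruct (kern_bounds (Datatypes.S k) th Hth); apply Rabs_le; lra.
- apply HM; nra.
Qed.

Lemma phi_op_linear k tau : 0 <= tau -> is_linear (phi_op S k tau).
Proof.
intros Ht; split; [intros; now apply phi_op_plus|intros; now apply phi_op_scal|].
destruct (sg_bounded S HS tau) as [M [HM HMb]]; exists M; split; [lra|].
intros x; apply (phi_op_norm tau); auto; lra.
Qed.

Lemma phi_op_at_0 k x : phi_op S k 0 x = scal (/ INR (fact k)) x.
Proof.
destruct k as [|k].
- simpl; rewrite (sg_0 S HS); module.
- apply (is_RInt_unique (V := X)).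
  assert (H : is_RInt (fun th => scal (kern (Datatypes.S k) th) x) 0 1
    (minus (scal (kern (Datatypes.S (Datatypes.S k)) 1) x)
           (scal (kern (Datatypes.S (Datatypes.S k)) 0) x))).
  { apply (ftc_on 0 1 (fun th => scal (kern (Datatypes.S (Datatypes.S k)) th) x)
      (fun th => scal (kern (Datatypes.S k) th) x)); [lra| |].
    - intros t _; apply is_derive_has_deriv_on.
      apply (is_derive_scal_l (K := R_AbsRing) (V := X)), is_derive_kern.
    - apply (cont_on_scal (V := X) 0 1 (kern (Datatypes.S k)) (fun _ => x));
        [apply kern_cont_on|].
      intros t _ e He; exists 1; split; [lra|]; intros r _ _.
      apply (norm_le_eq (V := X) zero); [module|].
      eapply Rle_trans; [right; apply (norm_zero (V := X))|lra]. }
  apply (is_RInt_ext (V := X) (fun th => scal (kern (Datatypes.S k) th) x)).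
  { intros th _; rewrite Rmult_0_r, (sg_0 S HS); reflexivity. }
  refine (eq_ind _ (is_RInt _ 0 1) H _ _).
  rewrite !kern_S, pow1, pow_i by lia; module.
Qed.

(** [integrated_generator x y] is the integrated form of [A x = y]: it is
    phi_k(tau A) x - tau phi_(k+1)(tau A) y = phi_k(0) x. *)
Definition integrated_generator (x y : X) : Prop := forall k tau, 0 <= tau ->
  phi_op S k tau x =
  plus (scal (/ INR (fact k)) x) (scal tau (phi_op S (Datatypes.S k) tau y)).

(** Integration by parts: each kernel is the derivative of the next one, and differentiating S((1 -
    th) tau) x produces the factor - tau and [A x]. For k = 0 it is the fundamental theorem along
    the orbit. *)
Lemma generator_integrated (D : X -> Prop) (A : X -> X) x :
  generator S D A -> D x -> integrated_generator x (A x).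
Proof.
intros HG HD k tau Ht.
assert (Hd : forall th, 0 <= th <= 1 ->
  has_deriv_on 0 1 (fun r => S ((1 - r) * tau) x) th
    (scal (- tau) (S ((1 - th) * tau) (A x)))).
{ intros th Hth.
  apply (has_deriv_on_ext 0 1 (fun r => S (- tau * r + tau) x));
    [easy|intros r _; f_equal; ring|].
  replace ((1 - th) * tau) with (- tau * th + tau) by ring.
  apply (has_deriv_on_affine (V := X) 0 tau 0 1 (fun s => S s x)); [intros; nra|].
  apply (sg_generator_deriv S HS tau D); [easy|easy|nra]. }
assert (Hc := sg_cont_on_rev tau (A x) Ht).
assert (HJ := is_RInt_scal _ _ _ (- tau) _ (phi_op_is_RInt k tau (A x) Ht)).
destruct k as [|k].
- assert (H : is_RInt (fun th => scal (- tau) (S ((1 - th) * tau) (A x))) 0 1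
    (minus (S ((1 - 1) * tau) x) (S ((1 - 0) * tau) x))).
  { apply (ftc_on 0 1 (fun r => S ((1 - r) * tau) x)); [lra|exact Hd|].
    apply (cont_on_scal (V := X) 0 1 (fun _ => - tau)); [|exact Hc].
    apply (is_derive_cont_on (V := R_NormedModule) _ _ _ (fun _ => 0)).
    intros t _; apply (is_derive_const (V := R_NormedModule)). }
  assert (E := is_RInt_unique _ _ _ _ H).
  assert (E' : RInt (fun th => scal (- tau) (S ((1 - th) * tau) (A x))) 0 1 =
    scal (- tau) (phi_op S 1 tau (A x))).
  { apply (is_RInt_unique (V := X)).
    apply (is_RInt_ext (V := X)) with (2 := HJ).
    intros th _; rewrite kern_S; simpl; module. }
  rewrite E' in E; rewrite Rminus_diag, Rmult_0_l, (sg_0 S HS), Rminus_0_r, Rmult_1_l in E.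
  change (phi_op S 0 tau x) with (S tau x).
  apply minus_eq.
  refine (eq_trans (f_equal norm (_ : _ = minus (scal (- tau) (phi_op S 1 tau (A x)))
    (minus x (S tau x)))) _); [simpl fact; simpl INR; module|].
  rewrite E; refine (eq_trans (f_equal norm _) (norm_zero (V := X))); module.
- assert (HJ2 := is_RInt_scal _ _ _ (- tau) _
    (phi_op_is_RInt (Datatypes.S k) tau (A x) Ht)).
  assert (H : is_RInt (fun th => plus
      (scal (kern (Datatypes.S k) th) (S ((1 - th) * tau) x))
      (scal (kern (Datatypes.S (Datatypes.S k)) th)
        (scal (- tau) (S ((1 - th) * tau) (A x))))) 0 1
    (minus (scal (kern (Datatypes.S (Datatypes.S k)) 1) (S ((1 - 1) * tau) x))
           (scal (kern (Datatypes.S (Datatypes.S k)) 0) (S ((1 - 0) * tau) x)))).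
  { apply (ftc_on 0 1 (fun r => scal (kern (Datatypes.S (Datatypes.S k)) r)
      (S ((1 - r) * tau) x))); [lra| |].
    - intros th Hth; apply (has_deriv_on_mult (V := X)); [|now apply Hd].
      apply (is_derive_has_deriv_on (V := R_NormedModule)), is_derive_kern.
    - assert (K1 := cont_on_scal 0 1 _ _ (kern_cont_on k 0 1) (sg_cont_on_rev tau x Ht)).
      assert (K2 := cont_on_scal 0 1 _ _ (kern_cont_on (Datatypes.S k) 0 1) Hc).
      assert (K3 : cont_on (V := R_NormedModule) 0 1 (fun _ => - tau)).
      { apply (is_derive_cont_on (V := R_NormedModule) _ _ _ (fun _ => 0)).
        intros t _; apply (is_derive_const (V := R_NormedModule)). }
      assert (K4 := cont_on_scal 0 1 _ _ K3 K2).
      intros t Ht1 e He.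
      destruct (K1 t Ht1 (e / 2)) as [d1 [Hd1 L1]]; [lra|].
      destruct (K4 t Ht1 (e / 2)) as [d2 [Hd2 L2]]; [lra|].
      exists (Rmin d1 d2); split; [now apply Rmin_glb_lt|]; intros s Hs Hsd.
      specialize (L1 s Hs (Rlt_le_trans _ _ _ Hsd (Rmin_l _ _))).
      specialize (L2 s Hs (Rlt_le_trans _ _ _ Hsd (Rmin_r _ _))).
      replace e with (e / 2 + e / 2) by field.
      eapply (norm_le_eq (V := X)); [|apply (norm_plus_le (V := X)); [exact L1|exact L2]].
      module. }
  assert (K := is_RInt_plus _ _ _ _ _ _ (phi_op_is_RInt k tau x Ht) HJ2).
  assert (E : plus (phi_op S (Datatypes.S k) tau x)
      (scal (- tau) (phi_op S (Datatypes.S (Datatypes.S k)) tau (A x))) =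
    minus (scal (kern (Datatypes.S (Datatypes.S k)) 1) (S ((1 - 1) * tau) x))
           (scal (kern (Datatypes.S (Datatypes.S k)) 0) (S ((1 - 0) * tau) x))).
  { rewrite <- (is_RInt_unique _ _ _ _ H); symmetry; apply (is_RInt_unique (V := X)).
    apply (is_RInt_ext (V := X)) with (2 := K); intros th _; module. }
  rewrite !kern_S, pow1, pow_i, Rminus_diag, Rmult_0_l, (sg_0 S HS) in E by lia.
  apply minus_eq.
  refine (eq_trans (f_equal norm (_ : _ = minus (plus (phi_op S (Datatypes.S k) tau x)
      (scal (- tau) (phi_op S (Datatypes.S (Datatypes.S k)) tau (A x))))
     (scal (/ INR (fact (Datatypes.S k))) x))) _); [module|].
  rewrite E; refine (eq_trans (f_equal norm _) (norm_zero (V := X))); module.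
Qed.

Lemma integrated_generator_lincomb x y x' y' (a : R) :
  integrated_generator x y -> integrated_generator x' y' ->
  integrated_generator (plus x (scal a x')) (plus y (scal a y')).
Proof.
intros H H' k tau Ht; rewrite !phi_op_plus, !phi_op_scal by easy.
rewrite (H k tau Ht), (H' k tau Ht); module.
Qed.

(** Only bounded operators occur in the relation, so it passes to limits of pairs. It plays the part
    that closedness would play for [A] itself. *)
Lemma integrated_generator_closed x y :
  (forall eps, 0 < eps -> exists x' y', integrated_generator x' y' /\
     norm (minus x' x) <= eps /\ norm (minus y' y) <= eps) ->
  integrated_generator x y.
Proof.
intros H k tau Ht.
destruct (sg_bounded S HS tau) as [M [HM HMb]].
apply norm_small_eq; intros e He.
assert (Hf : 1 <= INR (fact k)).
{ apply (le_INR 1); pose proof (lt_O_fact k); lia. }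
assert (Hfi : 0 < / INR (fact k) <= 1).
{ split; [apply Rinv_0_lt_compat; lra|]; rewrite <- Rinv_1; apply Rinv_le_contravar; lra. }
set (c := M + 1 + tau * M).
assert (HtM : 0 <= tau * M) by (apply Rmult_le_pos; lra).
assert (Hc : 0 < c) by (unfold c; lra).
destruct (H (e / c)) as [x' [y' [HG [Hx Hy]]]]; [now apply Rdiv_lt_0_compat|].
assert (E := HG k tau Ht).
assert (Hec : 0 < e / c) by now apply Rdiv_lt_0_compat.
assert (L := phi_op_linear k tau Ht).
assert (L' := phi_op_linear (Datatypes.S k) tau Ht).
apply (norm_le_eq (V := X) (plus (opp (phi_op S k tau (minus x' x)))
  (plus (scal (/ INR (fact k)) (minus x' x))
   (scal tau (phi_op S (Datatypes.S k) tau (minus y' y)))))).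
{ rewrite (linear_minus _ _ _ L), (linear_minus _ _ _ L'), E; module. }
replace e with (M * (e / c) + (1 * (e / c) + tau * (M * (e / c)))) by (unfold c in *; field; lra).
apply (norm_plus_le (V := X)); [|apply (norm_plus_le (V := X))].
- eapply Rle_trans; [right; apply (norm_opp (V := X))|].
  eapply Rle_trans; [apply (phi_op_norm tau M); auto; lra|].
  apply Rmult_le_compat_l; [lra|exact Hx].
- apply (norm_scal_le (V := X)); [rewrite Rabs_pos_eq; lra|exact Hx].
- apply (norm_scal_le (V := X)); [rewrite Rabs_pos_eq; lra|].
  eapply Rle_trans; [apply (phi_op_norm tau M); auto; lra|].
  apply Rmult_le_compat_l; [lra|exact Hy].
Qed.

Lemma coef_op_linear f h : admissible f -> 0 <= h -> is_linear (coef_op S f h).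
Proof.
intros Hf Hh; induction f as [|q f IH];
  [exact (is_linear_zero (U := X) (V := X))|].
assert (Hq : 0 <= tscale q * h).
{ apply Rmult_le_pos; [apply Hf; simpl; auto|easy]. }
apply (is_linear_comp (fun x => (scal (twt q) (phi_op S (tidx q) (tscale q * h) x),
  coef_op S f h x)) (fun w => plus (fst w) (snd w))); [|apply is_linear_plus].
apply is_linear_prod; [|apply IH; intros q' Hq'; apply Hf; simpl; auto].
apply (is_linear_comp (phi_op S (tidx q) (tscale q * h)) (fun x => scal (twt q) x)).
- now apply phi_op_linear.
- exact (is_linear_scal_r (K := R_AbsRing) (V := X) (twt q) Rmult_comm).
Qed.

Lemma coef_op_bounded f (Hm : R) : admissible f -> exists C, 0 < C /\
  forall h x, 0 <= h <= Hm -> norm (coef_op S f h x) <= C * norm x.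
Proof.
intros Hf; induction f as [|q f IH]; simpl.
- exists 1; split; [lra|]; intros h x _.
  eapply Rle_trans; [right; apply (norm_zero (V := X))|].
  pose proof (norm_ge_0 x); lra.
- destruct IH as [C [HC HCb]]; [intros q' Hq'; apply Hf; simpl; auto|].
  assert (Hq : 0 <= tscale q) by (apply Hf; simpl; auto).
  destruct (sg_bounded S HS (tscale q * Hm)) as [M [HM HMb]].
  exists (Rabs (twt q) * M + C); split.
  { assert (0 <= Rabs (twt q) * M); [apply Rmult_le_pos; [apply Rabs_pos|lra]|lra]. }
  intros h x Hh; rewrite Rmult_plus_distr_r, Rmult_assoc.
  apply (norm_plus_le (V := X)); [|now apply HCb].
  apply (norm_scal_le (V := X)); [apply Rle_refl|].
  apply (phi_op_norm (tscale q * Hm)); auto; [lra|]; split.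
  + apply Rmult_le_pos; lra.
  + apply Rmult_le_compat_l; lra.
Qed.

End PhiOperators.

(** * Linear independence of the functions phi_k(lambda z) *)

Lemma phi_is_RInt k z :
  is_RInt (fun th => exp ((1 - th) * z) * kern (S k) th) 0 1 (phi (S k) z).
Proof.
apply (RInt_correct (V := R_CompleteNormedModule)).
apply (ex_RInt_cont_on (V := R_CompleteNormedModule)); [lra|].
apply (cont_on_scal (V := R_NormedModule) 0 1 (fun th => exp ((1 - th) * z)));
  [|apply kern_cont_on].
apply (is_derive_cont_on (V := R_NormedModule) _ _ _ (fun th => - z * exp ((1 - th) * z))).
intros t _; auto_derive; [easy|unfold Rminus; ring].
Qed.

Lemma phi_recurrence k z : z * phi (S k) z = phi k z - / INR (fact k).
Proof.
assert (Hexp : forall t, is_derive (fun th => exp ((1 - th) * z)) t (- z * exp ((1 - t) * z))).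
{ intros t; auto_derive; [easy|unfold Rminus; ring]. }
assert (Hc : cont_on (V := R_NormedModule) 0 1 (fun th => exp ((1 - th) * z))).
{ apply (is_derive_cont_on (V := R_NormedModule) _ _ _ (fun th => - z * exp ((1 - th) * z))).
  intros t _; apply Hexp. }
assert (HI := is_RInt_scal _ _ _ (- z) _ (phi_is_RInt k z)).
destruct k as [|k].
- assert (H : is_RInt (fun th => - z * exp ((1 - th) * z)) 0 1
    (exp ((1 - 1) * z) - exp ((1 - 0) * z))).
  { apply (ftc_on (V := R_CompleteNormedModule) 0 1 (fun th => exp ((1 - th) * z))); [lra| |].
    - intros t _; apply (is_derive_has_deriv_on (V := R_NormedModule)), Hexp.
    - apply (cont_on_scal (V := R_NormedModule) 0 1 (fun _ => - z)); [|exact Hc].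
      apply (is_derive_cont_on (V := R_NormedModule) _ _ _ (fun _ => 0)).
      intros t _; apply (is_derive_const (V := R_NormedModule)). }
  assert (E : RInt (fun th => - z * exp ((1 - th) * z)) 0 1 = - z * phi 1 z).
  { apply (is_RInt_unique (V := R_CompleteNormedModule)).
    apply (is_RInt_ext (V := R_NormedModule)) with (2 := HI).
    intros th _; rewrite kern_S; simpl.
    change (- z * (exp ((1 - th) * z) * (1 / 1)) = - z * exp ((1 - th) * z)); field. }
  rewrite (is_RInt_unique _ _ _ _ H) in E.
  rewrite Rminus_diag, Rmult_0_l, Rminus_0_r, Rmult_1_l, exp_0 in E.
  change (phi 0 z) with (exp z); simpl fact; simpl INR; lra.
- assert (H : is_RInt (fun th => exp ((1 - th) * z) * kern (S k) th +
     - z * (exp ((1 - th) * z) * kern (S (S k)) th)) 0 1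
    (exp ((1 - 1) * z) * kern (S (S k)) 1 - exp ((1 - 0) * z) * kern (S (S k)) 0)).
  { apply (ftc_on (V := R_CompleteNormedModule) 0 1
      (fun th => exp ((1 - th) * z) * kern (S (S k)) th)); [lra| |].
    - intros t _; apply (is_derive_has_deriv_on (V := R_NormedModule)).
      replace (exp ((1 - t) * z) * kern (S k) t + - z * (exp ((1 - t) * z) * kern (S (S k)) t))
        with (- z * exp ((1 - t) * z) * kern (S (S k)) t + exp ((1 - t) * z) * kern (S k) t)
        by ring.
      apply (is_derive_mult (fun th => exp ((1 - th) * z)) (kern (S (S k))));
        [apply Hexp|apply is_derive_kern|apply Rmult_comm].
    - assert (K1 := cont_on_scal (V := R_NormedModule) 0 1 _ _ Hc (kern_cont_on k 0 1)).
      assert (K2 := cont_on_scal (V := R_NormedModule) 0 1 _ _ Hc (kern_cont_on (S k) 0 1)).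
      intros t Ht e He.
      assert (Hz := Rabs_pos z).
      destruct (K1 t Ht (e / 2)) as [d1 [Hd1 L1]]; [lra|].
      destruct (K2 t Ht (e / (2 * (Rabs z + 1)))) as [d2 [Hd2 L2]];
        [apply Rdiv_lt_0_compat; lra|].
      exists (Rmin d1 d2); split; [now apply Rmin_glb_lt|]; intros s Hs Hsd.
      specialize (L1 s Hs (Rlt_le_trans _ _ _ Hsd (Rmin_l _ _))).
      specialize (L2 s Hs (Rlt_le_trans _ _ _ Hsd (Rmin_r _ _))).
      apply Rle_trans with (e / 2 + Rabs (- z) * (e / (2 * (Rabs z + 1)))).
      + eapply (norm_le_eq (V := R_NormedModule)); [|apply (norm_plus_le (V := R_NormedModule));
          [exact L1|apply (norm_scal_le (V := R_NormedModule)); [apply Rle_refl|exact L2]]].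
        change (exp ((1 - s) * z) * kern (S k) s +
     - z * (exp ((1 - s) * z) * kern (S (S k)) s) - (exp ((1 - t) * z) * kern (S k) t +
     - z * (exp ((1 - t) * z) * kern (S (S k)) t)) =
     (exp ((1 - s) * z) * kern (S k) s - exp ((1 - t) * z) * kern (S k) t) +
     - z * (exp ((1 - s) * z) * kern (S (S k)) s - exp ((1 - t) * z) * kern (S (S k)) t)).
        ring.
      + rewrite Rabs_Ropp.
        replace e with (e / 2 + (Rabs z + 1) * (e / (2 * (Rabs z + 1)))) at 3 by (field; lra).
        apply Rplus_le_compat_l, Rmult_le_compat_r; [apply Rlt_le, Rdiv_lt_0_compat|]; lra. }
  assert (K := is_RInt_plus _ _ _ _ _ _ (phi_is_RInt k z) HI).
  assert (E : phi (S k) z + - z * phi (S (S k)) z =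
    exp ((1 - 1) * z) * kern (S (S k)) 1 - exp ((1 - 0) * z) * kern (S (S k)) 0).
  { rewrite <- (is_RInt_unique _ _ _ _ H); symmetry.
    apply (is_RInt_unique (V := R_CompleteNormedModule)); exact K. }
  rewrite !kern_S, pow1, pow_i, Rminus_diag, Rmult_0_l, exp_0 in E by lia.
  unfold Rdiv in E; lra.
Qed.

Lemma phi_bounds k z : 0 <= z -> 0 <= phi k z <= exp z.
Proof.
intros Hz; destruct k as [|k].
- change (phi 0 z) with (exp z); pose proof (exp_pos z); lra.
- assert (Hb : forall th, 0 <= th <= 1 -> 0 <= exp ((1 - th) * z) * kern (S k) th <= exp z).
  { intros th Hth; destruct (kern_bounds (S k) th Hth) as [K1 K2].
    assert (He := exp_pos ((1 - th) * z)).
    split; [apply Rmult_le_pos; lra|].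
    rewrite <- (Rmult_1_r (exp z)); apply Rmult_le_compat; try lra.
    destruct (Req_dec ((1 - th) * z) z) as [->|Hne]; [lra|].
    apply Rlt_le, exp_increasing; nra. }
  split.
  + rewrite <- (Rmult_0_r (1 - 0)).
    apply (is_RInt_le (fun _ => 0) (fun th => exp ((1 - th) * z) * kern (S k) th) 0 1);
      [lra|apply (is_RInt_const (V := R_NormedModule))|apply phi_is_RInt|].
    intros th Hth; apply Hb; lra.
  + rewrite <- (Rmult_1_l (exp z)), <- (Rminus_0_r 1) at 1.
    apply (is_RInt_le (fun th => exp ((1 - th) * z) * kern (S k) th) (fun _ => exp z) 0 1);
      [lra|apply phi_is_RInt|apply (is_RInt_const (V := R_NormedModule))|].
    intros th Hth; apply Hb; lra.
Qed.

Lemma phi_at_0 k : phi k 0 = / INR (fact k).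
Proof. pose proof (phi_recurrence k 0); lra. Qed.

(** From exp x >= x at x = z/(n+1), raised to the power n + 1; the one spare factor z absorbs the
    constants. *)
Lemma exp_beats_pow n K : exists Z, 0 < Z /\ forall z, Z <= z -> K * z ^ n <= exp z.
Proof.
assert (Hn : 0 < INR (S n)) by (apply lt_0_INR; lia).
assert (He : forall m x, exp (INR m * x) = exp x ^ m).
{ intros m x; induction m as [|m IH]; [simpl; rewrite Rmult_0_l; apply exp_0|].
  rewrite S_INR, Rmult_plus_distr_r, Rmult_1_l, exp_plus, IH; simpl; ring. }
exists (Rabs K * INR (S n) ^ S n + 1).
assert (Hp : 0 <= Rabs K * INR (S n) ^ S n).
{ apply Rmult_le_pos; [apply Rabs_pos|apply pow_le; lra]. }
split; [lra|]; intros z Hz.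
assert (Hzn : 0 <= z ^ n) by (apply pow_le; lra).
replace (exp z) with (exp (INR (S n) * (z / INR (S n)))) by (f_equal; field; lra).
rewrite He; apply Rle_trans with ((z / INR (S n)) ^ S n).
- unfold Rdiv; rewrite Rpow_mult_distr, pow_inv by lra.
  apply Rle_trans with (Rabs K * z ^ n); [apply Rmult_le_compat_r; [easy|apply Rle_abs]|].
  assert (Hpp : 0 < INR (S n) ^ S n) by (apply pow_lt; lra).
  apply Rmult_le_reg_r with (INR (S n) ^ S n); [easy|].
  rewrite (Rmult_assoc (z ^ S n)), Rinv_l, Rmult_1_r by lra.
  change (z ^ S n) with (z * z ^ n).
  replace (Rabs K * z ^ n * INR (S n) ^ S n) with ((Rabs K * INR (S n) ^ S n) * z ^ n) by ring.
  apply Rmult_le_compat_r; lra.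
- apply pow_incr; split; [apply Rdiv_le_0_compat; lra|].
  pose proof (exp_ineq1_le (z / INR (S n))); lra.
Qed.

(** By the recurrence, z^k phi_k(z) differs from exp z only by a polynomial, whose absorption halves
    the constant at each index. *)
Lemma phi_lower k : exists c Z, 0 < c /\ 0 < Z /\
  forall z, Z <= z -> c * exp z <= z ^ k * phi k z.
Proof.
induction k as [|k [c [Z [Hc [HZ H]]]]].
- exists 1, 1; split; [lra|split; [lra|]]; intros z _; simpl; lra.
- destruct (exp_beats_pow k (2 / c)) as [Z' [HZ' H']].
  exists (c / 2), (Rmax Z Z'); split; [lra|split].
  + eapply Rlt_le_trans; [exact HZ|apply Rmax_l].
  + intros z Hz.
    assert (Hz1 := Rle_trans _ _ _ (Rmax_l Z Z') Hz).
    assert (Hz2 := Rle_trans _ _ _ (Rmax_r Z Z') Hz).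
    specialize (H z Hz1); specialize (H' z Hz2).
    change (z ^ S k) with (z * z ^ k).
    replace (z * z ^ k * phi (S k) z) with (z ^ k * (z * phi (S k) z)) by ring.
    rewrite phi_recurrence.
    assert (Hzk : 0 <= z ^ k) by (apply pow_le; lra).
    assert (Hf : 1 <= INR (fact k)).
    { apply (le_INR 1); pose proof (lt_O_fact k); lia. }
    assert (Hfi : / INR (fact k) <= 1).
    { rewrite <- Rinv_1; apply Rinv_le_contravar; lra. }
    assert (z ^ k * / INR (fact k) <= z ^ k * 1) by (apply Rmult_le_compat_l; lra).
    apply (Rmult_le_compat_l (c / 2)) in H'; [|lra].
    replace (c / 2 * (2 / c * z ^ k)) with (z ^ k) in H' by (field; lra).
    lra.
Qed.

Lemma phi_pos k : exists Z, 0 < Z /\ forall z, Z <= z -> 0 < phi k z.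
Proof.
destruct (phi_lower k) as [c [Z [Hc [HZ H]]]]; exists Z; split; [easy|]; intros z Hz.
specialize (H z Hz); assert (He := exp_pos z).
assert (Hzk : 0 < z ^ k) by (apply pow_lt; lra).
apply Rmult_lt_reg_l with (z ^ k); [easy|].
rewrite Rmult_0_r; eapply Rlt_le_trans; [|exact H]; now apply Rmult_lt_0_compat.
Qed.

Lemma phi_decreasing k n z : 1 <= z -> phi (S n + k) z * z <= phi k z.
Proof.
intros Hz.
assert (Hstep : forall j, z * phi (S j) z <= phi j z).
{ intros j; rewrite phi_recurrence.
  assert (0 < / INR (fact j)) by (apply Rinv_0_lt_compat, INR_fact_lt_0); lra. }
induction n as [|n IH]; [rewrite Rmult_comm; apply Hstep|].
eapply Rle_trans; [|exact IH]; apply Rmult_le_compat_r; [lra|].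
specialize (Hstep (S n + k)%nat); destruct (phi_bounds (S (S n) + k) z) as [K _]; [lra|].
simpl in *; nra.
Qed.

(** At infinity phi_k(lambda z) behaves like e^(lambda z) / (lambda z)^k, so growth is ordered
    lexicographically: by the larger scaling, then by the smaller index. *)
Lemma phi_dominated k lam k0 lam0 eps :
  0 <= lam -> 0 < lam0 -> 0 < eps -> lam < lam0 \/ lam = lam0 /\ (k0 < k)%nat ->
  exists Z, 0 < Z /\ forall z, Z <= z -> phi k (lam * z) <= eps * phi k0 (lam0 * z).
Proof.
intros Hl Hl0 He [Hlt|[-> Hk]].
- destruct (phi_lower k0) as [c [Z [Hc [HZ H]]]].
  set (m := lam0 - lam).
  assert (Hm : 0 < m) by (unfold m; lra).
  set (K := (lam0 / m) ^ k0 / (eps * c)).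
  destruct (exp_beats_pow k0 K) as [Z' [HZ' H']].
  assert (Hec : 0 < eps * c) by now apply Rmult_lt_0_compat.
  exists (Z / lam0 + Z' / m).
  assert (HZl : 0 < Z / lam0) by now apply Rdiv_lt_0_compat.
  assert (HZm : 0 < Z' / m) by now apply Rdiv_lt_0_compat.
  split; [lra|]; intros z Hz.
  assert (Hz1 : Z <= lam0 * z).
  { apply Rle_trans with (lam0 * (Z / lam0)); [right; field; lra|].
    apply Rmult_le_compat_l; lra. }
  assert (Hz2 : Z' <= m * z).
  { apply Rle_trans with (m * (Z' / m)); [right; field; lra|].
    apply Rmult_le_compat_l; lra. }
  specialize (H _ Hz1); specialize (H' _ Hz2).
  assert (Hp : 0 < (lam0 * z) ^ k0) by (apply pow_lt; lra).
  eapply Rle_trans; [apply phi_bounds; apply Rmult_le_pos; lra|].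
  apply Rmult_le_reg_l with ((lam0 * z) ^ k0); [easy|].
  apply Rle_trans with (eps * (c * exp (lam0 * z))); [|].
  2:{ replace ((lam0 * z) ^ k0 * (eps * phi k0 (lam0 * z))) with
        (eps * ((lam0 * z) ^ k0 * phi k0 (lam0 * z))) by ring.
      apply Rmult_le_compat_l; lra. }
  replace (lam0 * z) with (m * z + lam * z) at 2 by (unfold m; ring).
  rewrite exp_plus, <- Rmult_assoc, <- Rmult_assoc; apply Rmult_le_compat_r;
    [apply Rlt_le, exp_pos|].
  apply (Rmult_le_compat_l (eps * c)) in H'; [|lra].
  eapply Rle_trans; [right|exact H']; unfold K.
  replace ((lam0 * z) ^ k0) with ((lam0 / m) ^ k0 * (m * z) ^ k0).
  + field; lra.
  + rewrite <- Rpow_mult_distr; f_equal; field; lra.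
- exists ((1 + / eps) / lam0).
  assert (Hei : 0 < / eps) by now apply Rinv_0_lt_compat.
  split; [apply Rdiv_lt_0_compat; lra|]; intros z Hz.
  assert (Hz1 : 1 + / eps <= lam0 * z).
  { apply Rle_trans with (lam0 * ((1 + / eps) / lam0)); [right; field; lra|].
    apply Rmult_le_compat_l; lra. }
  assert (D := phi_decreasing k0 (k - S k0) (lam0 * z) ltac:(lra)).
  replace (S (k - S k0) + k0)%nat with k in D by lia.
  destruct (phi_bounds k (lam0 * z) ltac:(lra)) as [K _].
  apply Rmult_le_reg_l with (/ eps); [easy|].
  rewrite <- Rmult_assoc, Rinv_l, Rmult_1_l by lra.
  eapply Rle_trans; [|exact D].
  rewrite Rmult_comm; apply Rmult_le_compat_l; lra.
Qed.

Section Independence.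
Context {X Y : NormedModule R_AbsRing} {I : Type}
  (k : I -> nat) (lam : I -> R) (v : I -> X).

Lemma dominant_term (l : list I) : l <> nil -> exists i0, In i0 l /\
  forall i, In i l -> lam i < lam i0 \/ lam i = lam i0 /\ (k i0 <= k i)%nat.
Proof.
induction l as [|j l IH]; intros Hl; [easy|].
destruct l as [|j' l].
{ exists j; split; [now left|]; intros i [<-|[]]; right; auto. }
destruct IH as [i0 [Hi0 Hmax]]; [easy|].
destruct (Rtotal_order (lam j) (lam i0)) as [H|[H|H]].
- exists i0; split; [now right|]; intros i [<-|Hi]; [now left|now apply Hmax].
- destruct (Nat.le_gt_cases (k i0) (k j)) as [Hk|Hk].
  + exists i0; split; [now right|]; intros i [<-|Hi]; [now right|now apply Hmax].
  + exists j; split; [now left|]; intros i [<-|Hi]; [right; auto|].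
    destruct (Hmax i Hi) as [H'|[H1 H2]]; [left; lra|right; split; [lra|lia]].
- exists j; split; [now left|]; intros i [<-|Hi]; [right; auto|].
  destruct (Hmax i Hi) as [H'|[H1 H2]]; left; lra.
Qed.

Definition same_term (i0 i : I) : bool :=
  if Req_EM_T (lam i) (lam i0) then Nat.eqb (k i) (k i0) else false.

Lemma same_term_spec i0 i :
  same_term i0 i = true <-> lam i = lam i0 /\ k i = k i0.
Proof.
unfold same_term; destruct (Req_EM_T (lam i) (lam i0)) as [E|E].
- rewrite Nat.eqb_eq; tauto.
- split; [easy|tauto].
Qed.

Lemma vsum_same_term {W : NormedModule R_AbsRing} i0 (l : list I)
  (G : nat -> R -> X -> W) :
  (forall x y, G (k i0) (lam i0) (plus x y) =
     plus (G (k i0) (lam i0) x) (G (k i0) (lam i0) y)) ->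
  G (k i0) (lam i0) zero = zero ->
  vsum (filter (same_term i0) l) (fun i => G (k i) (lam i) (v i)) =
  G (k i0) (lam i0) (vsum (filter (same_term i0) l) v).
Proof.
intros HG H0; rewrite (vsum_linear (G (k i0) (lam i0))) by easy.
apply vsum_ext; intros i Hi; apply filter_In in Hi; destruct Hi as [_ Hi].
apply same_term_spec in Hi; destruct Hi as [-> ->]; easy.
Qed.

(** As z grows, the fastest growing function dominates all others, so the vectors attached to it
    must add up to zero. Removing this group shortens the list, and the argument repeats until only
    scaling 0 is left. *)
Lemma phi_independent (Phi : nat -> R -> X -> Y) :
  (forall j mu x y, Phi j mu (plus x y) = plus (Phi j mu x) (Phi j mu y)) ->
  (forall j mu a x, Phi j mu (scal a x) = scal a (Phi j mu x)) ->
  (forall j x, Phi j 0 x = scal (/ INR (fact j)) (Phi 0%nat 0 x)) ->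
  forall l : list I, (forall i, In i l -> 0 <= lam i) ->
  (forall z, 0 <= z -> vsum l (fun i => scal (phi (k i) (lam i * z)) (v i)) = zero) ->
  vsum l (fun i => Phi (k i) (lam i) (v i)) = zero.
Proof.
intros Hp Hs H0.
assert (Hz : forall j mu, Phi j mu zero = zero).
{ intros j mu; transitivity (Phi j mu (scal 0 zero)).
  - f_equal; module.
  - rewrite Hs; module. }
intros l; remember (length l) as n eqn:Hn; assert (Hn' : (length l <= n)%nat) by lia.
clear Hn; revert l Hn'; induction n as [|n IH]; intros l Hn Hlam H.
{ destruct l; [easy|simpl in Hn; lia]. }
assert (Hl : l = nil \/ l <> nil) by (destruct l; [now left|now right]).
destruct Hl as [->|Hl]; [easy|].
destruct (dominant_term l Hl) as [i0 [Hi0 Hmax]].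
destruct (Rle_lt_or_eq_dec 0 (lam i0) (Hlam i0 Hi0)) as [Hpos|Hzero].
(* With all scalings zero the functions are the constants 1/k!, and the hypothesis at [0] transfers
   exactly these relations. *)
2:{ assert (Hall : forall i, In i l -> lam i = 0).
    { intros i Hi; assert (P := Hlam i Hi); destruct (Hmax i Hi) as [Q|[Q _]]; lra. }
    transitivity (Phi 0%nat 0 (vsum l (fun i => scal (phi (k i) (lam i * 0)) (v i)))).
    - rewrite (vsum_linear (Phi 0%nat 0)) by auto; apply vsum_ext; intros i Hi.
      rewrite (Hall i Hi), H0, Hs, Rmult_0_l, phi_at_0; easy.
    - rewrite H by lra; apply Hz. }
set (l1 := filter (same_term i0) l).
set (l2 := filter (fun i => negb (same_term i0 i)) l).
assert (Hl2 : forall i, In i l2 -> In i l /\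
  (lam i < lam i0 \/ lam i = lam i0 /\ (k i0 < k i)%nat)).
{ intros i Hi; apply filter_In in Hi; destruct Hi as [Hi Hb]; split; [easy|].
  apply Bool.negb_true_iff in Hb.
  destruct (Hmax i Hi) as [Q|[Q1 Q2]]; [now left|right; split; [easy|]].
  destruct (Nat.eq_dec (k i) (k i0)) as [E|E]; [|lia].
  exfalso; assert (same_term i0 i = true) by now apply same_term_spec.
  congruence. }
set (V := vsum l1 v).
assert (Hsplit : forall z, 0 <= z -> plus (scal (phi (k i0) (lam i0 * z)) V)
  (vsum l2 (fun i => scal (phi (k i) (lam i * z)) (v i))) = zero).
{ intros z Hz0; refine (eq_trans _ (H z Hz0)); rewrite (vsum_filter (same_term i0) l); f_equal.
  symmetry; apply (vsum_same_term i0 l (fun j mu x => scal (phi j (mu * z)) x));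
    intros; module. }
assert (Hdom : forall l', (forall i, In i l' -> 0 <= lam i /\
    (lam i < lam i0 \/ lam i = lam i0 /\ (k i0 < k i)%nat)) ->
  forall eps, 0 < eps -> exists Z, 0 < Z /\ forall z, Z <= z ->
  norm (vsum l' (fun i => scal (phi (k i) (lam i * z)) (v i)))
    <= eps * phi (k i0) (lam i0 * z)).
{ induction l' as [|i l' IH']; intros Hl' e He.
  - exists 1; split; [lra|]; intros z Hz1; simpl; rewrite norm_zero.
    apply Rmult_le_pos; [lra|]; apply phi_bounds; apply Rmult_le_pos; lra.
  - destruct (IH' (fun i Hi => Hl' i (or_intror Hi)) (e / 2)) as [Z1 [HZ1 K1]]; [lra|].
    destruct (Hl' i (or_introl eq_refl)) as [Hli Hd].
    assert (Hv := norm_ge_0 (v i)).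
    destruct (phi_dominated (k i) (lam i) (k i0) (lam i0) (e / (2 * (norm (v i) + 1))))
      as [Z2 [HZ2 K2]]; auto; [apply Rdiv_lt_0_compat; lra|].
    exists (Z1 + Z2); split; [lra|]; intros z Hz1; cbn [vsum].
    specialize (K1 z ltac:(lra)); specialize (K2 z ltac:(lra)).
    assert (P0 : 0 <= phi (k i0) (lam i0 * z))
      by (apply phi_bounds, Rmult_le_pos; lra).
    replace (e * phi (k i0) (lam i0 * z)) with
      (e / 2 * phi (k i0) (lam i0 * z) + e / 2 * phi (k i0) (lam i0 * z)) by field.
    apply norm_plus_le; [|exact K1].
    apply Rle_trans with ((e / (2 * (norm (v i) + 1)) * phi (k i0) (lam i0 * z)) *
      (norm (v i) + 1)); [|right; field; lra].
    apply norm_scal_le; [|lra].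
    rewrite Rabs_pos_eq; [exact K2|]; apply phi_bounds, Rmult_le_pos; lra. }
assert (HV : V = zero).
{ apply norm_small_eq; intros e He.
  destruct (Hdom l2 (fun i Hi => conj (Hlam i (proj1 (Hl2 i Hi))) (proj2 (Hl2 i Hi))) e He)
    as [Z1 [HZ1 K1]].
  destruct (phi_pos (k i0)) as [Z2 [HZ2 K2]].
  set (z := Z1 + Z2 / lam i0).
  assert (HZ2' : 0 < Z2 / lam i0) by now apply Rdiv_lt_0_compat.
  assert (Hz1 : Z1 <= z) by (unfold z; lra).
  assert (Hz2 : Z2 <= lam i0 * z).
  { apply Rle_trans with (lam i0 * (Z2 / lam i0)); [right; field; lra|].
    apply Rmult_le_compat_l; unfold z; lra. }
  specialize (K1 z Hz1); specialize (K2 _ Hz2).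
  assert (E := Hsplit z ltac:(lra)).
  assert (E' : norm (scal (phi (k i0) (lam i0 * z)) V) <= e * phi (k i0) (lam i0 * z)).
  { apply (norm_le_eq (opp (vsum l2 (fun i => scal (phi (k i) (lam i * z)) (v i))))).
    - apply minus_eq; refine (eq_trans (f_equal norm _) (norm_zero (V := X))).
      refine (eq_trans _ E); module.
    - eapply Rle_trans; [right; apply norm_opp|exact K1]. }
  rewrite norm_scal_pos in E' by lra.
  eapply Rle_trans; [right; apply norm_minus_zero|].
  apply Rmult_le_reg_l with (phi (k i0) (lam i0 * z)); [easy|lra]. }
rewrite (vsum_filter (same_term i0) l), (vsum_same_term i0 l Phi) by auto.
fold l1 l2; fold V.
rewrite HV, Hz, IH; [apply plus_zero_l| | |].
- assert (Hlen : (length l1 + length l2 = length l)%nat).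
  { unfold l1, l2; clear; induction l as [|i l IHl]; simpl; [easy|].
    destruct (same_term i0 i); simpl; lia. }
  assert (Hi1 : In i0 l1) by (apply filter_In; split; [easy|now apply same_term_spec]).
  destruct l1; [easy|simpl in Hlen; lia].
- intros i Hi; apply Hlam, Hl2, Hi.
- intros z Hz0; refine (eq_trans _ (Hsplit z Hz0)); rewrite HV; module.
Qed.

End Independence.

(** Any family [Phi] that shares with phi_k(lambda A) the relation
    phi_k(0) = 1 / k! satisfies the linear relations between the functions
    phi_k(lambda z); the coefficients may be vectors. *)
Definition coef_gen {X Y : NormedModule R_AbsRing} (Phi : nat -> R -> X -> Y)
    (f : coef) (x : X) : Y :=
  vsum f (fun q => scal (twt q) (Phi (tidx q) (tscale q) x)).

Lemma coef_transfer {X Y : NormedModule R_AbsRing} {I : Type}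
  (Phi : nat -> R -> X -> Y) (l : list I) (f : I -> coef) (v : I -> X) :
  (forall j mu x y, Phi j mu (plus x y) = plus (Phi j mu x) (Phi j mu y)) ->
  (forall j mu a x, Phi j mu (scal a x) = scal a (Phi j mu x)) ->
  (forall j x, Phi j 0 x = scal (/ INR (fact j)) (Phi 0%nat 0 x)) ->
  (forall i, In i l -> admissible (f i)) ->
  (forall z, 0 <= z -> vsum l (fun i => scal (coef_eval (f i) z) (v i)) = zero) ->
  vsum l (fun i => coef_gen Phi (f i) (v i)) = zero.
Proof.
intros Hp Hs H0 Hf H.
set (L := flat_map (fun i => map (fun q => (i, q)) (f i)) l).
assert (E := phi_independent (fun iq : I * term => tidx (snd iq))
  (fun iq => tscale (snd iq)) (fun iq => scal (twt (snd iq)) (v (fst iq))) Phi Hp Hs H0 L).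
unfold L in E; rewrite vsum_flat_map in E.
rewrite <- E.
- apply vsum_ext; intros i _; rewrite vsum_map; apply vsum_ext; intros q _; simpl.
  now rewrite Hs.
- intros [i q] Hiq; apply in_flat_map in Hiq; destruct Hiq as [i' [Hi' Hq]].
  apply in_map_iff in Hq; destruct Hq as [q' [E' Hq]]; inversion E'; subst.
  simpl; now apply (Hf i).
- intros z Hz; rewrite vsum_flat_map; refine (eq_trans _ (H z Hz)).
  apply vsum_ext; intros i _.
  rewrite vsum_map; unfold coef_eval; rewrite <- vsum_scal_l.
  apply vsum_ext; intros q _; simpl; module.
Qed.

(** * Order conditions as identities between scalar functions *)

Definition rsum {I : Type} (l : list I) (F : I -> R) : R :=
  fold_right (fun i s => F i + s) 0 l.

(** The constant b as b e^(0 z), so that frozen weights are treated as coefficient functions too. *)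
Definition const_coef (b : R) : coef := Term b 0 0 :: nil.

(** The function psi_{j,i} as one list of terms, which makes it subject to the same transfer as the
    coefficients of the method. *)
Definition psi_coef (m : expRK) (j i : nat) : coef :=
  flat_map (fun k => map (fun q => Term (node_pow m k (j - 1) * twt q) (tidx q) (tscale q))
                       (acoef m i k)) (seq 2 (i - 2))
  ++ Term (- node m i ^ j) j (node m i) :: nil.

Lemma rsum_app {I} (l1 l2 : list I) F : rsum (l1 ++ l2) F = rsum l1 F + rsum l2 F.
Proof. induction l1 as [|i l IH]; simpl; [ring|rewrite IH; ring]. Qed.

Lemma coef_eval_rsum f z :
  coef_eval f z = rsum f (fun q => twt q * phi (tidx q) (tscale q * z)).
Proof. reflexivity. Qed.

Lemma coef_eval_const b z : coef_eval (const_coef b) z = b.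
Proof. simpl; rewrite Rmult_0_l, exp_0; ring. Qed.

Lemma coef_eval_psi m j i z :
  coef_eval (psi_coef m j i) z =
  rsum (seq 2 (i - 2)) (fun k => node_pow m k (j - 1) * coef_eval (acoef m i k) z)
  - node m i ^ j * phi j (node m i * z).
Proof.
rewrite coef_eval_rsum; unfold psi_coef; rewrite rsum_app; simpl rsum at 2.
assert (E : forall l, rsum (flat_map (fun k => map (fun q =>
    Term (node_pow m k (j - 1) * twt q) (tidx q) (tscale q)) (acoef m i k)) l)
    (fun q => twt q * phi (tidx q) (tscale q * z)) =
  rsum l (fun k => node_pow m k (j - 1) * coef_eval (acoef m i k) z)).
{ induction l as [|k l IH]; simpl; [easy|]; rewrite rsum_app, IH; f_equal.
  rewrite coef_eval_rsum; generalize (acoef m i k) as f; induction f as [|q f IHf]; simpl.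
  - ring.
  - rewrite IHf; ring. }
rewrite E; ring.
Qed.

Module MatrixConditions.
Import all_boot all_algebra Rstruct.
Import GRing.Theory.
Local Open Scope ring_scope.
Set Implicit Arguments.
Unset Strict Implicit.

Lemma big_list_rsum (I : Type) (l : list I) (F : I -> R) :
  \sum_(i <- l) F i = rsum l F.
Proof. by elim: l => [|i l IH]; rewrite ?big_nil // big_cons IH. Qed.

Lemma list_seq_iota a n : List.seq a n = iota a n.
Proof. by elim: n a => [|n IH] a //=; rewrite IH. Qed.

Lemma big_nat_rsum a n (F : nat -> R) :
  \sum_(a <= i < n) F i = rsum (List.seq a (n - a)) F.
Proof. by rewrite list_seq_iota -big_list_rsum. Qed.

Lemma exp_mx_diag n (d : 'rV[R]_n) :
  exp_mx (diag_mx d) = diag_mx (map_mx exp d).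
Proof.
have dX r : (diag_mx d) ^+ r = diag_mx (map_mx (fun x => x ^+ r) d) :> 'M_n.
  elim: r => [|r IH].
    by apply/matrixP => i j; rewrite expr0 !mxE expr0.
  rewrite exprS IH -[_ * _]/(_ *m _) mulmx_diag.
  by congr diag_mx; apply/rowP => j; rewrite !mxE exprS.
apply/matrixP => i j; rewrite !mxE; case: (altP (i =P j)) => [<-|ne].
  rewrite mulr1n -(is_series_unique _ _ (is_exp_Reals (d 0 i))).
  apply: Series_ext => r; rewrite dX !mxE eqxx mulr1n.
  rewrite pow_n_pow -RpowE.
  by rewrite /scal /= /mult /=; field; apply: INR_fact_neq_0.
rewrite mulr0n.
have -> : Series (fun r => Rdiv ((diag_mx d ^+ r) i j) (INR (fact r))) =
          Series (fun r => Rmult 0 0).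
  by apply: Series_ext => r; rewrite dX !mxE (negbTE ne) mulr0n Rmult_0_l /Rdiv Rmult_0_l.
by rewrite Series_scal_l Rmult_0_l.
Qed.

Lemma phi_mx_diag n k (d : 'rV[R]_n) :
  phi_mx k (diag_mx d) = diag_mx (map_mx (phi k) d).
Proof.
case: k => [|k]; first exact: exp_mx_diag.
apply/matrixP => i j; rewrite !mxE.
have E (th : R) : exp_mx ((1 - th) *: diag_mx d) i j =
   exp (Rmult (1 - th) (d 0 i)) *+ (i == j).
  by rewrite -linearZ exp_mx_diag !mxE.
case: (altP (i =P j)) E => [<-|ne] E.
  rewrite mulr1n; apply: RInt_ext => th _.
  by rewrite E mulr1n Rmult_comm.
rewrite mulr0n; transitivity (RInt (fun _ => 0 : R) 0 1).
  by apply: RInt_ext => th _; rewrite E mulr0n Rmult_0_r.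
by rewrite RInt_const; exact: Rmult_0_r.
Qed.

Lemma coef_mx_diag n (f : coef) (d : 'rV[R]_n) :
  coef_mx f (diag_mx d) = diag_mx (map_mx (coef_eval f) d).
Proof.
apply/matrixP => i j; rewrite /coef_mx summxE !mxE coef_eval_rsum -big_list_rsum.
rewrite -sumrMnl; apply: eq_bigr => q _.
by rewrite -linearZ phi_mx_diag !mxE mulrnAr.
Qed.

Lemma psi_diag m n j i (d : 'rV[R]_n) :
  psi m j i (diag_mx d) = diag_mx (map_mx (coef_eval (psi_coef m j i)) d).
Proof.
apply/matrixP => a b; rewrite /psi !mxE summxE coef_eval_psi.
rewrite -linearZ phi_mx_diag !mxE -big_nat_rsum -RminusE mulrnBl -sumrMnl -subn1.
congr (_ - _).
  by apply: eq_bigr => k _; rewrite !mxE coef_mx_diag !mxE mulrnAr.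
by rewrite -mulrnAr RpowE.
Qed.

Section ScalarCoefficients.
Variables (m : expRK) (W : weights) (wc : nat -> coef).
Hypothesis HW : forall n (d : 'rV[R]_n) i,
  W (diag_mx d) i = diag_mx (map_mx (coef_eval (wc i)) d).

(** Substituted for the arbitrary matrices, the shift raises the row index by one at each
    occurrence. A product of functions of a diagonal Z separated by shifts therefore evaluates each
    factor at its own diagonal entry. Size 4 suffices since condition 11, the longest, has four
    factors. *)
Let sh : 'M[R]_4 := \matrix_(i, j) (j == i.+1 :> nat)%:R.

Lemma diag_shift (a : 'rV[R]_4) (N : 'M[R]_4) (i j k : 'I_4) :
  k = i.+1 :> nat -> (diag_mx a *m sh *m N) i j = a 0 i * N k j.
Proof.
move=> ik; rewrite -mulmxA mul_diag_mx mxE; congr (_ * _).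
rewrite mxE (bigD1 k) //= mxE ik eqxx mul1r big1 ?addr0 // => l lk.
rewrite mxE -ik; case: eqP => [e|_]; last by rewrite mul0r.
by case/negP: lk; apply/eqP/val_inj.
Qed.

Let o0 : 'I_4 := @Ordinal 4 0 isT.
Let o1 : 'I_4 := @Ordinal 4 1 isT.
Let o2 : 'I_4 := @Ordinal 4 2 isT.
Let o3 : 'I_4 := @Ordinal 4 3 isT.
Let dvec (z0 z1 z2 z3 : R) : 'rV[R]_4 :=
  \row_j (if j == 0 :> nat then z0 else if j == 1 :> nat then z1
          else if j == 2 :> nat then z2 else z3).
Let stg := List.seq 2 ((stages m).+1 - 2).

Lemma one_slot (c : nat -> R) k :
  (forall n (Z : 'M[R]_n), \sum_(2 <= i < (stages m).+1) c i *: W Z i = phi_mx k Z) ->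
  forall z, rsum stg (fun i => Rmult (c i) (coef_eval (wc i) z)) = phi k z.
Proof.
move=> H z; have := congr1 (fun M : 'M_4 => M o0 o0) (H 4 (diag_mx (dvec z z z z))).
rewrite /= summxE phi_mx_diag !mxE /= mulr1n => <-.
rewrite /stg -big_nat_rsum; apply: eq_bigr => i _.
by rewrite mxE HW !mxE /= mulr1n.
Qed.

Lemma two_slot (c : nat -> R) j :
  (forall n (Z J : 'M[R]_n),
     \sum_(2 <= i < (stages m).+1) c i *: (W Z i *m J *m psi m j i Z) = 0) ->
  forall z1 z2, rsum stg (fun i => Rmult (c i) (Rmult (coef_eval (wc i) z1)
    (coef_eval (psi_coef m j i) z2))) = 0.
Proof.
move=> H z1 z2.
have := congr1 (fun M : 'M_4 => M o0 o1) (H 4 (diag_mx (dvec z1 z2 0 0)) sh).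
rewrite /= summxE mxE => E; rewrite -[RHS]E /stg -big_nat_rsum.
apply: eq_bigr => i _; rewrite mxE HW psi_diag (@diag_shift _ _ o0 o1 o1) //.
by rewrite !mxE /=.
Qed.

Lemma three_slot (c c' : nat -> R) p :
  (forall n (Z J : 'M[R]_n),
     \sum_(2 <= i < (stages m).+1) c i *: (W Z i *m J *m
       \sum_(2 <= j < i) c' j *: (coef_mx (acoef m i j) Z *m J *m psi m p j Z)) = 0) ->
  forall z1 z2 z3, rsum stg (fun i => Rmult (c i) (Rmult (coef_eval (wc i) z1)
    (rsum (List.seq 2 (i - 2)) (fun j => Rmult (c' j) (Rmult (coef_eval (acoef m i j) z2)
      (coef_eval (psi_coef m p j) z3)))))) = 0.
Proof.
move=> H z1 z2 z3.
have := congr1 (fun M : 'M_4 => M o0 o2) (H 4 (diag_mx (dvec z1 z2 z3 0)) sh).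
rewrite /= summxE mxE => E; rewrite -[RHS]E /stg -big_nat_rsum.
apply: eq_bigr => i _; rewrite mxE HW (@diag_shift _ _ o0 o2 o1) // !mxE summxE /=.
congr (_ * (_ * _)); rewrite -big_nat_rsum; apply: eq_bigr => j _.
rewrite mxE coef_mx_diag psi_diag (@diag_shift _ _ o1 o2 o2) //.
by rewrite !mxE /=.
Qed.

Lemma four_slot p :
  (forall n (Z J : 'M[R]_n),
     \sum_(2 <= i < (stages m).+1) W Z i *m J *m
       (\sum_(2 <= j < i) coef_mx (acoef m i j) Z *m J *m
         (\sum_(2 <= k < j) coef_mx (acoef m j k) Z *m J *m psi m p k Z)) = 0) ->
  forall z1 z2 z3 z4, rsum stg (fun i => Rmult (coef_eval (wc i) z1)
    (rsum (List.seq 2 (i - 2)) (fun j => Rmult (coef_eval (acoef m i j) z2)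
      (rsum (List.seq 2 (j - 2)) (fun k => Rmult (coef_eval (acoef m j k) z3)
      (coef_eval (psi_coef m p k) z4)))))) = 0.
Proof.
move=> H z1 z2 z3 z4.
have := congr1 (fun M : 'M_4 => M o0 o3) (H 4 (diag_mx (dvec z1 z2 z3 z4)) sh).
rewrite /= summxE mxE => E; rewrite -[RHS]E /stg -big_nat_rsum.
apply: eq_bigr => i _; rewrite HW (@diag_shift _ _ o0 o3 o1) // !mxE summxE /=.
congr (_ * _); rewrite -big_nat_rsum; apply: eq_bigr => j _.
rewrite coef_mx_diag (@diag_shift _ _ o1 o3 o2) // !mxE summxE /=.
congr (_ * _); rewrite -big_nat_rsum; apply: eq_bigr => k _.
rewrite coef_mx_diag psi_diag (@diag_shift _ _ o2 o3 o3) //.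
by rewrite !mxE /=.
Qed.

Lemma bilinear_slot : cond15 m W ->
  forall z1 z2 z3, rsum stg (fun i => Rmult (coef_eval (wc i) z1)
    (Rmult (coef_eval (psi_coef m 2 i) z2) (coef_eval (psi_coef m 2 i) z3))) = 0.
Proof.
move=> H z1 z2 z3.
(* Reading entries 1 and 2 and writing to row 0 lets the three factors see three different diagonal
   entries. *)
pose B (v w : 'cV[R]_4) : 'cV[R]_4 := (v o1 0 * w o2 0) *: delta_mx o0 0.
have HB : is_bilinear B.
  split=> [v a x y|v a x y]; rewrite /B !mxE scalerA -scalerDl; congr (_ *: _).
    by rewrite mulrDr mulrCA.
  by rewrite mulrDl mulrA.
have := congr1 (fun M : 'cV_4 => M o0 0) (H 4 (diag_mx (dvec z1 z2 z3 0)) B HB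
  (delta_mx o1 0) (delta_mx o2 0)).
rewrite /= summxE mxE => E; rewrite -[RHS]E /stg -big_nat_rsum.
apply: eq_bigr => i _; rewrite HW psi_diag mul_diag_mx mxE /B.
by rewrite !mul_diag_mx !mxE /= !mulr1.
Qed.

End ScalarCoefficients.

Lemma full_diag m n (d : 'rV[R]_n) i :
  full m n (diag_mx d) i = diag_mx (map_mx (coef_eval (bcoef m i)) d).
Proof. exact: coef_mx_diag. Qed.

Lemma frozen_diag m n (d : 'rV[R]_n) i :
  frozen m n (diag_mx d) i =
  diag_mx (map_mx (coef_eval (const_coef (coef_eval (bcoef m i) 0))) d).
Proof.
by apply/matrixP => a b; rewrite /frozen !mxE coef_eval_const.
Qed.

End MatrixConditions.

(** * Order conditions as identities between operators *)

(** Algebraic linearity: the transfer of identities involves finite sums only and no limits of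
    operators. *)
Definition lin {X Y : NormedModule R_AbsRing} (L : X -> Y) : Prop :=
  (forall x y, L (plus x y) = plus (L x) (L y)) /\
  (forall a x, L (scal a x) = scal a (L x)).

Lemma lin_zero {X Y : NormedModule R_AbsRing} (L : X -> Y) : lin L -> L zero = zero.
Proof.
intros [_ Hs]; transitivity (L (scal 0 zero)); [f_equal; module|].
rewrite Hs; module.
Qed.

Lemma lin_minus {X Y : NormedModule R_AbsRing} (L : X -> Y) x y :
  lin L -> L (minus x y) = minus (L x) (L y).
Proof.
intros [Hp Hs]; transitivity (L (plus x (scal (- (1)) y))); [f_equal; module|].
rewrite Hp, Hs; module.
Qed.

Lemma lin_vsum {X Y : NormedModule R_AbsRing} {I} (L : X -> Y) (l : list I) F :
  lin L -> L (vsum l F) = vsum l (fun i => L (F i)).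
Proof. intros HL; apply vsum_linear; [apply HL|now apply lin_zero]. Qed.

Lemma vsum_scal_rsum {V : NormedModule R_AbsRing} {I} (l : list I) (a : I -> R) (x : V) :
  vsum l (fun i => scal (a i) x) = scal (rsum l a) x.
Proof. apply vsum_scal_l. Qed.

Section OperatorConditions.
Context {X : NormedModule R_AbsRing} (ph : nat -> R -> X -> X).
Hypothesis ph_lin : forall k tau, 0 <= tau -> lin (ph k tau).
Hypothesis ph_0 : forall k x, ph k 0 x = scal (/ INR (fact k)) x.

(** The body of [coef_op] over an abstract family [ph], which isolates the two properties the
    transfer relies on: linearity and the values at 0. *)
Definition cop (f : coef) (h : R) (x : X) : X :=
  fold_right (fun q acc =>
    plus (scal (twt q) (ph (tidx q) (tscale q * h) x)) acc) zero f.

Lemma cop_vsum f h x :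
  cop f h x = vsum f (fun q => scal (twt q) (ph (tidx q) (tscale q * h) x)).
Proof. induction f as [|q f IH]; simpl; [easy|now rewrite <- IH]. Qed.

Lemma cop_lin f h : admissible f -> 0 <= h -> lin (cop f h).
Proof.
intros Hf Hh; induction f as [|q f IH].
- split; intros; simpl; module.
- destruct IH as [IH1 IH2]; [intros q' Hq'; apply Hf; simpl; auto|].
  assert (Hq : 0 <= tscale q * h).
  { apply Rmult_le_pos; [apply Hf; simpl; auto|easy]. }
  destruct (ph_lin (tidx q) _ Hq) as [H1 H2].
  split; intros; simpl; [rewrite H1, IH1|rewrite H2, IH2]; module.
Qed.

Lemma cop_const b h x : cop (const_coef b) h x = scal b x.
Proof. simpl; rewrite Rmult_0_l, ph_0; simpl; module. Qed.

Lemma admissible_const b : admissible (const_coef b).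
Proof. intros q [<-|[]]; simpl; lra. Qed.

Lemma admissible_psi m j i : expRK_wf m -> (2 <= i <= stages m)%nat ->
  admissible (psi_coef m j i).
Proof.
intros [Hc [Ha _]] Hi q Hq; apply in_app_or in Hq; destruct Hq as [Hq|[<-|[]]].
- apply in_flat_map in Hq; destruct Hq as [k [Hk Hq]]; apply in_seq in Hk.
  apply in_map_iff in Hq; destruct Hq as [q' [<- Hq']]; simpl.
  apply (Ha i k); auto; lia.
- simpl; now apply Hc.
Qed.

Lemma cop_psi m j i h x :
  cop (psi_coef m j i) h x =
  minus (vsum (seq 2 (i - 2)) (fun k => scal (node_pow m k (j - 1)) (cop (acoef m i k) h x)))
    (scal (node m i ^ j) (ph j (node m i * h) x)).
Proof.
rewrite cop_vsum; unfold psi_coef; rewrite vsum_app, vsum_flat_map.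
rewrite (vsum_ext (seq 2 (i - 2)) _
  (fun k => scal (node_pow m k (j - 1)) (cop (acoef m i k) h x))).
2:{ intros k _; rewrite vsum_map, cop_vsum, <- vsum_scal; apply vsum_ext; intros q _.
    simpl; module. }
unfold minus; f_equal; simpl; module.
Qed.

Context (h : R).
Hypothesis Hh : 0 <= h.

(** Cutting off negative scalings makes the family linear for every [mu], as the transfer demands;
    on admissible coefficients nothing changes. *)
Let Phi k mu x := ph k (Rmax 0 mu * h) x.

Lemma Phi_lin k mu : lin (Phi k mu).
Proof. apply ph_lin, Rmult_le_pos; [apply Rmax_l|easy]. Qed.

Lemma Phi_0 k x : Phi k 0 x = scal (/ INR (fact k)) (Phi 0%nat 0 x).
Proof. unfold Phi; rewrite Rmax_left, Rmult_0_l, !ph_0 by lra; simpl; module. Qed.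

Lemma cop_Phi {Y : NormedModule R_AbsRing} (L : X -> Y) f x : admissible f -> lin L ->
  L (cop f h x) = vsum f (fun q => scal (twt q) (L (Phi (tidx q) (tscale q) x))).
Proof.
intros Hf HL; rewrite cop_vsum, (lin_vsum L) by easy; apply vsum_ext; intros q Hq.
rewrite (proj2 HL); unfold Phi; now rewrite Rmax_right by now apply Hf.
Qed.

Lemma op_transfer {I} (l : list I) (f : I -> coef) (v : I -> X) :
  (forall i, In i l -> admissible (f i)) ->
  (forall z, 0 <= z -> vsum l (fun i => scal (coef_eval (f i) z) (v i)) = zero) ->
  vsum l (fun i => cop (f i) h (v i)) = zero.
Proof.
intros Hf H.
refine (eq_trans (vsum_ext l _ _ (fun i Hi => cop_Phi (fun x => x) (f i) (v i) (Hf i Hi) _))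
  (coef_transfer Phi l f v _ _ _ Hf H)).
- split; reflexivity.
- intros; apply Phi_lin.
- intros; apply Phi_lin.
- apply Phi_0.
Qed.

Lemma op_transfer2 {I J} (l : list I) (L : I -> list J) (f : I -> J -> coef)
  (v : I -> J -> X) :
  (forall i j, In i l -> In j (L i) -> admissible (f i j)) ->
  (forall z, 0 <= z ->
    vsum l (fun i => vsum (L i) (fun j => scal (coef_eval (f i j) z) (v i j))) = zero) ->
  vsum l (fun i => vsum (L i) (fun j => cop (f i j) h (v i j))) = zero.
Proof.
intros Hf H.
assert (E : forall F : I -> J -> X, vsum l (fun i => vsum (L i) (F i)) =
  vsum (flat_map (fun i => map (pair i) (L i)) l) (fun ij => F (fst ij) (snd ij))).
{ intros F; rewrite vsum_flat_map; apply vsum_ext; intros i _; now rewrite vsum_map. }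
rewrite E; apply (op_transfer _ (fun ij => f (fst ij) (snd ij)) (fun ij => v (fst ij) (snd ij))).
- intros [i j] Hij; apply in_flat_map in Hij; destruct Hij as [i' [Hi Hj]].
  apply in_map_iff in Hj; destruct Hj as [j' [Ej Hj]]; inversion Ej; subst; now apply Hf.
- intros z Hz; rewrite <- (E (fun i j => scal (coef_eval (f i j) z) (v i j))); auto.
Qed.

Lemma one_slot_op {I} (l : list I) (f : I -> coef) (c : I -> R) k x :
  (forall i, In i l -> admissible (f i)) ->
  (forall z, rsum l (fun i => c i * coef_eval (f i) z) = phi k z) ->
  vsum l (fun i => scal (c i) (cop (f i) h x)) = ph k h x.
Proof.
intros Hf H.
(* The right-hand side phi_k becomes one more summand, with vector - x, which turns the condition
   into a homogeneous relation. *)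
set (l' := ((Term 1 k 1 :: nil : coef), opp x) :: map (fun i => (f i, scal (c i) x)) l).
assert (E := op_transfer l' fst snd).
assert (E' : vsum l' (fun i => cop (fst i) h (snd i)) = zero).
{ apply E.
  - intros [g y] [Eq|Hg]; [inversion Eq; intros q [<-|[]]; simpl; lra|].
    apply in_map_iff in Hg; destruct Hg as [i [Eq Hi]]; inversion Eq; subst; now apply Hf.
  - intros z _; unfold l'; cbn [vsum fst snd]; rewrite vsum_map; cbn [fst snd].
    rewrite (vsum_ext l _ (fun i => scal (c i * coef_eval (f i) z) x)).
    + rewrite vsum_scal_rsum, H; simpl; rewrite !Rmult_1_l; module.
    + intros i _; module. }
unfold l' in E'; cbn [vsum fst snd] in E'; rewrite vsum_map in E'; cbn [fst snd] in E'.
rewrite (vsum_ext l (fun i => cop (f i) h (scal (c i) x))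
  (fun i => scal (c i) (cop (f i) h x))) in E'
  by (intros i Hi; apply (cop_lin (f i) h (Hf i Hi) Hh)).
assert (E1 : cop (Term 1 k 1 :: nil) h (opp x) = scal (- (1)) (ph k h x)).
{ simpl; rewrite Rmult_1_l.
  transitivity (plus (scal 1 (ph k h (scal (- (1)) x))) zero); [do 3 f_equal; module|].
  rewrite (proj2 (ph_lin k h Hh)); module. }
rewrite E1 in E'.
set (A := vsum l (fun i => scal (c i) (cop (f i) h x))) in *.
refine (eq_trans _ (eq_trans (f_equal (fun w => plus w (ph k h x)) E') _)); module.
Qed.

(** One variable at a time. With z1 kept scalar, the values of the outer functions move through the
    linear map [J] to the vector; the inner relation is transferred in z2, and [J] of zero is zero.
    The outer transfer then has vector coefficients. The longer conditions iterate this. *)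
Lemma two_slot_op {I} (l : list I) (f g : I -> coef) (c : I -> R) (J : X -> X) x :
  (forall i, In i l -> admissible (f i) /\ admissible (g i)) -> lin J ->
  (forall z1 z2, rsum l (fun i => c i * (coef_eval (f i) z1 * coef_eval (g i) z2)) = 0) ->
  vsum l (fun i => scal (c i) (cop (f i) h (J (cop (g i) h x)))) = zero.
Proof.
intros Hf HJ H.
rewrite (vsum_ext l _ (fun i => cop (f i) h (scal (c i) (J (cop (g i) h x)))))
  by (intros i Hi; symmetry; apply (cop_lin (f i) h (proj1 (Hf i Hi)) Hh)).
apply op_transfer; [intros i Hi; now apply Hf|]; intros z1 _.
rewrite (vsum_ext l _ (fun i => J (cop (g i) h (scal (c i * coef_eval (f i) z1) x)))).
2:{ intros i Hi; rewrite (proj2 (cop_lin (g i) h (proj2 (Hf i Hi)) Hh)), (proj2 HJ).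
    module. }
rewrite <- (lin_vsum J), op_transfer; [now apply lin_zero|intros i Hi; now apply Hf| |easy].
intros z2 _.
rewrite (vsum_ext l _ (fun i =>
  scal (c i * (coef_eval (f i) z1 * coef_eval (g i) z2)) x)) by (intros; module).
rewrite vsum_scal_rsum, H; module.
Qed.

Lemma rsum_scal {I} (l : list I) (a : R) F :
  a * rsum l F = rsum l (fun i => a * F i).
Proof. induction l as [|i l IH]; simpl; [ring|rewrite <- IH; ring]. Qed.

Lemma rsum_ext {I} (l : list I) (F G : I -> R) :
  (forall i, In i l -> F i = G i) -> rsum l F = rsum l G.
Proof.
induction l as [|i l IH]; simpl; intros H; [easy|]; rewrite H, IH; auto.
Qed.

Lemma three_slot_op (l : list nat) (L : nat -> list nat) (f : nat -> coef)
  (a : nat -> nat -> coef) (g : nat -> coef) (c c' : nat -> R) (J K : X -> X) x :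
  (forall i, In i l -> admissible (f i)) ->
  (forall i j, In i l -> In j (L i) -> admissible (a i j) /\ admissible (g j)) ->
  lin J -> lin K ->
  (forall z1 z2 z3, rsum l (fun i => c i * (coef_eval (f i) z1 *
     rsum (L i) (fun j => c' j * (coef_eval (a i j) z2 * coef_eval (g j) z3)))) = 0) ->
  vsum l (fun i => scal (c i) (cop (f i) h (J (vsum (L i)
    (fun j => scal (c' j) (cop (a i j) h (K (cop (g j) h x)))))))) = zero.
Proof.
intros Hf Ha HJ HK H.
rewrite (vsum_ext l _ (fun i => cop (f i) h (scal (c i) (J (vsum (L i)
    (fun j => scal (c' j) (cop (a i j) h (K (cop (g j) h x)))))))))
  by (intros i Hi; symmetry; apply (cop_lin (f i) h (Hf i Hi) Hh)).
apply op_transfer; [easy|]; intros z1 _.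
rewrite (vsum_ext l _ (fun i => J (vsum (L i) (fun j => cop (a i j) h
  (scal (c i * coef_eval (f i) z1 * c' j) (K (cop (g j) h x))))))).
2:{ intros i Hi.
    transitivity (scal (c i * coef_eval (f i) z1) (J (vsum (L i)
      (fun j => scal (c' j) (cop (a i j) h (K (cop (g j) h x))))))); [module|].
    rewrite <- (proj2 HJ), <- vsum_scal; f_equal; apply vsum_ext; intros j Hj.
    rewrite (proj2 (cop_lin (a i j) h (proj1 (Ha i j Hi Hj)) Hh)); module. }
rewrite <- (lin_vsum J), op_transfer2; [now apply lin_zero|intros; now apply Ha| |easy].
intros z2 _.
rewrite (vsum_ext l _ (fun i => K (vsum (L i) (fun j => cop (g j) h
  (scal (c i * coef_eval (f i) z1 * (c' j * coef_eval (a i j) z2)) x))))).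
2:{ intros i Hi; rewrite (lin_vsum K) by easy; apply vsum_ext; intros j Hj.
    rewrite (proj2 (cop_lin (g j) h (proj2 (Ha i j Hi Hj)) Hh)), (proj2 HK); module. }
rewrite <- (lin_vsum K), op_transfer2; [now apply lin_zero|intros i j Hi Hj; now apply (Ha i j)| |easy].
intros z3 _.
rewrite (vsum_ext l _ (fun i => scal (c i * (coef_eval (f i) z1 *
     rsum (L i) (fun j => c' j * (coef_eval (a i j) z2 * coef_eval (g j) z3)))) x)).
- rewrite vsum_scal_rsum, H; module.
- intros i Hi; rewrite (vsum_ext (L i) _ (fun j => scal (c i * coef_eval (f i) z1)
    (scal (c' j * (coef_eval (a i j) z2 * coef_eval (g j) z3)) x))) by (intros; module).
  rewrite vsum_scal, vsum_scal_rsum; module.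
Qed.

Lemma four_slot_op (l : list nat) (L : nat -> list nat) (f : nat -> coef)
  (a : nat -> nat -> coef) (g : nat -> coef) (J : X -> X) x :
  (forall i, In i l -> admissible (f i)) ->
  (forall i j, In i l -> In j (L i) -> In j l /\ admissible (a i j) /\ admissible (g j)) ->
  lin J ->
  (forall z1 z2 z3 z4, rsum l (fun i => coef_eval (f i) z1 *
     rsum (L i) (fun j => coef_eval (a i j) z2 *
       rsum (L j) (fun k => coef_eval (a j k) z3 * coef_eval (g k) z4))) = 0) ->
  vsum l (fun i => cop (f i) h (J (vsum (L i) (fun j => cop (a i j) h (J (vsum (L j)
    (fun k => cop (a j k) h (J (cop (g k) h x))))))))) = zero.
Proof.
intros Hf Ha HJ H.
apply op_transfer; [easy|]; intros z1 _.
rewrite (vsum_ext l _ (fun i => J (vsum (L i) (fun j => cop (a i j) h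
  (scal (coef_eval (f i) z1) (J (vsum (L j)
    (fun k => cop (a j k) h (J (cop (g k) h x)))))))))).
2:{ intros i Hi; rewrite <- (proj2 HJ), <- vsum_scal; f_equal; apply vsum_ext; intros j Hj.
    now rewrite (proj2 (cop_lin (a i j) h (proj1 (proj2 (Ha i j Hi Hj))) Hh)). }
rewrite <- (lin_vsum J), op_transfer2; [now apply lin_zero|intros; now apply Ha| |easy].
intros z2 _.
(* Treating the pairs (i, j) as one index reduces the remaining triple sum to a double one. *)
set (PL := flat_map (fun i => map (pair i) (L i)) l).
assert (HPL : forall ij, In ij PL -> In (fst ij) l /\ In (snd ij) (L (fst ij))).
{ intros [i j] Hij; apply in_flat_map in Hij; destruct Hij as [i' [Hi Hj]].
  apply in_map_iff in Hj; destruct Hj as [j' [Ej Hj]]; inversion Ej; subst; easy. }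
assert (E : forall F : nat -> nat -> X, vsum l (fun i => vsum (L i) (F i)) =
  vsum PL (fun ij => F (fst ij) (snd ij))).
{ intros F; unfold PL; rewrite vsum_flat_map; apply vsum_ext; intros i _; now rewrite vsum_map. }
rewrite (E (fun i j => scal (coef_eval (a i j) z2) (scal (coef_eval (f i) z1) (J (vsum (L j)
    (fun k => cop (a j k) h (J (cop (g k) h x)))))))).
set (s := fun ij => coef_eval (a (fst ij) (snd ij)) z2 * coef_eval (f (fst ij)) z1).
rewrite (vsum_ext PL _ (fun ij => J (vsum (L (snd ij)) (fun k => cop (a (snd ij) k) h
  (scal (s ij) (J (cop (g k) h x))))))).
2:{ intros ij Hij; destruct (HPL ij Hij) as [Hi Hj].
    transitivity (scal (s ij) (J (vsum (L (snd ij))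
      (fun k => cop (a (snd ij) k) h (J (cop (g k) h x)))))); [unfold s; module|].
    rewrite <- (proj2 HJ), <- vsum_scal; f_equal; apply vsum_ext; intros k Hk.
    destruct (Ha _ _ Hi Hj) as [Hjl _].
    now rewrite (proj2 (cop_lin (a (snd ij) k) h (proj1 (proj2 (Ha _ _ Hjl Hk))) Hh)). }
assert (HaPL : forall ij k, In ij PL -> In k (L (snd ij)) ->
  admissible (a (snd ij) k) /\ admissible (g k)).
{ intros ij k Hij Hk; destruct (HPL ij Hij) as [Hi Hj].
  destruct (Ha _ _ Hi Hj) as [Hjl _]; now apply (Ha _ _ Hjl Hk). }
rewrite <- (lin_vsum J), (op_transfer2 PL (fun ij => L (snd ij)) (fun ij => a (snd ij)));
  [now apply lin_zero|intros; now apply HaPL| |easy].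
intros z3 _.
rewrite (vsum_ext PL _ (fun ij => J (vsum (L (snd ij)) (fun k => cop (g k) h
  (scal (s ij * coef_eval (a (snd ij) k) z3) x))))).
2:{ intros ij Hij; rewrite (lin_vsum J) by easy; apply vsum_ext; intros k Hk.
    rewrite (proj2 (cop_lin (g k) h (proj2 (HaPL ij k Hij Hk)) Hh)), (proj2 HJ); module. }
rewrite <- (lin_vsum J), (op_transfer2 PL (fun ij => L (snd ij)) (fun _ => g));
  [now apply lin_zero|intros ij k Hij Hk; now apply (HaPL ij k)| |easy].
intros z4 _.
rewrite (vsum_ext PL _ (fun ij => scal (s ij * rsum (L (snd ij)) (fun k =>
  coef_eval (a (snd ij) k) z3 * coef_eval (g k) z4)) x)).
2:{ intros ij _; rewrite (vsum_ext (L (snd ij)) _ (fun k => scal (s ij)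
    (scal (coef_eval (a (snd ij) k) z3 * coef_eval (g k) z4) x))) by (intros; module).
    rewrite vsum_scal, vsum_scal_rsum; module. }
transitivity (vsum l (fun i => vsum (L i) (fun j => scal (s (i, j) * rsum (L j) (fun k =>
  coef_eval (a j k) z3 * coef_eval (g k) z4)) x))).
{ rewrite E; apply vsum_ext; intros [i j] _; reflexivity. }
rewrite (vsum_ext l _ (fun i => scal (coef_eval (f i) z1 *
     rsum (L i) (fun j => coef_eval (a i j) z2 *
       rsum (L j) (fun k => coef_eval (a j k) z3 * coef_eval (g k) z4))) x)).
- rewrite vsum_scal_rsum, H; module.
- intros i _; rewrite vsum_scal_rsum; f_equal; rewrite rsum_scal.
  apply rsum_ext; intros j _; unfold s; simpl; ring.
Qed.

(** The first argument of [B] is absorbed into the family [Phi'], a family of linear maps of the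
    second argument. Its variable is transferred first, with the second arguments as vector
    coefficients. *)
Lemma bilinear_op {I} (l : list I) (b : I -> R) (g : I -> coef) (B : X -> X -> X) x y :
  (forall i, In i l -> admissible (g i)) ->
  (forall v, lin (B v)) -> (forall w, lin (fun v => B v w)) ->
  (forall z1 z2, rsum l (fun i => b i * (coef_eval (g i) z1 * coef_eval (g i) z2)) = 0) ->
  vsum l (fun i => scal (b i) (B (cop (g i) h x) (cop (g i) h y))) = zero.
Proof.
intros Hg HB1 HB2 H.
set (Phi' := fun k mu w => B (Phi k mu x) w).
assert (E := coef_transfer Phi' l g (fun i => scal (b i) (cop (g i) h y))).
rewrite <- E.
- apply vsum_ext; intros i Hi; rewrite <- (proj2 (HB1 _)).
  apply (cop_Phi (fun v => B v (scal (b i) (cop (g i) h y)))); auto.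
- intros; apply HB1.
- intros; apply HB1.
- intros j w; unfold Phi'; rewrite Phi_0; apply (HB2 w).
- easy.
- intros z1 _.
  rewrite (vsum_ext l _ (fun i => cop (g i) h (scal (b i * coef_eval (g i) z1) y))).
  2:{ intros i Hi; rewrite (proj2 (cop_lin (g i) h (Hg i Hi) Hh)); module. }
  apply op_transfer; [easy|]; intros z2 _.
  rewrite (vsum_ext l _ (fun i =>
    scal (b i * (coef_eval (g i) z1 * coef_eval (g i) z2)) y)) by (intros; module).
  rewrite vsum_scal_rsum, H; module.
Qed.

End OperatorConditions.

Module ScalarConditions.
Import all_boot all_algebra Rstruct.
Import GRing.Theory MatrixConditions.
Local Open Scope ring_scope.

Section Conditions.
Variables (m : expRK) (W : weights) (wc : nat -> coef).
Hypothesis HW : forall n (d : 'rV[R]_n) i,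
  W n (diag_mx d) i = diag_mx (map_mx (coef_eval (wc i)) d).

(** The slot lemmas carry scalar weights and one matrix. Here they are matched to the conditions by
    weights equal to 1 and, where a condition has two matrices, by choosing them equal. *)
Lemma two_slot_1 j :
  (forall n (Z J : 'M[R]_n),
     \sum_(2 <= i < (stages m).+1) W n Z i *m J *m psi m j i Z = 0) ->
  forall z1 z2, rsum (List.seq 2 ((stages m).+1 - 2)) (fun i => Rmult 1
    (Rmult (coef_eval (wc i) z1) (coef_eval (psi_coef m j i) z2))) = 0.
Proof.
move=> H; apply: (two_slot HW (c := fun _ => 1)) => n Z J.
by rewrite -[RHS](H n Z J); apply: eq_bigr => i _; rewrite scale1r.
Qed.

Lemma three_slot_1 p :
  (forall n (Z J : 'M[R]_n),
     \sum_(2 <= i < (stages m).+1) W n Z i *m J *m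
       (\sum_(2 <= j < i) coef_mx (acoef m i j) Z *m J *m psi m p j Z) = 0) ->
  forall z1 z2 z3, rsum (List.seq 2 ((stages m).+1 - 2)) (fun i => Rmult 1
    (Rmult (coef_eval (wc i) z1)
    (rsum (List.seq 2 (i - 2)) (fun j => Rmult 1 (Rmult (coef_eval (acoef m i j) z2)
      (coef_eval (psi_coef m p j) z3)))))) = 0.
Proof.
move=> H; apply: (three_slot HW (c := fun _ => 1) (c' := fun _ => 1)) => n Z J.
rewrite -[RHS](H n Z J); apply: eq_bigr => i _; rewrite scale1r; congr (_ *m _).
by apply: eq_bigr => j _; rewrite scale1r.
Qed.

Lemma three_slot_inner : cond12 m W ->
  forall z1 z2 z3, rsum (List.seq 2 ((stages m).+1 - 2)) (fun i => Rmult 1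
    (Rmult (coef_eval (wc i) z1)
    (rsum (List.seq 2 (i - 2)) (fun j => Rmult (node m j) (Rmult (coef_eval (acoef m i j) z2)
      (coef_eval (psi_coef m 2 j) z3)))))) = 0.
Proof.
move=> H; apply: (three_slot HW (c := fun _ => 1) (c' := node m)) => n Z J.
by rewrite -[RHS](H n Z J J); apply: eq_bigr => i _; rewrite scale1r.
Qed.

Lemma three_slot_outer : cond14 m W ->
  forall z1 z2 z3, rsum (List.seq 2 ((stages m).+1 - 2)) (fun i => Rmult (node m i)
    (Rmult (coef_eval (wc i) z1)
    (rsum (List.seq 2 (i - 2)) (fun j => Rmult 1 (Rmult (coef_eval (acoef m i j) z2)
      (coef_eval (psi_coef m 2 j) z3)))))) = 0.
Proof.
move=> H; apply: (three_slot HW (c := node m) (c' := fun _ => 1)) => n Z J.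
rewrite -[RHS](H n Z J J); apply: eq_bigr => i _; congr (_ *: (_ *m _)).
by apply: eq_bigr => j _; rewrite scale1r.
Qed.

Lemma two_slot_square : cond16 m W ->
  forall z1 z2, rsum (List.seq 2 ((stages m).+1 - 2)) (fun i => Rmult (pow (node m i) 2)
    (Rmult (coef_eval (wc i) z1) (coef_eval (psi_coef m 2 i) z2))) = 0.
Proof.
move=> H; apply: (two_slot HW (c := fun i => pow (node m i) 2)) => n Z J.
by rewrite -[RHS](H n Z J); apply: eq_bigr => i _; rewrite RpowE.
Qed.

End Conditions.

Lemma cond8_rsum m : cond8_at0 m ->
  rsum (List.seq 2 ((stages m).+1 - 2)) (fun i => Rmult (coef_eval (bcoef m i) 0)
    (node_pow m i 4)) = phi 5 0.
Proof. by move=> <-; rewrite /cond8_at0 big_nat_rsum. Qed.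

End ScalarConditions.
Export ScalarConditions.

(** The arbitrary matrices have become arbitrary linear or bilinear maps on X, to be instantiated by
    the derivatives of [g] along the solution. *)
Record operator_conditions {X : NormedModule R_AbsRing} (ph : nat -> R -> X -> X)
    (m : expRK) (h : R) : Prop := {
  oc1 : forall x, vsum (seq 2 (S (stages m) - 2))
    (fun i => scal (node m i) (cop ph (bcoef m i) h x)) = ph 2%nat h x;
  oc2 : forall x, vsum (seq 2 (S (stages m) - 2))
    (fun i => scal (node_pow m i 2) (cop ph (bcoef m i) h x)) = ph 3%nat h x;
  oc4 : forall x, vsum (seq 2 (S (stages m) - 2))
    (fun i => scal (node_pow m i 3) (cop ph (bcoef m i) h x)) = ph 4%nat h x;
  oc3 : forall (J : X -> X) x, lin J -> vsum (seq 2 (S (stages m) - 2))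
    (fun i => cop ph (bcoef m i) h (J (cop ph (psi_coef m 2 i) h x))) = zero;
  oc5 : forall (J : X -> X) x, lin J -> vsum (seq 2 (S (stages m) - 2))
    (fun i => cop ph (bcoef m i) h (J (cop ph (psi_coef m 3 i) h x))) = zero;
  oc6 : forall (J : X -> X) x, lin J -> vsum (seq 2 (S (stages m) - 2))
    (fun i => cop ph (bcoef m i) h (J (vsum (seq 2 (i - 2))
      (fun j => cop ph (acoef m i j) h (J (cop ph (psi_coef m 2 j) h x)))))) = zero;
  oc7 : forall (K : X -> X) x, lin K -> vsum (seq 2 (S (stages m) - 2))
    (fun i => scal (node m i)
      (cop ph (bcoef m i) h (K (cop ph (psi_coef m 2 i) h x)))) = zero;
  oc8 : rsum (seq 2 (S (stages m) - 2))
    (fun i => coef_eval (bcoef m i) 0 * node_pow m i 4) = phi 5 0;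
  oc9 : forall (J : X -> X) x, lin J -> vsum (seq 2 (S (stages m) - 2))
    (fun i => scal (coef_eval (bcoef m i) 0) (J (cop ph (psi_coef m 4 i) h x))) = zero;
  oc10 : forall (J : X -> X) x, lin J -> vsum (seq 2 (S (stages m) - 2))
    (fun i => scal (coef_eval (bcoef m i) 0) (J (vsum (seq 2 (i - 2))
      (fun j => cop ph (acoef m i j) h (J (cop ph (psi_coef m 3 j) h x)))))) = zero;
  oc11 : forall (J : X -> X) x, lin J -> vsum (seq 2 (S (stages m) - 2))
    (fun i => scal (coef_eval (bcoef m i) 0) (J (vsum (seq 2 (i - 2))
      (fun j => cop ph (acoef m i j) h (J (vsum (seq 2 (j - 2))
        (fun k => cop ph (acoef m j k) h (J (cop ph (psi_coef m 2 k) h x))))))))) = zero;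
  oc12 : forall (J K : X -> X) x, lin J -> lin K -> vsum (seq 2 (S (stages m) - 2))
    (fun i => scal (coef_eval (bcoef m i) 0) (J (vsum (seq 2 (i - 2))
      (fun j => scal (node m j)
        (cop ph (acoef m i j) h (K (cop ph (psi_coef m 2 j) h x))))))) = zero;
  oc13 : forall (K : X -> X) x, lin K -> vsum (seq 2 (S (stages m) - 2))
    (fun i => scal (node m i) (scal (coef_eval (bcoef m i) 0)
      (K (cop ph (psi_coef m 3 i) h x)))) = zero;
  oc14 : forall (J K : X -> X) x, lin J -> lin K -> vsum (seq 2 (S (stages m) - 2))
    (fun i => scal (node m i) (scal (coef_eval (bcoef m i) 0) (K (vsum (seq 2 (i - 2))
      (fun j => cop ph (acoef m i j) h (J (cop ph (psi_coef m 2 j) h x))))))) = zero;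
  oc15 : forall (B : X -> X -> X) x, (forall v, lin (B v)) -> (forall w, lin (fun v => B v w)) ->
    vsum (seq 2 (S (stages m) - 2))
    (fun i => scal (coef_eval (bcoef m i) 0)
      (B (cop ph (psi_coef m 2 i) h x) (cop ph (psi_coef m 2 i) h x))) = zero;
  oc16 : forall (L : X -> X) x, lin L -> vsum (seq 2 (S (stages m) - 2))
    (fun i => scal (node m i ^ 2) (scal (coef_eval (bcoef m i) 0)
      (L (cop ph (psi_coef m 2 i) h x)))) = zero }.

Lemma order_conditions_operators {X : NormedModule R_AbsRing} (ph : nat -> R -> X -> X)
    (m : expRK) (h : R) :
  (forall k tau, 0 <= tau -> lin (ph k tau)) ->
  (forall k x, ph k 0 x = scal (/ INR (fact k)) x) -> 0 <= h -> expRK_wf m ->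
  cond1 m (full m) -> cond2 m (full m) -> cond3 m (full m) ->
  cond4 m (full m) -> cond5 m (full m) -> cond6 m (full m) ->
  cond7 m (full m) ->
  cond8_at0 m ->
  cond9 m (frozen m) -> cond10 m (frozen m) -> cond11 m (frozen m) ->
  cond12 m (frozen m) -> cond13 m (frozen m) -> cond14 m (frozen m) ->
  cond15 m (frozen m) -> cond16 m (frozen m) ->
  operator_conditions ph m h.
Proof.
intros Hl H0 Hh Hwf C1 C2 C3 C4 C5 C6 C7 C8 C9 C10 C11 C12 C13 C14 C15 C16.
assert (Hb : forall i, In i (seq 2 (S (stages m) - 2)) -> admissible (bcoef m i)).
{ intros i Hi; apply in_seq in Hi; apply Hwf; lia. }
assert (Hp : forall p i, In i (seq 2 (S (stages m) - 2)) -> admissible (psi_coef m p i)).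
{ intros p i Hi; apply in_seq in Hi; apply admissible_psi; [easy|lia]. }
assert (Hap : forall p i j, In i (seq 2 (S (stages m) - 2)) -> In j (seq 2 (i - 2)) ->
  In j (seq 2 (S (stages m) - 2)) /\
  admissible (acoef m i j) /\ admissible (psi_coef m p j)).
{ intros p i j Hi Hj; apply in_seq in Hi; apply in_seq in Hj; split; [apply in_seq; lia|].
  split; [apply Hwf; lia|]; apply admissible_psi; [easy|lia]. }
assert (Hfc : forall i, In i (seq 2 (S (stages m) - 2)) ->
  admissible (const_coef (coef_eval (bcoef m i) 0))) by (intros; apply admissible_const).
assert (F := MatrixConditions.full_diag m); assert (Z := MatrixConditions.frozen_diag m).
set (fc := fun i => const_coef (coef_eval (bcoef m i) 0)).
constructor.
- intros x; apply (one_slot_op ph Hl H0 h Hh _ (bcoef m) (node m)); [exact Hb|].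
  exact (MatrixConditions.one_slot F C1).
- intros x; apply (one_slot_op ph Hl H0 h Hh _ (bcoef m) (fun i => node_pow m i 2)); [exact Hb|].
  exact (MatrixConditions.one_slot F (c := fun i => node_pow m i 2) C2).
- intros x; apply (one_slot_op ph Hl H0 h Hh _ (bcoef m) (fun i => node_pow m i 3)); [exact Hb|].
  exact (MatrixConditions.one_slot F (c := fun i => node_pow m i 3) C4).
- intros J x HJ.
  assert (E := two_slot_op ph Hl H0 h Hh _ (bcoef m) (psi_coef m 2) (fun _ => 1) J x
    (fun i Hi => conj (Hb i Hi) (Hp 2%nat i Hi)) HJ (two_slot_1 m _ _ F 2 C3)).
  refine (eq_trans _ E); apply vsum_ext; intros i _; module.
- intros J x HJ.
  assert (E := two_slot_op ph Hl H0 h Hh _ (bcoef m) (psi_coef m 3) (fun _ => 1) J x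
    (fun i Hi => conj (Hb i Hi) (Hp 3%nat i Hi)) HJ (two_slot_1 m _ _ F 3 C5)).
  refine (eq_trans _ E); apply vsum_ext; intros i _; module.
- intros J x HJ.
  assert (E := three_slot_op ph Hl H0 h Hh _ (fun i => seq 2 (i - 2)) (bcoef m) (acoef m)
    (psi_coef m 2) (fun _ => 1) (fun _ => 1) J J x Hb
    (fun i j Hi Hj => proj2 (Hap 2%nat i j Hi Hj)) HJ HJ (three_slot_1 m _ _ F 2 C6)).
  refine (eq_trans _ E); apply vsum_ext; intros i _.
  refine (eq_trans _ (eq_sym (scal_one (K := R_AbsRing) _))); do 2 f_equal.
  apply vsum_ext; intros j _; module.
- intros K x HK.
  assert (E := two_slot_op ph Hl H0 h Hh _ (bcoef m) (psi_coef m 2) (node m) K x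
    (fun i Hi => conj (Hb i Hi) (Hp 2%nat i Hi)) HK
    (MatrixConditions.two_slot F (c := node m) C7)).
  exact E.
- exact (cond8_rsum m C8).
- intros J x HJ.
  assert (E := two_slot_op ph Hl H0 h Hh _ fc (psi_coef m 4) (fun _ => 1) J x
    (fun i Hi => conj (Hfc i Hi) (Hp 4%nat i Hi)) HJ (two_slot_1 m _ _ Z 4 C9)).
  refine (eq_trans _ E); apply vsum_ext; intros i _; unfold fc.
  rewrite (cop_const ph H0); module.
- intros J x HJ.
  assert (E := three_slot_op ph Hl H0 h Hh _ (fun i => seq 2 (i - 2)) fc (acoef m)
    (psi_coef m 3) (fun _ => 1) (fun _ => 1) J J x Hfc
    (fun i j Hi Hj => proj2 (Hap 3%nat i j Hi Hj)) HJ HJ (three_slot_1 m _ _ Z 3 C10)).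
  refine (eq_trans _ E); apply vsum_ext; intros i _; unfold fc.
  rewrite (cop_const ph H0).
  refine (eq_trans _ (eq_sym (scal_one (K := R_AbsRing) _))); do 2 f_equal.
  apply vsum_ext; intros j _; module.
- intros J x HJ.
  assert (E := four_slot_op ph Hl H0 h Hh _ (fun i => seq 2 (i - 2)) fc (acoef m)
    (psi_coef m 2) J x Hfc (fun i j Hi Hj => Hap 2%nat i j Hi Hj) HJ
    (MatrixConditions.four_slot Z C11)).
  refine (eq_trans _ E); apply vsum_ext; intros i _; unfold fc.
  now rewrite (cop_const ph H0).
- intros J K x HJ HK.
  assert (E := three_slot_op ph Hl H0 h Hh _ (fun i => seq 2 (i - 2)) fc (acoef m)
    (psi_coef m 2) (fun _ => 1) (node m) J K x Hfc
    (fun i j Hi Hj => proj2 (Hap 2%nat i j Hi Hj)) HJ HK (three_slot_inner m _ _ Z C12)).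
  refine (eq_trans _ E); apply vsum_ext; intros i _; unfold fc.
  rewrite (cop_const ph H0); module.
- intros K x HK.
  assert (E := two_slot_op ph Hl H0 h Hh _ fc (psi_coef m 3) (node m) K x
    (fun i Hi => conj (Hfc i Hi) (Hp 3%nat i Hi)) HK
    (MatrixConditions.two_slot Z (c := node m) C13)).
  refine (eq_trans _ E); apply vsum_ext; intros i _; unfold fc.
  now rewrite (cop_const ph H0).
- intros J K x HJ HK.
  assert (E := three_slot_op ph Hl H0 h Hh _ (fun i => seq 2 (i - 2)) fc (acoef m)
    (psi_coef m 2) (node m) (fun _ => 1) K J x Hfc
    (fun i j Hi Hj => proj2 (Hap 2%nat i j Hi Hj)) HK HJ (three_slot_outer m _ _ Z C14)).
  refine (eq_trans _ E); apply vsum_ext; intros i _; unfold fc.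
  rewrite (cop_const ph H0); do 3 f_equal.
  apply vsum_ext; intros j _; module.
- intros B x HB1 HB2.
  apply (bilinear_op ph Hl H0 h Hh _ (fun i => coef_eval (bcoef m i) 0) (psi_coef m 2) B x x
    (Hp 2%nat) HB1 HB2).
  intros z1 z2; assert (E := MatrixConditions.bilinear_slot Z C15 0 z1 z2).
  refine (eq_trans _ E); apply rsum_ext; intros i _; now rewrite coef_eval_const.
- intros L x HL.
  assert (E := two_slot_op ph Hl H0 h Hh _ fc (psi_coef m 2) (fun i => node m i ^ 2) L x
    (fun i Hi => conj (Hfc i Hi) (Hp 2%nat i Hi)) HL (two_slot_square m _ _ Z C16)).
  refine (eq_trans _ E); apply vsum_ext; intros i _; unfold fc.
  now rewrite (cop_const ph H0).
Qed.

(** * Parabolic smoothing *)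

Lemma vsum_seq_S {V : NormedModule R_AbsRing} n (F : nat -> V) :
  vsum (seq 0 (S n)) F = plus (vsum (seq 0 n) F) (F n).
Proof. rewrite seq_S, vsum_app; simpl; now rewrite plus_zero_r. Qed.

Lemma vsum_seq_shift {V : NormedModule R_AbsRing} n (F : nat -> V) :
  vsum (seq 0 (S n)) F = plus (F 0%nat) (vsum (seq 0 n) (fun j => F (S j))).
Proof. simpl; now rewrite <- seq_shift, vsum_map. Qed.

(** The sum is compared with the one where all [w j] equal [w 0]. Exchanging [w 0] for [w 1] costs a
    partial sum applied to w 1 - w 0, which is at most C W, and the rest is the same problem for the
    shifted sequence. *)
Lemma abel_summation {V : NormedModule R_AbsRing} (T : nat -> V -> V) (C W : R) (n : nat) :
  (forall i x y, T i (minus x y) = minus (T i x) (T i y)) ->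
  (forall m v, (m <= n)%nat -> norm (vsum (seq 0 m) (fun i => T i v)) <= C * norm v) ->
  0 <= C -> 0 <= W ->
  forall w : nat -> V, (forall j, (S j < n)%nat -> norm (minus (w (S j)) (w j)) <= W) ->
  norm (vsum (seq 0 n) (fun j => T (n - 1 - j)%nat (w j)))
    <= C * norm (w 0%nat) + INR n * (C * W).
Proof.
intros HT HR HC HW w Hw.
assert (H : forall m, (m <= n)%nat -> forall w : nat -> V,
  (forall j, (S j < m)%nat -> norm (minus (w (S j)) (w j)) <= W) -> (0 < m)%nat ->
  norm (minus (vsum (seq 0 m) (fun j => T (m - 1 - j)%nat (w j)))
    (vsum (seq 0 m) (fun i => T i (w 0%nat)))) <= INR (m - 1) * (C * W)).
{ clear w Hw; intros m; induction m as [|m IH]; intros Hm w Hw Hm0; [lia|].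
  destruct (Nat.eq_dec m 0) as [->|Hne].
  { simpl; eapply Rle_trans; [right; refine (eq_trans (f_equal norm _) (norm_zero (V := V)))|];
      [module|lra]. }
  rewrite (vsum_seq_shift m), (vsum_seq_S m).
  replace (S m - 1 - 0)%nat with m by lia; replace (S m - 1)%nat with m by lia.
  set (A := vsum (seq 0 m) (fun j => T (m - S j)%nat (w (S j)))).
  assert (EA : A = vsum (seq 0 m) (fun j => T (m - 1 - j)%nat (w (S j)))).
  { apply vsum_ext; intros j _; f_equal; lia. }
  apply (norm_le_eq (plus (minus A (vsum (seq 0 m) (fun i => T i (w 1%nat))))
    (vsum (seq 0 m) (fun i => T i (minus (w 1%nat) (w 0%nat)))))).
  { rewrite (vsum_ext _ (fun i => T i (minus _ _)) _ (fun i _ => HT i _ _)), vsum_minus.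
    module. }
  replace (INR m) with (INR (m - 1) + 1) by (rewrite <- S_INR; f_equal; lia).
  rewrite Rmult_plus_distr_r, Rmult_1_l; apply norm_plus_le.
  - rewrite EA; apply (IH ltac:(lia) (fun j => w (S j))); [|lia].
    intros j Hj; apply Hw; lia.
  - eapply Rle_trans; [apply HR; lia|]; apply Rmult_le_compat_l; [easy|apply Hw; lia]. }
destruct (Nat.eq_dec n 0) as [Hn|Hn].
{ rewrite Hn; simpl; rewrite norm_zero, Rmult_0_l, Rplus_0_r.
  apply Rmult_le_pos; [easy|apply norm_ge_0]. }
apply (norm_le_eq (plus (vsum (seq 0 n) (fun i => T i (w 0%nat)))
  (minus (vsum (seq 0 n) (fun j => T (n - 1 - j)%nat (w j)))
    (vsum (seq 0 n) (fun i => T i (w 0%nat)))))); [module|].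
apply norm_plus_le; [now apply HR|].
eapply Rle_trans; [apply H; auto; lia|].
apply Rmult_le_compat_r; [now apply Rmult_le_pos|apply le_INR; lia].
Qed.

Lemma is_RInt_vsum {V : NormedModule R_AbsRing} {I : Type} (l : list I)
  (f : I -> R -> V) (v : I -> V) a b :
  (forall i, In i l -> is_RInt (f i) a b (v i)) ->
  is_RInt (fun t => vsum l (fun i => f i t)) a b (vsum l v).
Proof.
induction l as [|i l IH]; intros H; simpl.
- assert (K := is_RInt_const a b (zero : V)).
  refine (eq_ind _ (is_RInt _ a b) K _ _); module.
- apply (is_RInt_plus (V := V)); [apply H; simpl; auto|].
  apply IH; intros j Hj; apply H; simpl; auto.
Qed.

Section Smoothing.
Context {X : CompleteNormedModule R_AbsRing} (S : R -> X -> X).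
Hypothesis HS : analytic_semigroup S.

(** From each difference the multiple sigma/h of the one-step difference is subtracted. The
    subtracted terms telescope to S(mh) - S(h); what remains is controlled by the second difference
    estimate. The term j = 0, where that estimate is singular, is bounded directly. *)
Lemma sum_difference_bounded (Tm Lam : R) : 0 <= Lam -> exists C, 0 < C /\
  forall h m sigma x, 0 < h <= 1 -> INR m * h <= Tm -> 0 <= sigma <= Lam * h ->
  norm (vsum (seq 0 m) (fun j => minus (S (INR j * h + sigma) x) (S (INR j * h) x)))
    <= C * norm x.
Proof.
intros HLam.
set (T' := Rabs Tm + Lam + 1).
destruct (sg_bounded S HS T') as [M [HM HMb]].
destruct (sg_second_difference S HS T') as [K [HK HKb]].
(* With a = sigma <= Lam h and b = h, the product a (a + b) is at most Lam (Lam + 1) h^2, and h^2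
   cancels against t^2 = (n h)^2. *)
set (c := K * (Lam * (Lam + 1))).
assert (Hc : 0 <= c).
{ unfold c; apply Rmult_le_pos; [lra|apply Rmult_le_pos; lra]. }
assert (HLM : 0 <= Lam * M) by (apply Rmult_le_pos; lra).
exists (2 * M + 2 * c + 2 * (Lam * M)); split; [lra|].
intros h m sigma x Hh Hm Hs.
assert (Hx := norm_ge_0 x).
assert (HTm := Rle_abs Tm).
assert (HLh : Lam * h <= Lam) by nra.
destruct (Nat.eq_dec m 0) as [->|Hm0].
{ simpl; eapply Rle_trans; [right; apply (norm_zero (V := X))|].
  apply Rmult_le_pos; lra. }
(* The majorant 2 - 2/n telescopes, increases by at least 1/n^2 at each step and stays below 2. *)
assert (Hind : forall n, (1 <= n <= m)%nat ->
  norm (minus (vsum (seq 0 n) (fun j => minus (S (INR j * h + sigma) x) (S (INR j * h) x)))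
    (scal (sigma / h) (minus (S (INR n * h) x) (S h x))))
  <= (2 * M + c * (2 - 2 / INR n)) * norm x).
{ induction n as [|n IH]; intros Hn; [lia|].
  destruct (Nat.eq_dec n 0) as [->|Hn0].
  - replace (INR 1) with 1 by reflexivity; rewrite Rmult_1_l.
    apply (norm_le_eq (V := X) (minus (S sigma x) (S 0 x))).
    { simpl; rewrite Rmult_0_l, Rplus_0_l; module. }
    replace ((2 * M + c * (2 - 2 / 1)) * norm x) with (M * norm x + M * norm x) by field.
    apply (norm_minus_le (V := X)); apply HMb; unfold T'; pose proof (Rabs_pos Tm); lra.
  - rewrite (vsum_seq_S n).
    specialize (IH ltac:(lia)).
    assert (Hn1 : 1 <= INR n) by (apply (le_INR 1); lia).
    assert (Hnm : INR n + 1 <= INR m) by (rewrite <- S_INR; apply le_INR; lia).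
    assert (Hnh : (INR n + 1) * h <= INR m * h) by (apply Rmult_le_compat_r; lra).
    assert (Hnh0 : 0 < INR n * h) by (apply Rmult_lt_0_compat; lra).
    assert (G := HKb (INR n * h) sigma h x Hnh0 (proj1 Hs) (proj1 Hh)
      ltac:(unfold T'; lra) ltac:(unfold T'; lra)).
    rewrite S_INR; replace ((INR n + 1) * h) with (INR n * h + h) by ring.
    match type of IH with norm ?a <= _ => set (E1 := a) in IH end.
    match type of G with norm ?a <= _ => set (E2 := a) in G end.
    apply (norm_le_eq (V := X) (plus E1 E2)); [unfold E1, E2; module|].
    apply Rle_trans with ((2 * M + c * (2 - 2 / INR n)) * norm x + c / INR n ^ 2 * norm x).
    + apply (norm_plus_le (V := X)); [exact IH|].
      eapply Rle_trans; [exact G|]; apply Rmult_le_compat_r; [easy|].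
      unfold c; replace (K * (Lam * (Lam + 1)) / INR n ^ 2) with
        (K * ((Lam * h) * (Lam * h + h)) / (INR n * h) ^ 2) by (field; lra).
      apply Rmult_le_compat_r.
      { apply Rlt_le, Rinv_0_lt_compat, pow_lt; lra. }
      apply Rmult_le_compat_l; [lra|]; apply Rmult_le_compat; lra.
    + rewrite <- Rmult_plus_distr_r; apply Rmult_le_compat_r; [easy|].
      assert (Hq : / INR n ^ 2 <= 2 / INR n - 2 / (INR n + 1)).
      { replace (2 / INR n - 2 / (INR n + 1)) with (2 / (INR n * (INR n + 1)))
          by (field; lra).
        apply Rmult_le_reg_r with (INR n ^ 2 * (INR n + 1)).
        { apply Rmult_lt_0_compat; [apply pow_lt; lra|lra]. }
        replace (/ INR n ^ 2 * (INR n ^ 2 * (INR n + 1))) with (INR n + 1) by (field; lra).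
        replace (2 / (INR n * (INR n + 1)) * (INR n ^ 2 * (INR n + 1))) with (2 * INR n)
          by (field; lra).
        lra. }
      apply (Rmult_le_compat_l c) in Hq; [|easy].
      unfold Rdiv in *; lra. }
specialize (Hind m ltac:(lia)).
match type of Hind with norm (minus ?a ?b) <= _ => set (E1 := a) in *; set (E2 := b) in Hind end.
apply (norm_le_eq (V := X) (plus (minus E1 E2) E2)); [unfold E1; module|].
assert (Hm1 : 1 <= INR m) by (apply (le_INR 1); lia).
apply Rle_trans with ((2 * M + c * (2 - 2 / INR m)) * norm x + Lam * (M * norm x + M * norm x)).
- apply (norm_plus_le (V := X)); [exact Hind|].
  apply (norm_scal_le (V := X)).
  + assert (Hsh : 0 <= sigma / h) by (apply Rdiv_le_0_compat; lra).
    rewrite Rabs_pos_eq by easy; apply Rmult_le_reg_r with h; [lra|].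
    unfold Rdiv; rewrite Rmult_assoc, Rinv_l; lra.
  + apply (norm_minus_le (V := X)); apply HMb; unfold T'; pose proof (Rabs_pos Tm); try lra.
    split; [apply Rmult_le_pos|]; lra.
- assert (0 < / INR m) by (apply Rinv_0_lt_compat; lra).
  assert (c * (2 - 2 / INR m) <= 2 * c) by (unfold Rdiv; nra).
  nra.
Qed.

(** The operator phi_k(lam h A) - phi_k(0) is a weighted average of the differences S((1 - th) lam
    h) - I, so the bound for differences, uniform in the shift, is integrated over th. *)
Lemma sum_phi_difference_bounded (Tm lam : R) k : 0 <= lam -> exists C, 0 < C /\
  forall h m x, 0 < h <= 1 -> INR m * h <= Tm ->
  norm (vsum (seq 0 m) (fun j => S (INR j * h)
    (minus (phi_op S k (lam * h) x) (scal (/ INR (fact k)) x)))) <= C * norm x.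
Proof.
intros Hlam; destruct (sum_difference_bounded Tm lam Hlam) as [C [HC HCb]].
exists C; split; [easy|]; intros h m x Hh Hm.
assert (Hlh : 0 <= lam * h) by (apply Rmult_le_pos; lra).
assert (Hjh : forall j, 0 <= INR j * h) by (intros; apply Rmult_le_pos; [apply pos_INR|lra]).
destruct k as [|k].
- eapply Rle_trans; [right|apply (HCb h m (lam * h) x Hh Hm); lra].
  f_equal; apply vsum_ext; intros j _.
  assert (L := sg_linear S HS _ (Hjh j)).
  rewrite (sg_add S HS) by easy.
  rewrite (linear_minus _ _ _ L), (linear_scal _ L); simpl phi_op.
  simpl fact; simpl INR; module.
- assert (H : is_RInt (fun th => vsum (seq 0 m) (fun j =>
     scal (kern (Datatypes.S k) th) (minus (S (INR j * h + (1 - th) * (lam * h)) x)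
       (S (INR j * h) x)))) 0 1
    (vsum (seq 0 m) (fun j => S (INR j * h)
    (minus (phi_op S (Datatypes.S k) (lam * h) x) (scal (/ INR (fact (Datatypes.S k))) x))))).
  { apply (is_RInt_vsum (V := X)); intros j _.
    assert (L := sg_linear S HS _ (Hjh j)).
    rewrite <- (phi_op_at_0 S HS).
    assert (K := is_RInt_minus _ _ _ _ _ _ (phi_op_is_RInt S HS k (lam * h) x Hlh)
      (phi_op_is_RInt S HS k 0 x (Rle_refl 0))).
    apply (is_RInt_linear (S (INR j * h))) in K; [|exact L].
    apply (is_RInt_ext (V := X)) with (2 := K); cbv beta.
    rewrite Rmin_left, Rmax_right by lra; intros th Hth.
    rewrite (linear_minus _ _ _ L), !(linear_scal _ L), Rmult_0_r, (sg_0 S HS).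
    rewrite (sg_add S HS) by (auto; apply Rmult_le_pos; lra); module. }
  replace (C * norm x) with ((1 - 0) * (1 * (C * norm x))) by ring.
  apply (norm_RInt_le_const _ 0 1 _ _ ltac:(lra)) with (2 := H).
  intros th Hth.
  eapply (norm_le_eq (V := X)); [apply (vsum_scal (V := X))|]; apply (norm_scal_le (V := X)).
  + destruct (kern_bounds (Datatypes.S k) th Hth); apply Rabs_le; lra.
  + apply HCb; auto; nra.
Qed.

Lemma sum_coef_difference_bounded (Tm : R) f : admissible f -> exists C, 0 < C /\
  forall h m x, 0 < h <= 1 -> INR m * h <= Tm ->
  norm (vsum (seq 0 m) (fun j => S (INR j * h)
    (minus (coef_op S f h x) (scal (coef_eval f 0) x)))) <= C * norm x.
Proof.
intros Hf; induction f as [|q f IH].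
- exists 1; split; [lra|]; intros h m x Hh Hm.
  assert (Hx := norm_ge_0 x).
  eapply (norm_le_eq (V := X)); [apply (vsum_zero (V := X))|].
  + intros j _; simpl.
    assert (L : is_linear (S (INR j * h))).
    { apply (sg_linear S HS), Rmult_le_pos; [apply pos_INR|lra]. }
    transitivity (S (INR j * h) zero); [f_equal; module|exact (linear_zero _ L)].
  + eapply Rle_trans; [right; apply (norm_zero (V := X))|lra].
- destruct IH as [C [HC HCb]]; [intros q' Hq'; apply Hf; simpl; auto|].
  destruct (sum_phi_difference_bounded Tm (tscale q) (tidx q)) as [C' [HC' HCb']];
    [apply Hf; simpl; auto|].
  assert (Hw := Rabs_pos (twt q)).
  exists (Rabs (twt q) * C' + C); split.
  { assert (0 <= Rabs (twt q) * C') by (apply Rmult_le_pos; lra); lra. }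
  intros h m x Hh Hm.
  rewrite Rmult_plus_distr_r, Rmult_assoc.
  specialize (HCb h m x Hh Hm); specialize (HCb' h m x Hh Hm).
  eapply (norm_le_eq (V := X)); [|apply (norm_plus_le (V := X));
    [apply (norm_scal_le (V := X) (twt q)); [apply Rle_refl|exact HCb']|exact HCb]].
  rewrite <- vsum_scal, <- vsum_plus; apply vsum_ext; intros j _.
  assert (L : is_linear (S (INR j * h))).
  { apply (sg_linear S HS), Rmult_le_pos; [apply pos_INR|lra]. }
  cbn [coef_op coef_eval fold_right].
  fold (coef_op S f h x); fold (coef_eval f 0).
  rewrite Rmult_0_r, phi_at_0.
  rewrite !(linear_minus _ _ _ L), (linear_plus _ L), !(linear_scal _ L).
  module.
Qed.

(** Summation by parts turns n increments of size W1 h into a total of at most (n h) W1, bounded on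
    the time interval. *)
Lemma smoothing (Tm : R) f : admissible f -> exists C, 0 < C /\
  forall h n w W0 W1, 0 < h <= 1 -> INR n * h <= Tm -> 0 <= W1 ->
  norm (w 0%nat) <= W0 ->
  (forall j, (Datatypes.S j < n)%nat ->
     norm (minus (w (Datatypes.S j)) (w j)) <= W1 * h) ->
  norm (vsum (seq 0 n) (fun j => S (INR (n - 1 - j) * h)
    (minus (coef_op S f h (w j)) (scal (coef_eval f 0) (w j))))) <= C * (W0 + W1).
Proof.
intros Hf; destruct (sum_coef_difference_bounded Tm f Hf) as [C [HC HCb]].
exists (C * (1 + Rabs Tm)); split; [pose proof (Rabs_pos Tm); nra|].
intros h n w W0 W1 Hh Hn HW1 HW0 Hw.
assert (Hjh : forall j, 0 <= INR j * h) by (intros; apply Rmult_le_pos; [apply pos_INR|lra]).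
assert (HA := abel_summation (V := X) (fun i v => S (INR i * h)
  (minus (coef_op S f h v) (scal (coef_eval f 0) v))) C (W1 * h) n).
eapply Rle_trans; [apply HA|]; clear HA.
- intros i x y.
  assert (L := sg_linear S HS _ (Hjh i)).
  assert (L' := coef_op_linear S HS f h Hf ltac:(lra)).
  rewrite (linear_minus _ _ _ L'), !(linear_minus _ _ _ L), !(linear_scal _ L).
  rewrite (linear_minus _ _ _ L); module.
- intros m v Hm; apply HCb; [easy|].
  eapply Rle_trans; [|exact Hn]; apply Rmult_le_compat_r; [lra|now apply le_INR].
- lra.
- apply Rmult_le_pos; lra.
- exact Hw.
- assert (HT := Rabs_pos Tm); assert (HT' := Rle_abs Tm).
  assert (HW00 := Rle_trans _ _ _ (norm_ge_0 (w 0%nat)) HW0).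
  replace (INR n * (C * (W1 * h))) with (C * ((INR n * h) * W1)) by ring.
  assert ((INR n * h) * W1 <= Rabs Tm * W1) by (apply Rmult_le_compat_r; lra).
  replace (C * (1 + Rabs Tm) * (W0 + W1)) with
    (C * W0 + C * (Rabs Tm * W1) + C * (W1 + Rabs Tm * W0)) by ring.
  assert (0 <= C * (W1 + Rabs Tm * W0)).
  { apply Rmult_le_pos; [lra|]; assert (0 <= Rabs Tm * W0) by (apply Rmult_le_pos; lra); lra. }
  assert (C * norm (w 0%nat) <= C * W0) by (apply Rmult_le_compat_l; [lra|exact HW0]).
  assert (C * (INR n * h * W1) <= C * (Rabs Tm * W1)) by (apply Rmult_le_compat_l; lra).
  eapply Rle_trans; [apply Rplus_le_compat_r; eassumption|]; lra.
Qed.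

End Smoothing.

(** * Variation of constants for Taylor polynomials *)

(** Difference quotients inherit the relation by linearity and their limits by closedness. *)
Lemma integrated_generator_deriv {X : CompleteNormedModule R_AbsRing} (S : R -> X -> X)
    (HS : analytic_semigroup S) a b (f k : R -> X) t l l' :
  a < b -> a <= t <= b ->
  (forall r, a <= r <= b -> integrated_generator S (f r) (k r)) ->
  has_deriv_on a b f t l -> has_deriv_on a b k t l' ->
  integrated_generator S l l'.
Proof.
intros Hab Ht Hfk Hf Hk; apply (integrated_generator_closed S HS); intros eps He.
assert (Hf' := proj1 (filterlim_norm_le (punctured a b t) _ _) Hf eps He).
assert (Hk' := proj1 (filterlim_norm_le (punctured a b t) _ _) Hk eps He).
destruct (@filter_ex _ _ (punctured_proper a b t Hab Ht)
  (fun r => (norm (minus (scal (/ (r - t)) (minus (f r) (f t))) l) <= eps /\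
     norm (minus (scal (/ (r - t)) (minus (k r) (k t))) l') <= eps) /\ a <= r <= b))
  as [r [[H1 H2] Hr]].
{ apply filter_and; [now apply filter_and|].
  apply punctured_spec; exists 1; split; [lra|]; intros; lra. }
(* This is the relation for the pair (0, 0), the first summand to which the scaled difference is
   added. *)
assert (H0 := integrated_generator_lincomb S HS _ _ _ _ (- (1)) (Hfk t Ht) (Hfk t Ht)).
assert (H := integrated_generator_lincomb S HS _ _ _ _ (/ (r - t)) H0
  (integrated_generator_lincomb S HS _ _ _ _ (- (1)) (Hfk r Hr) (Hfk t Ht))).
eexists; eexists; split; [exact H|]; split.
- apply (norm_le_eq (minus (scal (/ (r - t)) (minus (f r) (f t))) l)); [module|easy].
- apply (norm_le_eq (minus (scal (/ (r - t)) (minus (k r) (k t))) l')); [module|easy].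
Qed.

(** By the relation, tau^k x_k / k! equals tau^k phi_k x_k - tau^(k+1) phi_(k+1) (x_(k+1) - F_k).
    Summed over k, the terms with x telescope and those with F remain. *)
Lemma tpoly_variation_of_constants {X : NormedModule R_AbsRing} (ph : nat -> R -> X -> X)
    (x F : nat -> X) tau n :
  (forall k, lin (ph k tau)) ->
  (forall k, (k < n)%nat -> ph k tau (x k) = plus (scal (/ INR (fact k)) (x k))
     (scal tau (ph (S k) tau (minus (x (S k)) (F k))))) ->
  tpoly x n tau = minus (plus (ph 0%nat tau (x 0%nat))
    (vsum (seq 0 n) (fun k => scal (tau ^ S k) (ph (S k) tau (F k)))))
    (scal (tau ^ n) (ph n tau (x n))).
Proof.
intros Hl; induction n as [|n IH]; intros H.
- unfold tpoly; simpl; module.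
- rewrite tpoly_S_r, IH by (intros k Hk; apply H; lia).
  rewrite (H n), (lin_minus (ph (S n) tau)) by auto.
  rewrite seq_S, vsum_app; simpl; module.
Qed.

(** * Expansion of the internal stages *)

(** [F k] stands for the [k]-th derivative of [g(u(t))], and [J], [K], [L], [B]
    for g'(u(t)), its first two time derivatives, and g''(u(t)). *)
Section StageExpansion.
Context {X : NormedModule R_AbsRing} (ph : nat -> R -> X -> X) (m : expRK) (h : R).
Context (J K L : X -> X) (B : X -> X -> X) (F : nat -> X).

(** The coefficients of h^2, h^3 and h^4 in the deviation of a stage from the Taylor polynomial of
    the solution. The terms with psi measure how badly the stage reproduces the polynomial; the sums
    propagate the deviations of earlier stages through the derivatives of [g]. *)
Definition stage2 i : X := cop ph (psi_coef m 2 i) h (F 1%nat).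
Definition stage3 i : X :=
  plus (cop ph (psi_coef m 3 i) h (F 2%nat))
    (vsum (seq 2 (i - 2)) (fun j => cop ph (acoef m i j) h (J (stage2 j)))).
Definition stage4 i : X :=
  plus (cop ph (psi_coef m 4 i) h (F 3%nat))
    (vsum (seq 2 (i - 2)) (fun j => cop ph (acoef m i j) h
       (plus (J (stage3 j)) (scal (node m j) (K (stage2 j)))))).
Definition stage_error i : X :=
  plus (scal (h ^ 2) (stage2 i)) (plus (scal (h ^ 3) (stage3 i)) (scal (h ^ 4) (stage4 i))).
(** The share of the stage deviations in the h^4 coefficient of [g] at the stage; the half in front
    of [B] is that of the second-order Taylor term. *)
Definition stage_rest i : X :=
  plus (J (stage4 i)) (plus (scal (node m i) (K (stage3 i)))
    (plus (scal (node m i ^ 2 / 2) (L (stage2 i)))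
      (scal (/ 2) (B (stage2 i) (stage2 i))))).
Definition stage_weight i : X := plus (scal (node_pow m i 4) (F 4%nat)) (stage_rest i).
(** The expansion, through h^4, of [g] at the approximate stage minus [g] at the solution; it stands
    in for the difference D_{ni} of the scheme. *)
Definition stage_increment i : X :=
  plus (scal h (scal (node m i) (F 1%nat)))
  (plus (scal (h ^ 2) (plus (scal (node_pow m i 2) (F 2%nat)) (J (stage2 i))))
  (plus (scal (h ^ 3) (plus (scal (node_pow m i 3) (F 3%nat))
           (plus (J (stage3 i)) (scal (node m i) (K (stage2 i))))))
    (scal (h ^ 4) (stage_weight i)))).

Hypothesis ph_lin : forall k tau, 0 <= tau -> lin (ph k tau).
Hypothesis Hh : 0 <= h.
Hypothesis Hm : expRK_wf m.
Hypothesis HJ : lin J.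
Hypothesis HK : lin K.
Hypothesis HL : lin L.
Hypothesis HB1 : forall v, lin (B v).
Hypothesis HB2 : forall w, lin (fun v => B v w).

Let cop_acoef_lin i j : (2 <= j < i)%nat -> (i <= stages m)%nat ->
  lin (cop ph (acoef m i j) h).
Proof. intros Hj Hi; apply (cop_lin ph ph_lin); [now apply Hm|easy]. Qed.

Let cop_bcoef_lin i : (2 <= i <= stages m)%nat -> lin (cop ph (bcoef m i) h).
Proof. intros Hi; apply (cop_lin ph ph_lin); [now apply Hm|easy]. Qed.

Lemma cop_stage_increment (A : X -> X) i : lin A ->
  A (stage_increment i) =
  plus (scal h (scal (node m i) (A (F 1%nat))))
  (plus (scal (h ^ 2) (plus (scal (node_pow m i 2) (A (F 2%nat))) (A (J (stage2 i)))))
  (plus (scal (h ^ 3) (plus (scal (node_pow m i 3) (A (F 3%nat)))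
           (A (plus (J (stage3 i)) (scal (node m i) (K (stage2 i)))))))
    (scal (h ^ 4) (A (stage_weight i))))).
Proof. intros [Hp Hs]; unfold stage_increment; now repeat rewrite ?Hp, ?Hs. Qed.

Lemma vsum_increment (l : list nat) (a1 a2 a3 : nat -> R) (P1 P2 P3 P4 P5 P6 : nat -> X) :
  vsum l (fun j => plus (scal h (scal (a1 j) (P1 j)))
    (plus (scal (h ^ 2) (plus (scal (a2 j) (P2 j)) (P3 j)))
    (plus (scal (h ^ 3) (plus (scal (a3 j) (P4 j)) (P5 j))) (scal (h ^ 4) (P6 j))))) =
  plus (scal h (vsum l (fun j => scal (a1 j) (P1 j))))
    (plus (scal (h ^ 2) (plus (vsum l (fun j => scal (a2 j) (P2 j))) (vsum l P3)))
    (plus (scal (h ^ 3) (plus (vsum l (fun j => scal (a3 j) (P4 j))) (vsum l P5)))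
      (scal (h ^ 4) (vsum l P6)))).
Proof.
induction l as [|j l IH]; simpl vsum; [module|].
refine (eq_trans (f_equal _ IH) _); module.
Qed.

Lemma cop_sum_increment (l : list nat) (f : nat -> coef) :
  (forall j, In j l -> admissible (f j)) ->
  vsum l (fun j => cop ph (f j) h (stage_increment j)) =
  plus (scal h (vsum l (fun j => scal (node m j) (cop ph (f j) h (F 1%nat)))))
    (plus (scal (h ^ 2) (plus
       (vsum l (fun j => scal (node_pow m j 2) (cop ph (f j) h (F 2%nat))))
       (vsum l (fun j => cop ph (f j) h (J (stage2 j))))))
    (plus (scal (h ^ 3) (plus
       (vsum l (fun j => scal (node_pow m j 3) (cop ph (f j) h (F 3%nat))))
       (vsum l (fun j => cop ph (f j) h
          (plus (J (stage3 j)) (scal (node m j) (K (stage2 j))))))))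
      (scal (h ^ 4) (vsum l (fun j => cop ph (f j) h (stage_weight j)))))).
Proof.
intros Hf; refine (eq_trans (vsum_ext _ _ _ _) (vsum_increment _ _ _ _ _ _ _ _ _ _)).
intros j Hj; apply (cop_stage_increment (cop ph (f j) h)), (cop_lin ph ph_lin); auto.
Qed.

Lemma node_pow_1 i : node_pow m i 1 = node m i.
Proof. unfold node_pow; simpl; field. Qed.

(** By the choice of the three coefficients, the terms F_1 to F_3 of the Taylor polynomial together
    with the deviation reproduce the sum in the stage equation up to h^5. *)
Lemma stage_error_eq i : (2 <= i <= stages m)%nat ->
  plus (vsum (seq 1 3) (fun k =>
    scal ((node m i * h) ^ S k) (ph (S k) (node m i * h) (F k)))) (stage_error i) =
  minus (scal h (vsum (seq 2 (i - 2)) (fun j => cop ph (acoef m i j) h (stage_increment j))))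
    (scal (h ^ 5) (vsum (seq 2 (i - 2)) (fun j => cop ph (acoef m i j) h (stage_weight j)))).
Proof.
intros Hi; unfold stage_error, stage3 at 1, stage4 at 1, stage2 at 1; rewrite !(cop_psi ph).
rewrite cop_sum_increment.
2: { intros j Hj; apply in_seq in Hj; apply Hm; lia. }
cbn [Nat.sub].
rewrite (vsum_ext _ (fun k => scal (node_pow m k 1) _)
  (fun k => scal (node m k) (cop ph (acoef m i k) h (F 1%nat))))
  by (intros; now rewrite node_pow_1).
simpl vsum; module.
Qed.

Hypothesis Hoc : operator_conditions ph m h.

Let ls := seq 2 (S (stages m) - 2).

Lemma vsum_plus_zero (l : list nat) (P Q : nat -> X) :
  vsum l P = zero -> vsum l Q = zero -> vsum l (fun i => plus (P i) (Q i)) = zero.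
Proof. intros HP HQ; rewrite vsum_plus, HP, HQ; apply plus_zero_l. Qed.

Lemma vsum_scal_zero (l : list nat) (a : R) (P : nat -> X) :
  vsum l P = zero -> vsum l (fun i => scal a (P i)) = zero.
Proof. intros HP; rewrite vsum_scal, HP; module. Qed.

Lemma stage_order3 :
  vsum ls (fun i => cop ph (bcoef m i) h (J (stage2 i))) = zero.
Proof. exact (oc3 _ _ _ Hoc J (F 1%nat) HJ). Qed.

Lemma stage_order4 :
  vsum ls (fun i => cop ph (bcoef m i) h
    (plus (J (stage3 i)) (scal (node m i) (K (stage2 i))))) = zero.
Proof.
refine (eq_trans (vsum_ext _ _ _ _) (vsum_plus_zero ls _ _ (oc5 _ _ _ Hoc J (F 2%nat) HJ)
  (vsum_plus_zero ls _ _ (oc6 _ _ _ Hoc J (F 1%nat) HJ) (oc7 _ _ _ Hoc K (F 1%nat) HK)))).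
intros i Hi; apply in_seq in Hi.
destruct (cop_bcoef_lin i ltac:(lia)) as [Hp Hs].
unfold stage3; rewrite (proj1 HJ), !Hp, Hs; fold (stage2 i); module.
Qed.

(** Unfolding the stage coefficients splits the sum into eight pieces, one for each of the
    conditions 9 to 16. *)
Lemma stage_rest_sum :
  vsum ls (fun i => scal (coef_eval (bcoef m i) 0) (stage_rest i)) = zero.
Proof.
refine (eq_trans (vsum_ext _ _ _ _)
  (vsum_plus_zero ls _ _ (oc9 _ _ _ Hoc J (F 3%nat) HJ)
  (vsum_plus_zero ls _ _ (oc10 _ _ _ Hoc J (F 2%nat) HJ)
  (vsum_plus_zero ls _ _ (oc11 _ _ _ Hoc J (F 1%nat) HJ)
  (vsum_plus_zero ls _ _ (oc12 _ _ _ Hoc J K (F 1%nat) HJ HK)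
  (vsum_plus_zero ls _ _ (oc13 _ _ _ Hoc K (F 2%nat) HK)
  (vsum_plus_zero ls _ _ (oc14 _ _ _ Hoc J K (F 1%nat) HJ HK)
  (vsum_plus_zero ls _ _ (vsum_scal_zero ls (/ 2) _ (oc16 _ _ _ Hoc L (F 1%nat) HL))
    (vsum_scal_zero ls (/ 2) _ (oc15 _ _ _ Hoc B (F 1%nat) HB1 HB2)))))))))).
intros i Hi; apply in_seq in Hi.
assert (E : vsum (seq 2 (i - 2)) (fun j => cop ph (acoef m i j) h
    (plus (J (stage3 j)) (scal (node m j) (K (stage2 j))))) =
  plus (vsum (seq 2 (i - 2)) (fun j => cop ph (acoef m i j) h
      (J (cop ph (psi_coef m 3 j) h (F 2%nat)))))
  (plus (vsum (seq 2 (i - 2)) (fun j => cop ph (acoef m i j) h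
      (J (vsum (seq 2 (j - 2)) (fun k => cop ph (acoef m j k) h (J (stage2 k)))))))
    (vsum (seq 2 (i - 2)) (fun j => scal (node m j) (cop ph (acoef m i j) h (K (stage2 j))))))).
{ rewrite <- !vsum_plus; apply vsum_ext; intros j Hj; apply in_seq in Hj.
  destruct (cop_acoef_lin i j ltac:(lia) ltac:(lia)) as [Hp Hs].
  unfold stage3; rewrite (proj1 HJ), !Hp, Hs; module. }
unfold stage_rest, stage4, stage3 at 2; rewrite E, !(proj1 HJ), (proj1 HK).
fold (stage2 i); module.
Qed.

Lemma step_error_eq :
  vsum (seq 1 4) (fun k => scal (h ^ S k) (ph (S k) h (F k))) =
  plus (scal h (vsum ls (fun i => cop ph (bcoef m i) h (stage_increment i))))
    (scal (h ^ 5) (minus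
       (minus (ph 5%nat h (F 4%nat)) (scal (phi 5 0) (F 4%nat)))
       (vsum ls (fun i => minus (cop ph (bcoef m i) h (stage_weight i))
          (scal (coef_eval (bcoef m i) 0) (stage_weight i)))))).
Proof.
assert (E : vsum ls (fun i => scal (coef_eval (bcoef m i) 0) (stage_weight i)) =
  scal (phi 5 0) (F 4%nat)).
{ refine (eq_trans (y := plus (vsum ls (fun i =>
    scal (coef_eval (bcoef m i) 0 * node_pow m i 4) (F 4%nat)))
    (vsum ls (fun i => scal (coef_eval (bcoef m i) 0) (stage_rest i)))) _ _).
  - rewrite <- vsum_plus; apply vsum_ext; intros i _; unfold stage_weight; module.
  - rewrite stage_rest_sum, plus_zero_r, vsum_scal_rsum; unfold ls.
    now rewrite (oc8 _ _ _ Hoc). }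
rewrite cop_sum_increment.
2: { intros j Hj; apply in_seq in Hj; apply Hm; lia. }
rewrite vsum_minus, E, stage_order3, stage_order4.
unfold ls; rewrite (oc1 _ _ _ Hoc), (oc2 _ _ _ Hoc), (oc4 _ _ _ Hoc).
simpl vsum; module.
Qed.

End StageExpansion.

(** * The nonlinearity along the solution *)

Lemma tpoly_ext {V : NormedModule R_AbsRing} (c c' : nat -> V) n x :
  (forall j, (j < n)%nat -> c j = c' j) -> tpoly c n x = tpoly c' n x.
Proof.
intros H; apply vsum_ext; intros j Hj; apply in_seq in Hj; rewrite H; [easy|lia].
Qed.

Lemma multilinear_lin1 {X : NormedModule R_AbsRing} (m : list X -> X) :
  multilinear 1 m -> lin (fun y => m (y :: nil)).
Proof.
intros Hm; split.
- intros x y; exact (multilinear_plus 1 m nil nil x y Hm eq_refl).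
- intros a x; exact (multilinear_scal 1 m nil nil a x Hm eq_refl).
Qed.

Lemma multilinear_lin2 {X : NormedModule R_AbsRing} (m : list X -> X) :
  multilinear 2 m ->
  (forall x, lin (fun y => m (x :: y :: nil))) /\ (forall y, lin (fun x => m (x :: y :: nil))).
Proof.
intros Hm; split; intros z; split.
- intros x y; exact (multilinear_plus 2 m (z :: nil) nil x y Hm eq_refl).
- intros a x; exact (multilinear_scal 2 m (z :: nil) nil a x Hm eq_refl).
- intros x y; exact (multilinear_plus 2 m nil (z :: nil) x y Hm eq_refl).
- intros a x; exact (multilinear_scal 2 m nil (z :: nil) a x Hm eq_refl).
Qed.

Section Nonlinearity.
Context {X : NormedModule R_AbsRing}.
Context (g : X -> X) (t0 T : R) (u : R -> X) (rho : R) (p : nat).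
Context (du : nat -> R -> X) (K : R) (dg : nat -> X -> list X -> X) (M : R).
Let N := strip t0 T u rho.
Hypothesis HtT : t0 < T.
Hypothesis Hrho : 0 < rho.
Hypothesis Hp : (6 <= p)%nat.
Hypothesis HK : 1 <= K.
Hypothesis HM : 0 <= M.
Hypothesis Hu0 : forall t, t0 <= t <= T -> du 0%nat t = u t.
Hypothesis Hdu : forall k t, (k < p)%nat -> t0 <= t <= T ->
  has_deriv_on t0 T (du k) t (du (S k) t).
Hypothesis HduK : forall k t, (k <= p)%nat -> t0 <= t <= T -> norm (du k t) <= K.
Hypothesis Hg0 : forall x, N x -> dg 0%nat x nil = g x.
Hypothesis Hml : forall k x, (k <= p)%nat -> N x -> multilinear k (dg k x).
Hypothesis Hbd : forall k x vs, (1 <= k <= p)%nat -> N x -> length vs = k ->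
  norm (dg k x vs) <= M * norms_prod vs.
Hypothesis Hfr : forall k x, (k < p)%nat -> N x ->
  forall eps : posreal, exists delta : posreal, forall d : X,
  norm d < delta -> forall vs, length vs = k ->
  norm (minus (minus (dg k (plus x d) vs) (dg k x vs)) (dg (S k) x (d :: vs)))
    <= eps * norm d * norms_prod vs.

(** The [k]-th time derivative of [dg (length ys) (u t) ys]. *)
Definition along (ys : list X) (k : nat) (t : R) : X :=
  comp_deriv dg (u t) (fun j => du j t) ys k.

Lemma in_strip t : t0 <= t <= T -> N (u t).
Proof.
intros Ht; exists t; split; [easy|].
replace (minus (u t) (u t)) with (zero : X) by module; now rewrite norm_zero.
Qed.

Lemma near_in_strip t x : t0 <= t <= T -> norm (minus x (u t)) < rho -> N x.
Proof. intros Ht Hx; now exists t. Qed.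

Lemma pow_ge_base j : (1 <= j)%nat -> K <= K ^ j.
Proof.
intros Hj; rewrite <- (pow_1 K) at 1; apply Rle_pow; [easy|lia].
Qed.

Lemma along_deriv ys k t : t0 <= t <= T -> (k + length ys < p)%nat ->
  has_deriv_on t0 T (along ys k) t (along ys (S k) t).
Proof.
intros Ht Hk; apply (comp_deriv_deriv p N dg M Hml Hbd Hfr t0 T u du); auto.
- now apply in_strip.
- apply (has_deriv_on_ext t0 T (du 0%nat)); [easy|exact Hu0|apply Hdu; [lia|easy]].
- intros j Hj; apply Hdu; [lia|easy].
Qed.

Lemma along_norm k r : (1 <= k + r <= p)%nat -> exists C, 0 < C /\
  forall ys t, length ys = r -> t0 <= t <= T ->
  norm (along ys k t) <= C * norms_prod ys.
Proof.
intros Hk; set (C := INR (length (comp_lists k)) * (M * K ^ k)).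
assert (HC : 0 <= C).
{ apply Rmult_le_pos; [apply pos_INR|apply Rmult_le_pos; [easy|apply pow_le; lra]]. }
exists (C + 1); split; [lra|]; intros ys t Hys Ht.
apply Rle_trans with (C * norms_prod ys).
- unfold C; rewrite Rmult_assoc; apply (comp_deriv_norm p N dg M Hbd).
  + now apply in_strip.
  + lia.
  + lra.
  + easy.
  + intros j Hj; eapply Rle_trans; [apply HduK; [lia|easy]|apply pow_ge_base; lia].
- apply Rmult_le_compat_r; [apply norms_prod_ge_0|lra].
Qed.

Lemma along_lipschitz k r : (k + r < p)%nat -> exists C, 0 < C /\
  forall ys s t, length ys = r -> t0 <= s <= T -> t0 <= t <= T ->
  norm (minus (along ys k s) (along ys k t)) <= C * Rabs (s - t) * norms_prod ys.
Proof.
intros Hk; destruct (along_norm (S k) r ltac:(lia)) as [C [HC HCb]].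
exists C; split; [easy|]; intros ys s t Hys Hs Ht.
replace (C * Rabs (s - t) * norms_prod ys) with (C * norms_prod ys * Rabs (s - t)) by ring.
apply (has_deriv_on_lipschitz t0 T (along ys k) (along ys (S k))); auto.
intros r' Hr'; apply along_deriv; [easy|lia].
Qed.

Lemma along_multilinear k r t : (k + r <= p)%nat -> t0 <= t <= T ->
  multilinear r (fun ys => along ys k t).
Proof.
intros Hk Ht; apply (comp_deriv_multilinear p N dg Hml); [now apply in_strip|easy].
Qed.

(** The Taylor polynomial of [u] at [t] stays defined beyond the time [T], which
    matters for nodes larger than 1. *)
Definition upoly (t tau : R) : X := tpoly (fun j => du j t) 6 tau.

Let dupoly t j tau := tpoly (fun l => du (j + l)%nat t) (6 - j) tau.

Lemma dupoly_deriv t j a b tau :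
  has_deriv_on a b (dupoly t j) tau (dupoly t (S j) tau).
Proof.
unfold dupoly; destruct (6 - j)%nat as [|n] eqn:E.
- replace (6 - S j)%nat with 0%nat by lia; exact (has_deriv_on_const a b zero tau).
- replace (6 - S j)%nat with n by lia.
  assert (H := tpoly_deriv (fun l => du (j + l)%nat t) n a b tau).
  refine (has_deriv_on_eq _ _ _ _ _ _ _ H); apply tpoly_ext.
  intros l _; f_equal; lia.
Qed.

Lemma dupoly_norm t j tau : t0 <= t <= T -> 0 <= tau <= 1 ->
  norm (dupoly t j tau) <= 6 * K.
Proof.
intros Ht Htau; eapply Rle_trans; [apply (tpoly_norm_le _ _ _ K); [easy|]|].
- intros l Hl; apply HduK; [lia|easy].
- apply Rmult_le_compat_r; [lra|]; replace 6 with (INR 6) by (simpl; lra); apply le_INR; lia.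
Qed.

Lemma dupoly_0 t j : (j < 6)%nat -> dupoly t j 0 = du j t.
Proof.
intros Hj; unfold dupoly; replace (6 - j)%nat with (S (5 - j)) by lia.
rewrite tpoly_0; f_equal; lia.
Qed.

Lemma upoly_near t tau : t0 <= t <= T -> 0 <= tau <= 1 ->
  norm (minus (upoly t tau) (u t)) <= 6 * K * tau.
Proof.
intros Ht Htau.
assert (E : upoly t 0 = u t) by (unfold upoly; rewrite tpoly_0; now apply Hu0).
rewrite <- E; replace (6 * K * tau) with (6 * K * Rabs (tau - 0))
  by (rewrite Rminus_0_r, Rabs_pos_eq; lra).
apply (has_deriv_on_lipschitz 0 1 (upoly t) (dupoly t 1)); try lra.
- intros s Hs; exact (dupoly_deriv t 0 0 1 s).
- intros s Hs; now apply dupoly_norm.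
Qed.

(** The Taylor polynomial may use up half of the strip. A further quarter is reserved for the stage
    deviations and an eighth for the perturbation of the numerical stages. *)
Definition delta0 : R := Rmin 1 (rho / (12 * K)).

Lemma delta0_bounds : 0 < delta0 <= 1 /\ 6 * K * delta0 <= rho / 2.
Proof.
unfold delta0; split; [split|].
- apply Rmin_glb_lt; [lra|apply Rdiv_lt_0_compat; lra].
- apply Rmin_l.
- apply Rle_trans with (6 * K * (rho / (12 * K))); [|right; field; lra].
  apply Rmult_le_compat_l; [lra|apply Rmin_r].
Qed.

Lemma upoly_in_ball t tau : t0 <= t <= T -> 0 <= tau <= delta0 ->
  norm (minus (upoly t tau) (u t)) <= rho / 2.
Proof.
intros Ht Htau; destruct delta0_bounds as [H1 H2].
eapply Rle_trans; [apply upoly_near; lra|].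
eapply Rle_trans; [|exact H2]; apply Rmult_le_compat_l; lra.
Qed.

(** At 0 the polynomial and the solution have the same derivatives up to order 5. The expansion
    along the polynomial hence has the time derivatives along the solution as coefficients, even if
    t + tau exceeds T. *)
Lemma upoly_taylor n r : (n <= 5)%nat -> (1 <= n + r <= p)%nat -> exists C, 0 < C /\
  forall ys t tau, length ys = r -> t0 <= t <= T -> 0 <= tau <= delta0 ->
  norm (minus (dg r (upoly t tau) ys) (tpoly (fun k => along ys k t) n tau))
    <= C * tau ^ n * norms_prod ys.
Proof.
intros Hn Hnr; set (C := INR (length (comp_lists n)) * (M * (6 * K) ^ n)).
assert (HC : 0 <= C).
{ apply Rmult_le_pos; [apply pos_INR|apply Rmult_le_pos; [easy|apply pow_le; lra]]. }
exists (C + 1); split; [lra|]; intros ys t tau Hys Ht Htau.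
destruct delta0_bounds as [Hd1 Hd2].
set (df := fun k s => comp_deriv dg (upoly t s) (fun j => dupoly t j s) ys k).
assert (HN : forall s, 0 <= s <= delta0 -> N (upoly t s)).
{ intros s Hs; apply (near_in_strip t); [easy|].
  eapply Rle_lt_trans; [now apply upoly_in_ball|lra]. }
assert (H := taylor_bound 0 delta0 df n (C * norms_prod ys)).
assert (H' : norm (minus (df 0%nat tau)
  (tpoly (fun j => df (0 + j)%nat 0) n (tau - 0))) <= C * norms_prod ys * (tau - 0) ^ n).
{ apply H; auto.
  - intros k s Hk Hs; apply (comp_deriv_deriv p N dg M Hml Hbd Hfr 0 delta0 (upoly t) (dupoly t));
      auto; try lia.
    + exact (dupoly_deriv t 0 0 delta0 s).
    + intros j _; apply dupoly_deriv.
  - intros s Hs; unfold C; rewrite Rmult_assoc; apply (comp_deriv_norm p N dg M Hbd); auto.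
    + lia.
    + lra.
    + intros j Hj; eapply Rle_trans; [apply dupoly_norm; lra|].
      rewrite <- (pow_1 (6 * K)) at 1; apply Rle_pow; [lra|lia]. }
rewrite Rminus_0_r in H'.
assert (E0 : df 0%nat tau = dg r (upoly t tau) ys).
{ unfold df; now rewrite comp_deriv_0, Hys. }
rewrite E0, (tpoly_ext _ (fun k => along ys k t)) in H'.
- eapply Rle_trans; [exact H'|].
  replace (C * norms_prod ys * tau ^ n) with (C * (tau ^ n * norms_prod ys)) by ring.
  rewrite Rmult_assoc; apply Rmult_le_compat_r; [|lra].
  apply Rmult_le_pos; [apply pow_le; lra|apply norms_prod_ge_0].
- intros j Hj; unfold df, along; simpl plus.
  assert (E : upoly t 0 = u t) by (unfold upoly; rewrite tpoly_0; now apply Hu0).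
  rewrite E; apply comp_deriv_ext; intros i Hi; apply dupoly_0; lia.
Qed.

(** The chain rule along the segment from x to x + e, whose second and higher derivatives vanish;
    the segment stays in the strip since balls are convex. *)
Lemma segment_taylor : exists C, 0 < C /\ forall t x e, t0 <= t <= T ->
  norm (minus x (u t)) < rho -> norm (minus (plus x e) (u t)) < rho ->
  norm (minus (g (plus x e)) (plus (g x) (plus (dg 1%nat x (e :: nil))
    (scal (/ 2) (dg 2%nat x (e :: e :: nil)))))) <= C * norm e ^ 3.
Proof.
set (C := INR (length (comp_lists 3)) * M).
assert (HC : 0 <= C) by (apply Rmult_le_pos; [apply pos_INR|easy]).
exists (C + 1); split; [lra|]; intros t x e Ht Hx Hxe.
set (c := fun s => plus x (scal s e) : X).
set (dc := fun k s => match k with O => c s | 1%nat => e | _ => zero end : X).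
assert (HN : forall s, 0 <= s <= 1 -> N (c s)).
{ intros s Hs; apply (near_in_strip t); [easy|]; unfold c.
  apply Rle_lt_trans with ((1 - s) * norm (minus x (u t)) + s * norm (minus (plus x e) (u t))).
  - apply (norm_le_eq (plus (scal (1 - s) (minus x (u t)))
      (scal s (minus (plus x e) (u t))))); [module|].
    apply norm_plus_le; (rewrite norm_scal_pos; lra).
  - destruct (Req_dec s 0) as [->|Hs0]; [lra|]; nra. }
assert (Hdc : forall k s, has_deriv_on 0 1 (dc k) s (dc (S k) s)).
{ intros [|[|k]] s; simpl.
  - apply (has_deriv_on_eq 0 1 c s (plus zero (scal 1 e))); [module|].
    apply (has_deriv_on_plus 0 1 (fun _ => x) (fun s => scal s e));
      [apply has_deriv_on_const|].
    apply is_derive_has_deriv_on, (is_derive_scal_l (K := R_AbsRing) (fun s => s)).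
    apply (is_derive_id (K := R_AbsRing)).
  - exact (has_deriv_on_const 0 1 e s).
  - exact (has_deriv_on_const 0 1 zero s). }
set (df := fun k s => comp_deriv dg (c s) (fun j => dc j s) nil k).
assert (H' : norm (minus (df 0%nat 1)
  (tpoly (fun j => df (0 + j)%nat 0) 3 (1 - 0))) <= C * norm e ^ 3 * (1 - 0) ^ 3).
{ apply (taylor_bound 0 1 df 3); auto; try lra.
  - intros k s Hk Hs; apply (comp_deriv_deriv p N dg M Hml Hbd Hfr 0 1 c dc); auto.
    + simpl; lia.
    + exact (Hdc 0%nat s).
  - intros s Hs; unfold C; rewrite Rmult_assoc, <- (Rmult_1_r (M * norm e ^ 3)).
    apply (comp_deriv_norm p N dg M Hbd); auto.
    + simpl; lia.
    + apply norm_ge_0.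
    + intros [|[|j]] Hj; simpl dc; [lia|simpl; lra|].
      rewrite norm_zero; apply pow_le, norm_ge_0. }
replace ((1 - 0) ^ 3) with 1 in H' by ring; rewrite Rmult_1_r in H'.
assert (Ec : c 0 = x) by (unfold c; module).
assert (E0 : df 0%nat 1 = g (plus x e)).
{ unfold df; rewrite comp_deriv_0; simpl length; rewrite Hg0 by (apply HN; lra).
  unfold c; f_equal; module. }
assert (F0 : df 0%nat 0 = g x).
{ unfold df; rewrite comp_deriv_0, Ec; apply Hg0; rewrite <- Ec; apply HN; lra. }
assert (F1 : df 1%nat 0 = dg 1%nat x (e :: nil)).
{ unfold df, comp_deriv; simpl; rewrite Ec; module. }
assert (F2 : df 2%nat 0 = dg 2%nat x (e :: e :: nil)).
{ unfold df, comp_deriv; simpl; rewrite Ec.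
  assert (Hz : dg 1%nat x (zero :: nil) = zero).
  { apply (multilinear_zero 1 (dg 1%nat x) nil nil); [|easy].
    apply Hml; [lia|rewrite <- Ec; apply HN; lra]. }
  apply (eq_trans (y := plus (dg 2%nat x (e :: e :: nil)) (dg 1%nat x (zero :: nil))));
    [module|].
  refine (eq_trans (f_equal _ Hz) _); module. }
eapply Rle_trans; [|eapply Rle_trans; [exact H'|]].
- right; f_equal; unfold tpoly; simpl; rewrite E0, F0, F1, F2; module.
- apply Rmult_le_compat_r; [apply pow_le, norm_ge_0|lra].
Qed.

Lemma g_lipschitz : exists C, 0 < C /\ forall t x y, t0 <= t <= T ->
  norm (minus x (u t)) < rho -> norm (minus y (u t)) < rho ->
  norm (minus (g x) (g y)) <= C * norm (minus x y).
Proof.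
exists (M + 1); split; [lra|]; intros t x y Ht Hx Hy.
set (e := minus x y).
set (c := fun s => plus y (scal s e) : X).
assert (HN : forall s, 0 <= s <= 1 -> N (c s)).
{ intros s Hs; apply (near_in_strip t); [easy|]; unfold c, e.
  apply Rle_lt_trans with ((1 - s) * norm (minus y (u t)) + s * norm (minus x (u t))).
  - apply (norm_le_eq (plus (scal (1 - s) (minus y (u t)))
      (scal s (minus x (u t))))); [module|].
    apply norm_plus_le; (rewrite norm_scal_pos; lra).
  - destruct (Req_dec s 0) as [->|Hs0]; [lra|]; nra. }
set (dc := fun k s => match k with O => c s | 1%nat => e | _ => zero end : X).
assert (H := mean_value_inequality 0 1 (fun s => comp_deriv dg (c s) (fun j => dc j s) nil 0)
  (fun s => comp_deriv dg (c s) (fun j => dc j s) nil 1) (M * norm e) ltac:(lra)).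
assert (Hc : forall s, has_deriv_on 0 1 c s e).
{ intros s; apply (has_deriv_on_eq 0 1 c s (plus zero (scal 1 e))); [module|].
  apply (has_deriv_on_plus 0 1 (fun _ => y) (fun s => scal s e));
    [apply has_deriv_on_const|].
  apply is_derive_has_deriv_on, (is_derive_scal_l (K := R_AbsRing) (fun s => s)).
  apply (is_derive_id (K := R_AbsRing)). }
assert (H' : norm (minus (comp_deriv dg (c 1) (fun j => dc j 1) nil 0)
  (comp_deriv dg (c 0) (fun j => dc j 0) nil 0)) <= M * norm e * (1 - 0)).
{ apply H.
  - intros s Hs; apply (comp_deriv_deriv p N dg M Hml Hbd Hfr 0 1 c dc); auto.
    + simpl; lia.
    + intros j Hj; replace j with 0%nat by lia; exact (Hc s).
  - intros s Hs; unfold comp_deriv; simpl.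
    apply (norm_le_eq (dg 1%nat (c s) (e :: nil))); [module|].
    eapply Rle_trans; [apply Hbd; [lia|now apply HN|easy]|]; simpl; lra. }
rewrite !comp_deriv_0 in H'; simpl length in H'.
rewrite !Hg0 in H' by (apply HN; lra).
apply Rle_trans with (M * norm e); [|apply Rmult_le_compat_r; [apply norm_ge_0|lra]].
rewrite Rminus_0_r, Rmult_1_r in H'.
eapply Rle_trans; [|exact H'].
right; f_equal; f_equal; f_equal; unfold c, e; module.
Qed.

Lemma solution_taylor : exists C, 0 < C /\ forall t h, t0 <= t -> 0 <= h -> t + h <= T ->
  norm (minus (u (t + h)) (upoly t h)) <= C * h ^ 6.
Proof.
exists K; split; [lra|]; intros t h Ht Hh Hth.
assert (H := taylor_bound t T du 6 K).
rewrite <- Hu0 by lra.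
replace h with (t + h - t) at 2 3 by ring.
apply H; auto; try lra.
- intros k s Hk Hs; apply has_deriv_on_sub with t0 T; try lra; apply Hdu; [lia|lra].
- intros s Hs; apply HduK; [lia|lra].
Qed.

Lemma along_0 t : t0 <= t <= T -> along nil 0 t = g (u t).
Proof.
intros Ht; unfold along; rewrite comp_deriv_0; simpl; now apply Hg0, in_strip.
Qed.

(** A second-order expansion of [g] at the Taylor polynomial suffices, because the deviation is
    O(h^2) and its cube O(h^6). Each derivative of [g] is then expanded in time just far enough
    that, with the power of h in front of it, the error is O(h^5); this explains the orders 5, 3, 2,
    1 and 1. *)
Lemma g_stage_expansion (c Y : R) : 0 <= c -> 0 <= Y -> exists C h1, 0 < C /\ 0 < h1 <= 1 /\
  forall h t y2 y3 y4, 0 <= h <= h1 -> t0 <= t <= T ->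
  norm y2 <= Y -> norm y3 <= Y -> norm y4 <= Y ->
  let W := plus (upoly t (c * h))
    (plus (scal (h ^ 2) y2) (plus (scal (h ^ 3) y3) (scal (h ^ 4) y4))) in
  norm (minus W (u t)) <= 3 / 4 * rho /\
  norm (minus (minus (g W) (g (u t)))
    (plus (scal h (scal c (along nil 1 t)))
    (plus (scal (h ^ 2) (plus (scal (c ^ 2 / 2) (along nil 2 t)) (along (y2 :: nil) 0 t)))
    (plus (scal (h ^ 3) (plus (scal (c ^ 3 / 6) (along nil 3 t))
       (plus (along (y3 :: nil) 0 t) (scal c (along (y2 :: nil) 1 t)))))
      (scal (h ^ 4) (plus (scal (c ^ 4 / 24) (along nil 4 t))
        (plus (along (y4 :: nil) 0 t) (plus (scal c (along (y3 :: nil) 1 t))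
        (plus (scal (c ^ 2 / 2) (along (y2 :: nil) 2 t))
          (scal (/ 2) (along (y2 :: y2 :: nil) 0 t))))))))))) <= C * h ^ 5.
Proof.
intros Hc HY.
destruct (upoly_taylor 5 0 ltac:(lia) ltac:(lia)) as [C1 [HC1 Hr1]].
destruct (upoly_taylor 3 1 ltac:(lia) ltac:(lia)) as [C2 [HC2 Hr2]].
destruct (upoly_taylor 2 1 ltac:(lia) ltac:(lia)) as [C3 [HC3 Hr3]].
destruct (upoly_taylor 1 1 ltac:(lia) ltac:(lia)) as [C4 [HC4 Hr4]].
destruct (upoly_taylor 1 2 ltac:(lia) ltac:(lia)) as [C5 [HC5 Hr5]].
destruct segment_taylor as [C6 [HC6 Hr6]].
destruct delta0_bounds as [Hd1 Hd2].
(* The first fraction keeps c h within [delta0], the second keeps the stage deviation below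
   rho/4. *)
set (h1 := Rmin 1 (Rmin (delta0 / (c + 1)) (rho / (12 * (Y + 1))))).
assert (Hh1 : 0 < h1 <= 1 /\ c * h1 <= delta0 /\ 3 * Y * h1 <= rho / 4).
{ assert (P1 : 0 < delta0 / (c + 1)) by (apply Rdiv_lt_0_compat; lra).
  assert (P2 : 0 < rho / (12 * (Y + 1))) by (apply Rdiv_lt_0_compat; lra).
  assert (M1 : h1 <= 1) by apply Rmin_l.
  assert (M2 : h1 <= delta0 / (c + 1))
    by (eapply Rle_trans; [apply Rmin_r|apply Rmin_l]).
  assert (M3 : h1 <= rho / (12 * (Y + 1)))
    by (eapply Rle_trans; [apply Rmin_r|apply Rmin_r]).
  assert (M0 : 0 < h1) by (repeat apply Rmin_glb_lt; lra).
  assert (E1 : delta0 / (c + 1) * (c + 1) = delta0) by (field; lra).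
  assert (E2 : rho / (12 * (Y + 1)) * (12 * (Y + 1)) = rho) by (field; lra).
  assert (Q1 := Rmult_le_compat_l c _ _ Hc M2).
  assert (Q2 := Rmult_le_compat_l Y _ _ HY M3).
  set (x1 := delta0 / (c + 1)) in *; set (x2 := rho / (12 * (Y + 1))) in *.
  repeat split; nra. }
destruct Hh1 as [Hh1 [Hch1 HYh1]].
(* One summand for each remainder, in the order [r6], [r1] to [r5]; the last three bound the terms
   of [r7]. *)
set (C := C6 * (3 * Y) ^ 3 + (C1 * c ^ 5 + (C2 * c ^ 3 * Y + (C3 * c ^ 2 * Y + (C4 * c * Y +
  (C5 * c * Y ^ 2 + (2 * M * Y ^ 2 + 2 * M * Y ^ 2 + 4 * M * Y ^ 2))))))).
assert (HC : 0 <= C).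
{ unfold C; repeat apply Rplus_le_le_0_compat;
    repeat apply Rmult_le_pos; try apply pow_le; lra. }
exists (C + 1), h1; split; [lra|]; split; [easy|].
intros h t y2 y3 y4 Hh Ht H2 H3 H4.
set (q := upoly t (c * h) : X).
set (e := plus (scal (h ^ 2) y2) (plus (scal (h ^ 3) y3) (scal (h ^ 4) y4)) : X).
(* As e = h^2 y2 + h^3 w, the quadratic term is h^4 times its value at (y2, y2) plus O(h^5). *)
set (w := plus y3 (scal h y4) : X).
intros W.
assert (Hch : 0 <= c * h <= delta0) by (split; [apply Rmult_le_pos; lra|nra]).
assert (Hq : norm (minus q (u t)) <= rho / 2) by now apply upoly_in_ball.
assert (HqN : N q) by (apply (near_in_strip t); [easy|lra]).
assert (Hw : norm w <= 2 * Y).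
{ replace (2 * Y) with (Y + 1 * Y) by ring.
  apply norm_plus_le; [easy|apply norm_scal_le; [rewrite Rabs_pos_eq; lra|easy]]. }
assert (Hh2 : 0 <= h ^ 2 <= 1 /\ 0 <= h ^ 3 <= h ^ 2 /\ 0 <= h ^ 4 <= h ^ 3 /\ 0 <= h ^ 5 <= h ^ 4
  /\ 0 <= h ^ 6 <= h ^ 5 /\ h ^ 2 <= h).
{ assert (Hp5 : forall k, 0 <= h ^ S k <= h ^ k).
  { intros k; assert (0 <= h ^ k) by (apply pow_le; lra); simpl; split; nra. }
  pose proof (Hp5 1%nat); pose proof (Hp5 2%nat); pose proof (Hp5 3%nat);
    pose proof (Hp5 4%nat); pose proof (Hp5 5%nat); rewrite pow_1 in *.
  repeat split; lra. }
assert (He : norm e <= 3 * Y * h ^ 2).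
{ replace (3 * Y * h ^ 2) with (h ^ 2 * Y + (h ^ 2 * Y + h ^ 2 * Y)) by ring.
  repeat apply norm_plus_le; apply norm_scal_le; try easy; rewrite Rabs_pos_eq; lra. }
assert (HW : norm (minus W (u t)) <= 3 / 4 * rho).
{ apply (norm_le_eq (plus (minus q (u t)) e)); [unfold W, e, q; module|].
  replace (3 / 4 * rho) with (rho / 2 + rho / 4) by lra.
  apply norm_plus_le; [easy|]; nra. }
split; [exact HW|].
specialize (Hr1 nil t (c * h) eq_refl Ht Hch).
specialize (Hr2 (y2 :: nil) t (c * h) eq_refl Ht Hch).
specialize (Hr3 (y3 :: nil) t (c * h) eq_refl Ht Hch).
specialize (Hr4 (y4 :: nil) t (c * h) eq_refl Ht Hch).
specialize (Hr5 (y2 :: y2 :: nil) t (c * h) eq_refl Ht Hch).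
assert (Hq' : rho / 2 < rho) by lra.
assert (HW' : 3 / 4 * rho < rho) by lra.
specialize (Hr6 t q e Ht (Rle_lt_trans _ _ _ Hq Hq') (Rle_lt_trans _ _ _ HW HW')).
fold q in Hr1, Hr2, Hr3, Hr4, Hr5.
rewrite Hg0 in Hr1 by easy.
destruct (multilinear_lin1 _ (Hml 1 q ltac:(lia) HqN)) as [Dp Ds].
destruct (multilinear_lin2 _ (Hml 2 q ltac:(lia) HqN)) as [D2 D2'].
assert (E1 : dg 1%nat q (e :: nil) = plus (scal (h ^ 2) (dg 1%nat q (y2 :: nil)))
  (plus (scal (h ^ 3) (dg 1%nat q (y3 :: nil))) (scal (h ^ 4) (dg 1%nat q (y4 :: nil))))).
{ unfold e; rewrite !Dp, !Ds; easy. }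
assert (E2 : dg 2%nat q (e :: e :: nil) = plus (scal (h ^ 4) (dg 2%nat q (y2 :: y2 :: nil)))
  (plus (scal (h ^ 5) (plus (dg 2%nat q (y2 :: w :: nil)) (dg 2%nat q (w :: y2 :: nil))))
    (scal (h ^ 6) (dg 2%nat q (w :: w :: nil))))).
{ assert (Ee : e = plus (scal (h ^ 2) y2) (scal (h ^ 3) w)) by (unfold e, w; module).
  rewrite Ee; rewrite (proj1 (D2 _)), !(proj2 (D2 _)).
  rewrite (proj1 (D2' y2)), !(proj2 (D2' y2)), (proj1 (D2' w)), !(proj2 (D2' w)); module. }
assert (Hm2 : forall x y a b, 0 <= a -> 0 <= b -> norm x <= a -> norm y <= b ->
  norm (dg 2%nat q (x :: y :: nil)) <= M * (a * (b * 1))).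
{ intros x y a b Ha Hb Hx Hy; eapply Rle_trans; [apply Hbd; [lia|easy|easy]|].
  apply Rmult_le_compat_l; [easy|]; simpl.
  apply Rmult_le_compat; try apply norm_ge_0; try easy; [|lra].
  apply Rmult_le_pos; [apply norm_ge_0|lra]. }
apply Rle_trans with (C * h ^ 5); [|apply Rmult_le_compat_r; lra].
set (r1 := minus (g q) (tpoly (fun k => along nil k t) 5 (c * h)) : X).
set (r2 := minus (dg 1%nat q (y2 :: nil)) (tpoly (fun k => along (y2 :: nil) k t) 3 (c * h)) : X).
set (r3 := minus (dg 1%nat q (y3 :: nil)) (tpoly (fun k => along (y3 :: nil) k t) 2 (c * h)) : X).
set (r4 := minus (dg 1%nat q (y4 :: nil)) (tpoly (fun k => along (y4 :: nil) k t) 1 (c * h)) : X).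
set (r5 := minus (dg 2%nat q (y2 :: y2 :: nil))
  (tpoly (fun k => along (y2 :: y2 :: nil) k t) 1 (c * h)) : X).
set (r6 := minus (g (plus q e)) (plus (g q) (plus (dg 1%nat q (e :: nil))
    (scal (/ 2) (dg 2%nat q (e :: e :: nil))))) : X).
set (r7 := plus (plus (dg 2%nat q (y2 :: w :: nil)) (dg 2%nat q (w :: y2 :: nil)))
    (scal h (dg 2%nat q (w :: w :: nil))) : X).
apply (norm_le_eq (plus r6 (plus r1 (plus (scal (h ^ 2) r2) (plus (scal (h ^ 3) r3)
  (plus (scal (h ^ 4) r4) (plus (scal (h ^ 4 / 2) r5)
  (scal (h ^ 5 / 2) r7)))))))).
{ unfold r1, r2, r3, r4, r5, r6, r7; rewrite E1, E2; unfold tpoly; cbn [vsum seq].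
  rewrite (along_0 t Ht); unfold W; simpl; module. }
simpl norms_prod in Hr1, Hr2, Hr3, Hr4, Hr5.
assert (Hsc : forall k b x, (k <= 5)%nat -> norm x <= b * h ^ (5 - k) ->
  norm (scal (h ^ k) x : X) <= b * h ^ 5).
{ intros k b x Hk Hx; rewrite norm_scal_pos by (apply pow_le; lra).
  replace (b * h ^ 5) with (h ^ k * (b * h ^ (5 - k))).
  - apply Rmult_le_compat_l; [apply pow_le; lra|exact Hx].
  - replace 5%nat with (k + (5 - k))%nat at 2 by lia; rewrite pow_add; ring. }
unfold C; rewrite !(Rmult_plus_distr_r _ _ (h ^ 5)).
repeat apply norm_plus_le.
- eapply Rle_trans; [exact Hr6|].
  rewrite Rmult_assoc; apply Rmult_le_compat_l; [lra|].
  apply Rle_trans with ((3 * Y * h ^ 2) ^ 3); [apply pow_incr; split; [apply norm_ge_0|easy]|].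
  replace ((3 * Y * h ^ 2) ^ 3) with ((3 * Y) ^ 3 * h ^ 6) by ring.
  apply Rmult_le_compat_l; [apply pow_le|]; lra.
- eapply Rle_trans; [exact Hr1|right; ring].
- apply Hsc; [lia|]; eapply Rle_trans; [exact Hr2|].
  replace (C2 * c ^ 3 * Y * h ^ (5 - 2)) with (C2 * (c * h) ^ 3 * Y) by (simpl; ring).
  apply Rmult_le_compat_l; [|lra].
  apply Rmult_le_pos; [|apply pow_le]; lra.
- apply Hsc; [lia|]; eapply Rle_trans; [exact Hr3|].
  replace (C3 * c ^ 2 * Y * h ^ (5 - 3)) with (C3 * (c * h) ^ 2 * Y) by (simpl; ring).
  apply Rmult_le_compat_l; [|lra].
  apply Rmult_le_pos; [|apply pow_le]; lra.
- apply Hsc; [lia|]; eapply Rle_trans; [exact Hr4|].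
  replace (C4 * c * Y * h ^ (5 - 4)) with (C4 * (c * h) ^ 1 * Y) by (simpl; ring).
  apply Rmult_le_compat_l; [|lra].
  apply Rmult_le_pos; [|apply pow_le]; lra.
- apply (norm_le_eq (scal (h ^ 4) (scal (/ 2) r5))); [module|].
  apply Hsc; [lia|]; rewrite norm_scal_pos by lra.
  apply Rle_trans with (C5 * (c * h) ^ 1 * (Y * (Y * 1))).
  + apply Rle_trans with (norm r5); [pose proof (norm_ge_0 r5); lra|].
    eapply Rle_trans; [exact Hr5|]; apply Rmult_le_compat_l.
    * apply Rmult_le_pos; [|apply pow_le]; lra.
    * pose proof (norm_ge_0 y2); nra.
  + right; simpl; ring.
- rewrite <- !(Rmult_plus_distr_r _ _ (h ^ 5)).
  apply (norm_le_eq (scal (h ^ 5) (scal (/ 2) r7))); [module|].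
  apply Hsc; [lia|]; simpl (h ^ (5 - 5)); rewrite Rmult_1_r, norm_scal_pos by lra.
  assert (HMY : 0 <= M * Y ^ 2) by (apply Rmult_le_pos; [easy|apply pow_le; lra]).
  apply Rle_trans with (norm r7); [pose proof (norm_ge_0 r7); lra|].
  apply norm_plus_le; [apply norm_plus_le|].
  + eapply Rle_trans; [apply (Hm2 _ _ Y (2 * Y)); auto; lra|right; ring].
  + eapply Rle_trans; [apply (Hm2 _ _ (2 * Y) Y); auto; lra|right; ring].
  + replace (4 * M * Y ^ 2) with (1 * (4 * M * Y ^ 2)) by ring.
    apply norm_scal_le; [rewrite Rabs_pos_eq; lra|].
    eapply Rle_trans; [apply (Hm2 _ _ (2 * Y) (2 * Y)); auto; lra|right; ring].
Qed.

(** The arguments of the families are a step size and a time. *)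
Definition bigO (n : nat) (f : R -> R -> X) : Prop :=
  exists C, 0 <= C /\ forall h t, 0 <= h <= 1 -> t0 <= t <= T -> norm (f h t) <= C * h ^ n.

Definition lipschitz_in_time (f : R -> R -> X) : Prop :=
  exists C, 0 <= C /\ forall h s t, 0 <= h <= 1 -> t0 <= s <= T -> t0 <= t <= T ->
  norm (minus (f h s) (f h t)) <= C * Rabs (s - t).

(** Both bounds are uniform in the step size; they are what summation by parts requires of a family
    sampled on the time grid. *)
Definition regular f := bigO 0 f /\ lipschitz_in_time f.

Lemma bigO_ext n f f' :
  (forall h t, 0 <= h <= 1 -> t0 <= t <= T -> f' h t = f h t) -> bigO n f -> bigO n f'.
Proof.
intros E [C [HC H]]; exists C; split; [easy|]; intros h t Hh Ht; rewrite E; auto.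
Qed.

Lemma bigO_plus n f f' : bigO n f -> bigO n f' -> bigO n (fun h t => plus (f h t) (f' h t)).
Proof.
intros [C [HC H]] [C' [HC' H']]; exists (C + C'); split; [lra|]; intros h t Hh Ht.
rewrite Rmult_plus_distr_r; apply norm_plus_le; auto.
Qed.

Lemma bigO_scal n (a : R) f : bigO n f -> bigO n (fun h t => scal a (f h t)).
Proof.
intros [C [HC H]]; exists (Rabs a * C); split; [apply Rmult_le_pos; [apply Rabs_pos|easy]|].
intros h t Hh Ht; rewrite Rmult_assoc; apply norm_scal_le; [apply Rle_refl|auto].
Qed.

Lemma bigO_scal_pow n k f : bigO n f -> bigO (n + k) (fun h t => scal (h ^ k) (f h t)).
Proof.
intros [C [HC H]]; exists C; split; [easy|]; intros h t Hh Ht.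
rewrite norm_scal_pos by (apply pow_le; lra).
rewrite pow_add; replace (C * (h ^ n * h ^ k)) with (h ^ k * (C * h ^ n)) by ring.
apply Rmult_le_compat_l; [apply pow_le; lra|auto].
Qed.

Lemma bigO_scal_h n f : bigO n f -> bigO n (fun h t => scal h (f h t)).
Proof.
intros [C [HC H]]; exists C; split; [easy|]; intros h t Hh Ht.
replace (C * h ^ n) with (1 * (C * h ^ n)) by ring.
apply norm_scal_le; [rewrite Rabs_pos_eq; lra|auto].
Qed.

Lemma bigO_minus n f f' : bigO n f -> bigO n f' -> bigO n (fun h t => minus (f h t) (f' h t)).
Proof.
intros H H'; apply (bigO_ext n (fun h t => plus (f h t) (scal (- (1)) (f' h t)))).
- intros h t _ _; module.
- now apply bigO_plus, bigO_scal.
Qed.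

Lemma regular_plus f f' : regular f -> regular f' -> regular (fun h t => plus (f h t) (f' h t)).
Proof.
intros [H1 [C [HC H]]] [H1' [C' [HC' H']]]; split; [now apply bigO_plus|].
exists (C + C'); split; [lra|]; intros h s t Hh Hs Ht.
apply (norm_le_eq (plus (minus (f h s) (f h t)) (minus (f' h s) (f' h t)))); [module|].
rewrite Rmult_plus_distr_r; apply norm_plus_le; auto.
Qed.

Lemma regular_scal (a : R) f : regular f -> regular (fun h t => scal a (f h t)).
Proof.
intros [H1 [C [HC H]]]; split; [now apply bigO_scal|].
exists (Rabs a * C); split; [apply Rmult_le_pos; [apply Rabs_pos|easy]|].
intros h s t Hh Hs Ht.
apply (norm_le_eq (scal a (minus (f h s) (f h t)))); [module|].
rewrite Rmult_assoc; apply norm_scal_le; [apply Rle_refl|auto].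
Qed.

Lemma regular_zero : regular (fun _ _ => zero).
Proof.
split; exists 0; (split; [lra|]).
- intros; rewrite norm_zero; lra.
- intros; apply (norm_le_eq zero); [module|rewrite norm_zero; lra].
Qed.

Lemma regular_vsum (l : list nat) (f : nat -> R -> R -> X) :
  (forall j, In j l -> regular (f j)) -> regular (fun h t => vsum l (fun j => f j h t)).
Proof.
induction l as [|j l IH]; simpl; intros H; [apply regular_zero|].
apply regular_plus; auto.
Qed.

Lemma regular_along k : (1 <= k < p)%nat -> regular (fun _ t => along nil k t).
Proof.
intros Hk; split.
- destruct (along_norm k 0 ltac:(lia)) as [C [HC H]].
  exists C; split; [lra|]; intros h t Hh Ht; specialize (H nil t eq_refl Ht).
  simpl in *; lra.
- destruct (along_lipschitz k 0 ltac:(lia)) as [C [HC H]].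
  exists C; split; [lra|]; intros h s t Hh Hs Ht; specialize (H nil s t eq_refl Hs Ht).
  simpl in *; lra.
Qed.

Lemma regular_along1 k f : (k + 1 < p)%nat -> regular f ->
  regular (fun h t => along (f h t :: nil) k t).
Proof.
intros Hk [[Cf [HCf Hf]] [Cl [HCl Hl]]].
destruct (along_norm k 1 ltac:(lia)) as [C [HC H]].
destruct (along_lipschitz k 1 ltac:(lia)) as [C' [HC' H']].
split.
- exists (C * Cf); split; [apply Rmult_le_pos; lra|]; intros h t Hh Ht.
  eapply Rle_trans; [now apply H|]; rewrite Rmult_assoc.
  specialize (Hf h t Hh Ht); simpl in *.
  apply Rmult_le_compat_l; lra.
- exists (C' * Cf + C * Cl); split.
  { apply Rplus_le_le_0_compat; apply Rmult_le_pos; lra. }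
  intros h s t Hh Hs Ht.
  assert (Hlin := multilinear_lin1 _ (along_multilinear k 1 t ltac:(lia) Ht)).
  apply (norm_le_eq (plus (minus (along (f h s :: nil) k s) (along (f h s :: nil) k t))
    (along (minus (f h s) (f h t) :: nil) k t))).
  { rewrite (lin_minus _ _ _ Hlin); module. }
  rewrite Rmult_plus_distr_r; apply norm_plus_le.
  + eapply Rle_trans; [now apply H'|].
    specialize (Hf h s Hh Hs); simpl in *; rewrite Rmult_1_r in *.
    replace (C' * Cf * Rabs (s - t)) with (C' * Rabs (s - t) * Cf) by ring.
    apply Rmult_le_compat_l; [|lra]; apply Rmult_le_pos; [lra|apply Rabs_pos].
  + eapply Rle_trans; [now apply H|].
    rewrite Rmult_assoc; apply Rmult_le_compat_l; [lra|].
    simpl; rewrite Rmult_1_r; auto.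
Qed.

Lemma regular_along2 k f f' : (k + 2 < p)%nat -> regular f -> regular f' ->
  regular (fun h t => along (f h t :: f' h t :: nil) k t).
Proof.
intros Hk [[Cf [HCf Hf]] [Cl [HCl Hl]]] [[Cf' [HCf' Hf']] [Cl' [HCl' Hl']]].
destruct (along_norm k 2 ltac:(lia)) as [C [HC H]].
destruct (along_lipschitz k 2 ltac:(lia)) as [C' [HC' H']].
assert (HP : forall x y a b t, t0 <= t <= T -> norm x <= a -> norm y <= b -> 0 <= a ->
  norm (along (x :: y :: nil) k t) <= C * (a * b)).
{ intros x y a b t Ht Hx Hy Ha; eapply Rle_trans; [now apply H|].
  apply Rmult_le_compat_l; [lra|]; simpl; rewrite Rmult_1_r.
  apply Rmult_le_compat; try apply norm_ge_0; easy. }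
split.
- exists (C * (Cf * Cf')); split; [repeat apply Rmult_le_pos; lra|]; intros h t Hh Ht.
  specialize (Hf h t Hh Ht); specialize (Hf' h t Hh Ht); simpl in *.
  rewrite Rmult_1_r in *; apply HP; easy.
- exists (C' * (Cf * Cf') + (C * (Cl * Cf') + C * (Cf * Cl'))); split.
  { repeat apply Rplus_le_le_0_compat; repeat apply Rmult_le_pos; lra. }
  intros h s t Hh Hs Ht.
  destruct (multilinear_lin2 _ (along_multilinear k 2 t ltac:(lia) Ht)) as [L1 L2].
  assert (F1 := Hf h s Hh Hs); assert (F1' := Hf' h s Hh Hs).
  assert (F2 := Hf h t Hh Ht); simpl in F1, F1', F2; rewrite Rmult_1_r in F1, F1', F2.
  assert (Hst := Rabs_pos (s - t)).
  apply (norm_le_eq (plus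
    (minus (along (f h s :: f' h s :: nil) k s) (along (f h s :: f' h s :: nil) k t))
    (plus (along (minus (f h s) (f h t) :: f' h s :: nil) k t)
      (along (f h t :: minus (f' h s) (f' h t) :: nil) k t)))).
  { rewrite (lin_minus _ _ _ (L1 (f h t))), (lin_minus _ _ _ (L2 (f' h s))); module. }
  rewrite !Rmult_plus_distr_r; repeat apply norm_plus_le.
  + eapply Rle_trans; [now apply H'|]; simpl; rewrite Rmult_1_r.
    replace (C' * (Cf * Cf') * Rabs (s - t)) with (C' * Rabs (s - t) * (Cf * Cf')) by ring.
    apply Rmult_le_compat_l; [apply Rmult_le_pos; lra|].
    apply Rmult_le_compat; try apply norm_ge_0; easy.
  + replace (C * (Cl * Cf') * Rabs (s - t)) with (C * ((Cl * Rabs (s - t)) * Cf')) by ring.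
    apply HP; auto; apply Rmult_le_pos; lra.
  + replace (C * (Cf * Cl') * Rabs (s - t)) with (C * (Cf * (Cl' * Rabs (s - t)))) by ring.
    apply HP; auto.
Qed.

(** * Defects of the approximate stages and of one step along the solution *)

Context (ph : nat -> R -> X -> X) (m : expRK).
Hypothesis ph_lin : forall k tau, 0 <= tau -> lin (ph k tau).
Hypothesis cop_bounded : forall f, admissible f -> exists C, 0 < C /\
  forall h x, 0 <= h <= 1 -> norm (cop ph f h x) <= C * norm x.
Hypothesis ph_solution : forall k j tau t, (j <= 5)%nat -> 0 <= tau -> t0 <= t <= T ->
  ph k tau (du j t) = plus (scal (/ INR (fact k)) (du j t))
    (scal tau (ph (S k) tau (minus (du (S j) t) (along nil j t)))).
Hypothesis Hm : expRK_wf m.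
Hypothesis Hoc : forall h, 0 <= h -> operator_conditions ph m h.

Lemma bigO_cop n f F : admissible f -> bigO n F -> bigO n (fun h t => cop ph f h (F h t)).
Proof.
intros Hf [C [HC H]]; destruct (cop_bounded f Hf) as [Cf [HCf Hcf]].
exists (Cf * C); split; [apply Rmult_le_pos; lra|]; intros h t Hh Ht.
eapply Rle_trans; [now apply Hcf|].
rewrite Rmult_assoc; apply Rmult_le_compat_l; [lra|auto].
Qed.

Lemma regular_cop f F : admissible f -> regular F -> regular (fun h t => cop ph f h (F h t)).
Proof.
intros Hf [H1 [C [HC H]]]; split; [now apply bigO_cop|].
destruct (cop_bounded f Hf) as [Cf [HCf Hcf]].
exists (Cf * C); split; [apply Rmult_le_pos; lra|]; intros h s t Hh Hs Ht.
apply (norm_le_eq (cop ph f h (minus (F h s) (F h t)))).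
{ symmetry; apply lin_minus, (cop_lin ph ph_lin); [easy|lra]. }
eapply Rle_trans; [now apply Hcf|].
rewrite Rmult_assoc; apply Rmult_le_compat_l; [lra|auto].
Qed.

Lemma bigO_ph n k (c : R) F : 0 <= c -> bigO n F -> bigO n (fun h t => ph k (c * h) (F h t)).
Proof.
intros Hc HF; apply (bigO_ext n (fun h t => cop ph (Term 1 k c :: nil) h (F h t))).
- intros h t _ _; simpl; module.
- apply bigO_cop; [|easy]; intros q [<-|[]]; easy.
Qed.

Let J t y := along (y :: nil) 0 t.
Let K1 t y := along (y :: nil) 1 t.
Let L t y := along (y :: nil) 2 t.
Let B t y z := along (y :: z :: nil) 0 t.
Let F t k := along nil k t.

Definition Stage2 h t := stage2 ph m h (F t).
Definition Stage3 h t := stage3 ph m h (J t) (F t).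
Definition Stage4 h t := stage4 ph m h (J t) (K1 t) (F t).
Definition Weight h t := stage_weight ph m h (J t) (K1 t) (L t) (B t) (F t).
Definition Increment h t := stage_increment ph m h (J t) (K1 t) (L t) (B t) (F t).
Definition Stage h t i : X :=
  plus (upoly t (node m i * h)) (stage_error ph m h (J t) (K1 t) (F t) i).

Let stages_acoef i j : (2 <= i <= stages m)%nat -> In j (seq 2 (i - 2)) ->
  admissible (acoef m i j) /\ (2 <= j <= stages m)%nat.
Proof. intros Hi Hj; apply in_seq in Hj; split; [apply Hm; lia|lia]. Qed.

Lemma Stage2_regular i : (2 <= i <= stages m)%nat -> regular (fun h t => Stage2 h t i).
Proof.
intros Hi; apply regular_cop; [now apply admissible_psi|apply regular_along; lia].
Qed.

Lemma Stage3_regular i : (2 <= i <= stages m)%nat -> regular (fun h t => Stage3 h t i).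
Proof.
intros Hi; apply regular_plus.
- apply regular_cop; [now apply admissible_psi|apply regular_along; lia].
- apply regular_vsum; intros j Hj; destruct (stages_acoef i j Hi Hj) as [Ha Hj'].
  apply regular_cop; [easy|]; apply regular_along1; [lia|now apply Stage2_regular].
Qed.

Lemma Stage4_regular i : (2 <= i <= stages m)%nat -> regular (fun h t => Stage4 h t i).
Proof.
intros Hi; apply regular_plus.
- apply regular_cop; [now apply admissible_psi|apply regular_along; lia].
- apply regular_vsum; intros j Hj; destruct (stages_acoef i j Hi Hj) as [Ha Hj'].
  apply regular_cop; [easy|]; apply regular_plus; [|apply regular_scal];
    (apply regular_along1; [lia|]).
  + now apply Stage3_regular.
  + now apply Stage2_regular.
Qed.

Lemma Weight_regular i : (2 <= i <= stages m)%nat -> regular (fun h t => Weight h t i).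
Proof.
intros Hi; apply regular_plus; [apply regular_scal, regular_along; lia|].
apply regular_plus; [apply regular_along1; [lia|now apply Stage4_regular]|].
apply regular_plus; [apply regular_scal, regular_along1; [lia|now apply Stage3_regular]|].
apply regular_plus; [apply regular_scal, regular_along1; [lia|now apply Stage2_regular]|].
apply regular_scal, regular_along2; [lia|now apply Stage2_regular|now apply Stage2_regular].
Qed.

Lemma upoly_variation_of_constants t tau : t0 <= t <= T -> 0 <= tau ->
  upoly t tau = minus (plus (ph 0%nat tau (u t))
    (vsum (seq 0 6) (fun k => scal (tau ^ S k) (ph (S k) tau (along nil k t)))))
    (scal (tau ^ 6) (ph 6%nat tau (du 6 t))).
Proof.
intros Ht Htau; rewrite <- (Hu0 t Ht).
apply (tpoly_variation_of_constants ph (fun j => du j t) (fun k => along nil k t)).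
- intros k; now apply ph_lin.
- intros k Hk; apply ph_solution; [lia|easy|easy].
Qed.

Lemma bigO_du6 : bigO 0 (fun _ t => du 6 t).
Proof.
exists K; split; [lra|]; intros h t _ Ht; rewrite Rmult_1_r; now apply HduK.
Qed.

(** The approximate stage solves the stage equation, with the differences of [g] replaced by their
    expansions, up to an explicit remainder carrying the factor h^5. *)
Lemma stage_defect i : (2 <= i <= stages m)%nat ->
  bigO 5 (fun h t => minus (Stage h t i) (plus (ph 0%nat (node m i * h) (u t))
    (plus (scal (node m i * h) (ph 1%nat (node m i * h) (g (u t))))
      (scal h (vsum (seq 2 (i - 2)) (fun j => cop ph (acoef m i j) h (Increment h t j))))))).
Proof.
intros Hi; assert (Hc : 0 <= node m i) by now apply Hm.
set (c := node m i) in *.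
apply (bigO_ext 5 (fun h t => scal (h ^ 5) (minus (plus
  (scal (c ^ 5) (ph 5%nat (c * h) (along nil 4 t)))
  (scal h (scal (c ^ 6) (minus (ph 6%nat (c * h) (along nil 5 t)) (ph 6%nat (c * h) (du 6 t))))))
  (vsum (seq 2 (i - 2)) (fun j => cop ph (acoef m i j) h (Weight h t j)))))).
- intros h t Hh Ht.
  assert (E := stage_error_eq ph m h (J t) (K1 t) (L t) (B t) (F t) ph_lin (proj1 Hh) Hm i Hi).
  fold c in E; unfold Stage; fold c.
  rewrite (upoly_variation_of_constants t (c * h) Ht) by (apply Rmult_le_pos; lra).
  rewrite <- (along_0 t Ht).
  set (Er := stage_error _ _ _ _ _ _ _) in *.
  (* The term k = 0 is the one with g(u(t)) in the stage equation, k = 1 to 3 are absorbed by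
     [stage_error], and k = 4, 5 already carry h^5 and h^6. *)
  change (vsum (seq 0 6) (fun k => scal ((c * h) ^ S k) (ph (S k) (c * h) (along nil k t))))
    with (plus (scal ((c * h) ^ 1) (ph 1%nat (c * h) (along nil 0 t)))
      (vsum (seq 1 3 ++ seq 4 2)
        (fun k => scal ((c * h) ^ S k) (ph (S k) (c * h) (along nil k t))))).
  rewrite vsum_app.
  set (V3 := vsum (seq 1 3) _) in *.
  assert (E' : V3 = minus (minus (scal h (vsum (seq 2 (i - 2))
        (fun j => cop ph (acoef m i j) h (Increment h t j))))
      (scal (h ^ 5) (vsum (seq 2 (i - 2)) (fun j => cop ph (acoef m i j) h (Weight h t j))))) Er).
  { refine (eq_trans _ (f_equal (fun z => minus z Er) E)); unfold F; fold V3; module. }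
  rewrite E'; simpl vsum; module.
- apply (bigO_scal_pow 0 5), bigO_minus; [apply bigO_plus|].
  + apply bigO_scal, bigO_ph; [easy|apply regular_along; lia].
  + apply bigO_scal_h, bigO_scal, bigO_minus; apply bigO_ph; try easy.
    * apply regular_along; lia.
    * apply bigO_du6.
  + apply regular_vsum; intros j Hj; destruct (stages_acoef i j Hi Hj) as [Ha Hj'].
    apply regular_cop; [easy|now apply Weight_regular].
Qed.

(** The coefficient of h^5 in the local error. It is kept explicit because a mere bound on it would
    give only order 4 after summation over the steps. *)
Definition StepError h t : X :=
  minus (minus (ph 5%nat h (along nil 4 t)) (scal (phi 5 0) (along nil 4 t)))
    (vsum (seq 2 (S (stages m) - 2)) (fun i => minus (cop ph (bcoef m i) h (Weight h t i))
       (scal (coef_eval (bcoef m i) 0) (Weight h t i)))).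

Lemma step_defect :
  bigO 6 (fun h t => minus (upoly t h) (plus (plus (ph 0%nat h (u t))
    (plus (scal h (ph 1%nat h (g (u t)))) (scal h (vsum (seq 2 (S (stages m) - 2))
      (fun i => cop ph (bcoef m i) h (Increment h t i))))))
    (scal (h ^ 5) (StepError h t)))).
Proof.
apply (bigO_ext 6 (fun h t => scal (h ^ 6) (minus
  (ph 6%nat (1 * h) (along nil 5 t)) (ph 6%nat (1 * h) (du 6 t))))).
- intros h t Hh Ht; rewrite Rmult_1_l.
  assert (E := step_error_eq ph m h (J t) (K1 t) (L t) (B t) (F t) ph_lin (proj1 Hh) Hm
    (multilinear_lin1 _ (along_multilinear 0 1 t ltac:(lia) Ht))
    (multilinear_lin1 _ (along_multilinear 1 1 t ltac:(lia) Ht))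
    (multilinear_lin1 _ (along_multilinear 2 1 t ltac:(lia) Ht))
    (proj1 (multilinear_lin2 _ (along_multilinear 0 2 t ltac:(lia) Ht)))
    (proj2 (multilinear_lin2 _ (along_multilinear 0 2 t ltac:(lia) Ht)))
    (Hoc h (proj1 Hh))).
  rewrite (upoly_variation_of_constants t h Ht) by easy.
  rewrite <- (along_0 t Ht).
  (* Here k = 1 to 4 enter [step_error_eq]; the term k = 5 and the Taylor remainder carry h^6. *)
  change (vsum (seq 0 6) (fun k => scal (h ^ S k) (ph (S k) h (along nil k t))))
    with (plus (scal (h ^ 1) (ph 1%nat h (along nil 0 t)))
      (vsum (seq 1 4 ++ seq 5 1) (fun k => scal (h ^ S k) (ph (S k) h (along nil k t))))).
  rewrite vsum_app.
  refine (eq_trans (f_equal (fun z => minus (minus (plus (ph 0%nat h (u t))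
     (plus (scal (h ^ 1) (ph 1%nat h (along nil 0 t))) (plus z _))) _) _) E) _).
  unfold StepError; simpl (vsum (seq 5 1) _).
  unfold Weight, F; module.
- apply (bigO_scal_pow 0 6), bigO_minus; apply bigO_ph; try lra.
  + apply regular_along; lia.
  + apply bigO_du6.
Qed.

Lemma stage_increments i : (2 <= i <= stages m)%nat -> exists C h1, 0 < C /\ 0 < h1 <= 1 /\
  forall h t, 0 <= h <= h1 -> t0 <= t <= T ->
  norm (minus (Stage h t i) (u t)) <= 3 / 4 * rho /\
  norm (minus (minus (g (Stage h t i)) (g (u t))) (Increment h t i)) <= C * h ^ 5.
Proof.
intros Hi.
destruct (Stage2_regular i Hi) as [[Y2 [HY2 H2]] _].
destruct (Stage3_regular i Hi) as [[Y3 [HY3 H3]] _].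
destruct (Stage4_regular i Hi) as [[Y4 [HY4 H4]] _].
destruct (g_stage_expansion (node m i) (Y2 + Y3 + Y4) ltac:(now apply Hm) ltac:(lra))
  as [C [h1 [HC [Hh1 H]]]].
exists C, h1; split; [easy|]; split; [easy|]; intros h t Hh Ht.
assert (Hh' : 0 <= h <= 1) by lra.
specialize (H2 h t Hh' Ht); specialize (H3 h t Hh' Ht); specialize (H4 h t Hh' Ht).
simpl in H2, H3, H4; rewrite Rmult_1_r in H2, H3, H4.
assert (H2' : norm (Stage2 h t i) <= Y2 + Y3 + Y4) by (eapply Rle_trans; [exact H2|lra]).
assert (H3' : norm (Stage3 h t i) <= Y2 + Y3 + Y4) by (eapply Rle_trans; [exact H3|lra]).
assert (H4' : norm (Stage4 h t i) <= Y2 + Y3 + Y4) by (eapply Rle_trans; [exact H4|lra]).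
destruct (H h t _ _ _ Hh Ht H2' H3' H4') as [HW HG]; split; [exact HW|].
refine (norm_le_eq _ _ _ _ HG).
apply (f_equal (fun z => minus (minus (g (Stage h t i)) (g (u t))) z)).
unfold Increment, stage_increment, stage_weight, stage_rest, node_pow, J, K1, L, B, F.
fold (Stage2 h t) (Stage3 h t) (Stage4 h t); simpl; module.
Qed.

Lemma uniform_constants (l : list nat) (Q : nat -> R -> R -> Prop) :
  (forall i C C' h h', C <= C' -> h' <= h -> Q i C h -> Q i C' h') ->
  (forall i, In i l -> exists C h, 0 < C /\ 0 < h <= 1 /\ Q i C h) ->
  exists C h, 0 < C /\ 0 < h <= 1 /\ forall i, In i l -> Q i C h.
Proof.
intros Hmon; induction l as [|i l IH]; intros H.
- exists 1, 1; repeat split; try lra; intros i [].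
- destruct (H i (or_introl eq_refl)) as [C [h [HC [Hh HQ]]]].
  destruct IH as [C' [h' [HC' [Hh' HQ']]]]; [intros; apply H; now right|].
  exists (C + C'), (Rmin h h'); split; [lra|]; split.
  + split; [apply Rmin_glb_lt; lra|eapply Rle_trans; [apply Rmin_l|lra]].
  + intros j [<-|Hj].
    * apply (Hmon i C _ h); [lra|apply Rmin_l|easy].
    * apply (Hmon j C' _ h'); [lra|apply Rmin_r|auto].
Qed.

Lemma cop_bounded_list (l : list nat) (f : nat -> coef) :
  (forall i, In i l -> admissible (f i)) -> exists C, 0 < C /\
  forall i h x, In i l -> 0 <= h <= 1 -> norm (cop ph (f i) h x) <= C * norm x.
Proof.
intros Hf; destruct (uniform_constants l (fun i C _ =>
  forall h x, 0 <= h <= 1 -> norm (cop ph (f i) h x) <= C * norm x)) as [C [_ [HC [_ H]]]].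
- intros i C C' _ _ HCC _ H h x Hh; eapply Rle_trans; [now apply H|].
  apply Rmult_le_compat_r; [apply norm_ge_0|easy].
- intros i Hi; destruct (cop_bounded (f i) (Hf i Hi)) as [C [HC H]].
  exists C, 1; split; [easy|]; split; [lra|easy].
- exists C; split; [easy|]; intros; now apply H.
Qed.

Lemma ph_bounded k c : 0 <= c -> exists C, 0 < C /\
  forall h x, 0 <= h <= 1 -> norm (ph k (c * h) x) <= C * norm x.
Proof.
intros Hc; destruct (cop_bounded (Term 1 k c :: nil)) as [C [HC H]].
- intros q [<-|[]]; easy.
- exists C; split; [easy|]; intros h x Hh.
  apply (norm_le_eq (cop ph (Term 1 k c :: nil) h x)); [simpl; module|auto].
Qed.

(** * Stability of one step under perturbation of its initial value *)

(** The mild form of a stage: [A] has disappeared, so the expression makes sense for every v and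
    depends on it in a Lipschitz manner near the solution. *)
Definition stage_value h (v : X) (U : nat -> X) i : X :=
  plus (ph 0%nat (node m i * h) v)
    (plus (scal (node m i * h) (ph 1%nat (node m i * h) (g v)))
      (scal h (vsum (seq 2 (i - 2))
        (fun j => cop ph (acoef m i j) h (minus (g (U j)) (g v)))))).

Definition step_value h (v : X) (U : nat -> X) : X :=
  plus (ph 0%nat h v) (plus (scal h (ph 1%nat h (g v)))
    (scal h (vsum (seq 2 (S (stages m) - 2))
      (fun i => cop ph (bcoef m i) h (minus (g (U i)) (g v)))))).

Lemma local_errors : exists C h1, 0 < C /\ 0 < h1 <= 1 /\
  (forall i, (2 <= i <= stages m)%nat -> forall h t, 0 <= h <= h1 -> t0 <= t <= T ->
    norm (minus (Stage h t i) (u t)) <= 3 / 4 * rho /\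
    norm (minus (minus (g (Stage h t i)) (g (u t))) (Increment h t i)) <= C * h ^ 5 /\
    norm (minus (Stage h t i) (plus (ph 0%nat (node m i * h) (u t))
      (plus (scal (node m i * h) (ph 1%nat (node m i * h) (g (u t))))
      (scal h (vsum (seq 2 (i - 2)) (fun j => cop ph (acoef m i j) h (Increment h t j)))))))
      <= C * h ^ 5) /\
  (forall h t, 0 <= h <= h1 -> t0 <= t -> t + h <= T ->
    norm (minus (u (t + h)) (plus (plus (ph 0%nat h (u t))
    (plus (scal h (ph 1%nat h (g (u t)))) (scal h (vsum (seq 2 (S (stages m) - 2))
      (fun i => cop ph (bcoef m i) h (Increment h t i))))))
    (scal (h ^ 5) (StepError h t)))) <= C * h ^ 6).
Proof.
destruct (uniform_constants (seq 2 (S (stages m) - 2)) (fun i C h1 =>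
  forall h t, 0 <= h <= h1 -> t0 <= t <= T ->
    norm (minus (Stage h t i) (u t)) <= 3 / 4 * rho /\
    norm (minus (minus (g (Stage h t i)) (g (u t))) (Increment h t i)) <= C * h ^ 5 /\
    norm (minus (Stage h t i) (plus (ph 0%nat (node m i * h) (u t))
      (plus (scal (node m i * h) (ph 1%nat (node m i * h) (g (u t))))
      (scal h (vsum (seq 2 (i - 2)) (fun j => cop ph (acoef m i j) h (Increment h t j)))))))
      <= C * h ^ 5)) as [C [h1 [HC [Hh1 H]]]].
- intros i C C' h h' HCC Hhh H s t Hs Ht.
  destruct (H s t ltac:(lra) Ht) as [H1 [H2 H3]]; split; [easy|].
  assert (Hs5 : 0 <= s ^ 5) by (apply pow_le; lra).
  assert (HCs := Rmult_le_compat_r _ _ _ Hs5 HCC).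
  split; eapply Rle_trans; eassumption.
- intros i Hi; apply in_seq in Hi; assert (Hi' : (2 <= i <= stages m)%nat) by lia.
  destruct (stage_increments i Hi') as [C [h1 [HC [Hh1 H]]]].
  destruct (stage_defect i Hi') as [C' [HC' H']].
  exists (C + C'), h1; split; [lra|]; split; [easy|]; intros h t Hh Ht.
  destruct (H h t Hh Ht) as [H1 H2]; split; [easy|].
  assert (Hs5 : 0 <= h ^ 5) by (apply pow_le; lra).
  assert (D1 := Rmult_le_pos _ _ HC' Hs5).
  assert (D2 := Rmult_le_pos _ _ (Rlt_le _ _ HC) Hs5).
  split; [eapply Rle_trans; [exact H2|lra]|].
  eapply Rle_trans; [apply H'; [lra|easy]|lra].
- destruct step_defect as [C' [HC' H']].
  destruct solution_taylor as [C'' [HC'' H'']].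
  exists (C + C' + C''), h1; split; [lra|]; split; [easy|]; split.
  + intros i Hi h t Hh Ht.
    destruct (H i ltac:(apply in_seq; lia) h t Hh Ht) as [H1 [H2 H3]].
    assert (Hs5 : 0 <= h ^ 5) by (apply pow_le; lra).
    assert (D1 := Rmult_le_pos _ _ HC' Hs5).
    assert (D2 := Rmult_le_pos _ _ (Rlt_le _ _ HC'') Hs5).
    split; [easy|]; split; (eapply Rle_trans; [eassumption|lra]).
  + intros h t Hh Ht Hth.
    assert (Hs6 : 0 <= h ^ 6) by (apply pow_le; lra).
    eapply Rle_trans; [apply (norm_minus_trans _ (upoly t h))|].
    assert (Q1 := H'' t h Ht (proj1 Hh) Hth).
    assert (Q2 := H' h t ltac:(lra) ltac:(lra)).
    eapply Rle_trans; [exact (Rplus_le_compat _ _ _ _ Q1 Q2)|].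
    assert (D1 := Rmult_le_pos _ _ (Rlt_le _ _ HC) Hs6); lra.
Qed.

Lemma self_near t : norm (minus (u t) (u t)) < rho.
Proof.
apply Rle_lt_trans with 0; [|easy].
apply (norm_le_eq zero); [module|rewrite norm_zero; lra].
Qed.

Lemma vsum_cop_minus (l : list nat) (f : nat -> coef) (x y : nat -> X) h : 0 <= h ->
  (forall j, In j l -> admissible (f j)) ->
  vsum l (fun j => cop ph (f j) h (minus (x j) (y j))) =
  minus (vsum l (fun j => cop ph (f j) h (x j))) (vsum l (fun j => cop ph (f j) h (y j))).
Proof.
intros Hh Hf; refine (eq_trans (vsum_ext _ _ _ _) (vsum_minus _ _ _)).
intros j Hj; apply (lin_minus (cop ph (f j) h)), (cop_lin ph ph_lin); auto.
Qed.

(** The error splits into stage against approximate stage, u against v, and the expansion error of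
    [g]. The Lipschitz bound applies to U because 3/4 + 1/8 of rho leaves it inside the strip. *)
Lemma increment_stability (L0 C0 C : R) h t (v U W G : X) :
  0 <= L0 -> 0 <= C0 -> 0 <= h ->
  (forall x y, norm (minus x (u t)) < rho -> norm (minus y (u t)) < rho ->
     norm (minus (g x) (g y)) <= L0 * norm (minus x y)) ->
  norm (minus v (u t)) < rho ->
  norm (minus W (u t)) <= 3 / 4 * rho ->
  norm (minus (minus (g W) (g (u t))) G) <= C0 * h ^ 5 ->
  norm (minus U W) <= C * (norm (minus v (u t)) + h ^ 5) ->
  C * (norm (minus v (u t)) + h ^ 5) <= rho / 8 ->
  norm (minus (minus (g U) (g v)) G) <= (L0 * C + L0 + C0) * (norm (minus v (u t)) + h ^ 5).
Proof.
intros HL0 HC0 Hh HL Hv HW HG HU Hsm.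
assert (Hh5 : 0 <= h ^ 5) by (now apply pow_le).
assert (HUr : norm (minus U (u t)) < rho).
{ assert (Q := norm_minus_trans U W (u t)).
  eapply Rle_lt_trans; [exact Q|].
  eapply Rle_lt_trans; [exact (Rplus_le_compat _ _ _ _ HU HW)|lra]. }
assert (HWr : norm (minus W (u t)) < rho) by (eapply Rle_lt_trans; [exact HW|lra]).
assert (Hur := self_near t).
assert (G1 := HL U W HUr HWr).
assert (G2 := HL (u t) v Hur Hv).
rewrite (norm_minus_sym (u t) v) in G2.
set (eps := norm (minus v (u t)) + h ^ 5) in *.
assert (He : norm (minus v (u t)) <= eps) by (unfold eps; lra).
assert (He5 : h ^ 5 <= eps) by (unfold eps; pose proof (norm_ge_0 (minus v (u t))); lra).
apply (norm_le_eq (plus (minus (g U) (g W)) (plus (minus (g (u t)) (g v))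
  (minus (minus (g W) (g (u t))) G)))); [module|].
replace ((L0 * C + L0 + C0) * eps) with (L0 * (C * eps) + (L0 * eps + C0 * eps)) by ring.
repeat apply norm_plus_le.
- eapply Rle_trans; [exact G1|]; now apply Rmult_le_compat_l.
- eapply Rle_trans; [exact G2|]; now apply Rmult_le_compat_l.
- eapply Rle_trans; [exact HG|]; now apply Rmult_le_compat_l.
Qed.

Lemma vsum_cop_le (l : list nat) (f : nat -> coef) (x : nat -> X) C b h :
  0 <= C -> 0 <= h <= 1 ->
  (forall j h x, In j l -> 0 <= h <= 1 -> norm (cop ph (f j) h x) <= C * norm x) ->
  (forall j, In j l -> norm (x j) <= b) ->
  norm (vsum l (fun j => cop ph (f j) h (x j))) <= INR (length l) * (C * b).
Proof.
intros HC Hh Hf Hx; apply norm_vsum_le; intros j Hj.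
eapply Rle_trans; [now apply Hf|]; apply Rmult_le_compat_l; auto.
Qed.

(** The scheme is explicit, so induction on the stage index works, with C growing and r shrinking at
    each stage. As 2 r bounds the initial error plus h^5, the condition C (2 r) <= rho/8 keeps every
    stage computed so far in the strip. *)
Lemma stage_stability (n : nat) : exists C r, 0 < C /\ 0 < r <= 1 /\ C * (2 * r) <= rho / 8 /\
  forall h t v U, 0 <= h <= r -> t0 <= t <= T -> norm (minus v (u t)) <= r ->
  (forall i, (2 <= i <= stages m)%nat -> U i = stage_value h v U i) ->
  forall i, (2 <= i < n)%nat -> (i <= stages m)%nat ->
  norm (minus (U i) (Stage h t i)) <= C * (norm (minus v (u t)) + h ^ 5).
Proof.
induction n as [|n IH].
{ exists 1, (Rmin 1 (rho / 16)).
  assert (H1 : 0 < Rmin 1 (rho / 16)) by (apply Rmin_glb_lt; lra).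
  assert (H2 := Rmin_l 1 (rho / 16)); assert (H3 := Rmin_r 1 (rho / 16)).
  repeat split; try lra; intros; lia. }
destruct IH as [C [r [HC [Hr [HCr IH]]]]].
destruct (Nat.le_gt_cases 2 n) as [Hn2|Hn2].
2: { exists C, r; repeat split; try lra; intros; lia. }
destruct (Nat.le_gt_cases n (stages m)) as [Hns|Hns].
2: { exists C, r; repeat split; try lra; intros h t v U Hh Ht Hv HU i Hi Hi'.
     apply IH; auto; lia. }
destruct local_errors as [C0 [h1 [HC0 [Hh1 [Hst _]]]]].
destruct g_lipschitz as [L0 [HL0 HL]].
assert (Hc : 0 <= node m n) by (apply Hm; lia).
destruct (ph_bounded 0 (node m n) Hc) as [B0 [HB0 Hb0]].
destruct (ph_bounded 1 (node m n) Hc) as [B1 [HB1 Hb1]].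
destruct (cop_bounded_list (seq 2 (n - 2)) (acoef m n)) as [Ca [HCa Ha]].
{ intros j Hj; apply (stages_acoef n j); [lia|easy]. }
set (Ns := INR (length (seq 2 (n - 2)))).
assert (HNs : 0 <= Ns) by apply pos_INR.
(* The contributions, in order: propagated initial error, change of g(v), increments of the earlier
   stages, defect of the approximate stage. *)
set (C' := B0 + (node m n * (B1 * L0) + (Ns * (Ca * (L0 * C + L0 + C0)) + C0))).
assert (HC' : 0 < C').
{ unfold C'; apply Rplus_lt_le_0_compat; [easy|].
  repeat apply Rplus_le_le_0_compat; repeat apply Rmult_le_pos; try lra.
  repeat apply Rplus_le_le_0_compat; try apply Rmult_le_pos; lra. }
(* The last bound restores the smallness condition for the enlarged constant C + C'. *)
set (r' := Rmin (Rmin r h1) (Rmin (rho / 2) (rho / (16 * (C + C'))))).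
assert (Hr' : 0 < r' /\ r' <= r /\ r' <= h1 /\ r' <= rho / 2 /\ r' <= rho / (16 * (C + C'))).
{ unfold r'; split.
  - repeat apply Rmin_glb_lt; try lra; apply Rdiv_lt_0_compat; lra.
  - repeat split.
    + eapply Rle_trans; [apply Rmin_l|apply Rmin_l].
    + eapply Rle_trans; [apply Rmin_l|apply Rmin_r].
    + eapply Rle_trans; [apply Rmin_r|apply Rmin_l].
    + eapply Rle_trans; [apply Rmin_r|apply Rmin_r]. }
destruct Hr' as [R0 [R1 [R2 [R3 R4]]]].
exists (C + C'), r'; split; [lra|]; split; [lra|]; split.
{ apply Rle_trans with ((C + C') * (2 * (rho / (16 * (C + C'))))); [|right; field; lra].
  apply Rmult_le_compat_l; lra. }
intros h t v U Hh Ht Hv HU i Hi His.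
set (eps := norm (minus v (u t)) + h ^ 5).
assert (Hh5 : 0 <= h ^ 5 <= h).
{ split; [apply pow_le; lra|]; assert (0 <= h ^ 4 <= 1).
  { split; [apply pow_le; lra|]; rewrite <- (pow1 4); apply pow_incr; lra. }
  simpl in *; nra. }
assert (Heps : 0 <= eps <= 2 * r').
{ unfold eps; pose proof (norm_ge_0 (minus v (u t))); lra. }
assert (IH' : forall j, (2 <= j < n)%nat -> (j <= stages m)%nat ->
  norm (minus (U j) (Stage h t j)) <= C * eps).
{ apply IH; try lra; auto. }
destruct (Nat.eq_dec i n) as [->|Hin].
2: { eapply Rle_trans; [apply IH'; lia|apply Rmult_le_compat_r; lra]. }
apply Rle_trans with (C' * eps); [|apply Rmult_le_compat_r; lra].
destruct (Hst n ltac:(lia) h t ltac:(lra) Ht) as [_ [_ Hdef]].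
set (Rw := plus (ph 0%nat (node m n * h) (u t)) _) in Hdef.
assert (Hvr : norm (minus v (u t)) < rho) by lra.
assert (Hgv : norm (minus (g v) (g (u t))) <= L0 * norm (minus v (u t))).
{ apply (HL t); [easy|easy|apply self_near]. }
assert (Hd : forall j, In j (seq 2 (n - 2)) ->
  norm (minus (minus (g (U j)) (g v)) (Increment h t j)) <= (L0 * C + L0 + C0) * eps).
{ intros j Hj; apply in_seq in Hj.
  destruct (Hst j ltac:(lia) h t ltac:(lra) Ht) as [HW [HG _]].
  apply (increment_stability L0 C0 C h t v (U j) (Stage h t j)); auto; try lra.
  - intros x y; now apply (HL t).
  - apply IH'; lia.
  - fold eps; apply Rle_trans with (C * (2 * r)); [apply Rmult_le_compat_l|]; lra. }
assert (Htau : 0 <= node m n * h) by (apply Rmult_le_pos; lra).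
assert (Hadm : forall j, In j (seq 2 (n - 2)) -> admissible (acoef m n j)).
{ intros j Hj; apply (stages_acoef n j); [lia|easy]. }
rewrite HU by lia.
apply (norm_le_eq (plus (ph 0%nat (node m n * h) (minus v (u t)))
  (plus (scal (node m n * h) (ph 1%nat (node m n * h) (minus (g v) (g (u t)))))
  (minus (scal h (vsum (seq 2 (n - 2)) (fun j => cop ph (acoef m n j) h
    (minus (minus (g (U j)) (g v)) (Increment h t j)))))
   (minus (Stage h t n) Rw))))).
{ rewrite (lin_minus _ _ _ (ph_lin 0%nat _ Htau)), (lin_minus _ _ _ (ph_lin 1%nat _ Htau)).
  refine (eq_trans _ (f_equal (fun z => plus _ (plus _ (minus (scal h z) _)))
    (eq_sym (vsum_cop_minus _ _ (fun j => minus (g (U j)) (g v)) _ h (proj1 Hh) Hadm)))).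
  unfold stage_value, Rw; module. }
unfold C'; rewrite !(Rmult_plus_distr_r _ _ eps).
assert (Hve : norm (minus v (u t)) <= eps) by (unfold eps; lra).
assert (Hh1' : 0 <= h <= 1) by lra.
repeat apply norm_plus_le.
- eapply Rle_trans; [now apply Hb0|]; apply Rmult_le_compat_l; lra.
- rewrite Rmult_assoc; apply norm_scal_le.
  { rewrite Rabs_pos_eq by easy; rewrite <- (Rmult_1_r (node m n)) at 2.
    apply Rmult_le_compat_l; lra. }
  eapply Rle_trans; [now apply Hb1|].
  rewrite Rmult_assoc; apply Rmult_le_compat_l; [lra|].
  eapply Rle_trans; [exact Hgv|]; apply Rmult_le_compat_l; lra.
- rewrite <- (Rmult_1_l (Ns * _ * eps)).
  apply norm_scal_le; [rewrite Rabs_pos_eq; lra|].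
  eapply Rle_trans; [apply (vsum_cop_le _ _ _ Ca _ h ltac:(lra) Hh1' Ha Hd)|].
  fold Ns; right; ring.
- eapply Rle_trans; [right; apply (norm_opp (V := X))|].
  eapply Rle_trans; [exact Hdef|]; apply Rmult_le_compat_l; [lra|].
  unfold eps; pose proof (norm_ge_0 (minus v (u t))); lra.
Qed.

(** The error recursion as an identity: the exactly propagated old error, a term h d suited to
    Gronwall, and h^5 [StepError], which must not be estimated yet since only its accumulated effect
    is small enough. *)
Lemma one_step_error : exists C r, 0 < C /\ 0 < r <= 1 /\
  forall h t v U, 0 < h <= r -> t0 <= t -> t + h <= T -> norm (minus v (u t)) <= r ->
  (forall i, (2 <= i <= stages m)%nat -> U i = stage_value h v U i) ->
  exists d, norm d <= C * (norm (minus v (u t)) + h ^ 5) /\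
  minus (step_value h v U) (u (t + h)) =
  plus (ph 0%nat h (minus v (u t))) (minus (scal h d) (scal (h ^ 5) (StepError h t))).
Proof.
destruct (stage_stability (S (stages m))) as [C [r [HC [Hr [HCr Hst']]]]].
destruct local_errors as [C0 [h1 [HC0 [Hh1 [Hst Hdef]]]]].
destruct g_lipschitz as [L0 [HL0 HL]].
destruct (ph_bounded 1 1 ltac:(lra)) as [B1 [HB1 Hb1]].
set (l := seq 2 (S (stages m) - 2)).
assert (Hadm : forall i, In i l -> admissible (bcoef m i)).
{ intros i Hi; apply in_seq in Hi; apply Hm; lia. }
destruct (cop_bounded_list l (bcoef m) Hadm) as [Ca [HCa Ha]].
set (Ns := INR (length l)).
assert (HNs : 0 <= Ns) by apply pos_INR.
set (C' := B1 * L0 + (Ns * (Ca * (L0 * C + L0 + C0)) + C0)).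
assert (HC' : 0 < C').
{ unfold C'; apply Rplus_lt_le_0_compat; [apply Rmult_lt_0_compat; lra|].
  repeat apply Rplus_le_le_0_compat; repeat apply Rmult_le_pos; try lra.
  repeat apply Rplus_le_le_0_compat; try apply Rmult_le_pos; lra. }
set (r' := Rmin (Rmin r h1) (rho / 2)).
assert (Hr' : 0 < r' /\ r' <= r /\ r' <= h1 /\ r' <= rho / 2).
{ unfold r'; split; [repeat apply Rmin_glb_lt; lra|]; repeat split.
  - eapply Rle_trans; [apply Rmin_l|apply Rmin_l].
  - eapply Rle_trans; [apply Rmin_l|apply Rmin_r].
  - apply Rmin_r. }
destruct Hr' as [R0 [R1 [R2 R3]]].
exists C', r'; split; [lra|]; split; [lra|].
intros h t v U Hh Ht Hth Hv HU.
assert (Ht' : t0 <= t <= T) by lra.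
set (eps := norm (minus v (u t)) + h ^ 5).
assert (Hh5 : 0 <= h ^ 5 <= h).
{ split; [apply pow_le; lra|]; assert (0 <= h ^ 4 <= 1).
  { split; [apply pow_le; lra|]; rewrite <- (pow1 4); apply pow_incr; lra. }
  simpl in *; nra. }
assert (Heps : 0 <= eps <= 2 * r').
{ unfold eps; pose proof (norm_ge_0 (minus v (u t))); lra. }
assert (Hve : norm (minus v (u t)) <= eps) by (unfold eps; lra).
assert (Hvr : norm (minus v (u t)) < rho) by lra.
assert (Hgv : norm (minus (g v) (g (u t))) <= L0 * norm (minus v (u t))).
{ apply (HL t); [easy|easy|apply self_near]. }
assert (Hd : forall j, In j l ->
  norm (minus (minus (g (U j)) (g v)) (Increment h t j)) <= (L0 * C + L0 + C0) * eps).
{ intros j Hj; apply in_seq in Hj.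
  destruct (Hst j ltac:(lia) h t ltac:(lra) Ht') as [HW [HG _]].
  apply (increment_stability L0 C0 C h t v (U j) (Stage h t j)); auto; try lra.
  - intros x y; now apply (HL t).
  - apply Hst'; auto; try lra; lia.
  - fold eps; apply Rle_trans with (C * (2 * r)); [apply Rmult_le_compat_l|]; lra. }
specialize (Hdef h t ltac:(lra) Ht Hth).
set (Rw := minus (u (t + h)) _) in Hdef.
(* The residual [Rw] is O(h^6); dividing it by h makes it part of the term h d. *)
exists (plus (ph 1%nat h (minus (g v) (g (u t)))) (minus (vsum l (fun j => cop ph (bcoef m j) h
    (minus (minus (g (U j)) (g v)) (Increment h t j)))) (scal (/ h) Rw))); split.
- unfold C'; rewrite !(Rmult_plus_distr_r _ _ eps).
  assert (Hh1' : 0 <= h <= 1) by lra.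
  repeat apply norm_plus_le.
  + specialize (Hb1 h (minus (g v) (g (u t))) Hh1'); rewrite Rmult_1_l in Hb1.
    eapply Rle_trans; [exact Hb1|].
    rewrite Rmult_assoc; apply Rmult_le_compat_l; [lra|].
    eapply Rle_trans; [exact Hgv|]; apply Rmult_le_compat_l; lra.
  + eapply Rle_trans; [apply (vsum_cop_le _ _ _ Ca _ h ltac:(lra) Hh1' Ha Hd)|].
    fold Ns; right; ring.
  + assert (Hi : 0 < / h) by (apply Rinv_0_lt_compat; lra).
    eapply Rle_trans; [right; apply (norm_opp (V := X))|].
    rewrite norm_scal_pos by lra.
    apply Rle_trans with (/ h * (C0 * h ^ 6)); [apply Rmult_le_compat_l; lra|].
    replace (/ h * (C0 * h ^ 6)) with (C0 * h ^ 5) by (field; lra).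
    apply Rmult_le_compat_l; [lra|].
    unfold eps; pose proof (norm_ge_0 (minus v (u t))); lra.
- rewrite (lin_minus _ _ _ (ph_lin 0%nat h ltac:(lra))), (lin_minus _ _ _ (ph_lin 1%nat h ltac:(lra))).
  refine (eq_trans _ (f_equal (fun z => plus _ (minus (scal h (plus _ (minus z _))) _))
    (eq_sym (vsum_cop_minus _ _ (fun j => minus (g (U j)) (g v)) _ h ltac:(lra) Hadm)))).
  unfold step_value, Rw, l; module.
Qed.

(** * Propagation and accumulation of the local errors *)

Hypothesis ph_0 : forall k x, ph k 0 x = scal (/ INR (fact k)) x.
Hypothesis ph_add : forall r s x, 0 <= r -> 0 <= s ->
  ph 0%nat (r + s) x = ph 0%nat r (ph 0%nat s x).
Hypothesis ph_smoothing : forall f, admissible f -> exists C, 0 < C /\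
  forall h n w W0 W1, 0 < h <= 1 -> INR n * h <= T - t0 -> 0 <= W1 ->
  norm (w 0%nat) <= W0 ->
  (forall j, (S j < n)%nat -> norm (minus (w (S j)) (w j)) <= W1 * h) ->
  norm (vsum (seq 0 n) (fun j => ph 0%nat (INR (n - 1 - j) * h)
    (minus (cop ph f h (w j)) (scal (coef_eval f 0) (w j))))) <= C * (W0 + W1).

Lemma ph_bounded_on_interval : exists Ms, 0 < Ms /\
  forall s x, 0 <= s <= T - t0 -> norm (ph 0%nat s x) <= Ms * norm x.
Proof.
destruct (ph_bounded 0 (T - t0) ltac:(lra)) as [C [HC H]].
exists C; split; [easy|]; intros s x Hs.
replace s with ((T - t0) * (s / (T - t0))) by (field; lra).
apply H; split; [apply Rdiv_le_0_compat; lra|].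
apply (Rmult_le_reg_r (T - t0)); [lra|]; unfold Rdiv; rewrite Rmult_assoc, Rinv_l; lra.
Qed.

(** Contributions whose propagated sum over O(1/h) steps stays bounded, although
    they are not small individually. *)
Definition summable (f : R -> R -> X) : Prop :=
  exists C, 0 <= C /\ forall h n, 0 < h <= 1 -> INR n * h <= T - t0 ->
  norm (vsum (seq 0 n) (fun j => ph 0%nat (INR (n - 1 - j) * h) (f h (t0 + INR j * h)))) <= C.

Lemma INR_mult_pos n h : 0 < h -> 0 <= INR n * h.
Proof. intros Hh; apply Rmult_le_pos; [apply pos_INR|lra]. Qed.

Lemma grid_mem j n h : 0 < h -> INR n * h <= T - t0 -> (j <= n)%nat ->
  t0 <= t0 + INR j * h <= T.
Proof.
intros Hh Hn Hj; apply le_INR in Hj.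
assert (INR j * h <= INR n * h) by (apply Rmult_le_compat_r; lra).
pose proof (INR_mult_pos j h Hh); lra.
Qed.

Lemma summable_coef f w : admissible f -> regular w ->
  summable (fun h t => minus (cop ph f h (w h t)) (scal (coef_eval f 0) (w h t))).
Proof.
intros Hf [[C0 [HC0 H0]] [C1 [HC1 H1]]].
destruct (ph_smoothing f Hf) as [C [HC H]].
exists (C * (C0 + C1)); split; [apply Rmult_le_pos; lra|]; intros h n Hh Hn.
apply (H h n (fun j => w h (t0 + INR j * h)) C0 C1 Hh Hn HC1).
- eapply Rle_trans; [apply H0; [lra|apply (grid_mem 0 n); try lra; lia]|simpl; lra].
- intros j Hj; eapply Rle_trans; [apply H1; [lra| |]; apply (grid_mem _ n); try lra; lia|].
  replace (t0 + INR (S j) * h - (t0 + INR j * h)) with h by (rewrite S_INR; ring).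
  rewrite Rabs_pos_eq; lra.
Qed.

Lemma summable_ext f f' :
  (forall h t, 0 < h <= 1 -> t0 <= t <= T -> f' h t = f h t) -> summable f -> summable f'.
Proof.
intros E [C [HC H]]; exists C; split; [easy|]; intros h n Hh Hn.
refine (norm_le_eq _ _ _ (vsum_ext _ _ _ _) (H h n Hh Hn)).
intros j Hj; apply in_seq in Hj; rewrite E; auto; apply (grid_mem j n); try lra; lia.
Qed.

Lemma summable_plus f f' : summable f -> summable f' ->
  summable (fun h t => plus (f h t) (f' h t)).
Proof.
intros [C [HC H]] [C' [HC' H']]; exists (C + C'); split; [lra|]; intros h n Hh Hn.
refine (norm_le_eq _ _ _ _ (norm_plus_le _ _ _ _ (H h n Hh Hn) (H' h n Hh Hn))).
refine (eq_trans (vsum_ext _ _ _ _) (vsum_plus _ _ _)).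
intros j _; apply ph_lin, INR_mult_pos; lra.
Qed.

Lemma summable_opp f : summable f -> summable (fun h t => opp (f h t)).
Proof.
intros [C [HC H]]; exists C; split; [easy|]; intros h n Hh Hn.
apply (norm_le_eq (scal (- (1)) (vsum (seq 0 n)
  (fun j => ph 0%nat (INR (n - 1 - j) * h) (f h (t0 + INR j * h)))))).
- refine (eq_trans (vsum_ext _ _ _ _) (vsum_scal _ _ _)).
  intros j _; assert (L1 := ph_lin 0%nat _ (INR_mult_pos (n - 1 - j) h (proj1 Hh))).
  refine (eq_trans _ (proj2 L1 _ _)); apply f_equal; module.
- replace C with (1 * C) by ring.
  apply norm_scal_le; [rewrite Rabs_left; lra|now apply H].
Qed.

Lemma summable_vsum (l : list nat) (f : nat -> R -> R -> X) :
  (forall j, In j l -> summable (f j)) -> summable (fun h t => vsum l (fun j => f j h t)).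
Proof.
induction l as [|j l IH]; simpl; intros H; [|apply summable_plus; auto].
exists 0; split; [lra|]; intros h n Hh Hn.
apply (norm_le_eq zero); [|rewrite norm_zero; lra].
apply vsum_zero; intros j _; apply lin_zero, ph_lin, INR_mult_pos; lra.
Qed.

Lemma StepError_summable : summable StepError.
Proof.
apply (summable_ext (fun h t => plus
  (minus (cop ph (Term 1 5 1 :: nil) h (along nil 4 t))
     (scal (coef_eval (Term 1 5 1 :: nil) 0) (along nil 4 t)))
  (opp (vsum (seq 2 (S (stages m) - 2)) (fun i => minus (cop ph (bcoef m i) h (Weight h t i))
     (scal (coef_eval (bcoef m i) 0) (Weight h t i))))))).
- intros h t _ _.
  assert (E1 : cop ph (Term 1 5 1 :: nil) h (along nil 4 t) = ph 5%nat h (along nil 4 t)).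
  { unfold cop, fold_right, twt, tidx, tscale; rewrite Rmult_1_l; module. }
  assert (E2 : coef_eval (Term 1 5 1 :: nil) 0 = phi 5 0).
  { unfold coef_eval, fold_right, twt, tidx, tscale; rewrite !Rmult_1_l; apply Rplus_0_r. }
  rewrite E1, E2; unfold StepError; module.
- apply summable_plus.
  + apply (summable_coef _ (fun _ t => along nil 4 t)); [|apply regular_along; lia].
    intros q [<-|[]]; simpl; lra.
  + apply summable_opp, summable_vsum; intros i Hi; apply in_seq in Hi.
    apply (summable_coef _ (fun h t => Weight h t i)); [apply Hm; lia|].
    apply Weight_regular; lia.
Qed.

Lemma error_propagation h (e z : nat -> X) n : 0 < h -> e 0%nat = zero ->
  (forall j, (j < n)%nat -> e (S j) = plus (ph 0%nat h (e j)) (z j)) ->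
  e n = vsum (seq 0 n) (fun j => ph 0%nat (INR (n - 1 - j) * h) (z j)).
Proof.
intros Hh He; induction n as [|n IH]; intros H; [easy|].
rewrite (H n (le_n _)), (IH (fun j Hj => H j (Nat.lt_lt_succ_r _ _ Hj))).
rewrite vsum_seq_S; f_equal.
- rewrite (lin_vsum _ _ _ (ph_lin 0%nat h ltac:(lra))); apply vsum_ext; intros j Hj.
  apply in_seq in Hj; rewrite <- ph_add by (try apply INR_mult_pos; lra).
  f_equal; replace (S n - 1 - j)%nat with (S (n - 1 - j)) by lia.
  rewrite S_INR; ring.
- replace (S n - 1 - n)%nat with 0%nat by lia.
  simpl INR; rewrite Rmult_0_l, ph_0; simpl; module.
Qed.

Lemma norm_vsum_rsum {V : NormedModule R_AbsRing} {I} (l : list I) (f : I -> V) (b : I -> R) :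
  (forall i, In i l -> norm (f i) <= b i) -> norm (vsum l f) <= rsum l b.
Proof.
induction l as [|i l IH]; simpl; intros H; [rewrite norm_zero; lra|].
apply norm_plus_le; auto.
Qed.

(** The induction is on the majorant a + b sum x, which grows by at most the factor 1 + b per
    step. *)
Lemma discrete_gronwall (a b : R) (x : nat -> R) n : 0 <= b ->
  (forall k, (k <= n)%nat -> x k <= a + b * rsum (seq 0 k) x) ->
  forall k, (k <= n)%nat -> x k <= a * (1 + b) ^ k.
Proof.
intros Hb H.
assert (Hs : forall k, (k <= n)%nat -> a + b * rsum (seq 0 k) x <= a * (1 + b) ^ k).
{ induction k as [|k IH]; intros Hk; [simpl; lra|].
  assert (IHk := IH ltac:(lia)); assert (Hx := H k ltac:(lia)).
  rewrite seq_S, rsum_app; simpl rsum; rewrite Rplus_0_r.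
  simpl pow; nra. }
intros k Hk; eapply Rle_trans; [now apply H|now apply Hs].
Qed.

(** A bootstrap by strong induction: the bound at all earlier steps keeps the numerical solution in
    the range of the one-step estimate, and Gronwall then reproduces the bound with the same
    constant. *)
Lemma global_error : exists C h0, 0 < h0 /\ forall h (un : nat -> X), 0 < h <= h0 ->
  un 0%nat = u t0 ->
  (forall n, t0 + INR (n + 1) * h <= T -> exists U,
     (forall i, (2 <= i <= stages m)%nat -> U i = stage_value h (un n) U i) /\
     un (n + 1)%nat = step_value h (un n) U) ->
  forall n, t0 + INR n * h <= T ->
  norm (minus (un n) (u (t0 + INR n * h))) <= C * h ^ 5.
Proof.
destruct one_step_error as [C1 [r [HC1 [Hr Hstep]]]].
destruct ph_bounded_on_interval as [Ms [HMs Hs]].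
destruct StepError_summable as [Ca [HCa Ha]].
(* [b0] is the Gronwall rate. In [a0], the h^6 terms accumulate to b0 (T - t0) h^5, and [Ca] bounds
   the propagated sum of the [StepError] terms. *)
set (b0 := Ms * C1).
assert (Hb0 : 0 < b0) by (apply Rmult_lt_0_compat; lra).
set (a0 := b0 * (T - t0) + Ca).
assert (Ha0 : 0 < a0) by (unfold a0; nra).
set (C := a0 * exp (b0 * (T - t0))).
assert (HC : 0 < C) by (apply Rmult_lt_0_compat; [easy|apply exp_pos]).
assert (HrC : 0 < r / C) by (apply Rdiv_lt_0_compat; lra).
(* This ensures C h^5 <= C h <= r, so the bound to be proved implies the smallness assumption of the
   one-step estimate. *)
exists C, (Rmin r (r / C)); split; [apply Rmin_glb_lt; lra|].
intros h un Hh Hun0 Hun.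
assert (Hhr : h <= r) by (eapply Rle_trans; [apply Hh|apply Rmin_l]).
assert (HhC : C * h <= r).
{ apply Rle_trans with (C * (r / C)); [|right; field; lra].
  apply Rmult_le_compat_l; [lra|]; eapply Rle_trans; [apply Hh|apply Rmin_r]. }
assert (Hh5 : 0 <= h ^ 5 <= h).
{ split; [apply pow_le; lra|]; assert (0 <= h ^ 4 <= 1).
  { split; [apply pow_le; lra|]; rewrite <- (pow1 4); apply pow_incr; lra. }
  simpl in *; nra. }
set (e := fun n => minus (un n) (u (t0 + INR n * h)) : X).
intros n; change (t0 + INR n * h <= T -> norm (e n) <= C * h ^ 5).
induction n as [n IH] using lt_wf_ind; intros Hn.
set (z := fun j => minus (e (S j)) (ph 0%nat h (e j)) : X).
assert (Hnh : INR n * h <= T - t0) by lra.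
assert (Hz : forall j, (j < n)%nat ->
  norm (plus (z j) (scal (h ^ 5) (StepError h (t0 + INR j * h)))) <=
  h * (C1 * (norm (e j) + h ^ 5))).
{ intros j Hj.
  assert (Hj1 : t0 + INR (j + 1) * h <= T).
  { apply (grid_mem (j + 1) n); try lra; lia. }
  assert (HjT : t0 <= t0 + INR j * h <= T) by (apply (grid_mem j n); try lra; lia).
  destruct (Hun j Hj1) as [U [HU HU1]].
  assert (Ej : norm (e j) <= r).
  { eapply Rle_trans; [apply IH; [easy|lra]|].
    apply Rle_trans with (C * h); [apply Rmult_le_compat_l|]; lra. }
  assert (Etime : t0 + INR j * h + h = t0 + INR (S j) * h) by (rewrite S_INR; ring).
  destruct (Hstep h (t0 + INR j * h) (un j) U) as [d [Hd Ed]]; auto; try lra.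
  { rewrite Etime; replace (S j) with (j + 1)%nat by lia; exact Hj1. }
  apply (norm_le_eq (scal h d)).
  - unfold z, e at 1; replace (S j) with (j + 1)%nat by lia; rewrite HU1.
    replace (t0 + INR (j + 1) * h) with (t0 + INR j * h + h)
      by (rewrite plus_INR; simpl; ring).
    rewrite Ed; unfold e; module.
  - rewrite norm_scal_pos by lra; apply Rmult_le_compat_l; [lra|exact Hd]. }
assert (He : forall k, (k <= n)%nat -> norm (e k) <=
  a0 * h ^ 5 + (b0 * h) * rsum (seq 0 k) (fun j => norm (e j))).
{ intros k Hk.
  assert (Hkh : INR k * h <= T - t0).
  { pose proof (grid_mem k n h (proj1 Hh) Hnh Hk); lra. }
  assert (Ek := error_propagation h e z k (proj1 Hh)).
  apply (norm_le_eq (minus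
    (vsum (seq 0 k) (fun j => ph 0%nat (INR (k - 1 - j) * h)
       (plus (z j) (scal (h ^ 5) (StepError h (t0 + INR j * h))))))
    (scal (h ^ 5) (vsum (seq 0 k) (fun j => ph 0%nat (INR (k - 1 - j) * h)
       (StepError h (t0 + INR j * h))))))).
  - rewrite Ek.
    + rewrite <- vsum_scal, <- vsum_minus; apply vsum_ext; intros j Hj.
      destruct (ph_lin 0%nat _ (INR_mult_pos (k - 1 - j) h (proj1 Hh))) as [Hadd Hsc].
      rewrite Hadd, Hsc; module.
    + unfold e; simpl INR; rewrite Rmult_0_l, Rplus_0_r, Hun0; module.
    + intros j _; unfold z; module.
  - assert (Hsum : rsum (seq 0 k) (fun j => Ms * (h * (C1 * (norm (e j) + h ^ 5)))) =
      (b0 * h) * rsum (seq 0 k) (fun j => norm (e j)) + INR k * (b0 * h * h ^ 5)).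
    { unfold b0; clear; induction k as [|k IH]; [simpl; ring|].
      rewrite seq_S, !rsum_app, IH, S_INR; simpl; ring. }
    apply Rle_trans with (rsum (seq 0 k) (fun j => Ms * (h * (C1 * (norm (e j) + h ^ 5))))
      + h ^ 5 * Ca).
    + apply norm_minus_le.
      * apply norm_vsum_rsum; intros j Hj; apply in_seq in Hj.
        eapply Rle_trans; [apply Hs|].
        { pose proof (grid_mem (k - 1 - j) n h (proj1 Hh) Hnh ltac:(lia)); lra. }
        apply Rmult_le_compat_l; [lra|apply Hz; lia].
      * apply norm_scal_le; [rewrite Rabs_pos_eq; lra|apply Ha; [lra|easy]].
    + rewrite Hsum; unfold a0.
      assert (Hq : INR k * (b0 * h * h ^ 5) <= b0 * (T - t0) * h ^ 5).
      { replace (INR k * (b0 * h * h ^ 5)) with (b0 * (INR k * h) * h ^ 5) by ring.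
        apply Rmult_le_compat_r; [lra|]; apply Rmult_le_compat_l; lra. }
      lra. }
assert (Hbh : 0 <= b0 * h) by (apply Rmult_le_pos; lra).
eapply Rle_trans; [apply (discrete_gronwall _ _ (fun j => norm (e j)) n Hbh He n (le_n n))|].
unfold C; replace (a0 * h ^ 5 * (1 + b0 * h) ^ n) with (a0 * (1 + b0 * h) ^ n * h ^ 5) by ring.
apply Rmult_le_compat_r; [lra|]; apply Rmult_le_compat_l; [lra|].
apply Rle_trans with (exp (b0 * h) ^ n).
- apply pow_incr; split; [lra|apply exp_ineq1_le].
- assert (E : exp (b0 * h) ^ n = exp (b0 * (INR n * h))).
  { clear; induction n as [|n IHn].
    - simpl; now rewrite Rmult_0_l, Rmult_0_r, exp_0.
    - simpl pow; rewrite IHn, <- exp_plus, S_INR; f_equal; ring. }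
  assert (Hle : b0 * (INR n * h) <= b0 * (T - t0)) by (apply Rmult_le_compat_l; lra).
  rewrite E; destruct Hle as [Hlt | ->]; [left; now apply exp_increasing|lra].
Qed.

End Nonlinearity.

(** * The method in mild form *)

Section MildForm.
Context {X : CompleteNormedModule R_AbsRing} (D : X -> Prop) (A : X -> X) (S : R -> X -> X).
Context (HS : analytic_semigroup S) (HG : generator S D A).

Lemma phi_op_lin k tau : 0 <= tau -> lin (phi_op S k tau).
Proof.
intros Ht; split; [intros; now apply phi_op_plus|intros; now apply phi_op_scal].
Qed.

(** The identity v + tau phi_1(tau A) A v = e^(tau A) v removes the unbounded operator from the
    scheme. *)
Lemma phi_op_1_generator v tau y : D v -> 0 <= tau ->
  plus v (scal tau (phi_op S 1 tau (plus (A v) y))) =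
  plus (phi_op S 0 tau v) (scal tau (phi_op S 1 tau y)).
Proof.
intros Hv Ht; rewrite (phi_op_plus S HS 1 tau) by easy.
rewrite (generator_integrated S HS D A v HG Hv 0%nat tau Ht); simpl; module.
Qed.

Lemma expRK_step_mild m g h v w : expRK_wf m -> 0 <= h -> expRK_step m D A S g h v w ->
  exists U, (forall i, (2 <= i <= stages m)%nat -> U i = stage_value g (phi_op S) m h v U i) /\
    w = step_value g (phi_op S) m h v U.
Proof.
intros Hm Hh [Hv [U [HU Hw]]]; exists U; split.
- intros i Hi; rewrite (HU i Hi).
  assert (Hc : 0 <= node m i * h) by (apply Rmult_le_pos; [now apply Hm|easy]).
  refine (eq_trans (f_equal2 plus (phi_op_1_generator v (node m i * h) (g v) Hv Hc)
    (f_equal (scal h) (sum_n_m_vsum _ _ _))) _).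
  replace (Datatypes.S (i - 1) - 2)%nat with (i - 2)%nat by lia.
  unfold stage_value; rewrite <- plus_assoc; reflexivity.
- rewrite Hw.
  refine (eq_trans (f_equal2 plus (phi_op_1_generator v h (g v) Hv Hh)
    (f_equal (scal h) (sum_n_m_vsum _ _ _))) _).
  unfold step_value; rewrite <- plus_assoc; reflexivity.
Qed.

(** For j = 0 this is the differential equation, and each further j differentiates it in time within
    the integrated relation, so that [A] is applied to no derivative of u. *)
Lemma solution_integrated (g : X -> X) t0 T (u : R -> X) rho p du dg M :
  t0 < T -> 0 < rho -> (6 <= p)%nat ->
  (forall t, t0 <= t <= T -> D (u t) /\ has_deriv_on t0 T u t (plus (A (u t)) (g (u t)))) ->
  (forall t, t0 <= t <= T -> du 0%nat t = u t) ->
  (forall k t, (k < p)%nat -> t0 <= t <= T -> has_deriv_on t0 T (du k) t (du (Datatypes.S k) t)) ->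
  (forall x, strip t0 T u rho x -> dg 0%nat x nil = g x) ->
  (forall k x, (k <= p)%nat -> strip t0 T u rho x -> multilinear k (dg k x)) ->
  (forall k x vs, (1 <= k <= p)%nat -> strip t0 T u rho x -> length vs = k ->
    norm (dg k x vs) <= M * norms_prod vs) ->
  (forall k x, (k < p)%nat -> strip t0 T u rho x ->
    forall eps : posreal, exists delta : posreal, forall d : X,
    norm d < delta -> forall vs, length vs = k ->
    norm (minus (minus (dg k (plus x d) vs) (dg k x vs)) (dg (Datatypes.S k) x (d :: vs)))
      <= eps * norm d * norms_prod vs) ->
  forall j t, (j < p)%nat -> t0 <= t <= T ->
  integrated_generator S (du j t) (minus (du (Datatypes.S j) t) (along u du dg nil j t)).
Proof.
intros HtT Hrho Hp Hu Hu0 Hdu Hg0 Hml Hbd Hfr j; induction j as [|j IH]; intros t Hj Ht.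
- destruct (Hu t Ht) as [HD Hd].
  assert (E : plus (A (u t)) (g (u t)) = du 1%nat t).
  { apply (has_deriv_on_unique t0 T u t); [easy|easy|exact Hd|].
    apply (has_deriv_on_ext t0 T (du 0%nat)); [easy|exact Hu0|apply Hdu; [lia|easy]]. }
  assert (H := generator_integrated S HS D A (u t) HG HD).
  rewrite (Hu0 t Ht), <- E.
  assert (E' : A (u t) = minus (plus (A (u t)) (g (u t))) (along u du dg nil 0 t)).
  { rewrite (along_0 g t0 T u rho du dg Hrho Hg0 t Ht); module. }
  now rewrite <- E'.
- apply (integrated_generator_deriv S HS t0 T (du j)
    (fun t => minus (du (Datatypes.S j) t) (along u du dg nil j t)) t); auto.
  + intros r Hr; apply IH; [lia|easy].
  + apply Hdu; [lia|easy].
  + assert (Ha : has_deriv_on t0 T (along u du dg nil j) t (along u du dg nil (Datatypes.S j) t)).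
    { apply (along_deriv t0 T u rho p du dg M); auto; simpl; lia. }
    assert (Hb := has_deriv_on_plus t0 T (du (Datatypes.S j))
      (fun r => scal (- (1)) (along u du dg nil j r)) t _ _
      (Hdu (Datatypes.S j) t ltac:(lia) Ht)
      (has_deriv_on_mult t0 T (fun _ => - (1)) (along u du dg nil j) t 0 _
        (has_deriv_on_const (V := R_NormedModule) t0 T (- (1)) t) Ha)).
    refine (has_deriv_on_eq _ _ _ _ _ _ _ (has_deriv_on_ext _ _ _ _ _ _ Ht _ Hb)).
    * module.
    * intros r _; simpl; module.
Qed.

End MildForm.

Theorem theorem4p1 :
  exists p : nat,
  forall (X : CompleteNormedModule R_AbsRing)
    (D : X -> Prop) (A : X -> X) (S : R -> X -> X)
    (g : X -> X) (t0 T : R) (u0 : X) (u : R -> X) (rho : R) (m : expRK),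
  t0 < T ->
  generates_analytic_semigroup D A S ->
  u t0 = u0 ->
  (forall t, t0 <= t <= T ->
     D (u t) /\ has_deriv_on t0 T u t (plus (A (u t)) (g (u t)))) ->
  smooth_curve p t0 T u ->
  0 < rho ->
  frechet_smooth p (strip t0 T u rho) g ->
  expRK_wf m ->
  cond1 m (full m) -> cond2 m (full m) -> cond3 m (full m) ->
  cond4 m (full m) -> cond5 m (full m) -> cond6 m (full m) ->
  cond7 m (full m) ->
  cond8_at0 m ->
  cond9 m (frozen m) -> cond10 m (frozen m) -> cond11 m (frozen m) ->
  cond12 m (frozen m) -> cond13 m (frozen m) -> cond14 m (frozen m) ->
  cond15 m (frozen m) -> cond16 m (frozen m) ->
  exists C h0 : R, 0 < h0 /\
  forall (h : R) (un : nat -> X),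
  0 < h <= h0 ->
  un 0%nat = u0 ->
  (forall n, t0 + INR (n + 1) * h <= T ->
     expRK_step m D A S g h (un n) (un (n + 1)%nat)) ->
  forall n, t0 + INR n * h <= T ->
  norm (minus (un n) (u (t0 + INR n * h))) <= C * h ^ 5.
Proof.
(* The h^6 remainder of a step involves the sixth derivative of u and the fifth derivative of
   g(u(t)). *)
exists 6%nat; intros X D A S g t0 T u0 u rho m HtT [HS HG] Hut0 Hu.
intros [du [K0 [Hdu0 [Hdu HduK]]]] Hrho [dg [M0 [Hg0 [Hml [Hbd Hfr]]]]] Hm.
intros c1 c2 c3 c4 c5 c6 c7 c8 c9 c10 c11 c12 c13 c14 c15 c16.
(* A bound of at least 1 on the derivatives of u is dominated by all its positive powers, as the
   chain rule estimate needs; the absolute value makes the bound for [dg] nonnegative. *)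
destruct (global_error g t0 T u rho 6 du (1 + Rabs K0) dg (Rabs M0)) with (ph := phi_op S) (m := m)
  as [C [h0 [Hh0 H]]]; auto.
- pose proof (Rabs_pos K0); lra.
- apply Rabs_pos.
- intros k t Hk Ht; eapply Rle_trans; [now apply HduK|].
  pose proof (Rle_abs K0); lra.
- intros k x vs Hk Hx Hvs; eapply Rle_trans; [now apply Hbd|].
  apply Rmult_le_compat_r; [apply norms_prod_ge_0|apply Rle_abs].
- intros k tau; apply (phi_op_lin S HS).
- intros f Hf; exact (coef_op_bounded S HS f 1 Hf).
- intros k j tau t Hj Htau Ht.
  apply (solution_integrated D A S HS HG g t0 T u rho 6 du dg M0); auto; lia.
- intros h Hh; apply order_conditions_operators; auto.
  + apply (phi_op_lin S HS).
  + apply (phi_op_at_0 S HS).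
- apply (phi_op_at_0 S HS).
- intros r s x; apply (sg_add S HS).
- intros f Hf; exact (smoothing S HS (T - t0) f Hf).
- exists C, h0; split; [easy|]; intros h un Hh Hun0 Hun; apply H; auto.
  + now rewrite Hut0.
  + intros n Hn; apply (expRK_step_mild D A S HS HG); auto; lra.
Qed.
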